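(* Fix $\tau>0$. For any $n\in\mathbb{Z}_{\ge1}$, the random vector $(X^{(1,\epsilon)}_\tau,\ldots,X^{(n,\epsilon)}_\tau)$ of rescaled fluctuations of slowed $t$-TASEP (with $t=e^{-\epsilon}$ and packed initial condition) converges in distribution as $\epsilon\to0^+$ to a mean-zero Gaussian random vector $(X^{(1)}_\tau,\ldots,X^{(n)}_\tau)$. The covariances of these Gaussian vectors are determined by the formula $$\operatorname{Cov}\left(X^{(1)}_\tau+\cdots+X^{(r)}_\tau,\;X^{(1)}_\tau+\cdots+X^{(s)}_\tau\right)=\frac{\displaystyle\oint dz_{2,1}\cdots\oint dz_{2,s}\oint dz_{1,1}\cdots\oint dz_{1,r}\sum_{\substack{1\le i\le r\\1\le j\le s}}\frac{z_{2,j}}{z_{1,i}-z_{2,j}}\,F_\tau(z_{2,1},\ldots,z_{2,s})\,F_\tau(z_{1,1},\ldots,z_{1,r})}{\left(\displaystyle\oint dz_{2,1}\cdots\oint dz_{2,s}\,F_\tau(z_{2,1},\ldots,z_{2,s})\right)\left(\displaystyle\oint dz_{1,1}\cdots\oint dz_{1,r}\,F_\tau(z_{1,1},\ldots,z_{1,r})\right)}$$ for all $r\ge s\ge1$, where $$F_\tau(z_1,\ldots,z_k)=\prod_{1\le i<j\le k}(z_i-z_j)^2\;\prod_{i=1}^k\frac{e^{\tau z_i}(1+z_i)}{z_i^{k+1}}$$ and the contours are all positively oriented, encircle $0$, and satisfy $|z_{2,j}|<|z_{1,i}|$ for all $1\le i\le r$, $1\le j\le s$.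
   Context: Slowed $t$-TASEP with parameter $t\in(0,1)$ is the continuous-time Markov jump process on particle configurations $x_1>x_2>\cdots$ in $\mathbb{Z}$ in which, when the current configuration is $(x_1,x_2,\ldots)$, the $k$-th particle jumps one unit to the right at rate $t^{x_k+k}\left(1-t^{x_{k-1}-x_k-1}\right)$, $k\ge1$, independently, with $x_0:=\infty$. Packed initial condition means $x_k(0)=-k$ for all $k\ge1$. With $t=e^{-\epsilon}$ and packed initial condition, the rescaled fluctuations are $$X^{(i,\epsilon)}_\tau:=\epsilon^{1/2}\left(x_i\left(\tfrac{\tau}{1-t}\right)-\mathbb{E}\left[x_i\left(\tfrac{\tau}{1-t}\right)\right]\right).$$ *)

(* Defs.v *)
From HB Require Import structures.
From mathcomp Require Import all_boot all_order all_algebra.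
From mathcomp Require Import all_classical all_reals all_analysis.
From mathcomp Require Import complex.

Set Implicit Arguments.
Unset Strict Implicit.
Unset Printing Implicit Defensive.

Import Order.TTheory GRing.Theory Num.Theory numFieldNormedType.Exports.

Local Open Scope classical_set_scope.
Local Open Scope ring_scope.

(* Particles are numbered from 0: [x k] is the position x_{k+1} of the usual
   numbering x_1 > x_2 > ... *)
Definition config := nat -> int.

Definition is_config (x : config) : Prop := forall k, x k.+1 < x k.

Definition packed : config := fun k => - k.+1%:Z.

Section SlowedTTASEP.
Variable R : realType.

(* For the first particle the gap is infinite (x_0 = oo) and t ^ oo = 0. *)
Definition jump_rate (t : R) (x : config) (k : nat) : R :=
  t ^ (x k + k.+1%:Z) *
  (1 - (if k is k'.+1 then t ^ (x k' - x k - 1) else 0)).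

(* On configurations with finitely many particles away from their packed
   position the series telescopes to 1; these are the only configurations
   reached from the packed one. *)
Definition total_rate (t : R) (x : config) : R :=
  fine (\sum_(0 <= k <oo) (jump_rate t x k)%:E)%E.

Definition jump (x : config) (k : nat) : config :=
  fun j => if j == k then x j + 1 else x j.

Fixpoint trajectory (x0 : config) (k : nat -> nat) (i : nat) : config :=
  if i is j.+1 then jump (trajectory x0 k j) (k j) else x0.

(* Joint law of the embedded jump chain Y and of the holding times S: given Y,
   the S i are independent and S i is exponential with rate the total jump rate
   of Y i; the chain moves particle k with probability its share of the total
   rate. *)
Definition jump_chain_holding_law d (T : measurableType d)
    (P : probability T R) (t : R) (x0 : config)
    (Y : nat -> T -> config) (S : nat -> T -> R) : Prop :=
  [/\ forall i k z, measurable [set w | Y i w k = z],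
      forall i, measurable_fun setT (S i) &
      forall (n : nat) (k : nat -> nat) (u : nat -> R),
        (forall i, 0 <= u i) ->
        P [set w | (forall i, (i <= n)%N -> Y i w = trajectory x0 k i) /\
                   (forall i, (i <= n)%N -> u i < S i w)] =
        ((\prod_(i < n) (jump_rate t (trajectory x0 k i) (k i)
                         / total_rate t (trajectory x0 k i))) *
         (\prod_(i < n.+1)
            expR (- (total_rate t (trajectory x0 k i) * u i))))%:E].

(* [X s w] is the configuration at time s >= 0.  The path almost surely sits at
   Y m between the m-th and the (m+1)-st jump times. *)
Definition slowed_tTASEP d (T : measurableType d) (P : probability T R)
    (t : R) (x0 : config) (X : R -> T -> config) : Prop :=
  [/\ forall s w, 0 <= s -> is_config (X s w),
      forall s k z, 0 <= s -> measurable [set w | X s w k = z] &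
      exists (Y : nat -> T -> config) (S : nat -> T -> R),
        jump_chain_holding_law P t x0 Y S /\
        {ae P, forall w, forall (m : nat) (s : R),
           \sum_(i < m) S i w <= s < \sum_(i < m.+1) S i w ->
           X s w = Y m w}].

Definition rescaled_fluctuation d (T : measurableType d) (P : probability T R)
    (e tau : R) (X : R -> T -> config) (i : nat) (w : T) : R :=
  let s := tau / (1 - expR (- e)) in
  Num.sqrt e *
  ((X s w i)%:~R - fine ('E_P[fun w' => (X s w' i)%:~R])%E).

End SlowedTTASEP.

Section GaussianLimits.
Variable R : realType.

Definition cvg_in_distribution (n : nat) (F : set_system R)
    (d : R -> measure_display) (T : forall e, measurableType (d e))
    (P : forall e, probability (T e) R) (X : forall e, T e -> 'rV[R]_n)
    d' (T' : measurableType d') (P' : probability T' R)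
    (Y : T' -> 'rV[R]_n) : Prop :=
  forall f : 'rV[R]_n -> R,
    continuous f -> (exists M, forall v, `|f v| <= M) ->
    ('E_(P e)[fun w => f (X e w)])%E @[e --> F] --> ('E_P'[fun w => f (Y w)])%E.

(* [normal_prob m 0] is not the point mass at m in the library, hence the case
   distinction. *)
Definition gaussian_vector (n : nat) d (T : measurableType d)
    (P : probability T R) (G : 'I_n -> {RV P >-> R}) : Prop :=
  forall a : 'I_n -> R, exists m s : R, forall A : set R, measurable A ->
    P ((fun w => \sum_(i < n) a i * G i w) @^-1` A) =
    if s == 0 then dirac m A else normal_prob m s A.

End GaussianLimits.

Section ContourIntegrals.
Variable R : realType.
Local Open Scope complex_scope.

Definition cexp (z : R[i]) : R[i] :=
  (expR (complex.Re z) * cos (complex.Im z)) +i*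
  (expR (complex.Re z) * sin (complex.Im z)).

Definition re_part (g : R -> R[i]) : R -> R := fun u => complex.Re (g u).
Definition im_part (g : R -> R[i]) : R -> R := fun u => complex.Im (g u).

Definition velocity (g : R -> R[i]) (u : R) : R[i] :=
  derive1 (re_part g) u +i* derive1 (im_part g) u.

Definition integral01 (h : R -> R[i]) : R[i] :=
  Rintegral lebesgue_measure `[0, 1] (re_part h) +i*
  Rintegral lebesgue_measure `[0, 1] (im_part h).

Definition contour_integral (g : R -> R[i]) (f : R[i] -> R[i]) : R[i] :=
  integral01 (fun u => f (g u) * velocity g u).

(* Positively oriented simple closed C^1 curve around 0, with period 1.  The
   velocity may vanish, so curves with corners are covered, after slowing the
   parametrization down at the corners. *)
Definition contour_around0 (g : R -> R[i]) : Prop :=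
  [/\ forall u, g (u + 1) = g u,
      forall u, derivable (re_part g) u 1 /\ derivable (im_part g) u 1,
      continuous (derive1 (re_part g)) /\ continuous (derive1 (im_part g)),
      {in `[0, 1[ &, injective g} &
      (forall u, g u != 0) /\
      contour_integral g (fun z => z^-1) = 0 +i* (2 * pi)].

(* oint dz_1 ... oint dz_k f(z_1, ..., z_k), the i-th variable on the i-th
   contour. *)
Fixpoint iterated_contour_integral (gs : seq (R -> R[i]))
    (f : seq R[i] -> R[i]) : R[i] :=
  if gs is g :: gs' then
    contour_integral g
      (fun z => iterated_contour_integral gs' (fun zs => f (z :: zs)))
  else f [::].

Definition F_tau (tau : R) (zs : seq R[i]) : R[i] :=
  (\prod_(j < size zs) \prod_(i < j) (zs`_i - zs`_j) ^+ 2) *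
  \prod_(z <- zs) (cexp (tau%:C * z) * (1 + z) / z ^+ (size zs).+1).

Definition cov_numerator (tau : R) (g2 g1 : seq (R -> R[i])) : R[i] :=
  iterated_contour_integral g2 (fun zs2 =>
    iterated_contour_integral g1 (fun zs1 =>
      (\sum_(z1 <- zs1) \sum_(z2 <- zs2) z2 / (z1 - z2)) *
      F_tau tau zs2 * F_tau tau zs1)).

Definition cov_denominator (tau : R) (g : seq (R -> R[i])) : R[i] :=
  iterated_contour_integral g (F_tau tau).

End ContourIntegrals.

(* Main.v *)
(* With [lam_k = x_k + k], the total jump rate telescopes to 1, so the number of
   jumps before time s is Poisson of parameter s and independent of the jump
   chain.  Put [f_r = t ^ - (lam_1 + .. + lam_r)] and [kappa = 1 / t - 1].  The
   generator maps [f_r] to [kappa f_{r-1}], whence [E f_r = D_r (kappa s)] with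
   [D_r(u)] the exponential series truncated after [u ^ r], and
   [E (f_r - D_r) ^ 2 = O(kappa)].
     For a linear combination of the [f_r - D_r] whose coefficients solve the
   backward equation, [theta] being its quotient by [sqrt kappa] plus a constant
   and [B] its limiting variance, [E (e ^ (B / 2) cos theta)] has derivative
   O(sqrt kappa) in kappa s, so the limit is Gaussian.  As x_1 + .. + x_r is an affine
   function of [log f_r], linearizing the logarithm transfers this to the
   particles.  Convergence of [E cos] of all affine forms, with tightness, gives
   convergence in distribution; the limit is a linear image of independent
   standard normals, obtained by factoring the covariance.
     On the contour side, the squared Vandermonde product is a double sum over
   permutations, which turns the iterated integrals into Toeplitz determinants in
   the coefficients [c_m] of [e ^ (tau z) (1 + z)].  The kernel
   [z_2 / (z_1 - z_2)] is expanded in a geometric series; each of its terms shifts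
   one row of the determinant, and the sums of the shifted determinants are read
   off the adjugate.  Both sides then equal
   [tau D_r D_{s-1} - sum_{m = 1}^s D_{s-m} (D_{r+m} - D_r)] over [D_r D_s]. *)

Require Import Defs.
From HB Require Import structures.
From mathcomp Require Import all_boot all_order all_algebra fingroup perm.
From mathcomp Require Import all_classical all_reals all_analysis.
From mathcomp Require Import measurable_realfun complex.
From mathcomp Require Import zify ring lra.

Set Implicit Arguments.
Unset Strict Implicit.
Unset Printing Implicit Defensive.

Import Order.TTheory GRing.Theory Num.Theory numFieldNormedType.Exports.

Local Open Scope classical_set_scope.
Local Open Scope ring_scope.

(** * Derivatives and trigonometric bounds *)

Section RealDerivatives.
Variable R : realType.
Implicit Types (f g : R -> R) (x a b c : R).

(** The exponential heights are chosen because the rates telescope: the particles that move [f_b]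
    jump with total rate [t ^ lam_b], and this factor turns [f_b] into [f_{b-1}], so the moment
    equations are closed and triangular. Expectations are cut to fewer than [M] jumps, so that the
    generator calculus takes place in finite sums; every estimate carries an error that vanishes as
    [M] grows. Cosines with a phase take the place of complex characteristic functions. The factor
    [e ^ (B / 2)] cancels the second order term of the cosine; what remains is the cubic Taylor
    error and the deviation of the quadratic variation from its deterministic value, both of
    relative order [sqrt kappa]. In three places (laws of jump times, normal characteristic
    function, residue of [e ^ (t z) / z]) a function of a parameter is shown to be constant not by
    differentiating an integral, but by bounding its increments by squares of the step. On the
    contour side [c] and [D] are dual like complete and elementary symmetric functions, so that the
    determinants are of Jacobi-Trudi type and the shifts act like power sums. *)

Definition has_deriv f x a := is_derive x (1 : R) f a.

Lemma has_deriv_eq f x a b : has_deriv f x a -> a = b -> has_deriv f x b.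
Proof. by move=> h <-. Qed.

Lemma has_deriv_ext f g x a : f =1 g -> has_deriv f x a -> has_deriv g x a.
Proof. by move=> /funext ->. Qed.

Lemma has_deriv_cst c x : has_deriv (fun=> c) x 0.
Proof. exact: is_derive_cst. Qed.

Lemma has_deriv_id x : has_deriv (fun y => y) x 1.
Proof. exact: is_derive_id. Qed.

Lemma has_derivD f g x a b : has_deriv f x a -> has_deriv g x b ->
  has_deriv (fun y => f y + g y) x (a + b).
Proof. by move=> hf hg; apply: is_deriveD. Qed.

Lemma has_derivN f x a : has_deriv f x a -> has_deriv (fun y => - f y) x (- a).
Proof. by move=> hf; apply: is_deriveN. Qed.

Lemma has_derivB f g x a b : has_deriv f x a -> has_deriv g x b ->
  has_deriv (fun y => f y - g y) x (a - b).
Proof. by move=> hf hg; apply: is_deriveB. Qed.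

Lemma has_derivM f g x a b : has_deriv f x a -> has_deriv g x b ->
  has_deriv (fun y => f y * g y) x (a * g x + f x * b).
Proof.
move=> hf hg; apply: (@is_derive_eq _ _ _ _ _ _ _ _ (is_deriveM hf hg)).
by rewrite /GRing.scale /=; ring.
Qed.

Lemma has_derivZ c f x a : has_deriv f x a -> has_deriv (fun y => c * f y) x (c * a).
Proof. by move=> hf; apply: (has_deriv_eq (has_derivM (has_deriv_cst c x) hf)); ring. Qed.

Lemma has_derivX f n x a : has_deriv f x a ->
  has_deriv (fun y => f y ^+ n) x (n%:R * f x ^+ n.-1 * a).
Proof.
move=> hf; apply: (@has_deriv_ext (f ^+ n)) => [y|].
  by elim: n => [|n IH]; rewrite ?expr0 // !exprS -IH.
exact: is_deriveX.
Qed.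

Lemma has_deriv_comp f g x a b : has_deriv f (g x) a -> has_deriv g x b ->
  has_deriv (fun y => f (g y)) x (a * b).
Proof. exact: is_derive1_comp. Qed.

Lemma has_deriv_sum (I : Type) (r : seq I) (Q : pred I) (F : I -> R -> R) (d : I -> R) x :
  (forall i, Q i -> has_deriv (F i) x (d i)) ->
  has_deriv (fun y => \sum_(i <- r | Q i) F i y) x (\sum_(i <- r | Q i) d i).
Proof.
move=> h; elim: r => [|i r IH].
  rewrite big_nil; apply: has_deriv_ext (has_deriv_cst 0 x) => y.
  by rewrite big_nil.
rewrite big_cons; case: ifPn => Qi.
  by apply: has_deriv_ext (has_derivD (h i Qi) IH) => y; rewrite big_cons Qi.
by apply: has_deriv_ext IH => y; rewrite big_cons (negPf Qi).
Qed.

Lemma has_deriv_scale f c x a : has_deriv f (c * x) a ->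
  has_deriv (fun y => f (c * y)) x (c * a).
Proof.
move=> h; have hc : has_deriv (fun y => c * y) x c.
  by apply: has_deriv_eq (has_derivZ c (has_deriv_id x)) _; rewrite mulr1.
by apply: has_deriv_eq (has_deriv_comp h hc) _; rewrite mulrC.
Qed.

Lemma has_deriv_expR f x a : has_deriv f x a ->
  has_deriv (fun y => expR (f y)) x (expR (f x) * a).
Proof. by move=> hf; apply: has_deriv_comp hf; exact: is_derive_expR. Qed.

Lemma has_deriv_cos f x a : has_deriv f x a ->
  has_deriv (fun y => cos (f y)) x (- sin (f x) * a).
Proof. by move=> hf; apply: has_deriv_comp hf; exact: is_derive_cos. Qed.

Lemma has_deriv_sin f x a : has_deriv f x a ->
  has_deriv (fun y => sin (f y)) x (cos (f x) * a).
Proof. by move=> hf; apply: has_deriv_comp hf; exact: is_derive_sin. Qed.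

Lemma has_deriv_continuous f x a : has_deriv f x a -> {for x, continuous f}.
Proof. by move=> [df _]; apply: differentiable_continuous; apply/derivable1_diffP. Qed.

Lemma has_deriv_mean_value f df a b : (a <= b)%R ->
  (forall x, a <= x <= b -> has_deriv f x (df x)) ->
  exists2 x, a <= x <= b & f b - f a = df x * (b - a).
Proof.
move=> ab h; have [x] : exists2 x, x \in `[a, b] & f b - f a = df x * (b - a).
  apply: MVT_segment => //.
    by move=> x; rewrite in_itv /= => /andP[ax xb]; apply: h; rewrite !ltW.
  apply: continuous_in_subspaceT => x; rewrite inE /= in_itv /= => /h.
  exact: has_deriv_continuous.
by rewrite in_itv /= => xab e; exists x.
Qed.

Lemma has_deriv_le f df a b C : a <= b ->
  (forall x, a <= x <= b -> has_deriv f x (df x)) ->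
  (forall x, a <= x <= b -> df x <= C) -> f b - f a <= C * (b - a).
Proof.
move=> ab h hC; have [x xab ->] := has_deriv_mean_value ab h.
by rewrite ler_wpM2r ?subr_ge0 // hC.
Qed.

End RealDerivatives.

(** * Taylor bounds for sine and cosine *)

Section TrigBounds.
Variable R : realType.
Implicit Types u x : R.

(** Each Taylor bound below is obtained from an earlier one by integrating it from 0 with this
    lemma. *)
Lemma has_deriv_ge0 (f df : R -> R) u : 0 <= u -> f 0 = 0 ->
  (forall x, has_deriv f x (df x)) -> (forall x, 0 <= x -> 0 <= df x) -> 0 <= f u.
Proof.
move=> u0 f0 hd hdf.
have := @has_deriv_le R (fun x => - f x) (fun x => - df x) 0 u 0 u0.
rewrite f0 oppr0 subr0 mul0r oppr_le0; apply.
  by move=> x _; apply: has_derivN.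
by move=> x /andP[x0 _]; rewrite oppr_le0 hdf.
Qed.

Lemma sin_le u : 0 <= u -> sin u <= u.
Proof.
move=> u0; rewrite -subr_ge0.
apply: (@has_deriv_ge0 (fun x => x - sin x) (fun x => 1 - cos x)) => //.
- by rewrite sin0 subrr.
- move=> x; apply: has_derivB; [exact: has_deriv_id | exact: is_derive_sin].
Qed.

Lemma cos_ge_quad u : 0 <= u -> 1 - u ^+ 2 / 2 <= cos u.
Proof.
move=> u0; rewrite -subr_ge0.
apply: (@has_deriv_ge0 (fun x => cos x - (1 - x ^+ 2 / 2)) (fun x => x - sin x)) => //.
- by rewrite cos0 expr0n mul0r subr0 subrr.
- move=> x; apply: has_deriv_eq.
    apply: has_derivB; first exact: is_derive_cos.
    apply: has_derivB (has_deriv_cst _ _) _.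
    by apply: has_derivM (has_derivX 2 (has_deriv_id x)) (has_deriv_cst _ _).
  by rewrite /=; field.
- by move=> x x0; rewrite subr_ge0 sin_le.
Qed.

Lemma sin_ge_cubic u : 0 <= u -> u - u ^+ 3 / 6 <= sin u.
Proof.
move=> u0; rewrite -subr_ge0.
apply: (@has_deriv_ge0 (fun x => sin x - (x - x ^+ 3 / 6))
  (fun x => cos x - (1 - x ^+ 2 / 2))) => //.
- by rewrite sin0 expr0n mul0r subr0 subrr.
- move=> x; apply: has_deriv_eq.
    apply: has_derivB; first exact: is_derive_sin.
    apply: has_derivB (has_deriv_id _) _.
    by apply: has_derivM (has_derivX 3 (has_deriv_id x)) (has_deriv_cst _ _).
  by rewrite /=; field.
- by move=> x x0; rewrite subr_ge0 cos_ge_quad.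
Qed.

Lemma sin_ge_quad u : 0 <= u -> u - u ^+ 2 / 2 <= sin u.
Proof.
move=> u0; rewrite -subr_ge0.
apply: (@has_deriv_ge0 (fun x => sin x - (x - x ^+ 2 / 2))
  (fun x => cos x - 1 + x)) => //.
- by rewrite sin0 expr0n mul0r subr0 subrr.
- move=> x; apply: has_deriv_eq.
    apply: has_derivB; first exact: is_derive_sin.
    apply: has_derivB (has_deriv_id _) _.
    by apply: has_derivM (has_derivX 2 (has_deriv_id x)) (has_deriv_cst _ _).
  by rewrite /=; field.
- move=> x x0; have := cos_ge_quad x0; have := cos_geN1 x => h1 h2.
  (* Up to 2 the quadratic bound on the cosine suffices because [x ^ 2 / 2 <= x]; beyond 2 the bound
     [cos x >= -1] does. *)
  by have [x1|x1] := leP x 2; [have : x ^+ 2 <= 2 * x by rewrite expr2 ler_wpM2r | ]; lra.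
Qed.

Lemma cos_le_cubic u : 0 <= u -> cos u <= 1 - u ^+ 2 / 2 + u ^+ 3 / 6.
Proof.
move=> u0; rewrite -subr_ge0.
apply: (@has_deriv_ge0 (fun x => 1 - x ^+ 2 / 2 + x ^+ 3 / 6 - cos x)
  (fun x => sin x - (x - x ^+ 2 / 2))) => //.
- by rewrite cos0 !expr0n !mul0r subr0 addr0 subrr.
- move=> x; apply: has_deriv_eq.
    apply: has_derivB; last exact: is_derive_cos.
    apply: has_derivD.
      apply: has_derivB (has_deriv_cst _ _) _.
      by apply: has_derivM (has_derivX 2 (has_deriv_id x)) (has_deriv_cst _ _).
    by apply: has_derivM (has_derivX 3 (has_deriv_id x)) (has_deriv_cst _ _).
  by rewrite /=; field.
- by move=> x x0; rewrite subr_ge0 sin_ge_quad.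
Qed.

(** Parity reduces to [u >= 0], and the addition formula reduces the expansion at [x] to those of
    sine and cosine at 0, each with error at most [u ^ 3 / 6]. Applied to the phase, this is the
    cost of one jump in the central limit estimate. *)
Lemma cos_taylor2 x u :
  `|cos (x + u) - cos x + sin x * u + cos x * u ^+ 2 / 2| <= `|u| ^+ 3.
Proof.
wlog u0 : x u / 0 <= u => [hw|].
  have [/hw//|u0] := leP 0 u.
  have := hw (- x) (- u); rewrite oppr_ge0 (ltW u0) => /(_ isT).
  by rewrite -opprD !cosN sinN mulrNN sqrrN normrN.
rewrite (ger0_norm u0) cosD.
have -> : cos x * cos u - sin x * sin u - cos x + sin x * u + cos x * u ^+ 2 / 2 =
  cos x * (cos u - (1 - u ^+ 2 / 2)) + sin x * (u - sin u) by field.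
apply: (le_trans (ler_normD _ _)); rewrite !normrM.
have c1 : `|cos x| <= 1 by rewrite ler_norml cos_geN1 cos_le1.
have s1 : `|sin x| <= 1 by rewrite ler_norml sin_geN1 sin_le1.
have h1 := cos_ge_quad u0; have h2 := cos_le_cubic u0.
have h3 := sin_le u0; have h4 := sin_ge_cubic u0.
have u3 : 0 <= u ^+ 3 by rewrite exprn_ge0.
have A : `|cos u - (1 - u ^+ 2 / 2)| <= u ^+ 3 / 6 by rewrite ger0_norm; lra.
have B : `|u - sin u| <= u ^+ 3 / 6 by rewrite ger0_norm; lra.
have A' := ler_pM (normr_ge0 _) (normr_ge0 _) c1 A.
have B' := ler_pM (normr_ge0 _) (normr_ge0 _) s1 B.
by rewrite !mul1r in A' B'; lra.
Qed.

Lemma cos_lipschitz x u : `|cos (x + u) - cos x| <= `|u|.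
Proof.
wlog u0 : x u / 0 <= u => [hw|].
  have [/hw//|u0] := leP 0 u.
  have := hw (- x) (- u); rewrite oppr_ge0 (ltW u0) => /(_ isT).
  by rewrite -opprD !cosN normrN.
rewrite (ger0_norm u0); have xu : x <= x + u by rewrite lerDl.
have [z _ ->] := @has_deriv_mean_value R cos (fun z => - sin z) _ _ xu
  (fun z _ => is_derive_cos z).
by rewrite normrM normrN addrAC subrr add0r (ger0_norm u0) ler_piMl // ler_norml
  sin_geN1 sin_le1.
Qed.

End TrigBounds.

(** * Toeplitz determinants *)

Section Toeplitz.
Variables (F : fieldType) (c e : nat -> F).
Hypothesis c0 : c 0 = 1.
Hypothesis duality : forall n,
  \sum_(p < n.+1) (-1) ^+ p * e p * c (n - p) = (n == 0%N)%:R.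

Definition int_coef (a : nat -> F) (z : int) : F := if z is Posz n then a n else 0.

(** Reading [c] as the complete and [e] as the elementary symmetric functions, which [duality]
    permits, the case [m = 0] is the Jacobi-Trudi matrix of a column of height [k]. *)
Definition toeplitz k m : 'M[F]_k :=
  \matrix_(i, j) int_coef c (1 + j%:Z - i%:Z + m).

Lemma toeplitz_e0 : e 0 = 1.
Proof. by have := duality 0; rewrite big_ord1 expr0 mul1r c0 mulr1. Qed.

Lemma duality_int (z : int) K : z <= K%:Z ->
  \sum_(p < K.+1) (-1) ^+ p * e p * int_coef c (z - p%:Z) = (z == 0)%:R.
Proof.
case: z => [n|n] zK; last first.
  rewrite big1 // => p _; have -> : Negz n - p%:Z = Negz (n + p) by rewrite !NegzE; lia.
  by rewrite /= mulr0.
have -> : (Posz n == 0) = (n == 0%N) by lia.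
rewrite -duality.
have nK : (n < K.+1)%N by lia.
rewrite (big_ord_widen_cond K.+1 xpredT
  (fun p => (-1) ^+ p * e p * c (n - p))) // [RHS]big_mkcond /=.
apply: eq_bigr => p _; case: ltnP => pn.
  by rewrite subzn.
have -> : Posz n - p%:Z = Negz (p - n).-1%N by rewrite NegzE; lia.
by rewrite mulr0.
Qed.

(** The sum stops one term before the full relation; the missing term is nonzero only for
    [z = K + 1], where it contains [c 0 = 1]. These boundary terms are what makes the determinants
    below nontrivial. *)
Lemma duality_int_miss (z : int) K : z <= K.+1%:Z ->
  \sum_(p < K.+1) (-1) ^+ p * e p * int_coef c (z - p%:Z) =
  (z == 0)%:R - (-1) ^+ K.+1 * e K.+1 * (z == K.+1%:Z)%:R.
Proof.
move=> zK; rewrite -(duality_int zK) [in RHS]big_ord_recr /=.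
suff -> : int_coef c (z - K.+1%:Z) = (z == K.+1%:Z)%:R by rewrite addrK.
have [->|zn] := eqVneq z K.+1%:Z; first by rewrite subrr /= c0.
have : z - K.+1%:Z < 0 by lia.
by case: (z - _).
Qed.

(** Multiplying by the unitriangular matrix [E] of signed [e] leaves only row 0 and a subdiagonal of
    ones; expansion along the last column then isolates the corner entry. *)
Lemma det_toeplitz0 k : \det (toeplitz k 0) = e k.
Proof.
case: k => [|k]; first by rewrite det_mx00 toeplitz_e0.
pose E : 'M[F]_k.+1 :=
  \matrix_(l, j) if (l <= j)%N then (-1) ^+ (j - l) * e (j - l) else 0.
pose N : 'M[F]_k.+1 :=
  \matrix_(i, j) if i == ord0 then (-1) ^+ j * e j.+1 else (i == j.+1 :> nat)%:R.
have TE : toeplitz k.+1 0 *m E = N.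
  apply/matrixP => i j; rewrite !mxE.
  rewrite (eq_bigr (fun l : 'I_k.+1 => if (l < j.+1)%N then
      (-1) ^+ (j - l) * e (j - l) * int_coef c (1 + l%:Z - i%:Z) else 0)); last first.
    move=> l _; rewrite !mxE addr0 ltnS; case: leqP => _; last by rewrite mulr0.
    by rewrite mulrC.
  rewrite -big_mkcond -(big_ord_widen k.+1 (fun l =>
     (-1) ^+ (j - l) * e (j - l) * int_coef c (1 + l%:Z - i%:Z))) //.
  rewrite (reindex_inj rev_ord_inj) /=.
  rewrite (eq_bigr (fun l : 'I_j.+1 => (-1) ^+ l * e l *
     int_coef c ((1 + j%:Z - i%:Z) - l%:Z))); last first.
    move=> l _; have lj := ltn_ord l.
    have -> : (j - (j.+1 - l.+1) = l)%N by lia.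
    by congr (_ * int_coef c _); lia.
  rewrite duality_int_miss; last by lia.
  have [i0|i0] := eqVneq i ord0.
    have -> : (1 + j%:Z - i%:Z == 0) = false by rewrite i0 /=; lia.
    have -> : (1 + j%:Z - i%:Z == j.+1%:Z) = true by rewrite i0 /=; lia.
    by rewrite sub0r mulr1 exprS; ring.
  have i1 : (0 < i)%N by rewrite lt0n; apply: contra i0 => /eqP i0; apply/eqP/val_inj.
  have -> : (1 + j%:Z - i%:Z == j.+1%:Z) = false by lia.
  by rewrite mulr0 subr0; congr (_%:R); apply/eqP/eqP; lia.
have dE : \det E = 1.
  rewrite -det_tr det_trig.
    by rewrite big1 // => i _; rewrite !mxE leqnn subnn expr0 mul1r toeplitz_e0.
  by apply/is_trig_mxP => i j ij; rewrite !mxE leqNgt ij.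
have <- : \det N = e k.+1.
  rewrite (expand_det_col _ ord_max) big_ord_recl big1 ?addr0; last first.
    move=> i _; rewrite !mxE /= -[X in _ == X.+1]/(nat_of_ord (@ord_max k)) /=.
    rewrite /bump /= (_ : _ == _ = false) ?mul0r //.
    by have := ltn_ord i; lia.
  rewrite !mxE eqxx /cofactor (_ : row' _ _ = 1%:M) ?det1; last first.
    apply/matrixP => i j; rewrite !mxE.
    rewrite (_ : (lift ord0 i == ord0) = false); last by [].
    rewrite lift0 lift_max /=; congr (_%:R).
  by rewrite mulr1 /= add0n mulrAC -expr2 -exprM mulnC exprM sqrrN !expr1n mul1r.
by rewrite -TE det_mulmx dE mulr1.
Qed.

Lemma duality_int_lt (z : int) K : z <= K%:Z ->
  \sum_(p < K) (-1) ^+ p * e p * int_coef c (z - p%:Z) =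
  (z == 0)%:R - (-1) ^+ K * e K * (z == K%:Z)%:R.
Proof.
case: K => [|K] zK; last exact: duality_int_miss.
by rewrite big_ord0 toeplitz_e0 expr0 !mul1r subrr.
Qed.

(** A closed form of the adjugate of [toeplitz k 0], as [toeplitz_adjE] shows when [e k] is nonzero:
    a rank-one part corrected by a strictly triangular part. *)
Definition toeplitz_adj k : 'M[F]_k :=
  \matrix_(l, i) ((-1) ^+ (i + l) *
    (e i * e (k.-1 - l) - if (l < i)%N then e k * e (i - l).-1 else 0)).

(** The rank-one and the triangular part each give an incomplete duality sum. Keeping [z] an
    arbitrary integer makes the formula available for shifted columns as well. *)
Lemma toeplitz_adj_row k (l : 'I_k) (z : int) :
  \sum_(i < k) toeplitz_adj k l i * int_coef c (z - i%:Z) =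
  (-1) ^+ l * e (k.-1 - l) *
    (\sum_(i < k) (-1) ^+ i * e i * int_coef c (z - i%:Z)) +
  e k * \sum_(p < k.-1 - l)
          (-1) ^+ p * e p * int_coef c (z - l.+1%:Z - p%:Z).
Proof.
have lk := ltn_ord l.
under eq_bigr do rewrite mxE mulrBr mulrBl.
rewrite sumrB; congr (_ + _).
  rewrite mulr_sumr; apply: eq_bigr => i _; rewrite exprD; ring.
rewrite (eq_bigr (fun i : 'I_k => if (l < i)%N then
  (-1) ^+ (i + l) * (e k * e (i - l).-1) * int_coef c (z - i%:Z) else 0)); last first.
  by move=> i _; case: ifP => //; rewrite mulr0 mul0r.
rewrite -(big_mkord xpredT (fun i => if (l < i)%N then
  (-1) ^+ (i + l) * (e k * e (i - l).-1) * int_coef c (z - i%:Z) else 0)).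
rewrite (@big_cat_nat _ _ _ l.+1) //= big_nat_cond big1 ?add0r; last first.
  by move=> i /andP[/andP[_ il] _]; rewrite ltnNge -ltnS il.
rewrite -{1}[l.+1]add0n big_addn big_mkord -sumrN mulr_sumr.
rewrite (_ : (k - l.+1 = k.-1 - l)%N); last by lia.
apply: eq_bigr => p _.
rewrite (_ : (l < p + l.+1)%N); last by lia.
rewrite (_ : (p + l.+1 - l).-1 = p); last by lia.
have -> : (-1) ^+ (p + l.+1 + l) = - (-1) ^+ p :> F.
  by rewrite (_ : (p + l.+1 + l = p + (l * 2).+1)%N) ?exprD ?exprS ?exprM ?sqrr_sign; [ring|lia].
rewrite (_ : z - (p + l.+1)%N%:Z = z - l.+1%:Z - p%:Z); last by lia.
ring.
Qed.

Lemma toeplitz_adj_mul k : toeplitz_adj k *m toeplitz k 0 = (e k)%:M.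
Proof.
apply/matrixP => l j; rewrite !mxE.
have lk := ltn_ord l; have jk := ltn_ord j.
rewrite (eq_bigr (fun i : 'I_k => toeplitz_adj k l i *
  int_coef c ((1 + j%:Z) - i%:Z))); last by move=> i _; rewrite [toeplitz _ _ _ _]mxE addr0.
rewrite toeplitz_adj_row !duality_int_lt; try by lia.
have -> : (1 + j%:Z == 0) = false by lia.
have -> : (1 + j%:Z - l.+1%:Z == 0) = (l == j) by apply/eqP/eqP => [?|->]; [apply/val_inj => /=|]; lia.
have -> : (1 + j%:Z - l.+1%:Z == (k.-1 - l)%N%:Z) = (1 + j%:Z == k%:Z) by lia.
(* Only the last column meets the boundary terms of the two sums, and there they cancel each
   other. *)
case: (1 + j%:Z == k%:Z); rewrite /= ?mulr1 ?mulr0 ?subr0 ?mulr0.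
  have -> : (-1) ^+ k = - ((-1) ^+ l * (-1) ^+ (k.-1 - l)) :> F.
    by rewrite -exprD -[RHS]mulN1r -exprS; congr (_ ^+ _); lia.
  have := sqrr_sign F l; rewrite expr2 => sl.
  rewrite (_ : (-1) ^+ l * e (k.-1 - l) *
    (0 - - ((-1) ^+ l * (-1) ^+ (k.-1 - l)) * e k) =
    ((-1) ^+ l * (-1) ^+ l) * ((-1) ^+ (k.-1 - l) * e (k.-1 - l) * e k)); last by ring.
  by rewrite sl -(mulr_natr (e k)); ring.
by rewrite add0r mulr_natr.
Qed.

Lemma toeplitz_adjE k : e k != 0 -> \adj (toeplitz k 0) = toeplitz_adj k.
Proof.
move=> ek; have := mul_mx_adj (toeplitz k 0).
rewrite det_toeplitz0 => /(congr1 (fun B => (e k)^-1 *: (toeplitz_adj k *m B))).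
rewrite mulmxA toeplitz_adj_mul mul_scalar_mx mul_mx_scalar !scalerA.
by rewrite mulVf // !scale1r.
Qed.

(* Row [l] alone is shifted; summing over [l] gives the action of a power sum
   on the determinant. *)
Definition toeplitz_shift k m (l : 'I_k) : 'M[F]_k :=
  \matrix_(i, j) int_coef c (1 + j%:Z - i%:Z + (if i == l then m else 0)).

(** Expanding along the shifted row uses only cofactors of the unshifted rows, which are entries of
    the adjugate of [toeplitz k 0]. *)
Lemma sum_det_shift k m : e k != 0 ->
  \sum_(l < k) \det (toeplitz_shift m l) =
  \sum_(l < k) \sum_(i < k) toeplitz_adj k l i * int_coef c (1 + l%:Z - i%:Z + m).
Proof.
move=> ek; rewrite [RHS]exchange_big /=; apply: eq_bigr => l _.
rewrite (expand_det_row _ l); apply: eq_bigr => j _.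
rewrite mxE eqxx mulrC; congr (_ * _).
rewrite -(toeplitz_adjE ek) mxE /cofactor; congr (_ * \det _).
apply/matrixP => i j'; rewrite !mxE.
by rewrite (eq_sym _ l) (negPf (neq_lift _ _)).
Qed.

(** For a downward shift no boundary term occurs and the duality relation keeps only [l + 1 = m]. In
    symmetric functions: the adjoint of multiplication by the power sum [p_m] sends [e_k] to
    [(-1) ^ (m - 1) e_{k-m}]. *)
Lemma sum_det_shiftN k m : e k != 0 -> (0 < m)%N ->
  \sum_(l < k) \det (toeplitz_shift (- m%:Z) l) =
  if (m <= k)%N then (-1) ^+ m.-1 * e (k - m) else 0 :> F.
Proof.
move=> ek m0; rewrite sum_det_shift //.
rewrite (eq_bigr (fun l : 'I_k => if l.+1 == m then (-1) ^+ l * e (k.-1 - l) else 0)).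
  rewrite -big_mkcond; case: leqP => mk.
    have mk' : (m.-1 < k)%N by lia.
    rewrite (big_pred1 (Ordinal mk')) /=; last first.
      by move=> l; apply/eqP/eqP => [?|->]; [apply/val_inj => /=|move=> /=]; lia.
    by congr (_ * e _); lia.
  by rewrite big_pred0 // => l; have := ltn_ord l; lia.
move=> l _; have lk := ltn_ord l.
rewrite (eq_bigr (fun i : 'I_k => toeplitz_adj k l i *
  int_coef c ((1 + l%:Z - m%:Z) - i%:Z))); last first.
  by move=> i _; congr (_ * int_coef c _); lia.
rewrite toeplitz_adj_row !duality_int_lt; try by lia.
have -> : (1 + l%:Z - m%:Z - l.+1%:Z == 0) = false by lia.
have -> : (1 + l%:Z - m%:Z - l.+1%:Z == (k.-1 - l)%N%:Z) = false by lia.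
have -> : (1 + l%:Z - m%:Z == k%:Z) = false by lia.
have -> : (1 + l%:Z - m%:Z == 0) = (l.+1 == m) by lia.
by case: ifP => _; rewrite !mulr0 !subr0 ?mulr0 ?mulr1 addr0.
Qed.

Lemma sum_partial_sums (g : nat -> F) n :
  \sum_(b < n) \sum_(p < b) g p = n%:R * \sum_(p < n) g p - \sum_(p < n) p.+1%:R * g p.
Proof.
elim: n => [|n IH]; first by rewrite !big_ord0 mulr0 subrr.
by rewrite !big_ord_recr /= IH -natr1; ring.
Qed.

(** By Newton's identity the sum on the right is [- p_m], so this is the expansion of [p_m e_k] over
    row shifts, with [e_{k+m}] accounting for a shift in a row below the matrix. *)
Lemma sum_det_shiftP k m : e k != 0 -> (0 < m <= k)%N ->
  \sum_(l < k) \det (toeplitz_shift m%:Z l) =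
  (-1) ^+ m * e (k + m) -
  e k * \sum_(p < m.+1) p%:R * ((-1) ^+ p * e p * c (m - p)).
Proof.
move=> ek /andP[m0 mk]; rewrite sum_det_shift //.
pose S K (z : int) := \sum_(i < K) (-1) ^+ i * e i * int_coef c (z - i%:Z).
(* Rows are counted from the bottom, [b = k - 1 - l], so that only the [m] smallest values of [b]
   will contribute. *)
pose G b := (-1) ^+ (k.-1 - b) * e b * S k (k%:Z + m%:Z - b%:Z) + e k * S b m%:Z.
transitivity (\sum_(b < k) G b).
  rewrite [RHS](reindex_inj rev_ord_inj) /=; apply: eq_bigr => l _.
  have lk := ltn_ord l.
  rewrite (eq_bigr (fun i : 'I_k => toeplitz_adj k l i *
    int_coef c ((1 + l%:Z + m%:Z) - i%:Z))); last first.
    by move=> i _; congr (_ * int_coef c _); lia.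
  rewrite toeplitz_adj_row /G /S.
  rewrite (_ : (k - l.+1 = k.-1 - l)%N); last by lia.
  rewrite (_ : (k.-1 - (k.-1 - l))%N = l); last by lia.
  rewrite (_ : 1 + l%:Z + m%:Z - l.+1%:Z = m%:Z); last by lia.
  by rewrite (_ : 1 + l%:Z + m%:Z = k%:Z + m%:Z - (k.-1 - l)%N%:Z); last by lia.
have Gm b : (m <= b < k)%N -> G b = 0.
  move=> /andP[mb bk]; rewrite /G /S !duality_int_lt; try by lia.
  have -> : (k%:Z + m%:Z - b%:Z == 0) = false by lia.
  have -> : (k%:Z + m%:Z - b%:Z == k%:Z) = (b == m) by lia.
  have -> : (m%:Z == b%:Z) = (b == m) by lia.
  have -> : (m%:Z == 0) = false by lia.
  have -> : (-1) ^+ k = - ((-1) ^+ b * (-1) ^+ (k.-1 - b)) :> F.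
    by rewrite -exprD -[RHS]mulN1r -exprS; congr (_ ^+ _); lia.
  case: eqVneq => [_|_]; last by rewrite !mulr0 subrr !mulr0 addr0.
  rewrite !mulr1 (_ : (-1) ^+ (k.-1 - b) * e b *
    (0 - - ((-1) ^+ b * (-1) ^+ (k.-1 - b)) * e k) =
    ((-1) ^+ (k.-1 - b) * (-1) ^+ (k.-1 - b)) * ((-1) ^+ b * e b * e k)); last by ring.
  by rewrite -expr2 sqrr_sign /=; ring.
transitivity (\sum_(b < m) G b).
  rewrite -(big_mkord xpredT G) (@big_cat_nat _ _ _ m) //= -[RHS]addr0 big_mkord.
  by congr (_ + _); rewrite big_nat_cond big1 // => b /andP[/Gm].
pose W b := (-1) ^+ b * e b *
  \sum_(a < m.+1) (-1) ^+ a * e (k + a) * int_coef c (m%:Z - a%:Z - b%:Z).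
have GW b : (b < m)%N -> G b = W b + e k * S b m%:Z.
  move=> bm; congr (_ + _).
  (* The complete relation with [k + m + 1] terms vanishes, so its first [k] terms are minus the
     tail, which involves only [e_k, ..., e_{k+m}]. *)
  have : (k%:Z + m%:Z - b%:Z) <= (k + m)%N%:Z by lia.
  move=> /duality_int; rewrite -addnS big_split_ord /=.
  have -> : (k%:Z + m%:Z - b%:Z == 0) = false by lia.
  move=> /eqP; rewrite addr_eq0 => /eqP; rewrite -/(S k _) => ->.
  rewrite /W mulrN -mulNr.
  have -> : (-1) ^+ (k.-1 - b) = - ((-1) ^+ k * (-1) ^+ b) :> F.
    rewrite -exprD (_ : (k + b = (b + b) + (k.-1 - b).+1)%N); last by lia.
    by rewrite exprD exprS addnn -mul2n exprM sqrrN !expr1n; ring.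
  rewrite !mulr_sumr; apply: eq_bigr => a _.
  rewrite (_ : k%:Z + m%:Z - b%:Z - (k + a)%N%:Z = m%:Z - a%:Z - b%:Z); last by lia.
  transitivity (((-1) ^+ k * (-1) ^+ k) * ((-1) ^+ b * e b *
    ((-1) ^+ a * e (k + a)%N * int_coef c (m%:Z - a%:Z - b%:Z)))).
    by rewrite (exprD _ k a); ring.
  by rewrite -expr2 sqrr_sign mul1r.
rewrite (eq_bigr (fun b : 'I_m => W b + e k * S b m%:Z)) => [|b _]; last exact: GW.
rewrite big_split /= -mulr_sumr.
have -> : \sum_(b < m) W b = (-1) ^+ m * e (k + m) - (-1) ^+ m * e m * e k.
  (* The missing term [b = m] is added so that, after exchanging the sums, the sum over [b] is a
     complete duality relation; it vanishes unless [a = m]. *)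
  have -> : \sum_(b < m) W b = \sum_(b < m.+1) W b - W m.
    by rewrite big_ord_recr /= addrK.
  congr (_ - _); last first.
    rewrite /W big_ord_recl big1 => [|a _]; last first.
      rewrite lift0 (_ : m%:Z - a.+1%:Z - m%:Z = Negz a) ?mulr0 //.
      by rewrite NegzE; lia.
    by rewrite /= subr0 subrr /= c0 addn0 expr0; ring.
  rewrite (eq_bigr (fun b : 'I_m.+1 => \sum_(a < m.+1) (-1) ^+ a * e (k + a) *
    ((-1) ^+ b * e b * int_coef c (m%:Z - a%:Z - b%:Z)))); last first.
    by move=> b _; rewrite /W mulr_sumr; apply: eq_bigr => a _; ring.
  rewrite exchange_big /= big_ord_recr big1 /=; last first.
    move=> a _; rewrite -mulr_sumr duality_int; last by lia.
    have -> : (m%:Z - a%:Z == 0) = false by have := ltn_ord a; lia.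
    by rewrite mulr0.
  by rewrite add0r -mulr_sumr duality_int ?subrr ?eqxx ?mulr1.
pose g p := (-1) ^+ p * e p * c (m - p).
have Sg b : (b < m)%N -> S b m%:Z = \sum_(p < b) g p.
  move=> bm; apply: eq_bigr => p _; have pb := ltn_ord p.
  by rewrite subzn //=; lia.
rewrite (eq_bigr (fun b : 'I_m => \sum_(p < b) g p)) => [|b _]; last exact: Sg.
rewrite sum_partial_sums.
have := duality m; rewrite big_ord_recr /= -/(g m).
rewrite (_ : (m == 0%N) = false); last by lia.
move=> /eqP; rewrite addr_eq0 => /eqP; rewrite -/(g _) => gs.
have -> : \sum_(p < m) p.+1%:R * g p = \sum_(p < m) p%:R * g p + \sum_(p < m) g p.
  by rewrite -big_split; apply: eq_bigr => p _; rewrite -natr1 /=; ring.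
rewrite gs big_ord_recr /= -/(g m).
have -> : g m = (-1) ^+ m * e m by rewrite /g subnn c0 mulr1.
rewrite (eq_bigr (fun p : 'I_m => p%:R * g p)) //; ring.
Qed.

End Toeplitz.

(** * The limiting covariance of the heights *)

Section TruncatedExp.
Variable F : numFieldType.
Implicit Type tau : F.

Definition expterm tau n : F := tau ^+ n / n`!%:R.

Definition truncexp tau k : F := \sum_(j < k.+1) expterm tau j.

Definition exp1coef tau n : F :=
  expterm tau n + (if n is n'.+1 then expterm tau n' else 0).

(** Limiting covariance of the fluctuations of [f_r] and [f_s] over [sqrt kappa]. The expression is
    not symmetric in [r] and [s] and is meant for [s <= r + 1]; [sym_cov] covers the other order. *)
Definition limit_cov tau r s : F :=
  if s is s'.+1 then
    tau * truncexp tau r * truncexp tau s' -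
    \sum_(m < s) truncexp tau (s' - m) * (truncexp tau (r + m.+1) - truncexp tau r)
  else 0.

Lemma expterm0 tau : expterm tau 0 = 1.
Proof. by rewrite /expterm expr0 fact0 divr1. Qed.

Lemma expterm1 tau : expterm tau 1 = tau.
Proof. by rewrite /expterm expr1 factS fact0 muln1 divr1. Qed.

Lemma exptermS tau n : n.+1%:R * expterm tau n.+1 = tau * expterm tau n.
Proof.
rewrite /expterm factS natrM exprS.
have n0 : n.+1%:R != 0 :> F by rewrite pnatr_eq0.
have f0 : n`!%:R != 0 :> F by rewrite pnatr_eq0 -lt0n fact_gt0.
by move: n.+1%:R n`!%:R n0 f0 => u v u0 v0; field; rewrite u0 v0.
Qed.

Lemma truncexp0 tau : truncexp tau 0 = 1.
Proof. by rewrite /truncexp big_ord1 expterm0. Qed.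

Lemma truncexpS tau k : truncexp tau k.+1 = truncexp tau k + expterm tau k.+1.
Proof. by rewrite /truncexp big_ord_recr. Qed.

Lemma exp1coefS tau n : exp1coef tau n.+1 = expterm tau n.+1 + expterm tau n.
Proof. by []. Qed.

Lemma exp1coef0 tau : exp1coef tau 0 = 1.
Proof. by rewrite /exp1coef expterm0 addr0. Qed.

(** Coefficient of [z ^ n] in [exp (- tau z) exp (tau z) = 1]. *)
Lemma alternating_expterm tau n :
  \sum_(p < n.+1) (-1) ^+ p * expterm tau p * expterm tau (n - p) = (n == 0%N)%:R.
Proof.
have f0 k : k`!%:R != 0 :> F by rewrite pnatr_eq0 -lt0n fact_gt0.
transitivity ((tau - tau) ^+ n / n`!%:R).
  rewrite exprBn mulr_suml; apply: eq_bigr => p _.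
  have pn : (p <= n)%N by rewrite -ltnS ltn_ord.
  rewrite -mulr_natr -(bin_fact pn) !natrM invfM /expterm -[tau ^+ (n - p)]mulr1.
  have b0 : 'C(n, p)%:R != 0 :> F by rewrite pnatr_eq0 -lt0n bin_gt0.
  by move: 'C(n, p)%:R p`!%:R (n - p)`!%:R b0 (f0 p) (f0 (n - p)%N) => u v w u0 v0 w0;
    field; rewrite u0 v0 w0.
by rewrite subrr expr0n; case: n => [|n] /=; rewrite ?mul0r // fact0 divr1.
Qed.

Lemma alternating_truncexp tau n :
  \sum_(p < n.+1) (-1) ^+ p * truncexp tau p * expterm tau (n - p) = (-1) ^+ n.
Proof.
elim: n => [|n IH]; first by rewrite big_ord1 expr0 truncexp0 expterm0 !mul1r.
have := alternating_expterm tau n.+1; rewrite big_ord_recl /=.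
rewrite (eq_bigr (fun p : 'I_n.+1 =>
   (-1) ^+ p.+1 * truncexp tau p.+1 * expterm tau (n.+1 - p.+1) +
   (-1) ^+ p * truncexp tau p * expterm tau (n - p))); last first.
  by move=> p _; rewrite /bump /= add1n truncexpS subSS exprS; ring.
rewrite big_split /= IH => h; rewrite big_ord_recl /= truncexp0.
under eq_bigr do rewrite /bump /= add1n.
by move: h => /eqP; rewrite expterm0 addrA addr_eq0 => /eqP ->; rewrite exprS mulN1r.
Qed.

(** The generating function of [(-1) ^ p D_p] is [exp (- tau z) / (1 + z)], the inverse of that of
    [exp1coef]. *)
Lemma truncexp_duality tau n :
  \sum_(p < n.+1) (-1) ^+ p * truncexp tau p * exp1coef tau (n - p) = (n == 0%N)%:R.
Proof.
case: n => [|n]; first by rewrite big_ord1 expr0 truncexp0 exp1coef0 !mul1r.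
rewrite big_ord_recr /= subnn exp1coef0 mulr1.
rewrite (eq_bigr (fun p : 'I_n.+1 =>
   (-1) ^+ p * truncexp tau p * expterm tau (n.+1 - p) +
   (-1) ^+ p * truncexp tau p * expterm tau (n - p))); last first.
  move=> p _; rewrite subSn; last by rewrite -ltnS.
  by rewrite exp1coefS mulrDr.
rewrite big_split /= alternating_truncexp addrAC.
have := alternating_truncexp tau n.+1.
rewrite big_ord_recr /= subnn expterm0 mulr1 => ->.
by rewrite exprS mulN1r addNr.
Qed.

(** With [E (z) = exp (- tau z) / (1 + z)], the left side is the coefficient of [z ^ m] in
    [z E' / E = - tau z - z / (1 + z)]. The exceptional value at [m = 1] is the origin of the
    leading term of [limit_cov]. *)
Lemma truncexp_newton tau m : (0 < m)%N ->
  \sum_(p < m.+1) p%:R * ((-1) ^+ p * truncexp tau p * exp1coef tau (m - p)) =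
  (-1) ^+ m - (if m == 1%N then tau else 0).
Proof.
case: m => // m _.
rewrite big_ord_recr /= subnn exp1coef0 mulr1.
rewrite (eq_bigr (fun p : 'I_m.+1 =>
   p%:R * ((-1) ^+ p * truncexp tau p * expterm tau (m.+1 - p)) +
   p%:R * ((-1) ^+ p * truncexp tau p * expterm tau (m - p)))); last first.
  move=> p _; rewrite subSn; last by rewrite -ltnS.
  by rewrite exp1coefS; ring.
rewrite big_split /= addrAC.
have -> : \sum_(p < m.+1) p%:R * ((-1) ^+ p * truncexp tau p * expterm tau (m.+1 - p)) +
   m.+1%:R * ((-1) ^+ m.+1 * truncexp tau m.+1) =
  - \sum_(p < m.+1) p.+1%:R * ((-1) ^+ p * truncexp tau p.+1 * expterm tau (m - p)).
  transitivity (\sum_(p < m.+2) p%:R * ((-1) ^+ p * truncexp tau p * expterm tau (m.+1 - p))).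
    by rewrite [RHS]big_ord_recr /= subnn expterm0 mulr1.
  rewrite big_ord_recl mul0r add0r -sumrN; apply: eq_bigr => p _.
  by rewrite lift0 subSS exprS; ring.
rewrite -mulN1r mulr_sumr -big_split /=.
rewrite (eq_bigr (fun p : 'I_m.+1 =>
   - (tau * ((-1) ^+ p * expterm tau p * expterm tau (m - p))) -
   (-1) ^+ p * truncexp tau p * expterm tau (m - p))); last first.
  move=> p _; rewrite truncexpS -[p.+1%:R]natr1.
  transitivity (- ((-1) ^+ p * expterm tau (m - p) * (p.+1%:R * expterm tau p.+1)) -
     (-1) ^+ p * truncexp tau p * expterm tau (m - p)).
    by rewrite -natr1; ring.
  by rewrite exptermS; ring.
rewrite big_split /= !sumrN -mulr_sumr alternating_expterm alternating_truncexp.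
rewrite eqSS exprS mulN1r; case: (m == 0%N); rewrite ?mulr1 ?mulr0 addrC ?subr0 //.
Qed.

Lemma sum_truncexp tau k :
  \sum_(j < k.+1) truncexp tau j = k.+1%:R * truncexp tau k.+1 - tau * truncexp tau k.
Proof.
elim: k => [|k IH].
  by rewrite big_ord1 truncexpS truncexp0 expterm1; ring.
rewrite big_ord_recr /= IH [truncexp tau k.+2]truncexpS.
rewrite [in RHS]mulrDr exptermS -[k.+2%:R]natr1 [truncexp tau k.+1]truncexpS; ring.
Qed.

(** The differential equation on the diagonal lowers the first index below the second; this identity
    says that the asymmetric formula still has the symmetric value there. *)
Lemma limit_cov_diag tau s : limit_cov tau s s.+1 = limit_cov tau s.+1 s.
Proof.
case: s => [|s].
  rewrite /limit_cov big_ord1 /= truncexpS truncexp0 expterm1; ring.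
have sumE n r : \sum_(m < n.+1) truncexp tau (n - m) * (truncexp tau (r + m.+1) - truncexp tau r) =
    \sum_(m < n.+1) truncexp tau (n - m) * truncexp tau (r + m.+1) -
    truncexp tau r * (n.+1%:R * truncexp tau n.+1 - tau * truncexp tau n).
  rewrite -sum_truncexp mulr_sumr (reindex_inj rev_ord_inj) [in RHS](reindex_inj rev_ord_inj) /=.
  rewrite -sumrB; apply: eq_bigr => m _.
  by have mn := ltn_ord m; rewrite subSS subKn //; ring.
rewrite /limit_cov !sumE big_ord_recl /=.
rewrite (eq_bigr (fun m : 'I_s.+1 => truncexp tau (s - m) * truncexp tau (s.+2 + m.+1))); last first.
  by move=> m _; rewrite /bump /= add1n subSS; congr (_ * truncexp tau _); lia.
rewrite subn0 addn1 -[s.+2%:R]natr1; ring.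
Qed.

End TruncatedExp.

(** * Differential equations for the limiting covariance *)

Section LimitCovariance.
Variable R : realType.
Implicit Type tau : R.

Definition sym_cov tau r s : R := limit_cov tau (maxn r s) (minn r s).

Lemma sym_covC tau r s : sym_cov tau r s = sym_cov tau s r.
Proof. by rewrite /sym_cov maxnC minnC. Qed.

Lemma has_deriv_expterm0 tau : has_deriv (fun x => expterm x 0) tau 0.
Proof. by apply: has_deriv_ext (has_deriv_cst 1 tau) => x; rewrite expterm0. Qed.

Lemma has_deriv_exptermS tau n :
  has_deriv (fun x => expterm x n.+1) tau (expterm tau n).
Proof.
apply: (@has_deriv_ext _ (fun x => (n.+1)`!%:R^-1 * x ^+ n.+1)) => [x|].
  by rewrite /expterm mulrC.
apply: has_deriv_eq (has_derivZ _ (has_derivX n.+1 (has_deriv_id tau))) _.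
have f0 : n`!%:R != 0 :> R by rewrite pnatr_eq0 -lt0n fact_gt0.
have n0 : n.+1%:R != 0 :> R by rewrite pnatr_eq0.
rewrite /expterm factS natrM /=.
by move: n.+1%:R n`!%:R n0 f0 => u v u0 v0; field; rewrite u0 v0.
Qed.

Definition dexpterm tau n : R := if n is n'.+1 then expterm tau n' else 0.

Lemma has_deriv_expterm tau n : has_deriv (fun x => expterm x n) tau (dexpterm tau n).
Proof. by case: n => [|n]; [exact: has_deriv_expterm0 | exact: has_deriv_exptermS]. Qed.

Lemma has_deriv_truncexp0 tau : has_deriv (fun x => truncexp x 0) tau 0.
Proof. by apply: has_deriv_ext (has_deriv_cst 1 tau) => x; rewrite truncexp0. Qed.

Lemma has_deriv_truncexpS tau k :
  has_deriv (fun x => truncexp x k.+1) tau (truncexp tau k).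
Proof.
elim: k => [|k IH].
  apply: (@has_deriv_ext _ (fun x => truncexp x 0 + expterm x 1)) => [x|].
    by rewrite truncexpS.
  apply: has_deriv_eq (has_derivD (has_deriv_truncexp0 tau) (has_deriv_exptermS tau 0)) _.
  by rewrite add0r truncexp0 expterm0.
apply: (@has_deriv_ext _ (fun x => truncexp x k.+1 + expterm x k.+2)) => [x|].
  by rewrite [RHS]truncexpS.
by rewrite truncexpS; apply: has_derivD IH (has_deriv_exptermS _ _).
Qed.

Definition dtruncexp tau k : R := if k is k'.+1 then truncexp tau k' else 0.

Lemma has_deriv_truncexp tau k :
  has_deriv (fun x => truncexp x k) tau (dtruncexp tau k).
Proof. by case: k => [|k]; [exact: has_deriv_truncexp0 | exact: has_deriv_truncexpS]. Qed.

Lemma truncexp_ge1 tau k : 0 <= tau -> 1 <= truncexp tau k.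
Proof.
move=> t0; rewrite /truncexp big_ord_recl expterm0 lerDl sumr_ge0 // => i _.
by rewrite divr_ge0 ?exprn_ge0.
Qed.

Lemma truncexp_ge0 tau k : 0 <= tau -> 0 <= truncexp tau k.
Proof. by move=> t0; rewrite (le_trans ler01) // truncexp_ge1. Qed.

Lemma expterm_bound tau T k : 0 <= tau <= T -> 0 <= expterm tau k <= expterm T k.
Proof.
move=> /andP[t0 tT]; rewrite /expterm divr_ge0 ?exprn_ge0 //= ler_wpM2r ?invr_ge0 //.
by rewrite lerXn2r // nnegrE // (le_trans t0).
Qed.

Lemma truncexp_le tau T k m : 0 <= tau <= T -> (k <= m)%N -> truncexp tau k <= truncexp T m.
Proof.
move=> tT; have := expterm_bound _ tT => e; move=> /subnK <-.
apply: (@le_trans _ _ (truncexp T k)).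
  by apply: ler_sum => j _; case/andP: (e j).
elim: (m - k)%N => // j; rewrite addSn truncexpS => /le_trans; apply.
by rewrite lerDl; case/andP: (e (j + k).+1) => /le_trans; apply.
Qed.

(** The index is doubled because the formula for indices up to [n] contains [D_{r+m}] with
    [r + m <= 2 n]. *)
Definition cov_bound T n : R := (T + n%:R) * truncexp T n.*2 ^+ 2.

Lemma limit_cov_bound tau T n r s : 0 <= tau <= T -> (r <= n)%N -> (s <= n)%N ->
  `|limit_cov tau r s| <= cov_bound T n.
Proof.
move=> tT rn sn; set E := truncexp T n.*2.
have [t0 tT'] := andP tT; have T0 := le_trans t0 tT'.
have dE k : (k <= n.*2)%N -> 0 <= truncexp tau k <= E.
  by move=> kn; rewrite (truncexp_le tT) // (le_trans ler01) // truncexp_ge1.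
have E0 : 0 <= E by case/andP: (dE 0%N isT) => /le_trans h /h.
case: s sn => [|s] sn; first by rewrite normr0 mulr_ge0 ?sqr_ge0 // addr_ge0.
rewrite /limit_cov; apply: (le_trans (ler_normB _ _)).
rewrite /cov_bound mulrDl; apply: lerD.
  rewrite -mulrA normrM (ger0_norm t0); apply: ler_pM => //.
  rewrite normrM expr2; have /dE/andP[h1 h2] : (r <= n.*2)%N by lia.
  have /dE/andP[h3 h4] : (s <= n.*2)%N by lia.
  by rewrite !ger0_norm // ler_pM.
apply: (le_trans (ler_norm_sum _ _ _)).
apply: (@le_trans _ _ (\sum_(m < s.+1) E ^+ 2)); last first.
  by rewrite sumr_const card_ord -[_ *+ s.+1]mulr_natl ler_wpM2r ?sqr_ge0 // ler_nat.
apply: ler_sum => m _; rewrite normrM expr2; have ms := ltn_ord m.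
have /dE/andP[h1 h2] : ((s - m)%N <= n.*2)%N by lia.
have /dE/andP[h3 h4] : ((r + m.+1)%N <= n.*2)%N by lia.
have /dE/andP[h5 h6] : (r <= n.*2)%N by lia.
have h7 : truncexp tau r <= truncexp tau (r + m.+1).
  by apply: truncexp_le; rewrite ?t0 ?lexx ?leq_addr.
rewrite ger0_norm // ger0_norm ?subr_ge0 // ler_pM ?subr_ge0 //.
by rewrite lerBlDr (le_trans h4) // lerDl.
Qed.

Lemma has_deriv_limit_covS tau r s :
  has_deriv (fun x => limit_cov x r.+1 s.+1) tau
    (limit_cov tau r s.+1 + limit_cov tau r.+1 s + truncexp tau r.+1 * truncexp tau s).
Proof.
rewrite {1}/limit_cov.
apply: has_deriv_eq.
  apply: has_derivB.
    by apply: has_derivM (has_deriv_truncexp _ _); apply: has_derivM;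
      [exact: has_deriv_id | exact: has_deriv_truncexp].
  apply: has_deriv_sum => m _; apply: has_derivM; first exact: has_deriv_truncexp.
  by apply: has_derivB; exact: has_deriv_truncexp.
rewrite /= big_split /=.
(* Differentiating the weights [D_{s-m}] lowers [s] by one; the last of them is the constant [D_0]
   and drops out. *)
have -> : limit_cov tau r.+1 s = tau * truncexp tau r.+1 * dtruncexp tau s -
   \sum_(m < s.+1) dtruncexp tau (s - m) * (truncexp tau (r.+1 + m.+1) - truncexp tau r.+1).
  case: s => [|s] /=; first by rewrite big_ord1 /= mul0r mulr0 subr0.
  rewrite [in RHS]big_ord_recr /= subnn mul0r addr0; congr (_ - _).
  apply: eq_bigr => m _; rewrite subSn //; last by rewrite -ltnS.
by ring.
Qed.

(** Right side of the second moment equation: the drift lowers either index, and the jumps that move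
    both heights contribute [D_max D_{min-1}]. *)
Definition sym_cov_drift tau r s : R :=
  (if r is r'.+1 then sym_cov tau r' s else 0) +
  (if s is s'.+1 then sym_cov tau r s' else 0) +
  (if minn r s is m.+1 then truncexp tau (maxn r s) * truncexp tau m else 0).

Lemma sym_cov_bound tau T n r s : 0 <= tau <= T -> (r <= n)%N -> (s <= n)%N ->
  `|sym_cov tau r s| <= cov_bound T n.
Proof. by move=> tT rn sn; apply: limit_cov_bound; rewrite // ?geq_max ?rn // geq_min rn. Qed.

Lemma sym_covr0 tau r : sym_cov tau r 0 = 0.
Proof. by rewrite /sym_cov minn0. Qed.

Lemma sym_covE tau r s : (s <= r.+1)%N -> sym_cov tau r s = limit_cov tau r s.
Proof.
rewrite leq_eqVlt => /orP[/eqP ->|sr].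
  by rewrite /sym_cov (maxn_idPr (leqnSn r)) (minn_idPl (leqnSn r)) limit_cov_diag.
by rewrite /sym_cov (maxn_idPl _) ?(minn_idPr _).
Qed.

Lemma has_deriv_sym_cov tau r s :
  has_deriv (fun x => sym_cov x r s) tau (sym_cov_drift tau r s).
Proof.
wlog rs : r s / (s <= r)%N => [hw|].
  have [/hw//|/ltnW/hw h] := leqP s r.
  apply: has_deriv_ext (has_deriv_eq h _) => [x|]; first exact: sym_covC.
  rewrite /sym_cov_drift minnC maxnC (addrC (if s is _.+1 then _ else _)).
  by congr (_ + _ + _); [case: (r)|case: (s)] => // ?; exact: sym_covC.
case: s rs => [|s] rs.
  rewrite /sym_cov_drift minn0 addr0; case: r rs => [|r] rs.
    by rewrite addr0; apply: has_deriv_ext (has_deriv_cst 0 _) => x; rewrite sym_covr0.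
  rewrite sym_covr0 addr0.
  by apply: has_deriv_ext (has_deriv_cst 0 _) => x; rewrite sym_covr0.
case: r rs => // r rs.
have -> : sym_cov_drift tau r.+1 s.+1 =
    limit_cov tau r s.+1 + limit_cov tau r.+1 s + truncexp tau r.+1 * truncexp tau s.
  rewrite /sym_cov_drift (maxn_idPl _) // (minn_idPr _) //.
  by rewrite !sym_covE //; lia.
by apply: has_deriv_ext (has_deriv_limit_covS _ _ _) => x; rewrite sym_covE //; lia.
Qed.

Lemma sym_cov_at0 r s : sym_cov (0 : R) r s = 0.
Proof.
rewrite /sym_cov /limit_cov; case: minn => // m.
have e0 k : expterm (0 : R) k.+1 = 0 by rewrite /expterm expr0n mul0r.
have t0 k : truncexp (0 : R) k = 1.
  by elim: k => [|k IH]; rewrite ?truncexp0 // truncexpS IH e0 addr0.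
by rewrite !mul0r big1 ?subr0 // => i _; rewrite !t0 subrr mulr0.
Qed.

Lemma truncexp_at0 k : truncexp (0 : R) k = 1.
Proof.
elim: k => [|k IH]; rewrite ?truncexp0 // truncexpS IH /expterm expr0n mul0r.
by rewrite addr0.
Qed.

End LimitCovariance.

(** * Moments of Poissonized chains *)

Section PoissonizedChain.
Variables (R : realType) (S : Type) (n : nat).
Implicit Types s : R.
Variables (r : S -> nat -> R) (J : S -> nat -> S) (V : S -> Prop) (x0 : S).

(** One step of the jump chain when the total rate is 1. Jumps with index from [n] on are counted as
    holding, which is harmless for functions of the first [n] coordinates. *)
Definition chain_step (h : S -> R) (x : S) : R :=
  h x + \sum_(k < n) r x k * (h (J x k) - h x).

Definition poisson_weight (s : R) m : R := expR (- s) * expterm s m.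

(** The part of the expectation at time [s] carried by the paths with fewer than [M] jumps, the
    number of jumps being Poisson and independent of the chain. *)
Definition trunc_expect M s (h : S -> R) : R :=
  \sum_(m < M) poisson_weight s m * iter m chain_step h x0.

Hypothesis Vx0 : V x0.
Hypothesis r_ge0 : forall x k, V x -> 0 <= r x k.
Hypothesis r_le1 : forall x, V x -> \sum_(k < n) r x k <= 1.
Hypothesis VJ : forall x k, V x -> r x k != 0 -> V (J x k).

Lemma chain_stepE h x :
  chain_step h x = (1 - \sum_(k < n) r x k) * h x + \sum_(k < n) r x k * h (J x k).
Proof.
rewrite /chain_step mulrBl mul1r -addrA; congr (_ + _).
rewrite mulr_suml -sumrN -big_split /=; apply: eq_bigr => k _; ring.
Qed.

Lemma chain_step_le h g : (forall x, V x -> h x <= g x) ->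
  forall x, V x -> chain_step h x <= chain_step g x.
Proof.
move=> hg x Vx; rewrite !chain_stepE lerD //.
  by rewrite ler_wpM2l ?hg // subr_ge0 r_le1.
apply: ler_sum => k _; have [->|rk] := eqVneq (r x k) 0; first by rewrite !mul0r.
by rewrite ler_wpM2l ?r_ge0 // hg //; apply: VJ.
Qed.

Lemma iter_chain_step_le m h g : (forall x, V x -> h x <= g x) ->
  forall x, V x -> iter m chain_step h x <= iter m chain_step g x.
Proof. by move=> hg; elim: m => //= m IH; exact: chain_step_le. Qed.

Lemma chain_step_lin a h g :
  chain_step (fun x => a * h x + g x) =1 (fun x => a * chain_step h x + chain_step g x).
Proof.
move=> x; rewrite /chain_step mulrDr mulr_sumr addrACA; congr (_ + _).
by rewrite -big_split /=; apply: eq_bigr => k _; ring.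
Qed.

Lemma iter_chain_step_lin m a h g :
  iter m chain_step (fun x => a * h x + g x) =1
  (fun x => a * iter m chain_step h x + iter m chain_step g x).
Proof.
elim: m => //= m IH x; rewrite -chain_step_lin.
by congr (chain_step _ x); apply/funext.
Qed.

Lemma iter_chain_step_cst m c x : iter m chain_step (fun=> c) x = c.
Proof.
elim: m x => //= m IH x; rewrite /chain_step !IH big1 ?addr0 // => k _.
by rewrite IH subrr mulr0.
Qed.

Lemma iter_chain_stepZ m a h x :
  iter m chain_step (fun y => a * h y) x = a * iter m chain_step h x.
Proof.
have := iter_chain_step_lin m a h (fun=> 0) x.
rewrite iter_chain_step_cst addr0 => <-; congr (iter m chain_step _ x).
by apply/funext => y; rewrite addr0.
Qed.

Lemma iter_chain_step_deriv m (h : R -> S -> R) dh s :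
  (forall x, has_deriv (fun u => h u x) s (dh x)) ->
  forall x, has_deriv (fun u => iter m chain_step (h u) x) s (iter m chain_step dh x).
Proof.
move=> hd; elim: m => //= m IH x.
apply: has_derivD => //; apply: has_deriv_sum => k _.
by apply: has_derivZ; apply: has_derivB.
Qed.

Lemma expterm_ge0 (s : R) m : 0 <= s -> 0 <= expterm s m.
Proof. by move=> s0; rewrite divr_ge0 ?exprn_ge0. Qed.

Lemma poisson_weight_ge0 s m : 0 <= s -> 0 <= poisson_weight s m.
Proof. by move=> s0; rewrite mulr_ge0 ?expR_ge0 ?expterm_ge0. Qed.

Lemma trunc_expect_le M s h g : 0 <= s -> (forall x, V x -> h x <= g x) ->
  trunc_expect M s h <= trunc_expect M s g.
Proof.
move=> s0 hg; apply: ler_sum => m _.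
by rewrite ler_wpM2l ?poisson_weight_ge0 // iter_chain_step_le.
Qed.

Lemma trunc_expect_lin M s a h g :
  trunc_expect M s (fun x => a * h x + g x) =
  a * trunc_expect M s h + trunc_expect M s g.
Proof.
rewrite /trunc_expect mulr_sumr -big_split; apply: eq_bigr => m _ /=.
by rewrite iter_chain_step_lin; ring.
Qed.

Lemma trunc_expectD M s h g :
  trunc_expect M s (fun x => h x + g x) = trunc_expect M s h + trunc_expect M s g.
Proof.
have := trunc_expect_lin M s 1 h g; rewrite mul1r => <-.
by congr trunc_expect; apply/funext => x; rewrite mul1r.
Qed.

Lemma trunc_expectZ M s a h :
  trunc_expect M s (fun x => a * h x) = a * trunc_expect M s h.
Proof.
rewrite /trunc_expect mulr_sumr; apply: eq_bigr => m _.
by rewrite iter_chain_stepZ mulrCA.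
Qed.

Lemma trunc_expect_sum M s (I : Type) (l : seq I) (h : I -> S -> R) :
  trunc_expect M s (fun x => \sum_(i <- l) h i x) =
  \sum_(i <- l) trunc_expect M s (h i).
Proof.
elim: l => [|i l IH].
  rewrite big_nil -[RHS](mul0r (trunc_expect M s (fun=> 0))) -trunc_expectZ.
  by congr trunc_expect; apply/funext => x; rewrite big_nil mul0r.
rewrite big_cons -IH -trunc_expectD; congr trunc_expect.
by apply/funext => x; rewrite big_cons.
Qed.

Lemma has_deriv_poisson_weight s m : has_deriv (poisson_weight^~ m) s
  ((if m is m'.+1 then poisson_weight s m' else 0) - poisson_weight s m).
Proof.
have he : has_deriv (fun u : R => expR (- u)) s (expR (- s) * - 1).
  exact: has_deriv_expR (has_derivN (has_deriv_id s)).
case: m => [|m].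
  apply: has_deriv_eq (has_derivM he (has_deriv_expterm0 s)) _; rewrite /poisson_weight. ring.
apply: has_deriv_eq (has_derivM he (has_deriv_exptermS s m)) _.
by rewrite /poisson_weight; ring.
Qed.

(** The derivative of a Poisson weight is a difference of neighbouring weights, so a shift of the
    sum reproduces the generator [chain_step - id]; the cut leaves the last weight as a boundary
    term. *)
Lemma has_deriv_trunc_expect M (h : R -> S -> R) dh s :
  (forall x, has_deriv (fun u => h u x) s (dh x)) ->
  has_deriv (fun u => trunc_expect M.+1 u (h u)) s
    (trunc_expect M.+1 s (fun x => dh x + chain_step (h s) x - h s x) -
     poisson_weight s M * iter M.+1 chain_step (h s) x0).
Proof.
move=> hd; apply: has_deriv_eq.
  apply: has_deriv_sum => m _.
  apply: has_derivM; first exact: has_deriv_poisson_weight.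
  exact: iter_chain_step_deriv.
pose a m := iter m chain_step (h s) x0.
have -> : trunc_expect M.+1 s (fun x => dh x + chain_step (h s) x - h s x) =
  trunc_expect M.+1 s dh + trunc_expect M.+1 s (chain_step (h s)) - trunc_expect M.+1 s (h s).
  rewrite -trunc_expectD -mulN1r addrC -trunc_expect_lin.
  by congr trunc_expect; apply/funext => x; ring.
have -> : trunc_expect M.+1 s (chain_step (h s)) =
    \sum_(m < M.+1) poisson_weight s m * a m.+1.
  by apply: eq_bigr => m _; rewrite /a iterSr.
rewrite big_split /= -/(trunc_expect _ _ dh).
rewrite (eq_bigr (fun m : 'I_M.+1 =>
   (if nat_of_ord m is m'.+1 then poisson_weight s m' else 0) * a m - poisson_weight s m * a m)); last first.
  by move=> m _; rewrite mulrBl.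
rewrite sumrB -/(trunc_expect _ _ (h s)) big_ord_recl /= mul0r add0r.
rewrite [X in _ = _ + X - _ - _]big_ord_recr /= -/(a M.+1).
have -> : \sum_(i < M) (if bump 0 i is m'.+1 then poisson_weight s m' else 0) * a (bump 0 i)
  = \sum_(i < M) poisson_weight s i * a i.+1 by [].
rewrite -[chain_step (iter M chain_step (h s)) x0]/(a M.+1); ring.
Qed.

Lemma trunc_expect_at0 M h : trunc_expect M.+1 0 h = h x0.
Proof.
rewrite /trunc_expect big_ord_recl big1 ?addr0.
  by rewrite /poisson_weight oppr0 expR0 expterm0 !mul1r.
by move=> m _; rewrite /poisson_weight lift0 /expterm expr0n /= !mul0r mulr0 mul0r.
Qed.

Lemma expterm_le (s s1 : R) m : 0 <= s <= s1 -> expterm s m <= expterm s1 m.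
Proof.
move=> /andP[s0 ss1]; rewrite /expterm ler_wpM2r ?invr_ge0 //.
by rewrite lerXn2r // nnegrE // (le_trans s0).
Qed.

Lemma poisson_weight_le (s s1 : R) m : 0 <= s <= s1 -> poisson_weight s m <= expterm s1 m.
Proof.
move=> /[dup] /expterm_le h /andP[s0 ss1]; apply: le_trans (h m).
by rewrite ler_piMl ?expterm_ge0 // -expR0 ler_expR oppr_le0.
Qed.

(* Dynkin's formula as an inequality; the last term is the price of keeping only
   the first [M.+1] jumps. *)
Lemma dynkin_le M (h dh g : R -> S -> R) (s1 B C rho : R) : 0 <= s1 -> 0 <= C -> 0 <= rho ->
  (forall s x, 0 <= s <= s1 -> has_deriv (fun u => h u x) s (dh s x)) ->
  (forall s x, 0 <= s <= s1 -> V x -> dh s x + chain_step (h s) x - h s x <= g s x) ->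
  (forall s, 0 <= s <= s1 -> trunc_expect M.+1 s (g s) <= B) ->
  (forall s, 0 <= s <= s1 -> - (C * rho ^+ M.+1) <= iter M.+1 chain_step (h s) x0) ->
  trunc_expect M.+1 s1 (h s1) <=
    h 0 x0 + B * s1 + C * rho ^+ M.+1 * expterm s1 M * s1.
Proof.
move=> s10 C0 rho0 hd hg hB hC.
have := @has_deriv_le R (fun u => trunc_expect M.+1 u (h u))
  (fun s => trunc_expect M.+1 s (fun x => dh s x + chain_step (h s) x - h s x) -
     poisson_weight s M * iter M.+1 chain_step (h s) x0) 0 s1
  (B + C * rho ^+ M.+1 * expterm s1 M) s10.
rewrite subr0 trunc_expect_at0 lerBlDl mulrDl addrA; apply.
  by move=> s hs; apply: has_deriv_trunc_expect => x; exact: hd.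
move=> s hs; have /andP[s0 ss1] := hs; apply: lerD.
  by apply: le_trans (hB s hs); apply: trunc_expect_le => // x Vx; exact: hg.
rewrite -mulrN mulrC.
have C1 : 0 <= C * rho ^+ M.+1 by rewrite mulr_ge0 ?exprn_ge0.
apply: (@le_trans _ _ (C * rho ^+ M.+1 * poisson_weight s M)).
  by rewrite ler_wpM2r ?poisson_weight_ge0 // lerNl; exact: hC.
by rewrite ler_wpM2l // poisson_weight_le.
Qed.

Lemma truncexp_le_expR (s : R) k : 0 <= s -> truncexp s k <= expR s.
Proof.
elim: k s => [|k IH] s s0; first by rewrite truncexp0 -expR0 ler_expR.
have := @has_deriv_le R (fun u => truncexp u k.+1 - expR u)
  (fun u => truncexp u k - expR u) 0 s 0 s0.
rewrite truncexp_at0 expR0 subrr subr0 mul0r subr_le0; apply.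
  move=> u _; apply: has_derivB; [exact: has_deriv_truncexpS | exact: is_derive_expR].
by move=> u /andP[u0 _]; rewrite subr_le0 IH.
Qed.

Lemma iter_chain_step_growth m h rho x : 0 <= rho ->
  (forall x, V x -> chain_step h x <= rho * h x) -> V x ->
  iter m chain_step h x <= rho ^+ m * h x.
Proof.
move=> rho0 hK; elim: m x => [|m IH] x Vx; first by rewrite mul1r.
rewrite iterSr; apply: (le_trans (iter_chain_step_le m hK Vx)).
by rewrite iter_chain_stepZ exprS -mulrA ler_wpM2l // IH.
Qed.

(* A geometric growth rate [rho] of the chain Poissonizes to [exp ((rho - 1) s)]. *)
Lemma trunc_expect_growth M s h rho : 0 <= s -> 0 <= rho ->
  (forall x, V x -> chain_step h x <= rho * h x) -> 0 <= h x0 ->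
  trunc_expect M s h <= h x0 * expR ((rho - 1) * s).
Proof.
move=> s0 rho0 hK h0.
have it m := iter_chain_step_growth m rho0 hK Vx0.
apply: (@le_trans _ _ (h x0 * (expR (- s) * truncexp (rho * s) M))).
  apply: (@le_trans _ _ (\sum_(m < M) h x0 * (expR (- s) * expterm (rho * s) m))).
    apply: ler_sum => m _.
    apply: (le_trans (ler_wpM2l (poisson_weight_ge0 m s0) (it m))).
    by rewrite /poisson_weight /expterm exprMn le_eqVlt; apply/orP; left; apply/eqP; ring.
  rewrite -!mulr_sumr !ler_wpM2l ?expR_ge0 // /truncexp [X in _ <= X]big_ord_recr /= lerDl.
  by rewrite expterm_ge0 // mulr_ge0.
rewrite ler_wpM2l // mulrBl mul1r addrC expRD ler_wpM2l ?expR_ge0 //.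
by rewrite truncexp_le_expR // mulr_ge0.
Qed.

Lemma trunc_expect_cst_le M s c : 0 <= s -> 0 <= c -> trunc_expect M s (fun=> c) <= c.
Proof.
move=> s0 c0.
have := @trunc_expect_growth M s (fun=> c) 1 s0 ler01.
rewrite subrr mul0r expR0 mulr1; apply => // x _.
by have := iter_chain_step_cst 1 c x => /= ->; rewrite mul1r.
Qed.

End PoissonizedChain.

(** No particle is behind its packed position; this is what keeps every [cum_rate] at most 1 and
    every exponential height at least 1. *)
Definition valid (x : config) : Prop :=
  forall k, (x k.+1 < x k) /\ (- k.+1%:Z <= x k).

Lemma valid_packed : valid packed.
Proof. by move=> k; split; rewrite /packed; lia. Qed.

(** * Exponential heights of the slowed process *)

Section SlowedMoments.
Variables (R : realType) (t : R) (n : nat).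
Hypothesis t01 : 0 < t < 1.

Let t0 : 0 < t. Proof. by case/andP: t01. Qed.
Let tN0 : t != 0. Proof. by rewrite gt_eqF. Qed.

(** By telescoping, the joint jump rate of the first [k + 1] particles ([sum_jump_rate]). *)
Definition cum_rate (x : config) k : R := t ^ (x k + k.+1%:Z).

Definition exp_height b (x : config) : R := \prod_(k < b) (cum_rate x k)^-1.

(** The relative increase of an exponential height when one of its particles jumps. *)
Definition tkappa : R := t^-1 - 1.

Lemma tkappa_gt0 : 0 < tkappa.
Proof. by rewrite /tkappa subr_gt0 invf_gt1 //; case/andP: t01. Qed.

Lemma jump_rateE x k :
  jump_rate t x k = cum_rate x k - (if k is k'.+1 then cum_rate x k' else 0).
Proof.
rewrite /jump_rate mulrBr mulr1; congr (_ - _).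
case: k => [|k]; first by rewrite mulr0.
by rewrite -expfzDr //; congr (t ^ _); lia.
Qed.

Lemma sum_jump_rate x b : \sum_(k < b.+1) jump_rate t x k = cum_rate x b.
Proof.
elim: b => [|b IH]; first by rewrite big_ord1 jump_rateE subr0.
by rewrite big_ord_recr /= IH jump_rateE addrCA subrr addr0.
Qed.

Lemma cum_rate_gt0 x k : 0 < cum_rate x k.
Proof. exact: exprz_gt0. Qed.

Lemma cum_rate_le1 x k : valid x -> cum_rate x k <= 1.
Proof.
move=> /(_ k)[_ xk]; rewrite /cum_rate.
have : 0 <= x k + k.+1%:Z by lia.
case: (x k + _) => // m _; rewrite -exprnP; apply: exprn_ile1; rewrite ?ltW //.
by case/andP: t01.
Qed.

Lemma valid_mono x k : valid x -> x k.+1 + k.+2%:Z <= x k + k.+1%:Z.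
Proof. by move=> /(_ k)[h _]; lia. Qed.

Lemma jump_rate_ge0 x k : valid x -> 0 <= jump_rate t x k.
Proof.
move=> vx; rewrite jump_rateE; case: k => [|k]; first by rewrite subr0 ltW ?cum_rate_gt0.
rewrite subr_ge0 /cum_rate; have := valid_mono k vx.
set d : int := x k + k.+1%:Z - (x k.+1 + k.+2%:Z).
move=> mono; have d0 : 0 <= d by rewrite /d; lia.
have -> : x k + k.+1%:Z = (x k.+1 + k.+2%:Z) + d by rewrite /d; lia.
rewrite expfzDr //; apply: ler_piMr; first by rewrite exprz_ge0 // ltW.
by clearbody d; case: d d0 => // m _; rewrite -exprnP; apply: exprn_ile1; rewrite ?ltW //; case/andP: t01.
Qed.

Lemma valid_jump x k : valid x -> jump_rate t x k != 0 -> valid (jump x k).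
Proof.
move=> vx rk j; rewrite /jump; have [h1 h2] := vx j.
split; last by case: eqP => _; lia.
have [jk|jk] := eqVneq j.+1 k; last by case: eqP => _; lia.
case: eqP => [e|_]; first by lia.
rewrite -jk jump_rateE in rk.
suff : x j.+1 + 1 != x j by lia.
apply: contra rk => /eqP e; rewrite /cum_rate subr_eq0; apply/eqP.
by congr (t ^ _); lia.
Qed.

Lemma exp_height0 x : exp_height 0 x = 1.
Proof. by rewrite /exp_height big_ord0. Qed.

Lemma exp_heightS b x : exp_height b.+1 x * cum_rate x b = exp_height b x.
Proof. by rewrite /exp_height big_ord_recr /= mulfVK // gt_eqF ?cum_rate_gt0. Qed.

Lemma exp_height_packed b : exp_height b packed = 1.
Proof.
rewrite /exp_height big1 // => k _; rewrite /cum_rate /packed addNr.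
by rewrite expr0z invr1.
Qed.

Lemma exp_height_ge1 b x : valid x -> 1 <= exp_height b x.
Proof.
move=> vx; rewrite /exp_height; elim/big_ind: _ => //.
  by move=> u v u1 v1; rewrite mulr_ege1.
by move=> k _; rewrite invf_ge1 ?cum_rate_gt0 ?cum_rate_le1.
Qed.

Lemma exp_height_mono b b' x : valid x -> (b <= b')%N ->
  exp_height b x <= exp_height b' x.
Proof.
move=> vx /subnK <-; elim: (b' - b)%N => [//|m IH].
apply: (le_trans IH); rewrite addSn -(exp_heightS (m + b)).
by rewrite ler_piMr ?cum_rate_le1 // (le_trans ler01) ?exp_height_ge1.
Qed.

Lemma exp_height_jump b x k :
  exp_height b (jump x k) = exp_height b x * (if (k < b)%N then t^-1 else 1).
Proof.
elim: b => [|b IH]; first by rewrite !exp_height0 mulr1.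
rewrite /exp_height !big_ord_recr /= -!/(exp_height _ _) IH /cum_rate /jump.
rewrite ltnS (leq_eqVlt k b) (eq_sym b k); have [->|kb] /= := eqVneq k b.
  by rewrite ltnn mulr1 -[x b + 1]addrC -addrA expfzDr // invfM expr1z; ring.
by ring.
Qed.

Lemma exp_height_jumpB b x k :
  exp_height b (jump x k) - exp_height b x =
  (if (k < b)%N then tkappa * exp_height b x else 0).
Proof. by rewrite exp_height_jump /tkappa; case: ifP => _; ring. Qed.

(** A jump changes [f_{b+1}] exactly when its index is at most [b]; these jumps have joint rate
    [cum_rate x b], the factor that turns [f_{b+1}] into [f_b]. *)
Lemma sum_rate_lt x b a : (b < n)%N ->
  \sum_(k < n) jump_rate t x k * (if (k < b.+1)%N then a else 0) = cum_rate x b * a.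
Proof.
move=> bn; rewrite -sum_jump_rate mulr_suml.
rewrite (big_ord_widen_cond n xpredT (fun k => jump_rate t x k * a)) //.
by rewrite [RHS]big_mkcond /=; apply: eq_bigr => k _; case: ifP; rewrite ?mulr0.
Qed.

Notation step := (chain_step n (jump_rate t) jump).
Notation texp := (trunc_expect n (jump_rate t) jump packed).

Lemma sum_jump_rate_le1 x : valid x -> \sum_(k < n) jump_rate t x k <= 1.
Proof.
case: (n) => [|m] vx; first by rewrite big_ord0.
by rewrite sum_jump_rate cum_rate_le1.
Qed.

Lemma step_exp_height_pow p x : valid x ->
  step (fun x => exp_height n x ^+ p) x <= t^-1 ^+ p * exp_height n x ^+ p.
Proof.
move=> vx; rewrite /chain_step.
have f0 : 0 <= exp_height n x ^+ p.
  by rewrite exprn_ge0 // (le_trans ler01) ?exp_height_ge1.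
rewrite (eq_bigr (fun k : 'I_n => jump_rate t x k * ((t^-1 ^+ p - 1) * exp_height n x ^+ p))).
  rewrite -mulr_suml -lerBrDl.
  have -> : t^-1 ^+ p * exp_height n x ^+ p - exp_height n x ^+ p =
    (t^-1 ^+ p - 1) * exp_height n x ^+ p by ring.
  rewrite ler_piMl ?sum_jump_rate_le1 // mulr_ge0 // subr_ge0 exprn_ege1 //.
  by rewrite invf_ge1 // ltW //; case/andP: t01.
by move=> k _; rewrite exp_height_jump ltn_ord exprMn; ring.
Qed.

Lemma texp_exp_height_pow M s p : 0 <= s ->
  texp M s (fun x => exp_height n x ^+ p) <= expR ((t^-1 ^+ p - 1) * s).
Proof.
move=> s0.
have := @trunc_expect_growth R _ n (jump_rate t) jump valid packed valid_packed
  (fun x k => @jump_rate_ge0 x k) sum_jump_rate_le1 (fun x k => @valid_jump x k)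
  M s (fun x => exp_height n x ^+ p) (t^-1 ^+ p) s0.
rewrite exp_height_packed expr1n mul1r; apply => //; last exact: step_exp_height_pow.
by rewrite exprn_ge0 // invr_ge0 ltW.
Qed.

End SlowedMoments.

(** * The central limit estimate *)

Section CosineEstimate.
Variables (R : realType) (t : R) (n : nat).
Hypothesis t01 : 0 < t < 1.
Implicit Types (s u : R) (x : config).

Local Notation kappa := (tkappa t).
Local Notation step := (chain_step n (jump_rate t) jump).
Local Notation texp := (trunc_expect n (jump_rate t) jump packed).
Local Notation ht := (exp_height t).

Let t0 : 0 < t. Proof. by case/andP: t01. Qed.
Let k0 : 0 < kappa. Proof. exact: tkappa_gt0. Qed.

Let r_ge0 (x : config) k (vx : valid x) : 0 <= jump_rate t x k.
Proof. exact: jump_rate_ge0. Qed.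
Let r_le1 (x : config) (vx : valid x) : \sum_(k < n) jump_rate t x k <= 1.
Proof. exact: sum_jump_rate_le1. Qed.
Let VJ (x : config) k (vx : valid x) : jump_rate t x k != 0 -> valid (jump x k).
Proof. exact: valid_jump. Qed.

Let dynkin := @dynkin_le R _ n _ _ _ _ valid_packed r_ge0 r_le1 VJ.

Lemma ht_gt0 b x : valid x -> 0 < ht b x.
Proof. by move=> vx; apply: lt_le_trans (exp_height_ge1 t01 b vx). Qed.

Definition fluct b s x : R := ht b x - truncexp (kappa * s) b.

Lemma has_deriv_truncexp_scaled c s b :
  has_deriv (fun u : R => truncexp (c * u) b) s (c * dtruncexp (c * s) b).
Proof.
exact: has_deriv_scale (has_deriv_truncexp (c * s) b).
Qed.

Lemma fluct_packed b : fluct b 0 packed = 0.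
Proof. by rewrite /fluct exp_height_packed mulr0 truncexp_at0 subrr. Qed.

Lemma fluct0 s x : fluct 0 s x = 0.
Proof. by rewrite /fluct exp_height0 truncexp0 subrr. Qed.

Lemma sum_jump_lin (eta : nat -> R) x :
  \sum_(k < n) jump_rate t x k *
     (\sum_(r < n.+1) if (k < r)%N then eta r * ht r x else 0) =
  \sum_(r < n.+1) eta r * (if nat_of_ord r is r'.+1 then ht r' x else 0).
Proof.
under eq_bigr do rewrite mulr_sumr.
rewrite exchange_big; apply: eq_bigr => -[[|r] rn] _ /=.
  by rewrite mulr0 big1 // => k _; rewrite mulr0.
by rewrite (sum_rate_lt t01) // mulrC -mulrA exp_heightS.
Qed.

(** The heights [r] and [s] move together exactly for the particles below [min r s], and the joint
    rate of these lowers the smaller height by one index. *)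
Lemma sum_jump_quad (eta : nat -> R) x :
  \sum_(k < n) jump_rate t x k *
     (\sum_(r < n.+1) if (k < r)%N then eta r * ht r x else 0) ^+ 2 =
  \sum_(r < n.+1) \sum_(s < n.+1) eta r * eta s *
     (if minn r s is m.+1 then ht (maxn r s) x * ht m x else 0).
Proof.
under eq_bigr do rewrite expr2 big_distrlr /= mulr_sumr.
rewrite exchange_big; apply: eq_bigr => r _ /=.
under eq_bigr do rewrite mulr_sumr.
rewrite exchange_big; apply: eq_bigr => s _ /=.
have mn : (minn r s < n.+1)%N by rewrite gtn_min ltn_ord.
rewrite (eq_bigr (fun k : 'I_n => jump_rate t x k *
   (if (k < minn r s)%N then eta r * eta s * (ht (maxn r s) x * ht (minn r s) x) else 0))).
  case: (minn r s) mn => [|m] mn; first by rewrite mulr0 big1 // => k _; rewrite mulr0.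
  by rewrite (sum_rate_lt t01) // -(exp_heightS t01 m); ring.
move=> k _; rewrite leq_min; congr (_ * _).
case: ifP => [kr|_]; case: ifP => [ks|_] /=; rewrite ?mul0r ?mulr0 //.
by case: (leqP r s) => _; ring.
Qed.

(* The backward equation: this linear statistic has zero drift, because the heights
   solve a linear nilpotent system. *)
Variables (xi : nat -> R) (s1 : R).
Hypothesis xi_supp : forall i, (n < i)%N -> xi i = 0.

(** The vector [exp (kappa (s1 - s) N) xi] with [N] the shift of indices, which is nilpotent on
    vectors supported in [0..n]. *)
Definition back_coef r s : R :=
  \sum_(j < n.+1) xi (r + j) * expterm (kappa * (s1 - s)) j.

Lemma back_coef_end r : back_coef r s1 = xi r.
Proof.
rewrite /back_coef subrr mulr0 big_ord_recl expterm0 mulr1 addn0 big1 ?addr0 // => j _.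
by rewrite lift0 /expterm expr0n mul0r mulr0.
Qed.

Lemma back_coef_supp s : back_coef n.+1 s = 0.
Proof. by rewrite /back_coef big1 // => j _; rewrite xi_supp ?mul0r //; lia. Qed.

Lemma has_deriv_back_coef r s :
  has_deriv (back_coef r) s (- kappa * back_coef r.+1 s).
Proof.
have h : has_deriv (fun u => kappa * (s1 - u)) s (- kappa).
  apply: has_deriv_eq (has_derivZ kappa (has_derivB (has_deriv_cst s1 s) (has_deriv_id s))) _.
  by ring.
apply: has_deriv_eq.
  apply: has_deriv_sum => j _; apply: has_derivZ.
  exact: (has_deriv_comp (has_deriv_expterm _ _) h).
rewrite big_ord_recl /= mul0r mulr0 add0r /back_coef big_ord_recr /=.
rewrite xi_supp ?mul0r ?addr0; last by lia.
rewrite mulr_sumr; apply: eq_bigr => j _.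
by rewrite /bump /= add1n addnS addSn; ring.
Qed.

Definition lin_stat s x : R := \sum_(r < n.+1) back_coef r s * fluct r s x.

Definition jump_coef s x k : R :=
  \sum_(r < n.+1) if (k < r)%N then back_coef r s * ht r x else 0.

Lemma lin_stat_end x : lin_stat s1 x = \sum_(r < n.+1) xi r * fluct r s1 x.
Proof. by apply: eq_bigr => r _; rewrite back_coef_end. Qed.

Lemma lin_stat_packed : lin_stat 0 packed = 0.
Proof. by rewrite /lin_stat big1 // => r _; rewrite fluct_packed mulr0. Qed.

Lemma lin_stat_jump s x k : lin_stat s (jump x k) = lin_stat s x + kappa * jump_coef s x k.
Proof.
rewrite /lin_stat /jump_coef mulr_sumr -big_split; apply: eq_bigr => r _ /=.
have -> : fluct r s (jump x k) = fluct r s x + (ht r (jump x k) - ht r x).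
  by rewrite /fluct; ring.
by rewrite (exp_height_jumpB t01); case: ifP => _; ring.
Qed.

(** Compared with [lin_stat_jump], this derivative is minus the action of the generator: [lin_stat]
    is a martingale. *)
Lemma has_deriv_lin_stat s x :
  has_deriv (fun u => lin_stat u x) s
    (- kappa * \sum_(k < n) jump_rate t x k * jump_coef s x k).
Proof.
apply: has_deriv_eq.
  apply: has_deriv_sum => r _; apply: has_derivM; first exact: has_deriv_back_coef.
  by apply: has_derivB (has_deriv_cst _ _) _; exact: has_deriv_truncexp_scaled.
rewrite /jump_coef (sum_jump_lin (fun r => back_coef r s)) mulr_sumr big_split /= [in RHS]big_ord_recl /=.
rewrite mulr0 mulr0 add0r big_ord_recr /= back_coef_supp mulr0 mul0r addr0.
rewrite [X in _ + X]big_ord_recl /= sub0r mulr0 oppr0 mulr0 add0r.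
rewrite -big_split /=; apply: eq_bigr => r _; rewrite /bump /= add1n /fluct; ring.
Qed.

Lemma sum_jump_le (a : nat -> R) b x : valid x -> 0 <= b ->
  (forall k, (k < n)%N -> `|a k| <= b) ->
  `|\sum_(k < n) jump_rate t x k * a k| <= b.
Proof.
move=> vx b0 h; apply: (le_trans (ler_norm_sum _ _ _)).
apply: (@le_trans _ _ (\sum_(k < n) jump_rate t x k * b)).
  apply: ler_sum => k _; rewrite normrM ger0_norm ?r_ge0 //.
  by rewrite ler_wpM2l ?r_ge0 // h.
by rewrite -mulr_suml ler_piMl // r_le1.
Qed.

Variable T : R.
Hypothesis kappa_le1 : kappa <= 1.
Hypothesis s1_ge0 : 0 <= s1.
Hypothesis s1T : kappa * s1 <= T.

Let T0 : 0 <= T. Proof. by apply: le_trans s1T; rewrite mulr_ge0 // ltW. Qed.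

Lemma ks_bound s : 0 <= s <= s1 -> 0 <= kappa * s <= T.
Proof.
move=> /andP[h1 h2]; rewrite mulr_ge0 ?(ltW k0) //=.
by apply: le_trans s1T; rewrite ler_wpM2l // ltW.
Qed.

(** The constants 3 here and 7 for the cube bound [((1 + kappa) ^ p - 1) / kappa] for [p = 2, 3] and
    [kappa <= 1]. *)
Lemma texp_ht2 M s : 0 <= s <= s1 -> texp M s (fun x => ht n x ^+ 2) <= expR (3 * T).
Proof.
move=> hs; have /andP[s0 _] := hs; have /andP[h1 h2] := ks_bound hs.
apply: (le_trans (texp_exp_height_pow n t01 M 2 s0)); rewrite ler_expR.
have -> : t^-1 = 1 + kappa by rewrite /tkappa; ring.
have -> : ((1 + kappa) ^+ 2 - 1) * s = (2 + kappa) * (kappa * s) by ring.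
apply: ler_pM => //; first by rewrite addr_ge0 ?(ltW k0).
by have := kappa_le1; lra.
Qed.

Lemma texp_ht3 M s : 0 <= s <= s1 -> texp M s (fun x => ht n x ^+ 3) <= expR (7 * T).
Proof.
move=> hs; have /andP[s0 _] := hs; have /andP[h1 h2] := ks_bound hs.
apply: (le_trans (texp_exp_height_pow n t01 M 3 s0)); rewrite ler_expR.
have -> : t^-1 = 1 + kappa by rewrite /tkappa; ring.
have -> : ((1 + kappa) ^+ 3 - 1) * s = (3 + 3 * kappa + kappa ^+ 2) * (kappa * s) by ring.
have k2 : kappa ^+ 2 <= 1 by rewrite exprn_ile1 // ltW.
have k20 : 0 <= kappa ^+ 2 by rewrite exprn_ge0 // ltW.
have k0' := ltW k0; have k1' := kappa_le1.
by apply: ler_pM => //; lra.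
Qed.

(** Constants of the induction in [texp_fluct2]: [exp T] undoes the integrating factor, [T] is the
    length of the rescaled time, and [exp (3 T)] bounds the quadratic variation. *)
Fixpoint var_bound b : R :=
  if b is b'.+1 then expR T * T * (var_bound b' + expR (3 * T)) else 0.

Lemma var_bound_ge0 b : 0 <= var_bound b.
Proof.
by elim: b => //= b IH; rewrite !mulr_ge0 ?expR_ge0 ?addr_ge0 ?expR_ge0.
Qed.

(** Induction on [b]: the drift of [F_{b+1} ^ 2] is [2 kappa F_{b+1} F_b] up to a term of order
    [kappa ^ 2]. The mixed product is at most [F_{b+1} ^ 2 + F_b ^ 2]; an integrating factor absorbs
    the former, the induction hypothesis bounds the latter. *)
Lemma texp_fluct2 M b s : 0 <= s <= s1 -> (b <= n)%N ->
  texp M s (fun x => fluct b s x ^+ 2) <= kappa * var_bound b.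
Proof.
case: M => [|M].
  by move=> _ _; rewrite /trunc_expect big_ord0 mulr_ge0 ?var_bound_ge0 // ltW.
elim: b s => [|b IH] s hs bn /=.
  rewrite mulr0 (_ : (fun x => _) = (fun=> 0)); last first.
    by apply/funext => x; rewrite fluct0 expr0n.
  by apply: trunc_expect_cst_le valid_packed r_ge0 r_le1 VJ _ _ _ _ _ => //; case/andP: hs.
have /andP[s0 ss1] := hs.
pose h u x := expR (- kappa * u) * fluct b.+1 u x ^+ 2.
pose dh u x := expR (- kappa * u) * (- kappa * fluct b.+1 u x ^+ 2
   - 2 * kappa * fluct b.+1 u x * truncexp (kappa * u) b).
pose g u x := kappa * (fluct b u x ^+ 2 + kappa * ht n x ^+ 2).
(* The truncation constant is 0: [h] is nonnegative, so the boundary term of the cut only helps. *)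
have : texp M.+1 s (h s) <= h 0 packed +
    kappa * (kappa * var_bound b + kappa * expR (3 * T)) * s +
    0 * 1 ^+ M.+1 * expterm s M * s.
  apply: (@dynkin M h dh g); [exact: s0|exact: lexx|exact: ler01| | | |].
  - move=> u x _; apply: has_deriv_eq.
      apply: has_derivM.
        by apply: has_deriv_expR; apply: has_derivZ (has_deriv_id _).
      by apply: has_derivX; apply: has_derivB (has_deriv_cst _ _) _; exact: has_deriv_truncexp_scaled.
    by rewrite /dh /fluct /=; ring.
  - move=> u x hu vx.
    have e1 : expR (- kappa * u) <= 1.
      by rewrite -expR0 ler_expR mulNr oppr_le0 mulr_ge0 ?(ltW k0) //; case/andP: hu.
    have -> : dh u x + step (h u) x - h u x = expR (- kappa * u) * kappa *
       (- fluct b.+1 u x ^+ 2 + 2 * fluct b.+1 u x * fluct b u x + kappa * (ht b.+1 x * ht b x)).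
      rewrite /chain_step (addrC (h u x)) addrA addrK.
      rewrite (eq_bigr (fun k : 'I_n => jump_rate t x k * (if (k < b.+1)%N then
         expR (- kappa * u) * (2 * fluct b.+1 u x * kappa * ht b.+1 x +
         kappa ^+ 2 * ht b.+1 x ^+ 2) else 0))).
        rewrite (sum_rate_lt t01) //.
        transitivity (dh u x + expR (- kappa * u) * (2 * fluct b.+1 u x * kappa *
           (ht b.+1 x * cum_rate t x b) + kappa ^+ 2 * ht b.+1 x * (ht b.+1 x * cum_rate t x b))).
          by ring.
        by rewrite exp_heightS // /dh [fluct b u x]/fluct; ring.
      move=> k _; congr (_ * _); rewrite /h /fluct (exp_height_jump t01) /tkappa.
      by case: ifP => _; ring.
    rewrite /g; have sq := sqr_ge0 (fluct b.+1 u x - fluct b u x).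
    have hh : ht b.+1 x * ht b x <= ht n x ^+ 2.
      by rewrite expr2 ler_pM ?(ltW (ht_gt0 _ vx)) // (exp_height_mono t01) // ltnW.
    rewrite -mulrA; apply: (@le_trans _ _ (expR (- kappa * u) *
       (kappa * (fluct b u x ^+ 2 + kappa * ht n x ^+ 2)))).
      rewrite ler_wpM2l ?expR_ge0 // ler_wpM2l ?(ltW k0) // lerD //; last by rewrite ler_wpM2l ?(ltW k0).
      (* The term [- F_{b+1} ^ 2] supplied by the integrating factor completes the square. *)
      by rewrite -subr_ge0; have -> : fluct b u x ^+ 2 - (- fluct b.+1 u x ^+ 2 +
        2 * fluct b.+1 u x * fluct b u x) = (fluct b.+1 u x - fluct b u x) ^+ 2 by ring.
    rewrite ler_piMl // mulr_ge0 ?(ltW k0) // addr_ge0 ?sqr_ge0 //.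
    by rewrite mulr_ge0 ?(ltW k0) ?sqr_ge0.
  - move=> u /andP[u0 us]; have hu : 0 <= u <= s1 by rewrite u0 (le_trans us).
    rewrite trunc_expectZ trunc_expectD trunc_expectZ.
    by rewrite ler_wpM2l ?(ltW k0) // lerD ?IH ?(ltnW bn) // ler_wpM2l ?(ltW k0) // texp_ht2.
  - move=> u _; rewrite mul0r oppr0 -(iter_chain_step_cst n (jump_rate t) jump M.+1 0 packed).
    apply: (@iter_chain_step_le _ _ _ _ _ _ r_ge0 r_le1 VJ) => [y vy|]; last exact: valid_packed.
    by rewrite mulr_ge0 ?expR_ge0 ?sqr_ge0.
rewrite {2}/h fluct_packed expr0n mulr0 add0r !mul0r addr0.
rewrite /h trunc_expectZ => hb.
have /andP[ks0 ksT] := ks_bound hs.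
have e0 := expR_gt0 (kappa * s).
have : texp M.+1 s (fun x => fluct b.+1 s x ^+ 2) <=
   expR (kappa * s) * (kappa * (kappa * var_bound b + kappa * expR (3 * T)) * s).
  by rewrite -ler_pdivrMl // -expRN -mulNr.
move=> /le_trans; apply.
have -> : expR (kappa * s) * (kappa * (kappa * var_bound b + kappa * expR (3 * T)) * s) =
  kappa * ((expR (kappa * s) * (kappa * s)) * (var_bound b + expR (3 * T))) by ring.
rewrite ler_wpM2l ?(ltW k0) // ler_wpM2r ?addr_ge0 ?var_bound_ge0 ?expR_ge0 //.
by apply: ler_pM; rewrite ?expR_ge0 ?ler_expR.
Qed.

Definition coef_bound : R := (\sum_(i < n.+1) `|xi i|) * truncexp T n.

Lemma coef_bound_ge0 : 0 <= coef_bound.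
Proof.
by apply: mulr_ge0; [exact: sumr_ge0 | exact: truncexp_ge0].
Qed.

Lemma xi_bound i : `|xi i| <= \sum_(i < n.+1) `|xi i|.
Proof.
have [ni|] := ltnP n i; first by rewrite xi_supp // normr0 sumr_ge0.
by rewrite -ltnS => ni; rewrite (bigD1 (Ordinal ni)) //= lerDl sumr_ge0.
Qed.

Lemma back_coef_bound r s : 0 <= s <= s1 -> `|back_coef r s| <= coef_bound.
Proof.
move=> /andP[s0 ss1]; apply: (le_trans (ler_norm_sum _ _ _)).
rewrite /coef_bound /truncexp mulr_sumr; apply: ler_sum => j _.
have /(@expterm_bound R _ _ j)/andP[e0 eT] : 0 <= kappa * (s1 - s) <= T.
  by apply: ks_bound; rewrite subr_ge0 ss1 lerBlDl lerDr.
by rewrite normrM (ger0_norm e0) ler_pM // xi_bound.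
Qed.

Lemma truncexp_ks r s : 0 <= s <= s1 -> (r <= n)%N ->
  0 <= truncexp (kappa * s) r <= truncexp T n.
Proof.
move=> /ks_bound hs rn; rewrite (truncexp_le hs rn) andbT.
by case/andP: hs => h _; rewrite (le_trans ler01) // truncexp_ge1.
Qed.

Lemma lin_stat_bound s x : 0 <= s <= s1 -> valid x ->
  `|lin_stat s x| <= n.+1%:R * coef_bound * (1 + truncexp T n) * ht n x.
Proof.
move=> hs vx; apply: (le_trans (ler_norm_sum _ _ _)).
apply: (@le_trans _ _ (\sum_(r < n.+1) coef_bound * ((1 + truncexp T n) * ht n x))).
  apply: ler_sum => r _; rewrite normrM ler_pM ?back_coef_bound //.
  have rn : (r <= n)%N by rewrite -ltnS.
  have /andP[h1 h2] := truncexp_ks hs rn.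
  apply: (le_trans (ler_normB _ _)); rewrite (ger0_norm h1) (gtr0_norm (ht_gt0 _ vx)).
  rewrite [leRHS]mulrDl mul1r lerD ?(exp_height_mono t01) //.
  by rewrite (le_trans h2) // ler_peMr ?(exp_height_ge1 t01) // (le_trans h1).
by rewrite sumr_const card_ord -[X in X <= _]mulr_natl !mulrA.
Qed.

(** The drift vanishes, so only the truncation error remains. It grows like [t ^ - M] because the
    statistic is bounded by a multiple of [f_n] and one jump multiplies [f_n] by at most [1 / t].
    Both signs of [a] together give an exact mean. *)
Lemma texp_lin_stat (a : R) : exists2 C, 0 <= C & forall M,
  texp M.+1 s1 (fun x => a * lin_stat s1 x) <=
    C * t^-1 ^+ M.+1 * expterm s1 M * s1.
Proof.
pose C' := n.+1%:R * coef_bound * (1 + truncexp T n).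
have C'0 : 0 <= C'.
  apply: mulr_ge0; first by apply: mulr_ge0 => //; exact: coef_bound_ge0.
  by apply: addr_ge0 => //; exact: truncexp_ge0.
exists (`|a| * C'); first by rewrite mulr_ge0.
move=> M; have : texp M.+1 s1 (fun x => a * lin_stat s1 x) <=
   a * lin_stat 0 packed + 0 * s1 + (`|a| * C') * t^-1 ^+ M.+1 * expterm s1 M * s1.
  apply: (@dynkin M (fun s x => a * lin_stat s x)
    (fun s x => a * (- kappa * \sum_(k < n) jump_rate t x k * jump_coef s x k))
    (fun _ _ => 0)) => //.
  - by rewrite mulr_ge0.
  - by rewrite invr_ge0 ltW.
  - by move=> s x _; apply: has_derivZ; exact: has_deriv_lin_stat.
  - move=> s x hs vx; rewrite /chain_step (addrC (a * lin_stat s x)) addrA addrK.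
    have -> : \sum_(k < n) jump_rate t x k * (a * lin_stat s (jump x k) - a * lin_stat s x) =
        a * kappa * \sum_(k < n) jump_rate t x k * jump_coef s x k.
      by rewrite [RHS]mulr_sumr; apply: eq_bigr => k _; rewrite lin_stat_jump; ring.
    by rewrite le_eqVlt; apply/orP; left; apply/eqP; ring.
  - by move=> s /andP[s0 _]; exact: (trunc_expect_cst_le valid_packed r_ge0 r_le1 VJ).
  - move=> s hs; apply: (@le_trans _ _ (- (`|a| * C') * iter M.+1 step (ht n) packed)).
      rewrite mulNr lerN2; apply: ler_wpM2l; first exact: mulr_ge0.
      have := @iter_chain_step_growth _ _ _ _ _ _ r_ge0 r_le1 VJ M.+1 (ht n) t^-1 packed.
      rewrite exp_height_packed mulr1; apply; [by rewrite invr_ge0 ltW| |exact: valid_packed].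
      by move=> x vx; have := step_exp_height_pow n t01 1 vx; rewrite !expr1.
    rewrite -iter_chain_stepZ.
    apply: (@iter_chain_step_le _ _ _ _ _ _ r_ge0 r_le1 VJ) => [x vx|]; last exact: valid_packed.
    rewrite mulNr lerNl -mulNr; apply: (le_trans (ler_norm _)); rewrite normrM normrN -mulrA.
    by rewrite ler_wpM2l // lin_stat_bound.
by rewrite lin_stat_packed mulr0 mul0r !add0r.
Qed.

Definition quad_mean s r r' : R :=
  if minn r r' is m.+1 then
    truncexp (kappa * s) (maxn r r') * truncexp (kappa * s) m else 0.

(** The variance of [lin_stat / sqrt kappa] accumulated up to time [s], in its deterministic
    approximation: zero at time 0 and the quadratic form of [xi] at time [s1]. *)
Definition back_var s : R :=
  \sum_(r < n.+1) \sum_(r' < n.+1)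
    back_coef r s * back_coef r' s * sym_cov (kappa * s) r r'.

Definition back_var_rate s : R :=
  \sum_(r < n.+1) \sum_(r' < n.+1) back_coef r s * back_coef r' s * quad_mean s r r'.

Lemma sum_back_coef_shift s (a : nat -> R) :
  \sum_(r < n.+1) back_coef r.+1 s * a r =
  \sum_(r < n.+1) back_coef r s * (if nat_of_ord r is r'.+1 then a r' else 0).
Proof.
rewrite big_ord_recr /= back_coef_supp mul0r addr0 [RHS]big_ord_recl mulr0 add0r.
by apply: eq_bigr => r _; rewrite lift0.
Qed.

(** The two index-lowering terms of the covariance equation cancel against the backward equation of
    the two coefficients, so that only the quadratic variation is left. *)
Lemma has_deriv_back_var s : has_deriv back_var s (kappa * back_var_rate s).
Proof.
have hA r r' := has_deriv_scale (has_deriv_sym_cov (kappa * s) r r').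
apply: has_deriv_eq.
  apply: has_deriv_sum => r _; apply: has_deriv_sum => r' _.
  apply: has_derivM; first by apply: has_derivM; exact: has_deriv_back_coef.
  exact: hA.
pose A r r' := sym_cov (kappa * s) r r'.
pose A1 r r' := if r is q.+1 then A q r' else 0.
pose A2 r r' := if r' is q.+1 then A r q else 0.
transitivity (kappa * (
  (\sum_(r < n.+1) \sum_(r' < n.+1) back_coef r s * back_coef r' s * A1 r r' -
   \sum_(r < n.+1) \sum_(r' < n.+1) back_coef r.+1 s * back_coef r' s * A r r') +
  (\sum_(r < n.+1) \sum_(r' < n.+1) back_coef r s * back_coef r' s * A2 r r' -
   \sum_(r < n.+1) \sum_(r' < n.+1) back_coef r s * back_coef r'.+1 s * A r r') +
  back_var_rate s)).
  rewrite -!sumrB -!big_split /= [RHS]mulr_sumr; apply: eq_bigr => r _.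
  rewrite -!sumrB -!big_split /= [RHS]mulr_sumr; apply: eq_bigr => r' _.
  rewrite /sym_cov_drift -/(quad_mean s r r') -/(A1 r r') -/(A2 r r') -/(A r r'); ring.
congr (_ * _).
have -> : \sum_(r < n.+1) \sum_(r' < n.+1) back_coef r s * back_coef r' s * A1 r r' =
   \sum_(r < n.+1) \sum_(r' < n.+1) back_coef r.+1 s * back_coef r' s * A r r'.
  rewrite exchange_big [RHS]exchange_big /=; apply: eq_bigr => r' _.
  rewrite (eq_bigr (fun r : 'I_n.+1 => back_coef r' s * (back_coef r s * A1 r r'))); last first.
    by move=> r _; ring.
  rewrite [RHS](eq_bigr (fun r : 'I_n.+1 => back_coef r' s * (back_coef r.+1 s * A r r'))); last first.
    by move=> r _; ring.
  by rewrite -!mulr_sumr (sum_back_coef_shift s (fun r => A r r')).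
have -> : \sum_(r < n.+1) \sum_(r' < n.+1) back_coef r s * back_coef r' s * A2 r r' =
   \sum_(r < n.+1) \sum_(r' < n.+1) back_coef r s * back_coef r'.+1 s * A r r'.
  apply: eq_bigr => r _.
  rewrite (eq_bigr (fun r' : 'I_n.+1 => back_coef r s * (back_coef r' s * A2 r r'))); last first.
    by move=> r' _; ring.
  rewrite [RHS](eq_bigr (fun r' : 'I_n.+1 => back_coef r s * (back_coef r'.+1 s * A r r'))); last first.
    by move=> r' _; ring.
  by rewrite -!mulr_sumr (sum_back_coef_shift s (A r)).
by rewrite !subrr !add0r.
Qed.

Lemma back_var_at0 : back_var 0 = 0.
Proof.
rewrite /back_var big1 // => r _; rewrite big1 // => r' _.
by rewrite mulr0 sym_cov_at0 mulr0.
Qed.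

Lemma back_var_end :
  back_var s1 = \sum_(r < n.+1) \sum_(r' < n.+1) xi r * xi r' * sym_cov (kappa * s1) r r'.
Proof. by do 2!(apply: eq_bigr => ? _); rewrite !back_coef_end. Qed.

Definition back_var_bound : R := n.+1%:R ^+ 2 * (coef_bound ^+ 2 * cov_bound T n).

Lemma double_sum_bound (F : 'I_n.+1 -> 'I_n.+1 -> R) (a : R) :
  (forall r r', `|F r r'| <= a) ->
  `|\sum_(r < n.+1) \sum_(r' < n.+1) F r r'| <= n.+1%:R ^+ 2 * a.
Proof.
move=> h; apply: (le_trans (ler_norm_sum _ _ _)).
apply: (@le_trans _ _ (\sum_(r < n.+1) \sum_(r' < n.+1) a)).
  by apply: ler_sum => r _; apply: (le_trans (ler_norm_sum _ _ _)); apply: ler_sum.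
rewrite !sumr_const card_ord -mulrnA -[X in X <= _]mulr_natl natrM expr2.
by [].
Qed.

Lemma back_var_le s : 0 <= s <= s1 -> `|back_var s| <= back_var_bound.
Proof.
move=> hs; apply: double_sum_bound => r r'.
rewrite !normrM expr2 !ler_pM ?mulr_ge0 ?back_coef_bound //.
by apply: sym_cov_bound; rewrite ?ks_bound // -ltnS.
Qed.

Variable c : R.

Local Notation w := (Num.sqrt kappa).

Let w0 : 0 < w. Proof. by rewrite sqrtr_gt0. Qed.
Let ww : w * w = kappa. Proof. by rewrite -expr2 sqr_sqrtr // ltW. Qed.
Let wV : w^-1 * kappa = w.
Proof. by rewrite -[X in _ * X]ww mulrA mulVf ?mul1r // gt_eqF. Qed.

Definition phase s x : R := w^-1 * lin_stat s x + c.

Lemma phase_jump s x k : phase s (jump x k) = phase s x + w * jump_coef s x k.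
Proof. by rewrite /phase lin_stat_jump mulrDr (mulrA w^-1) wV addrAC. Qed.

Lemma jump_coef_bound s x k : 0 <= s <= s1 -> valid x ->
  `|jump_coef s x k| <= n.+1%:R * coef_bound * ht n x.
Proof.
move=> hs vx; apply: (le_trans (ler_norm_sum _ _ _)).
apply: (@le_trans _ _ (\sum_(r < n.+1) coef_bound * ht n x)).
  apply: ler_sum => r _; have cb := coef_bound_ge0; have hn := ht_gt0 n vx.
  case: ifP => _; last by rewrite normr0 mulr_ge0 // ltW.
  rewrite normrM (gtr0_norm (ht_gt0 _ vx)) ler_pM ?back_coef_bound //.
    by rewrite ltW // ht_gt0.
  by rewrite (exp_height_mono t01) // -ltnS.
by rewrite sumr_const card_ord -[X in X <= _]mulr_natl mulrA.
Qed.

(** The weights [w = sqrt kappa] and [1 / w] come from the arithmetic-geometric inequality applied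
    to [f * F]; since the mean of [F ^ 2] is [O(kappa)], both parts have mean [O(sqrt kappa)]. *)
Definition fluct_size s x : R :=
  w * (ht n x ^+ 2 + truncexp T n ^+ 2) + w^-1 * \sum_(b < n.+1) fluct b s x ^+ 2.

Lemma product_fluct s x a b : 0 <= s <= s1 -> valid x -> (a <= n)%N -> (b <= n)%N ->
  `|ht a x * ht b x - truncexp (kappa * s) a * truncexp (kappa * s) b| <= fluct_size s x.
Proof.
move=> hs vx an bn; have /andP[D0 DT] := truncexp_ks hs bn.
have am_gm (u v : R) : `|u| * `|v| <= (w * u ^+ 2 + w^-1 * v ^+ 2) / 2.
  rewrite -[u ^+ 2]real_normK ?num_real // -[v ^+ 2]real_normK ?num_real //.
  move: `|u| `|v| => {}u {}v.
  rewrite -subr_ge0.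
  have -> : (w * u ^+ 2 + w^-1 * v ^+ 2) / 2 - u * v = w^-1 / 2 * (w * u - v) ^+ 2.
    by field; rewrite gt_eqF.
  by rewrite mulr_ge0 ?sqr_ge0 // divr_ge0 // invr_ge0 ltW.
(* The difference of the two products is written so that every term contains one fluctuation. *)
have -> : ht a x * ht b x - truncexp (kappa * s) a * truncexp (kappa * s) b =
   ht a x * fluct b s x + truncexp (kappa * s) b * fluct a s x by rewrite /fluct; ring.
apply: (le_trans (ler_normD _ _)); rewrite !normrM.
have Sx k : (k <= n)%N -> fluct k s x ^+ 2 <= \sum_(b < n.+1) fluct b s x ^+ 2.
  rewrite -ltnS => kn; rewrite (bigD1 (Ordinal kn)) //= lerDl sumr_ge0 // => i _.
  by rewrite sqr_ge0.
have h1 := am_gm (ht a x) (fluct b s x).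
have h2 := am_gm (truncexp (kappa * s) b) (fluct a s x).
have Sa := Sx a an; have Sb := Sx b bn.
have Ha : ht a x ^+ 2 <= ht n x ^+ 2.
  by rewrite lerXn2r ?nnegrE ?(ltW (ht_gt0 _ vx)) // (exp_height_mono t01).
have HD : truncexp (kappa * s) b ^+ 2 <= truncexp T n ^+ 2.
  by rewrite lerXn2r ?nnegrE ?D0 // (le_trans D0).
have wi : 0 <= w^-1 by rewrite invr_ge0 ltW.
have Sa' := ler_wpM2l wi Sa; have Sb' := ler_wpM2l wi Sb.
have Ha' := ler_wpM2l (ltW w0) Ha; have HD' := ler_wpM2l (ltW w0) HD.
have p1 : 0 <= w * ht n x ^+ 2 by rewrite mulr_ge0 ?sqr_ge0 // ltW.
have p2 : 0 <= w * truncexp T n ^+ 2 by rewrite mulr_ge0 ?sqr_ge0 // ltW.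
rewrite /fluct_size; lra.
Qed.

(** The quadratic variation rate at the configuration [x]; [back_var_rate] is its deterministic
    counterpart. *)
Definition quad_fluct s x : R :=
  \sum_(r < n.+1) \sum_(r' < n.+1) back_coef r s * back_coef r' s *
     (if minn r r' is m.+1 then ht (maxn r r') x * ht m x else 0).

Lemma fluct_size_ge0 s x : 0 <= fluct_size s x.
Proof.
rewrite addr_ge0 // mulr_ge0 ?invr_ge0 ?(ltW w0) ?addr_ge0 ?sqr_ge0 ?sumr_ge0 // => i _.
by rewrite sqr_ge0.
Qed.

Lemma quad_fluct_bound s x : 0 <= s <= s1 -> valid x ->
  `|quad_fluct s x - back_var_rate s| <=
    n.+1%:R ^+ 2 * (coef_bound ^+ 2 * fluct_size s x).
Proof.
move=> hs vx; rewrite /quad_fluct /back_var_rate -sumrB.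
under eq_bigr do rewrite -sumrB.
apply: double_sum_bound => r r'.
rewrite -(mulrBr (back_coef r s * back_coef r' s)) (normrM (back_coef r s * back_coef r' s)).
have mr : (maxn r r' <= n)%N by rewrite geq_max !leq_ord.
have mr' : (minn r r' <= n)%N by rewrite geq_min leq_ord.
apply: ler_pM => //.
  by rewrite normrM expr2 ler_pM ?back_coef_bound.
rewrite /quad_mean; case: (minn r r') mr' => [|m] mr'.
  by rewrite subrr normr0 fluct_size_ge0.
by apply: product_fluct => //; apply: ltnW.
Qed.

Definition half_bound : R := expR (back_var_bound / 2).

(** The first part pays for replacing the quadratic variation by its deterministic value, the second
    for the cubic Taylor remainder of the cosine at a jump. *)
Definition drift_bound s x : R :=
  half_bound * (kappa * (n.+1%:R ^+ 2 * (coef_bound ^+ 2 * fluct_size s x))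
    + kappa * w * ((n.+1%:R * coef_bound) ^+ 3 * ht n x ^+ 3)).

(* The sign [sg] turns the one-sided Dynkin inequality into a two-sided estimate. *)
Definition tilted_cos (sg : R) s x : R := sg * (expR (back_var s / 2) * cos (phase s x)).

Definition tilted_cos' (sg : R) s x : R :=
  sg * (expR (back_var s / 2) * (kappa * back_var_rate s / 2 * cos (phase s x)
    + sin (phase s x) * (w * \sum_(k < n) jump_rate t x k * jump_coef s x k))).

Lemma has_deriv_tilted_cos sg s x :
  has_deriv (fun u => tilted_cos sg u x) s (tilted_cos' sg s x).
Proof.
apply: has_deriv_eq.
  apply: has_derivZ; apply: has_derivM.
    apply: has_deriv_expR; apply: has_derivM (has_deriv_cst _ _).
    exact: has_deriv_back_var.
  apply: has_deriv_cos; apply: has_derivD (has_deriv_cst _ _).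
  by apply: has_derivZ; exact: has_deriv_lin_stat.
rewrite /tilted_cos' /=; move: (\sum_(k < n) _) => S.
have -> : w^-1 * (- kappa * S) = - (w * S) by rewrite mulrA mulrN wV mulNr.
move: (back_var s) (back_var_rate s) (phase s x) => B B' ph.
by field.
Qed.

Lemma back_var_half s : 0 <= s <= s1 -> expR (back_var s / 2) <= half_bound.
Proof.
move=> hs; rewrite ler_expR ler_wpM2r ?invr_ge0 //.
by rewrite (le_trans (ler_norm _)) // back_var_le.
Qed.

(** In the second order expansion of the cosine the sine terms cancel because [lin_stat] has no
    drift. The cosine terms cancel against the derivative of [exp (back_var / 2)], up to the error
    in the quadratic variation. *)
Lemma tilted_cos_drift sg s x : `|sg| <= 1 -> 0 <= s <= s1 -> valid x ->
  tilted_cos' sg s x + step (tilted_cos sg s) x - tilted_cos sg s x <= drift_bound s x.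
Proof.
move=> sg1 hs vx.
pose rem k := cos (phase s x + w * jump_coef s x k) - cos (phase s x)
  + sin (phase s x) * (w * jump_coef s x k)
  + cos (phase s x) * (w * jump_coef s x k) ^+ 2 / 2.
have -> : tilted_cos' sg s x + step (tilted_cos sg s) x - tilted_cos sg s x =
  sg * (expR (back_var s / 2) * (kappa * (cos (phase s x) / 2 *
     (back_var_rate s - quad_fluct s x)) + \sum_(k < n) jump_rate t x k * rem k)).
  rewrite /chain_step (addrC (tilted_cos sg s x)) addrA addrK.
  have -> : quad_fluct s x = \sum_(k < n) jump_rate t x k * jump_coef s x k ^+ 2.
    by rewrite /quad_fluct -(sum_jump_quad (fun r => back_coef r s)).
  have -> : \sum_(k < n) jump_rate t x k * (tilted_cos sg s (jump x k) - tilted_cos sg s x) =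
     sg * (expR (back_var s / 2) * (\sum_(k < n) jump_rate t x k * rem k
       - sin (phase s x) * w * (\sum_(k < n) jump_rate t x k * jump_coef s x k)
       - cos (phase s x) * kappa / 2 * (\sum_(k < n) jump_rate t x k * jump_coef s x k ^+ 2))).
    rewrite !mulr_sumr -!sumrB !mulr_sumr; apply: eq_bigr => k _.
    rewrite /tilted_cos phase_jump /rem; have := ww; move: (w) => v <-.
    move: (expR _) (jump_coef s x k) (jump_rate t x k) (sin _) (cos (phase s x)) (cos _)
      => E j r S C C'.
    by field.
  rewrite /tilted_cos'; move: (\sum_(k < n) _) (\sum_(k < n) _) (\sum_(k < n) _) => S1 S2 S3.
  by field.
apply: (le_trans (ler_norm _)); rewrite normrM -[X in _ <= X]mul1r.
apply: ler_pM => //; rewrite normrM (gtr0_norm (expR_gt0 _)).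
apply: ler_pM; rewrite ?expR_ge0 // ?back_var_half //.
apply: (le_trans (ler_normD _ _)); apply: lerD.
  rewrite normrM (gtr0_norm k0) ler_wpM2l ?(ltW k0) // normrM distrC.
  rewrite -[X in _ <= X]mul1r ler_pM ?quad_fluct_bound //.
  rewrite normrM normfV (ger0_norm (ler0n _ 2)) ler_pdivrMr // mul1r.
  by rewrite (@le_trans _ _ 1) ?ler1n // ler_norml cos_geN1 cos_le1.
have cb := coef_bound_ge0; have hn := ht_gt0 n vx.
apply: sum_jump_le => //.
  apply: mulr_ge0; first by apply: mulr_ge0; exact: ltW.
  by apply: mulr_ge0; apply: exprn_ge0; [exact: mulr_ge0 | exact: ltW].
move=> k kn; apply: (le_trans (cos_taylor2 _ _)); rewrite normrM (gtr0_norm w0).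
(* A jump moves the phase by [w] times [jump_coef], so the cubic remainder is of order
   [w ^ 3 = kappa w], one factor [w] better than the rate [kappa] of the time scale. *)
rewrite -exprMn; have -> : kappa * w = w ^+ 3 by rewrite -{1}ww; ring.
rewrite -exprMn; apply: lerXn2r; rewrite ?nnegrE.
- by apply: mulr_ge0 => //; exact: ltW.
- apply: mulr_ge0; first exact: ltW.
  by apply: mulr_ge0; [exact: mulr_ge0 | exact: ltW].
- by apply: ler_wpM2l; [exact: ltW | exact: jump_coef_bound].
Qed.

Definition clt_const : R :=
  half_bound * (n.+1%:R ^+ 2 * (coef_bound ^+ 2 *
      (expR (3 * T) + truncexp T n ^+ 2 + \sum_(b < n.+1) var_bound b))
    + (n.+1%:R * coef_bound) ^+ 3 * expR (7 * T)).

Lemma texp_drift_bound M s : 0 <= s <= s1 ->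
  texp M s (drift_bound s) <= kappa * w * clt_const.
Proof.
move=> hs; have /andP[s0 _] := hs; have cb := coef_bound_ge0.
have -> : texp M s (drift_bound s) = half_bound *
    (kappa * (n.+1%:R ^+ 2 * (coef_bound ^+ 2 * texp M s (fluct_size s)))
     + kappa * w * ((n.+1%:R * coef_bound) ^+ 3 * texp M s (fun x => ht n x ^+ 3))).
  by rewrite /drift_bound trunc_expectZ trunc_expectD !trunc_expectZ.
have hF : texp M s (fluct_size s) <=
    w * (expR (3 * T) + truncexp T n ^+ 2 + \sum_(b < n.+1) var_bound b).
  rewrite /fluct_size trunc_expectD !trunc_expectZ trunc_expectD trunc_expect_sum [leRHS]mulrDr.
  apply: lerD.
    apply: ler_wpM2l; first exact: ltW.
    apply: lerD; first exact: texp_ht2.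
    exact: (trunc_expect_cst_le valid_packed r_ge0 r_le1 VJ _ _ (sqr_ge0 _)).
  rewrite -[X in X * \sum_(b < _) var_bound b]wV -mulrA ler_wpM2l ?invr_ge0 ?(ltW w0) //.
  by rewrite mulr_sumr; apply: ler_sum => b _; apply: texp_fluct2; rewrite ?leq_ord.
have h3 := texp_ht3 M hs.
rewrite /clt_const [leRHS]mulrCA; apply: ler_wpM2l; first exact: expR_ge0.
rewrite [leRHS]mulrDr; apply: lerD; last first.
  apply: ler_wpM2l; first by apply: mulr_ge0; exact: ltW.
  by apply: ler_wpM2l => //; apply: exprn_ge0; exact: mulr_ge0.
rewrite -(mulrA kappa w); apply: ler_wpM2l; first exact: ltW.
rewrite (mulrCA w); apply: ler_wpM2l; first exact: exprn_ge0.
by rewrite (mulrCA w); apply: ler_wpM2l; first exact: exprn_ge0.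
Qed.

(** Integrating the drift over a time with [kappa s1 <= T] leaves an error of order [w]; dividing by
    the deterministic factor [exp (back_var s1 / 2)] turns the conserved value [cos c] into the
    Gaussian one. *)
Lemma cos_estimate (sg : R) M : `|sg| <= 1 ->
  texp M.+1 s1 (fun x => sg * cos (w^-1 * (\sum_(r < n.+1) xi r * fluct r s1 x) + c)) <=
  sg * (cos c * expR (- ((\sum_(r < n.+1) \sum_(r' < n.+1)
        xi r * xi r' * sym_cov (kappa * s1) r r') / 2)))
  + half_bound * (T * w * clt_const + half_bound * expterm s1 M * s1).
Proof.
move=> sg1; rewrite -back_var_end.
have cb := coef_bound_ge0.
have hs1 : 0 <= s1 <= s1 by rewrite s1_ge0 lexx.
have bound : texp M.+1 s1 (tilted_cos sg s1) <= tilted_cos sg 0 packed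
    + kappa * w * clt_const * s1 + half_bound * 1 ^+ M.+1 * expterm s1 M * s1.
  (* The tilted cosine is bounded by [half_bound], so the growth rate of the boundary term is 1. *)
  apply: (@dynkin M (tilted_cos sg) (tilted_cos' sg) drift_bound) => //.
  - exact: expR_ge0.
  - by move=> s x _; exact: has_deriv_tilted_cos.
  - by move=> s x hs vx; exact: tilted_cos_drift.
  - by move=> s hs; exact: texp_drift_bound.
  - move=> s hs; rewrite expr1n mulr1.
    rewrite -(iter_chain_step_cst n (jump_rate t) jump M.+1 (- half_bound) packed).
    apply: (@iter_chain_step_le _ _ _ _ _ _ r_ge0 r_le1 VJ) => [x vx|]; last exact: valid_packed.
    rewrite lerNl -mulNr (le_trans (ler_norm _)) // normrM normrN -[X in _ <= X]mul1r.
    apply: ler_pM => //; rewrite normrM (gtr0_norm (expR_gt0 _)) -[X in _ <= X]mulr1.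
    by apply: ler_pM; rewrite ?expR_ge0 ?back_var_half // ler_norml cos_geN1 cos_le1.
have t0E : tilted_cos sg 0 packed = sg * cos c.
  by rewrite /tilted_cos back_var_at0 mul0r expR0 mul1r /phase lin_stat_packed mulr0 add0r.
have -> : (fun x => sg * cos (w^-1 * (\sum_(r < n.+1) xi r * fluct r s1 x) + c)) =
    (fun x => expR (- (back_var s1 / 2)) * tilted_cos sg s1 x).
  apply/funext => x; rewrite /tilted_cos /phase -lin_stat_end mulrCA; congr (_ * _).
  by rewrite mulrA -expRD addNr expR0 mul1r.
rewrite trunc_expectZ; apply: (le_trans (ler_wpM2l (expR_ge0 _) bound)).
rewrite t0E expr1n mulr1 -addrA mulrDr lerD //.
  by rewrite le_eqVlt; apply/orP; left; apply/eqP; ring.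
have hN : expR (- (back_var s1 / 2)) <= half_bound.
  rewrite ler_expR -mulNr ler_wpM2r ?invr_ge0 //.
  by rewrite (le_trans (ler_norm _)) // normrN back_var_le.
have cc : 0 <= clt_const.
  apply: mulr_ge0; first exact: expR_ge0.
  apply: addr_ge0; last by apply: mulr_ge0; [apply: exprn_ge0; exact: mulr_ge0 | exact: expR_ge0].
  apply: mulr_ge0; first exact: exprn_ge0.
  apply: mulr_ge0; first exact: exprn_ge0.
  by rewrite !addr_ge0 ?expR_ge0 ?sqr_ge0 // sumr_ge0 // => b _; exact: var_bound_ge0.
have e0 : 0 <= expterm s1 M by exact: expterm_ge0.
apply: ler_pM; rewrite ?expR_ge0 //.
  apply: addr_ge0; apply: mulr_ge0 => //.
    by apply: mulr_ge0 => //; apply: mulr_ge0; exact: ltW.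
  by apply: mulr_ge0 => //; exact: expR_ge0.
rewrite lerD // (_ : kappa * w * clt_const * s1 = kappa * s1 * w * clt_const); last by ring.
by apply: ler_wpM2r => //; apply: ler_wpM2r => //; exact: ltW.
Qed.

End CosineEstimate.

(** * The law of the process at a fixed time *)

Section QuadraticIncrements.
Variable R : realType.

(** Cutting the interval into [N] equal pieces bounds the total increment by [K a ^ 2 / N]. *)
Lemma quadratic_increments_eq (D : R -> R) a K : 0 <= a ->
  (forall b b', 0 <= b -> b <= b' -> b' <= a -> `|D b' - D b| <= K * (b' - b) ^+ 2) ->
  D a = D 0.
Proof.
move=> a0 h; apply/eqP; rewrite -subr_eq0 -normr_le0; apply/ler_addgt0Pr => e e0.
rewrite add0r.
have K0 : 0 <= K * a ^+ 2 by have := h 0 a (lexx _) a0 (lexx _); rewrite subr0; apply: le_trans.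
pose N := (Num.truncn (K * a ^+ 2 / e)).+1.
have N0 : 0 < N%:R :> R by rewrite ltr0n.
pose s i := a * i%:R / N%:R.
have sN : s N = a by rewrite /s mulfK // gt_eqF.
have s0 : s 0%N = 0 by rewrite /s mulr0 mul0r.
have sS i : s i.+1 - s i = a / N%:R by rewrite /s -mulrBl -mulrBr -natrB // subSnn mulr1.
have step : a / N%:R >= 0 by rewrite divr_ge0.
have tele : `|D (s N) - D (s 0%N)| <= N%:R * (K * (a / N%:R) ^+ 2).
  have : forall j, (j <= N)%N -> `|D (s j) - D (s 0%N)| <= j%:R * (K * (a / N%:R) ^+ 2).
    elim=> [|j IH] jN; first by rewrite subrr normr0 mul0r.
    have -> : D (s j.+1) - D (s 0%N) = (D (s j) - D (s 0%N)) + (D (s j.+1) - D (s j)) by ring.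
    apply: (le_trans (ler_normD _ _)); rewrite -natr1 mulrDl mul1r lerD ?IH ?(ltnW jN) //.
    rewrite -(sS j); apply: h.
    - by rewrite /s divr_ge0 // mulr_ge0.
    - by rewrite -subr_ge0 sS.
    - by rewrite -[leRHS]sN /s ler_pM2r ?invr_gt0 // ler_wpM2l // ler_nat.
  exact.
rewrite sN s0 in tele; apply: (le_trans tele).
have -> : N%:R * (K * (a / N%:R) ^+ 2) = (K * a ^+ 2) / N%:R.
  by field; rewrite gt_eqF.
rewrite ler_pdivrMr // -ler_pdivrMl // [leLHS]mulrC ltW // /N.
exact: truncnS_gt.
Qed.

End QuadraticIncrements.

(** * Gamma tails of sums of holding times *)

Section HoldingTimes.
Context d (T : measurableType d) (R : realType) (P : probability T R).
Implicit Types (A B : set T) (U : T -> R).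

Definition prob A : R := fine (P A).

Lemma probE A : measurable A -> P A = (prob A)%:E.
Proof. by move=> mA; rewrite /prob fineK // fin_num_measure. Qed.

Lemma prob_ge0 A : 0 <= prob A.
Proof. by rewrite fine_ge0. Qed.

Lemma prob_le A B : measurable A -> measurable B -> A `<=` B -> prob A <= prob B.
Proof.
move=> mA mB AB; rewrite -lee_fin -!probE //; apply: le_measure => //; exact/mem_set.
Qed.

Lemma probU A B : measurable A -> measurable B -> A `&` B = set0 ->
  prob (A `|` B) = prob A + prob B.
Proof.
move=> mA mB AB; apply: EFin_inj; rewrite EFinD -!probE //; last exact: measurableU.
exact: measureU.
Qed.

Lemma prob0 : prob set0 = 0.
Proof. by rewrite /prob measure0. Qed.

Lemma measurable_gt U a : measurable_fun setT U -> measurable [set w | a < U w].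
Proof.
move=> mU; have := mU measurableT `]a, +oo[%classic (measurable_itv _).
by rewrite setTI; congr measurable; apply/seteqP; split => w /=; rewrite in_itv /= andbT.
Qed.

Lemma measurable_le U a : measurable_fun setT U -> measurable [set w | U w <= a].
Proof.
move=> mU; have := mU measurableT `]-oo, a]%classic (measurable_itv _).
by rewrite setTI; congr measurable; apply/seteqP; split => w /=; rewrite in_itv.
Qed.

(* [E] prescribes the first jumps of the chain, [U] is the time of the last of them and
   [S] the following holding time.  Only the joint tails are given; that of
   [U <= a < U + S] follows because, as a function of the bound on [U], the error has
   quadratic increments. *)
Section Overshoot.
Variables (E : set T) (U S : T -> R) (p : R) (j : nat).
Hypothesis mE : measurable E.
Hypothesis mU : measurable_fun setT U.
Hypothesis mS : measurable_fun setT S.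
Hypothesis EU : E `<=` [set w | 0 < U w].
Hypothesis law : forall a v, 0 <= a -> 0 <= v ->
  prob (E `&` [set w | a < U w] `&` [set w | v < S w]) =
  p * (expR (- a) * truncexp a j) * expR (- v).

(** The tail of the Gamma law of shape [j + 1], the sum of [j + 1] standard exponential times. *)
Let G a : R := expR (- a) * truncexp a j.

Let dG a : has_deriv G a (- (expR (- a) * expterm a j)).
Proof.
apply: has_deriv_eq.
  apply: has_derivM (has_deriv_truncexp a j).
  exact: has_deriv_expR (has_derivN (has_deriv_id a)).
by case: (j) => [|j'] /=; rewrite ?truncexp0 ?expterm0 ?truncexpS; ring.
Qed.

Let mUS : measurable_fun setT (fun w => U w + S w).
Proof. exact: measurable_funD. Qed.

Let law2 b b' v : 0 <= b -> b <= b' -> 0 <= v ->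
  prob (E `&` [set w | b < U w] `&` [set w | U w <= b'] `&` [set w | v < S w]) =
  p * (G b - G b') * expR (- v).
Proof.
move=> b0 bb' v0; have b'0 := le_trans b0 bb'.
have := law b0 v0; have := law b'0 v0; rewrite -/(G _) -/(G _) => e1 e2.
rewrite mulrBr mulrBl -e1 -e2; apply/eqP; rewrite -subr_eq opprK eq_sym; apply/eqP.
rewrite -probU.
- congr prob; apply/seteqP; split => w /=.
    move=> [[Ew bU] vS]; have [Ub|Ub] := leP (U w) b'; first by left.
    by right.
  move=> [[[[Ew bU] Ub] vS]|[[Ew b'U] vS]]; split => //; split => //.
  exact: le_lt_trans b'U.
- by do 3?apply: measurableI => //; [exact: measurable_gt|exact: measurable_le|exact: measurable_gt].
- by do 2?apply: measurableI => //; exact: measurable_gt.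
- apply/seteqP; split => w //= [[[_ Ub] _] [[_ b'U] _]].
  by move: (le_lt_trans Ub b'U); rewrite ltxx.
Qed.

Lemma overshoot_law a : 0 <= a ->
  prob (E `&` [set w | U w <= a /\ a < U w + S w]) = p * (expR (- a) * expterm a j.+1).
Proof.
move=> a0.
pose ev b := E `&` [set w | U w <= b] `&` [set w | a < U w + S w].
pose F b := prob (ev b).
have mev b : measurable (ev b).
  by apply: measurableI; [apply: measurableI => //; exact: measurable_le|exact: measurable_gt].
have p0 : 0 <= p.
  have := law (lexx 0) (lexx 0); rewrite !oppr0 expR0 truncexp_at0 !mulr1 => <-.
  exact: prob_ge0.
(* For [b < U <= b'] the event [a < U + S] contains [a - b < S] and is contained in [a - b' < S], up
   to equality, which the tails do not see. *)
have Finc b b' : 0 <= b -> b <= b' -> b' <= a ->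
   p * (G b - G b') * expR (b - a) <= F b' - F b <= p * (G b - G b') * expR (b' - a).
  move=> b0 bb' b'a.
  pose mid := E `&` [set w | b < U w] `&` [set w | U w <= b'].
  have mmid : measurable mid.
    by apply: measurableI; [apply: measurableI => //; exact: measurable_gt|exact: measurable_le].
  have -> : F b' - F b = prob (mid `&` [set w | a < U w + S w]).
    apply/eqP; rewrite subr_eq -probU //.
    - apply/eqP; congr prob; apply/seteqP; split => w /=.
        move=> [[Ew Ub'] aUS]; have [Ub|Ub] := leP (U w) b; first by right.
        by left.
      move=> [[[[Ew bU] Ub'] aUS]|[[Ew Ub] aUS]]; split => //; split => //.
      exact: le_trans bb'.
    - by apply: measurableI => //; exact: measurable_gt.
    - apply/seteqP; split => w //= [[[[_ bU] _] _] [[_ Ub] _]].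
      by move: (le_lt_trans Ub bU); rewrite ltxx.
  have -> : b - a = - (a - b) by ring.
  have -> : b' - a = - (a - b') by ring.
  rewrite -!law2 ?subr_ge0 ?(le_trans bb') //.
  apply/andP; split; apply: prob_le.
  - by apply: measurableI => //; exact: measurable_gt.
  - by apply: measurableI => //; exact: measurable_gt.
  - by move=> w [[[Ew bU] Ub'] /= hS]; split => //=; rewrite -(subrK b a) addrC ltrD.
  - by apply: measurableI => //; exact: measurable_gt.
  - by apply: measurableI => //; exact: measurable_gt.
  - move=> w [[[Ew bU] Ub'] /= hS]; split => //=.
    by rewrite ltrBlDr (lt_le_trans hS) // addrC lerD2l.
pose W b := p * (expR (- a) * expterm b j.+1).
have dW b : has_deriv W b (p * (expR (- a) * expterm b j)).
  by apply: has_derivZ; apply: has_derivZ; exact: has_deriv_exptermS.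
have gle1 x : 0 <= x -> 0 <= expR (- x) * expterm x j <= 1.
  move=> x0; rewrite mulr_ge0 ?expR_ge0 ?expterm_ge0 //=.
  rewrite expRN mulrC ler_pdivrMr ?expR_gt0 // mul1r.
  apply: le_trans (truncexp_le_expR j x0).
  by rewrite /truncexp big_ord_recr /= lerDr sumr_ge0 // => i _; exact: expterm_ge0.
(* The candidate [W] satisfies the same two bounds, by monotonicity of the exponential in the
   integrand of its increments. *)
have Winc b b' : 0 <= b -> b <= b' -> b' <= a ->
   p * (G b - G b') * expR (b - a) <= W b' - W b <= p * (G b - G b') * expR (b' - a).
  move=> b0 bb' b'a.
  have dV k x : has_deriv (fun x => W x + p * G x * expR (k - a)) x
      (p * (expR (- x) * expterm x j) * (expR (x - a) - expR (k - a))).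
    apply: has_deriv_eq.
      apply: has_derivD (dW x) _; apply: has_derivM (has_deriv_cst _ _).
      by apply: has_derivZ; exact: dG.
    have -> : expR (- a) = expR (- x) * expR (x - a).
      by rewrite -expRD; congr expR; ring.
    by rewrite /=; ring.
  apply/andP; split.
    have := @has_deriv_le R (fun x => - (W x + p * G x * expR (b - a)))
      _ b b' 0 bb' (fun x _ => has_derivN (dV b x)).
    rewrite mul0r => h; suff : - (W b' + p * G b' * expR (b - a)) + (W b + p * G b * expR (b - a)) <= 0 by lra.
    rewrite -[X in _ + X]opprK; apply: h => x /andP[bx _].
    have /gle1/andP[g0 _] := le_trans b0 bx.
    rewrite oppr_le0; apply: mulr_ge0; first exact: mulr_ge0.
    by rewrite subr_ge0 ler_expR lerD2r.
  have := @has_deriv_le R (fun x => W x + p * G x * expR (b' - a)) _ b b' 0 bb' (fun x _ => dV b' x).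
  rewrite mul0r => h; suff : W b' + p * G b' * expR (b' - a) - (W b + p * G b * expR (b' - a)) <= 0 by lra.
  apply: h => x /andP[bx xb].
  have /gle1/andP[g0 _] := le_trans b0 bx.
  apply: mulr_ge0_le0; first exact: mulr_ge0.
  by rewrite subr_le0 ler_expR lerD2r.
have Ginc b b' : 0 <= b -> b <= b' -> 0 <= G b - G b' <= b' - b.
  move=> b0 bb'; apply/andP; split.
    have := @has_deriv_le R G _ b b' 0 bb' (fun x _ => dG x); rewrite mul0r subr_le0 subr_ge0.
    apply=> x /andP[bx _]; have /gle1/andP[g0 _] := le_trans b0 bx.
    by rewrite oppr_le0.
  have := @has_deriv_le R (fun x => - G x) _ b b' 1 bb' (fun x _ => has_derivN (dG x)).
  rewrite mul1r opprK addrC; apply=> x /andP[bx _]; have /gle1/andP[_ g1] := le_trans b0 bx.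
  by rewrite opprK.
have einc b b' : b <= b' -> b' <= a -> expR (b' - a) - expR (b - a) <= b' - b.
  move=> bb' b'a.
  have de x : has_deriv (fun x => expR (x - a)) x (expR (x - a)).
    apply: has_deriv_eq (has_deriv_expR (has_derivB (has_deriv_id x) (has_deriv_cst a x))) _.
    by rewrite subr0 mulr1.
  have := @has_deriv_le R _ _ b b' 1 bb' (fun x _ => de x).
  rewrite mul1r; apply => x /andP[_ xb].
  by rewrite -expR0 ler_expR subr_le0 (le_trans xb).
(* Both increments lie between the same bounds, and the gap between these is a product of an
   increment of [G] and one of the exponential, hence quadratic in the step. *)
have : F a - W a = F 0 - W 0.
  apply: (@quadratic_increments_eq R (fun b => F b - W b) a p a0) => b b' b0 bb' b'a.
  have /andP[f1 f2] := Finc b b' b0 bb' b'a; have /andP[w1 w2] := Winc b b' b0 bb' b'a.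
  have /andP[G0 G1] := Ginc b b' b0 bb'; have e1 := einc b b' bb' b'a.
  have gap : p * (G b - G b') * expR (b' - a) - p * (G b - G b') * expR (b - a) <=
     p * (b' - b) ^+ 2.
    rewrite -mulrBr expr2 mulrA.
    apply: ler_pM => //; first by rewrite mulr_ge0.
      by rewrite subr_ge0 ler_expR lerD2r.
    by rewrite ler_wpM2l.
  by rewrite ler_norml; lra.
have -> : F 0 = 0.
  rewrite /F (_ : ev 0 = set0) ?prob0 //; apply/seteqP; split => w //= [[/EU /= U0 Ul] _].
  by move: (lt_le_trans U0 Ul); rewrite ltxx.
rewrite {2}/W /expterm expr0n /= mul0r !mulr0 subrr => /eqP; rewrite subr_eq0 => /eqP.
rewrite /W => <-; rewrite /F /ev; congr prob; apply/seteqP; split => w /=.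
  by move=> [Ew [Ua aUS]].
by move=> [[Ew Ua] aUS].
Qed.

End Overshoot.

End HoldingTimes.

(** * The Poisson law of the number of jumps *)

Section PoissonClock.
Context d (T : measurableType d) (R : realType) (P : probability T R).
Local Notation prob := (prob P).
Variables (S : nat -> T -> R) (E : set T) (p : R) (m : nat).
Hypothesis mS : forall i, measurable_fun setT (S i).
Hypothesis mE : measurable E.
Hypothesis law : forall u : nat -> R, (forall i, 0 <= u i) ->
  prob (E `&` [set w | forall i, (i <= m)%N -> u i < S i w]) =
  p * \prod_(i < m.+1) expR (- u i).

Definition jump_time j w : R := \sum_(i < j) S i w.

Lemma measurable_jump_time j : measurable_fun setT (jump_time j).
Proof.
elim: j => [|j IH].
  rewrite (_ : jump_time 0 = cst 0); first exact: measurable_cst.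
  by apply/funext => w; rewrite /jump_time big_ord0.
rewrite (_ : jump_time j.+1 = jump_time j \+ S j); first exact: measurable_funD.
by apply/funext => w; rewrite /jump_time big_ord_recr.
Qed.

Lemma jump_timeS j w : jump_time j.+1 w = jump_time j w + S j w.
Proof. by rewrite /jump_time big_ord_recr. Qed.

(** The first [j] holding times are only required to be positive, since their sum is controlled
    separately; the later ones keep their thresholds [u]. *)
Let lower j (u : nat -> R) i := if (i < j)%N then 0 else u i.

Let held j u := E `&` [set w | forall i, (i <= m)%N -> lower j u i < S i w].

Let measurable_held j u : measurable (held j u).
Proof.
apply: measurableI => //.
rewrite (_ : [set _ | _] = \bigcap_(i in [set i | (i <= m)%N]) [set w | lower j u i < S i w]) //.
by apply: bigcap_measurableType => i _; exact: measurable_gt.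
Qed.

Let upd (u : nat -> R) j v i := if i == j then v else u i.

Let held_upd j u v : (j <= m)%N -> 0 <= v ->
  held j.+1 u `&` [set w | v < S j w] = held j (upd u j v).
Proof.
move=> jm v0; apply/seteqP; split => w /=.
  move=> [[Ew h] vS]; split => // i im.
  have := h i im; rewrite /lower /upd ltnS.
  have [->|ij] := eqVneq i j; first by rewrite ltnn leqnn.
  by rewrite (leq_eqVlt i j) (negPf ij).
move=> [Ew h]; split; last by have := h j jm; rewrite /lower /upd ltnn eqxx.
split=> // i im; have := h i im; rewrite /lower /upd ltnS.
have [->|ij] := eqVneq i j; first by rewrite ltnn leqnn; exact: le_lt_trans.
by rewrite (leq_eqVlt i j) (negPf ij).
Qed.

Let held_gt0 j u i w : (i < j)%N -> (j <= m.+1)%N -> held j u w -> 0 < S i w.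
Proof.
move=> ij jm [_ /(_ i)]; rewrite /lower ij; apply.
by rewrite -ltnS (leq_trans ij).
Qed.

Let held_time_gt0 j u : (0 < j <= m.+1)%N -> held j u `<=` [set w | 0 < jump_time j w].
Proof.
move=> /andP[j0 jm] w hw; case: j j0 jm hw => // j _ jm hw.
rewrite /= jump_timeS ltr_wpDl //; last exact: held_gt0 (ltnSn j) jm hw.
apply: sumr_ge0 => i _; apply: ltW; apply: (held_gt0 _ jm hw).
by rewrite ltnS ltnW.
Qed.

Let law_held u : (forall i, 0 <= u i) -> prob (held 0 u) = p * \prod_(i < m.+1) expR (- u i).
Proof. exact: law. Qed.

(** Induction on [j]: the next jump time exceeds [a] either because the current one does, or because
    the current one is at most [a] and the next holding time overshoots. The second event adds the
    next term of the exponential series. The thresholds on later holding times carry independence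
    through the induction. *)
Lemma jump_time_law j (u : nat -> R) a : (j <= m)%N -> 0 <= a -> (forall i, 0 <= u i) ->
  prob (held j.+1 u `&` [set w | a < jump_time j.+1 w]) =
  p * (expR (- a) * truncexp a j) * \prod_(i < m.+1) expR (- lower j.+1 u i).
Proof.
elim: j u a => [|j IH] u a jm a0 u0.
  have -> : held 1 u `&` [set w | a < jump_time 1 w] = held 0 (upd u 0%N a).
    by rewrite -held_upd //; congr (_ `&` _); apply/seteqP; split => w /=;
      rewrite jump_timeS /jump_time big_ord0 add0r.
  rewrite law_held => [|i]; last by rewrite /upd; case: eqP.
  rewrite truncexp0 mulr1 !big_ord_recl /= oppr0 expR0 mul1r mulrA.
  by congr (_ * _); apply: eq_bigr.
have law2 a' v : 0 <= a' -> 0 <= v ->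
    prob (held j.+2 u `&` [set w | a' < jump_time j.+1 w] `&` [set w | v < S j.+1 w]) =
    (p * \prod_(i < m.+1) expR (- lower j.+2 u i)) * (expR (- a') * truncexp a' j) * expR (- v).
  move=> a'0 v0; rewrite setIAC held_upd // IH ?(ltnW jm) //; last first.
    by move=> i; rewrite /upd; case: eqP.
  have jm' : (j.+1 < m.+1)%N by [].
  rewrite (bigD1 (Ordinal jm')) //= [in RHS](bigD1 (Ordinal jm')) //=.
  rewrite /lower /upd ltnn eqxx ltnSn oppr0 expR0 mul1r.
  rewrite (eq_bigr (fun i : 'I_m.+1 => expR (- (if (i < j.+2)%N then 0 else u i)))); last first.
    move=> i ij; rewrite !ltnS [(i <= j.+1)%N]leq_eqVlt.
    have -> : (i == j.+1 :> nat) = false by apply/negbTE; apply: contra ij => /eqP ij; apply/eqP/val_inj.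
    by [].
  ring.
have m1 := measurable_jump_time j.+1.
have sub : held j.+2 u `<=` [set w | 0 < jump_time j.+1 w].
  move=> w hw; apply: (@held_time_gt0 j.+1 (upd u j.+1 0) _ w); first by apply/andP; split=> //; exact: leqW jm.
  by rewrite -(@held_upd j.+1 u 0 jm (lexx 0)); split => //; exact: (@held_gt0 j.+2 u j.+1 w (ltnSn _) jm hw).
have ov := overshoot_law (measurable_held j.+2 u) m1 (mS j.+1) sub law2 a0.
have -> : held j.+2 u `&` [set w | a < jump_time j.+2 w] =
  (held j.+2 u `&` [set w | a < jump_time j.+1 w] `&` [set w | 0 < S j.+1 w]) `|`
  (held j.+2 u `&` [set w | jump_time j.+1 w <= a /\ a < jump_time j.+1 w + S j.+1 w]).
  apply/seteqP; split => w /=.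
    move=> [hw aU]; have Sp := @held_gt0 j.+2 u j.+1 w (ltnSn _) jm hw.
    by rewrite jump_timeS in aU; have [Ua|Ua] := leP (jump_time j.+1 w) a; [right|left].
  move=> [[[hw aU] Sp]|[hw [Ua aU]]]; split => //; rewrite jump_timeS //.
  by rewrite (lt_trans aU) // ltrDl.
have mC : measurable [set w | jump_time j.+1 w <= a /\ a < jump_time j.+1 w + S j.+1 w].
  apply: measurableI; first exact: measurable_le.
  by apply: measurable_gt; exact: measurable_funD.
rewrite probU.
- rewrite law2 // ov oppr0 expR0 truncexpS; ring.
- by do 2?apply: measurableI => //; exact: measurable_gt.
- exact: measurableI.
- apply/seteqP; split => w //= [[[_ aU] _] [_ [Ua _]]].
  by move: (le_lt_trans Ua aU); rewrite ltxx.
Qed.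

Lemma jump_count_law s : 0 <= s ->
  prob (E `&` [set w | (forall i, (i <= m)%N -> 0 < S i w) /\
                       jump_time m w <= s < jump_time m.+1 w]) =
  p * poisson_weight s m.
Proof.
move=> s0; have z0 (i : nat) : 0 <= (fun=> 0 : R) i by [].
have heldE j : held j (fun=> 0) = E `&` [set w | forall i, (i <= m)%N -> 0 < S i w].
  by rewrite /held; congr (_ `&` _); apply/seteqP; split => w /= h i /h;
    rewrite /lower; case: ifP.
pose C := [set w | jump_time m w <= s /\ s < jump_time m w + S m w].
have -> : E `&` [set w | (forall i, (i <= m)%N -> 0 < S i w) /\
    jump_time m w <= s < jump_time m.+1 w] = held m (fun=> 0) `&` C.
  rewrite heldE; apply/seteqP; split => w /=; rewrite jump_timeS.
    by move=> [Ew [hS /andP[h1 h2]]].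
  by move=> [[Ew hS] [h1 h2]]; rewrite h1 h2.
(* Without jumps there is no jump time to overshoot from, and the event is a plain tail of the first
   holding time. *)
have [m0|m0] := posnP m.
  have -> : held m (fun=> 0) `&` C = held 0 (upd (fun=> 0) 0%N s).
    rewrite m0; apply/seteqP; split => w /=.
      move=> [[Ew hS] [_]]; rewrite m0 /jump_time big_ord0 add0r => sS; split => // i im.
      have i0 : i = 0%N by apply/eqP; rewrite -leqn0 -m0.
      by rewrite /lower /upd i0.
    move=> [Ew hS]; have := hS 0%N (leq0n m); rewrite /lower /upd /= => sS.
    split; last by rewrite /C /= m0 /jump_time big_ord0 add0r.
    by split=> // i im; have := hS i im; rewrite /lower /upd /=;
      case: eqP => // -> _; exact: le_lt_trans sS.
  rewrite law_held => [|i]; last by rewrite /upd; case: eqP.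
  by rewrite m0 big_ord1 /poisson_weight expterm0 mulr1.
have m1 : m = m.-1.+1 by rewrite prednK.
have law2 a v : 0 <= a -> 0 <= v ->
    prob (held m (fun=> 0) `&` [set w | a < jump_time m w] `&` [set w | v < S m w]) =
    p * (expR (- a) * truncexp a m.-1) * expR (- v).
  move=> a0 v0; rewrite heldE -(heldE m.+1) setIAC held_upd //.
  rewrite [in LHS]m1 jump_time_law ?leq_pred //; last by move=> i; rewrite /upd; case: eqP.
  rewrite -m1 big_ord_recr /= /lower ltnn /upd eqxx big1 ?mul1r // => i _.
  by rewrite ltn_ord oppr0 expR0.
have sub : held m (fun=> 0) `<=` [set w | 0 < jump_time m w].
  by apply: held_time_gt0; rewrite m0 leqnSn.
have := overshoot_law (measurable_held m (fun=> 0)) (measurable_jump_time m) (mS m) sub law2 s0.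
by rewrite prednK.
Qed.

End PoissonClock.

(** * Jump paths from the packed configuration *)

Section Trajectories.
Variables (R : realType) (t : R).
Hypothesis t01 : 0 < t < 1.

Let t0 : 0 < t. Proof. by case/andP: t01. Qed.

Definition rest_from m (x : config) : Prop := forall k, (m <= k)%N -> x k = packed k.

Lemma cum_rate_rest m x k : rest_from m x -> (m <= k)%N -> cum_rate t x k = 1.
Proof. by move=> hx mk; rewrite /cum_rate hx // /packed addNr expr0z. Qed.

Lemma jump_rate_rest m x k : rest_from m x -> (m < k)%N -> jump_rate t x k = 0.
Proof.
move=> hx; case: k => // k mk; rewrite (jump_rateE t01).
by rewrite !(cum_rate_rest hx) ?subrr // ltnW.
Qed.

Lemma rest_from_jump m m' x k : rest_from m x -> (m <= m')%N -> (k < m')%N ->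
  rest_from m' (jump x k).
Proof.
move=> hx mm' km' j m'j; rewrite /jump hx ?(leq_trans mm') //.
by rewrite gtn_eqF // (leq_trans km').
Qed.

Lemma total_rate_rest m x : rest_from m x -> total_rate t x = 1.
Proof.
move=> hx; rewrite /total_rate (@lim_near_cst _ _ _ _ _ 1%E) //.
exists m.+1 => // K /= mK; rewrite -(prednK (leq_trans (ltn0Sn m) mK)).
rewrite big_mkord sumEFin (sum_jump_rate t01) (cum_rate_rest hx) //.
by rewrite -ltnS prednK // (leq_trans _ mK).
Qed.

Lemma trajectory_rest k m : exists M, rest_from M (trajectory packed k m).
Proof.
elim: m => [|m [M IH]]; first by exists 0%N.
exists (maxn M (k m).+1); apply: (rest_from_jump IH); first exact: leq_maxl.
exact: leq_maxr.
Qed.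

Lemma total_rate_trajectory k m : total_rate t (trajectory packed k m) = 1.
Proof. by have [M] := trajectory_rest k m; exact: total_rate_rest. Qed.

(* The [j]-th jump moves one of the first [j.+1] particles, since all particles behind
   them are still packed: [jump_paths m] lists all possible jump sequences. *)
Fixpoint jump_paths m : seq (seq nat) :=
  if m is j.+1 then [seq rcons l k | l <- jump_paths j, k <- iota 0 m] else [:: [::]].

Definition path_config (l : seq nat) : config := trajectory packed (nth 0%N l) (size l).

Definition path_weight (l : seq nat) : R :=
  \prod_(i < size l) jump_rate t (trajectory packed (nth 0%N l) i) (nth 0%N l i).

Lemma jump_paths_size m l : l \in jump_paths m -> size l = m.
Proof.
elim: m l => [|m IH] l; first by rewrite inE => /eqP ->.
by case/allpairsP => -[l' k] [/IH sl' _ ->]; rewrite size_rcons /= sl'.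
Qed.

Lemma uniq_jump_paths m : uniq (jump_paths m).
Proof.
elim: m => // m IH; apply: allpairs_uniq => //; first exact: iota_uniq.
by move=> [l k] [l' k'] _ _ /= /rcons_inj.
Qed.

Lemma eq_trajectory x k k' m : (forall i, (i < m)%N -> k i = k' i) ->
  trajectory x k m = trajectory x k' m.
Proof.
elim: m => //= m IH h; rewrite IH ?h // => i im.
by apply: h; rewrite ltnS ltnW.
Qed.

Lemma path_config_rcons l k : path_config (rcons l k) = jump (path_config l) k.
Proof.
rewrite /path_config size_rcons /= nth_rcons ltnn eqxx; congr (jump _ _).
by apply: eq_trajectory => i il; rewrite nth_rcons il.
Qed.

Lemma path_weight_rcons l k :
  path_weight (rcons l k) = path_weight l * jump_rate t (path_config l) k.
Proof.
rewrite /path_weight size_rcons big_ord_recr /= nth_rcons ltnn eqxx.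
congr (_ * jump_rate t _ _).
  apply: eq_bigr => i _; rewrite nth_rcons ltn_ord; congr (jump_rate t _ _).
  by apply: eq_trajectory => j ji; rewrite nth_rcons (ltn_trans ji).
by apply: eq_trajectory => i il; rewrite nth_rcons il.
Qed.

Lemma path_config_rest m l : l \in jump_paths m -> rest_from m (path_config l).
Proof.
elim: m l => [|m IH] l; first by rewrite inE => /eqP ->.
case/allpairsP => -[l' k] [/IH hl']; rewrite mem_iota add0n => /andP[_ km] ->.
by rewrite path_config_rcons; apply: rest_from_jump hl' _ km.
Qed.

Definition first_coords n (h : config -> R) : Prop :=
  forall x y, (forall k, (k < n)%N -> x k = y k) -> h x = h y.

Lemma first_coords_jump n h x k : first_coords n h -> (n <= k)%N -> h (jump x k) = h x.
Proof.
move=> hh nk; apply: hh => j jn; rewrite /jump ifN //.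
by apply: contraTneq jn => ->; rewrite -leqNgt.
Qed.

Lemma first_coords_step n h : first_coords n h ->
  first_coords n (chain_step n (jump_rate t) jump h).
Proof.
move=> hh x y xy; rewrite /chain_step (hh x y) //; congr (_ + _).
apply: eq_bigr => k _; have kn := ltn_ord k; congr (_ * (_ - _)).
  rewrite !(jump_rateE t01) /cum_rate xy //.
  by case: (nat_of_ord k) kn => // k' kn; rewrite xy // ltnW.
by apply: hh => j jn; rewrite /jump xy.
Qed.

(** The left side follows the true chain, which can move only the first [m + 1] particles; the right
    side follows only the first [n]. Terms counted on one side alone vanish, either because [h] does
    not see the jump or because its rate is zero. *)
Lemma rest_step n m h x : first_coords n h -> rest_from m x ->
  \sum_(k < m.+1) jump_rate t x k * h (jump x k) = chain_step n (jump_rate t) jump h x.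
Proof.
move=> hh hx; have tot : \sum_(k < m.+1) jump_rate t x k = 1.
  by rewrite (sum_jump_rate t01) (cum_rate_rest hx).
rewrite (eq_bigr (fun k : 'I_m.+1 => jump_rate t x k * h x +
  jump_rate t x k * (h (jump x k) - h x))); last by move=> k _; ring.
rewrite big_split /= -mulr_suml tot mul1r /chain_step; congr (_ + _).
pose F k := jump_rate t x k * (h (jump x k) - h x).
have F0 k : (n <= k)%N || (m.+1 <= k)%N -> F k = 0.
  rewrite /F => /orP[nk|mk]; first by rewrite (first_coords_jump _ hh nk) subrr mulr0.
  by rewrite (jump_rate_rest hx mk) mul0r.
transitivity (\sum_(k < maxn n m.+1) F k).
  rewrite -(big_mkord xpredT F) -[RHS](big_mkord xpredT F).
  rewrite [RHS](@big_cat_nat _ _ _ m.+1) ?leq_maxr //= [X in _ = _ + X]big_nat_cond.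
  by rewrite [X in _ + X]big1 ?addr0 // => k /andP[/andP[mk _] _]; rewrite F0 // mk orbT.
rewrite -(big_mkord xpredT F) -[RHS](big_mkord xpredT F).
rewrite (@big_cat_nat _ _ _ n) ?leq_maxl //= [X in _ + X]big_nat_cond.
by rewrite [X in _ + X]big1 ?addr0 // => k /andP[/andP[nk _] _]; rewrite F0 // nk.
Qed.

Lemma sum_jump_paths n m h : first_coords n h ->
  \sum_(l <- jump_paths m) path_weight l * h (path_config l) =
  iter m (chain_step n (jump_rate t) jump) h packed.
Proof.
elim: m h => [|m IH] h hh.
  by rewrite big_seq1 /path_weight big_ord0 mul1r.
rewrite iterSr -IH; last exact: first_coords_step.
rewrite [LHS]big_allpairs_dep big_seq [RHS]big_seq; apply: eq_bigr => l lm.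
rewrite -(rest_step hh (path_config_rest lm)) mulr_sumr -(big_mkord xpredT (fun k =>
  path_weight l * (jump_rate t (path_config l) k * h (jump (path_config l) k)))).
by apply: eq_bigr => k _; rewrite path_weight_rcons path_config_rcons mulrA.
Qed.

Lemma sum_path_weight m : \sum_(l <- jump_paths m) path_weight l = 1.
Proof.
have := @sum_jump_paths 0 m (fun=> 1) (fun _ _ _ => erefl).
by rewrite iter_chain_step_cst => <-; apply: eq_bigr => l _; rewrite mulr1.
Qed.

Lemma jump_inj x k k' : jump x k = jump x k' -> k = k'.
Proof.
move=> /(congr1 (fun y : config => y k)); rewrite /jump eqxx.
by case: eqP => // _ /eqP; rewrite -subr_eq0 addrC addKr.
Qed.

Lemma trajectory_inj x k k' m :
  (forall i, (i <= m)%N -> trajectory x k i = trajectory x k' i) ->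
  forall i, (i < m)%N -> k i = k' i.
Proof.
move=> h i im; have := h i.+1 im; rewrite /= (h i (ltnW im)); exact: jump_inj.
Qed.

End Trajectories.

(** * Expectations at a fixed time *)

Section LawAtFixedTime.
Context d (T : measurableType d) (R : realType) (P : probability T R).
Variables (t s : R) (X : R -> T -> config).
Hypothesis t01 : 0 < t < 1.
Hypothesis s0 : 0 <= s.
Hypothesis hX : slowed_tTASEP P t packed X.

Lemma poisson_weight_series : (\sum_(0 <= m <oo) (poisson_weight s m)%:E = 1)%E.
Proof.
apply/cvg_lim => //.
rewrite (_ : (fun n => _) = EFin \o (fun n => expR (- s) * series (exp_coeff s) n)).
  apply/fine_cvgP; split; first by near=> n.
  rewrite -(expRxMexpNx_1 s) mulrC; apply: cvgMr; exact: is_cvg_series_exp_coeff.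
by apply/funext => n /=; rewrite sumEFin /series /= mulr_sumr.
Unshelve. all: by end_near. Qed.

(** The first [n] coordinates take countably many values, so every preimage is a countable union of
    cylinder events, whatever [h] is. *)
Lemma measurable_first_coords n (h : config -> R) : first_coords n h ->
  measurable_fun setT (fun w => h (X s w)).
Proof.
case: hX => _ mX _ hh _ A mA; rewrite setTI.
pose ext (v : {ffun 'I_n -> int}) : config :=
  fun k => if insub k is Some i then v i else 0.
have -> : (fun w => h (X s w)) @^-1` A =
  \bigcup_(v in [set: {ffun 'I_n -> int}]) (if h (ext v) \in A then
     \bigcap_(i in [set: 'I_n]) [set w | X s w i = v i] else set0).
  apply/seteqP; split => w /=.
    move=> Aw; exists [ffun i : 'I_n => X s w i] => //.
    have e : h (ext [ffun i : 'I_n => X s w i]) = h (X s w).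
      by apply: hh => k kn; rewrite /ext insubT ffunE.
    by rewrite ifT ?e ?inE // => i _ /=; rewrite ffunE.
  move=> [v _]; case: ifPn => // /set_mem Av hv.
  rewrite -(hh (ext v)) // => k kn; rewrite /ext insubT.
  exact/esym/(hv (Ordinal kn)).
apply: countable_bigcupT_measurable => [|v]; first exact: countableP.
case: ifP => _ //; apply: fin_bigcap_measurable => [|i _]; first exact: finite_finset.
exact: mX.
Qed.

Section Expectation.
Variables (n : nat) (h : config -> R).
Hypothesis hn : first_coords n h.
Hypothesis h0 : forall x, 0 <= h x.

(** The events given by a jump path and a number of jumps before time [s] are disjoint, with
    probabilities equal to path weight times Poisson weight. These sum to 1, so the rest, explosion
    included, is a null set. *)
Lemma expect_first_coords :
  ('E_P[fun w => h (X s w)] = \sum_(0 <= m <oo)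
     (poisson_weight s m * iter m (chain_step n (jump_rate t) jump) h packed)%:E)%E.
Proof.
case: hX => _ _ [Y [S [[mY mS law] aeX]]].
pose E l := [set w | forall i, (i <= size l)%N -> Y i w = trajectory packed (nth 0%N l) i].
(* Positivity of the holding times makes the jump times increase, which separates the events for
   different numbers of jumps. *)
pose C m := [set w | (forall i, (i <= m)%N -> 0 < S i w) /\
                     jump_time S m w <= s < jump_time S m.+1 w].
pose B l := E l `&` C (size l).
have mE l : measurable (E l).
  rewrite (_ : E l = \bigcap_(i in [set i | (i <= size l)%N]) \bigcap_k
     [set w | Y i w k = trajectory packed (nth 0%N l) i k]).
    by apply: bigcap_measurableType => i _; apply: bigcapT_measurable => k; exact: mY.
  apply/seteqP; split => w /=; first by move=> h' i il k _ /=; rewrite (h' i il).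
  by move=> h' i il; apply/funext => k; exact: (h' i il k).
have mC m : measurable (C m).
  rewrite (_ : C m = \bigcap_(i in [set i | (i <= m)%N]) [set w | 0 < S i w] `&`
    ([set w | jump_time S m w <= s] `&` [set w | s < jump_time S m.+1 w])).
    apply: measurableI; first by apply: bigcap_measurableType => i _; exact: measurable_gt.
    by apply: measurableI; [apply: measurable_le|apply: measurable_gt];
      exact: measurable_jump_time.
  by apply/seteqP; split => w /= [hS]; [move=> /andP[]|move=> [a b]; split=> //; apply/andP].
have mB l : measurable (B l) by exact: measurableI.
have PB l : P (B l) = (path_weight t l * poisson_weight s (size l))%:E.
  rewrite (probE P (mB l)); congr _%:E.
  apply: jump_count_law => // u u0; apply: EFin_inj.
  have mEu : measurable (E l `&` [set w | forall i, (i <= size l)%N -> u i < S i w]).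
    apply: measurableI => //.
    rewrite (_ : [set _ | _] = \bigcap_(i in [set i | (i <= size l)%N]) [set w | u i < S i w]) //.
    by apply: bigcap_measurableType => i _; exact: measurable_gt.
  rewrite -probE // (law (size l) (nth 0%N l) u u0); congr (_ * _)%:E.
    by apply: eq_bigr => i _; rewrite total_rate_trajectory // divr1.
  by apply: eq_bigr => i _; rewrite total_rate_trajectory // mul1r.
have B_inj m l l' w : l \in jump_paths m -> l' \in jump_paths m -> B l w -> B l' w -> l = l'.
  move=> /jump_paths_size lm /jump_paths_size l'm [El _] [El' _].
  apply: (@eq_from_nth _ 0%N); rewrite lm ?l'm // => i im.
  apply: (@trajectory_inj packed _ _ m) im => j jm.
  by rewrite -El ?lm // -El' ?l'm.
have C_inj m m' w : C m w -> C m' w -> m = m'.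
  have lt a b : (a < b)%N -> C a w -> C b w -> False.
    move=> ab [_ /andP[_ h1]] [hS /andP[h2 _]].
    have : jump_time S a.+1 w <= jump_time S b w.
      rewrite /jump_time -!(big_mkord xpredT (fun i => S i w)) (@big_cat_nat _ _ _ a.+1 0 b) //=.
      rewrite lerDl big_nat_cond sumr_ge0 // => i /andP[/andP[_ ib] _].
      by rewrite ltW // hS // ltnW.
    by move=> /(lt_le_trans h1) /(lt_le_trans) /(_ h2); rewrite ltxx.
  by move=> hm hm'; case: (ltngtP m m') => // /lt; tauto.
pose D m := \big[setU/set0]_(l <- jump_paths m) B l.
have mD m : measurable (D m) by apply: bigsetU_measurable => l _.
have inD m w : D m w -> exists2 l, l \in jump_paths m & B l w.
  by rewrite /D -bigcup_seq => -[l /= lm Bl]; exists l.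
have tD : trivIset setT D.
  apply/trivIsetP => m m' _ _ mm'; apply/seteqP; split => w //=.
  move=> [/inD[l lm [_ Cl]] /inD[l' lm' [_ Cl']]].
  move: mm'; rewrite -(jump_paths_size lm) -(jump_paths_size lm') => /eqP; apply.
  exact: C_inj Cl Cl'.
have tB m : trivIset [set` jump_paths m] B.
  move=> l l' /= lm l'm [w [Bl Bl']]; exact: (B_inj m l l' w).
have PD m : P (D m) = (poisson_weight s m)%:E.
  have := @ge0_integral_bigsetU _ _ _ P _ B (cst 1%E) (jump_paths m) mB (uniq_jump_paths m)
    (tB m) (measurable_cst _) (fun _ _ => lee01).
  rewrite -/(D m) integral_cst // mul1e => ->.
  rewrite (eq_bigr (fun l => P (B l))) => [|l _]; last by rewrite integral_cst // mul1e.
  rewrite big_seq (eq_bigr (fun l => (path_weight t l * poisson_weight s m)%:E)).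
    by rewrite -big_seq sumEFin -mulr_suml sum_path_weight // mul1r.
  by move=> l /jump_paths_size lm; rewrite PB lm.
pose U := \bigcup_m D m.
have mU : measurable U by exact: bigcupT_measurable.
have PU : P (~` U) = 0%E.
  rewrite probability_setC // measure_semi_bigcup //.
  by rewrite (eq_eseriesr (fun m _ => PD m)) poisson_weight_series subee.
pose f w := (h (X s w))%:E.
have f0 w : (0 <= f w)%E by rewrite lee_fin.
have mf A : measurable_fun A f.
  by apply: measurable_funTS; apply/measurable_EFinP; exact: measurable_first_coords hn.
rewrite unlock -/f.
rewrite (ge0_negligible_integral (measurableC mU) measurableT (mf _) (fun x _ => f0 x) PU).
rewrite setTD setCK ge0_integral_bigcup //.
apply: eq_eseriesr => m _.
rewrite ge0_integral_bigsetU //; last exact: uniq_jump_paths.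
rewrite -(sum_jump_paths t01) // mulr_sumr -sumEFin big_seq [RHS]big_seq.
apply: eq_bigr => l lm.
have -> : (\int[P]_(x in B l) f x = \int[P]_(x in B l) (h (path_config l))%:E)%E.
  apply: ge0_ae_eq_integral => //; first by move=> *; rewrite lee_fin.
  apply: filterS aeX => w hw [El [_ Cl]]; rewrite /f.
  by rewrite (hw (size l) s) // El.
rewrite integral_cst //.
apply: (etrans (congr1 (fun z => (_ * z)%E) (PB l))).
by rewrite (jump_paths_size lm) -EFinM; congr _%:E; ring.
Qed.

Lemma expect_ge_trunc M :
  ((trunc_expect n (jump_rate t) jump packed M s h)%:E <= 'E_P[fun w => h (X s w)])%E.
Proof.
rewrite expect_first_coords /trunc_expect.
rewrite -sumEFin -(big_mkord xpredT (fun m =>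
   (poisson_weight s m * iter m (chain_step n (jump_rate t) jump) h packed)%:E)).
apply: nneseries_lim_ge => m _; rewrite lee_fin mulr_ge0 ?poisson_weight_ge0 //.
rewrite -(iter_chain_step_cst n (jump_rate t) jump m 0 packed).
apply: (@iter_chain_step_le _ _ _ _ _ valid) => //.
- by move=> x k vx; exact: jump_rate_ge0.
- by move=> x; exact: sum_jump_rate_le1.
- by move=> x k vx; exact: valid_jump.
- exact: valid_packed.
Qed.

(** This is where the truncation errors of the Dynkin estimates are sent to zero. *)
Lemma expect_le_trunc (C : R) (eps : nat -> R) :
  eps @ \oo --> 0 ->
  (forall M, trunc_expect n (jump_rate t) jump packed M.+1 s h <= C + eps M) ->
  ('E_P[fun w => h (X s w)] <= C%:E)%E.
Proof.
move=> eps0 hC; rewrite expect_first_coords; apply/lee_addgt0Pr => e e0.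
apply: lime_le.
  apply: is_cvg_nneseries => m _ _; rewrite lee_fin mulr_ge0 ?poisson_weight_ge0 //.
  rewrite -(iter_chain_step_cst n (jump_rate t) jump m 0 packed).
  apply: (@iter_chain_step_le _ _ _ _ _ valid) => //.
  - by move=> x k vx; exact: jump_rate_ge0.
  - by move=> x; exact: sum_jump_rate_le1.
  - by move=> x k vx; exact: valid_jump.
  - exact: valid_packed.
have : \forall M \near \oo, eps M <= e.
  move/cvgrPdist_le : eps0 => /(_ e e0); apply: filterS => M.
  by rewrite sub0r normrN; apply: le_trans; exact: ler_norm.
move=> [N _ hN]; exists N.+1 => // -[//|M] /= NM.
rewrite big_mkord sumEFin -/(trunc_expect _ _ _ _ _ _ _) -EFinD lee_fin.
by apply: (le_trans (hC M)); rewrite lerD2l hN.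
Qed.

End Expectation.

End LawAtFixedTime.

(** * Normal laws *)

Section AffineLebesgue.
Variable R : realType.
Local Notation mu := (@lebesgue_measure R).

Lemma affine_preimage_itv (u b x y : R) : (0 < b)%R ->
  (fun z => u + b * z)%R @^-1` `]x, y] = `](x - u) / b, (y - u) / b]%classic.
Proof.
move=> b0; apply/seteqP; split => z /=; rewrite !in_itv /= => /andP[h1 h2]; apply/andP; split.
- by rewrite ltr_pdivrMr // ltrBlDl mulrC.
- by rewrite ler_pdivlMr // lerBrDl mulrC.
- by move: h1; rewrite ltr_pdivrMr // ltrBlDl mulrC.
- by move: h2; rewrite ler_pdivlMr // lerBrDl mulrC.
Qed.

Lemma measurable_affine (u b : R) : measurable_fun [set: measurableTypeR R]
  (fun z : measurableTypeR R => (u + b * z)%R : measurableTypeR R).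
Proof. by apply: measurable_funD => //; apply: measurable_funM. Qed.

Local Open Scope ereal_scope.

Lemma lebesgue_affine (u b : R) (A : set R) : (0 < b)%R -> measurable A ->
  mu A = b%:E * mu ((fun z => u + b * z)%R @^-1` A).
Proof.
move=> b0; have mF := measurable_affine u b.
pose mixin := isMeasurableFun.Build _ _ _ _ _ mF.
pose F : {mfun measurableTypeR R >-> measurableTypeR R} := HB.pack (fun z => u + b * z)%R mixin.
move=> mA; apply: (@lebesgue_measure_unique _ (mscale (NngNum (ltW b0)) (pushforward mu F))) => //= _ [[x y]] _ <-.
suff : mu `]x, y]%classic = b%:E * mu [set` `](x - u) / b, (y - u) / b]%R].
  by rewrite -(affine_preimage_itv u x y b0).
rewrite !lebesgue_measure_itv /= !lte_fin.
rewrite ltr_pM2r ?invr_gt0 // ltrD2r; case: ifP => _; last by rewrite mule0.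
rewrite -EFinD -EFinM; congr _%:E; field.
by rewrite gt_eqF.
Qed.

Lemma ge0_integral_affine_pos (u b : R) (f : R -> \bar R) : (0 < b)%R ->
  measurable_fun setT f -> (forall x, 0 <= f x) ->
  \int[mu]_x f x = b%:E * \int[mu]_x f (u + b * x)%R.
Proof.
move=> b0 mf f0.
have mF := measurable_affine u b.
pose mixin := isMeasurableFun.Build _ _ _ _ _ mF.
pose F : {mfun measurableTypeR R >-> measurableTypeR R} := HB.pack (fun z => u + b * z)%R mixin.
rewrite (eq_measure_integral (mscale (NngNum (ltW b0)) (pushforward mu F))); last first.
  by move=> A mA _; exact: lebesgue_affine.
rewrite ge0_integral_mscale //=; congr (_ * _).
by rewrite ge0_integral_pushforward // preimage_setT.
Qed.

Lemma ge0_integral_affine (u b : R) (f : R -> \bar R) : b != 0%R ->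
  measurable_fun setT f -> (forall x, 0 <= f x) ->
  \int[mu]_x f x = `|b|%:E * \int[mu]_x f (u + b * x)%R.
Proof.
move=> b0 mf f0; have [bp|bn] := ltP 0%R b.
  by rewrite gtr0_norm // (ge0_integral_affine_pos u bp).
have {}bn : (b < 0)%R by rewrite lt_neqAle b0.
have bp : (0 < - b)%R by rewrite oppr_gt0.
rewrite ltr0_norm // (ge0_integral_affine_pos u bp) //; congr (_ * _).
have mg : measurable_fun setT (fun x : R => f (u + b * x)%R).
  by apply: measurableT_comp mf _; exact: measurable_affine.
have mN : measurable_fun [set: measurableTypeR R] (-%R : measurableTypeR R -> measurableTypeR R) by [].
transitivity (\int[pushforward mu (-%R : _ -> measurableTypeR R)]_x f (u + b * x)%R).
  rewrite ge0_integral_pushforward // preimage_setT; apply: eq_integral => x _ /=.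
  by rewrite mulNr mulrN.
by apply: eq_measure_integral => A mA _; exact: lebesgue_measureN.
Qed.

End AffineLebesgue.

Section NormalLaws.
Variable R : realType.
Local Notation mu := (@lebesgue_measure R).
Local Open Scope ereal_scope.

(** The Radon-Nikodym derivative of the normal law and its density have the same integrals over
    measurable sets, hence agree almost everywhere. *)
Lemma ge0_integral_normal (m s : R) (f : R -> \bar R) : measurable_fun setT f ->
  (forall x, 0 <= f x) ->
  \int[normal_prob m s]_x f x = \int[mu]_x (f x * (normal_pdf m s x)%:E).
Proof.
move=> mf f0; have dom := @normal_prob_dominates R m s.
rewrite -(Radon_Nikodym_SigmaFinite.change_of_variables dom) //.
have mpdf : measurable_fun setT (fun x : R => (normal_pdf m s x)%:E).
  by apply/measurable_EFinP; exact: measurable_normal_pdf.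
have iRN := Radon_Nikodym_SigmaFinite.f_integrable dom.
apply: ge0_ae_eq_integral => //.
- apply: emeasurable_funM => //; exact: measurable_int iRN.
- exact: emeasurable_funM.
- by move=> x _; rewrite mule_ge0 // Radon_Nikodym_SigmaFinite.f_ge0.
- by move=> x _; rewrite mule_ge0 // lee_fin normal_pdf_ge0.
apply: ae_eqe_mul2l; apply: integral_ae_eq => //.
by move=> A _ mA; rewrite -Radon_Nikodym_SigmaFinite.f_integral.
Qed.

End NormalLaws.

(** * Centered normal laws and their sums *)

Section GaussianFamily.
Variable R : realType.
Local Notation mu := (@lebesgue_measure R).

Definition gauss_law (s : R) (A : set R) : \bar R :=
  if s == 0 then dirac (0 : R) A else normal_prob 0 s A.

Lemma normal_peak_scale (b : R) : b != 0 -> `|b| * normal_peak b = normal_peak 1.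
Proof.
move=> b0; rewrite /normal_peak expr1n -!mulrnAr sqrtrM ?sqr_ge0 // sqrtr_sqr mul1r.
by rewrite invfM mulrA divff ?mul1r // normr_eq0.
Qed.

Lemma normal_pdf_affine (u b y : R) : b != 0 ->
  `|b| * normal_pdf u b (u + b * y) = normal_pdf 0 1 y.
Proof.
move=> b0; rewrite !normal_pdfE ?oner_neq0 // mulrA normal_peak_scale //.
rewrite /normal_fun; congr (_ * expR _); rewrite addrC addKr subr0 expr1n.
field.
by rewrite b0.
Qed.

Lemma normal_prob_indic (m s : R) (A : set R) : measurable A ->
  normal_prob m s A = (\int[mu]_x ((\1_A x * normal_pdf m s x)%:E))%E.
Proof.
move=> mA; rewrite /normal_prob integral_mkcond; apply: eq_integral => x _.
by rewrite patchE indicE; case: ifP => _; rewrite ?mul1r ?mul0r.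
Qed.

Lemma normal_prob_affine (u b : R) (A : set R) : b != 0 -> measurable A ->
  normal_prob u b A = normal_prob 0 1 [set y | A (u + b * y)].
Proof.
move=> b0 mA.
have mA' : measurable [set y : measurableTypeR R | A (u + b * y)].
  by have := measurable_affine u b measurableT mA; rewrite setTI.
rewrite (normal_prob_indic u b mA) (normal_prob_indic 0 1 mA') (ge0_integral_affine u b0); first last.
- by move=> x; rewrite lee_fin mulr_ge0 ?normal_pdf_ge0 // indicE.
- by apply/measurable_EFinP; apply: measurable_funM;
    [exact: measurable_indic | exact: measurable_normal_pdf].
rewrite -ge0_integralZl //; first last.
- by move=> x _; rewrite lee_fin mulr_ge0 ?normal_pdf_ge0 // indicE.
- apply/measurable_EFinP; apply: measurable_funM.
    apply: (measurableT_comp (measurable_indic mA)); exact: measurable_affine.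
  apply: (measurableT_comp (measurable_normal_pdf u b)); exact: measurable_affine.
apply: eq_integral => y _; rewrite -EFinM mulrCA normal_pdf_affine // !indicE.
Qed.

(** Completing the square in [u]: the joint density is the density of the sum times the conditional
    density of the first summand given the sum. *)
Lemma normal_pdf_convolution (s b x u : R) : s != 0 -> b != 0 ->
  normal_pdf u b x * normal_pdf 0 s u =
  normal_pdf 0 (Num.sqrt (s ^+ 2 + b ^+ 2)) x *
  normal_pdf (x * s ^+ 2 / (s ^+ 2 + b ^+ 2)) (s * b / Num.sqrt (s ^+ 2 + b ^+ 2)) u.
Proof.
move=> s0 b0; set v := s ^+ 2 + b ^+ 2.
have v0 : 0 < v by rewrite addr_gt0 // exprn_even_gt0.
have vs : Num.sqrt v ^+ 2 = v by rewrite sqr_sqrtr // ltW.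
have w0 : Num.sqrt v != 0 by rewrite gt_eqF // sqrtr_gt0.
have p0 : s * b / Num.sqrt v != 0 by rewrite !mulf_neq0 // invr_eq0.
rewrite !normal_pdfE // mulrACA [RHS]mulrACA; congr (_ * _).
  rewrite /normal_peak -!invfM -!sqrtrM; last 2 first.
  - by rewrite mulrn_wge0 // mulr_ge0 ?sqr_ge0 // pi_ge0.
  - by rewrite mulrn_wge0 // mulr_ge0 ?sqr_ge0 // pi_ge0.
  congr (Num.sqrt _)^-1; rewrite !exprMn exprVn vs; field.
  by rewrite gt_eqF.
rewrite /normal_fun -!expRD; congr expR; rewrite !exprMn exprVn vs /v.
by field; rewrite s0 b0 -/v gt_eqF.
Qed.

Lemma measurable_normal_pdf2 (b : R) : b != 0 ->
  measurable_fun setT (fun z : measurableTypeR R * measurableTypeR R => normal_pdf z.1 b z.2).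
Proof.
move=> b0; rewrite (_ : (fun z => _) = (fun z : R * R =>
   normal_peak b * expR (- (z.2 - z.1) ^+ 2 / (b ^+ 2 *+ 2)))); last first.
  by apply/funext => z; rewrite normal_pdfE.
apply: measurable_funM => //; apply: measurableT_comp => //.
apply: measurable_funM => //; apply: measurableT_comp => //.
by apply: measurable_funX; apply: measurable_funB.
Qed.

Lemma measurable_normal_prob (b : R) (A : set R) : b != 0 -> measurable A ->
  measurable_fun setT (fun u : R => normal_prob u b A).
Proof.
move=> b0 mA.
rewrite (_ : (fun u => _) = (fun u => \int[mu]_x (\1_A x * normal_pdf u b x)%:E)%E); last first.
  by apply/funext => u; rewrite normal_prob_indic.
apply: (@measurable_fun_fubini_tonelli_F _ _ _ _ _ mu
  (fun z : measurableTypeR R * measurableTypeR R => (\1_A z.2 * normal_pdf z.1 b z.2)%:E)).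
- apply/measurable_EFinP; apply: measurable_funM; last exact: measurable_normal_pdf2.
  exact: measurableT_comp (measurable_indic mA) _.
- by move=> z; rewrite lee_fin mulr_ge0 ?normal_pdf_ge0 // indicE.
Qed.

Lemma normal_prob_convolution (s b : R) (A : set R) : s != 0 -> b != 0 -> measurable A ->
  (\int[normal_prob 0 s]_u normal_prob u b A = normal_prob 0 (Num.sqrt (s ^+ 2 + b ^+ 2)) A)%E.
Proof.
move=> s0 b0 mA.
pose F (z : measurableTypeR R * measurableTypeR R) : \bar R :=
  ((\1_A z.2 * normal_pdf z.1 b z.2 * normal_pdf 0 s z.1))%:E.
have F0 z : (0 <= F z)%E.
  by rewrite lee_fin !mulr_ge0 ?normal_pdf_ge0 // indicE.
have mF : measurable_fun setT F.
  apply/measurable_EFinP; apply: measurable_funM.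
    apply: measurable_funM; last exact: measurable_normal_pdf2.
    exact: measurableT_comp (measurable_indic mA) _.
  exact: measurableT_comp (measurable_normal_pdf 0 s) _.
have mnp := measurable_normal_prob b0 mA.
rewrite ge0_integral_normal //.
transitivity (\int[mu]_u \int[mu]_x F (u, x))%E.
  apply: eq_integral => u _; rewrite normal_prob_indic // -ge0_integralZr //.
  - apply/measurable_EFinP; apply: measurable_funM; first exact: measurable_indic.
    exact: measurable_normal_pdf.
  - by move=> x _; rewrite lee_fin mulr_ge0 ?normal_pdf_ge0 // indicE.
  - by rewrite lee_fin normal_pdf_ge0.
rewrite (@fubini_tonelli _ _ _ _ _ mu mu F) // (normal_prob_indic _ _ mA).
apply: eq_integral => x _.
transitivity (\int[mu]_u ((\1_A x * normal_pdf 0 (Num.sqrt (s ^+ 2 + b ^+ 2)) x)%:E *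
  (normal_pdf (x * s ^+ 2 / (s ^+ 2 + b ^+ 2)) (s * b / Num.sqrt (s ^+ 2 + b ^+ 2)) u)%:E))%E.
  by apply: eq_integral => u _; rewrite /F /= -EFinM -mulrA (normal_pdf_convolution x u s0 b0) mulrA.
rewrite ge0_integralZl //.
- by rewrite integral_normal_pdf mule1.
- by apply/measurable_EFinP; exact: measurable_normal_pdf.
- by move=> u _; rewrite lee_fin normal_pdf_ge0.
- by rewrite lee_fin mulr_ge0 ?normal_pdf_ge0 // indicE.
Qed.

Local Notation N := (@normal_prob R 0 1 : probability (measurableTypeR R) R).

Lemma normal_prob_norm (m b : R) (A : set R) : normal_prob m `|b| A = normal_prob m b A.
Proof.
rewrite /normal_prob; apply: eq_integral => x _; congr _%:E.
rewrite /normal_pdf normr_eq0; case: ifP => // _.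
by rewrite /normal_peak /normal_fun -!normrX !(ger0_norm (sqr_ge0 _)).
Qed.

Lemma gauss_law_scale (s : R) (A : set R) : measurable A ->
  N [set y | A (s * y)] = gauss_law `|s| A.
Proof.
move=> mA; rewrite /gauss_law normr_eq0; have [->|s0] := eqVneq s 0.
  rewrite diracE; have [/set_mem A0|/negP A0] := boolP (0 \in A).
    rewrite (_ : [set y | _] = setT) ?probability_setT //.
    by apply/seteqP; split => y //= _; rewrite mul0r.
  rewrite (_ : [set y | _] = set0) ?measure0 //.
  by apply/seteqP; split => y //=; rewrite mul0r => /mem_set.
rewrite normal_prob_norm normal_prob_affine //; congr (N _).
by apply/seteqP; split => y /=; rewrite add0r.
Qed.

(** The convolution formula needs two nonzero deviations; a vanishing [b] or [s] makes one law a
    point mass and is treated apart. *)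
Lemma gauss_law_add d (T : measurableType d) (P : probability T R) (W : T -> R) (s b : R) :
  0 <= s -> measurable_fun setT W ->
  (forall A, measurable A -> P (W @^-1` A) = gauss_law s A) ->
  forall A, measurable A ->
    (P \x N)%E [set z | A (W z.1 + b * z.2)] = gauss_law (Num.sqrt (s ^+ 2 + b ^+ 2)) A.
Proof.
move=> s_ge0 mW hW A mA.
have -> : (P \x N)%E [set z | A (W z.1 + b * z.2)] = (\int[P]_w N [set y : R | A (W w + b * y)%R])%E.
  rewrite /= /product_measure1; apply: eq_integral => w _ /=; congr (N _).
  by apply/seteqP; split => y; rewrite /xsection /= ?inE.
have [b0|b0] := eqVneq b 0.
  rewrite b0 expr0n addr0 sqrtr_sqr ger0_norm // -hW //.
  have mWA : measurable (W @^-1` A) by rewrite -[_ @^-1` _]setTI; exact: mW.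
  rewrite -[W @^-1` A]setIT -integral_indic //; apply: eq_integral => w _.
  rewrite indicE; have [/set_mem /= wA|/negP wA] := boolP (w \in W @^-1` A).
    rewrite (_ : [set y | _] = setT) ?probability_setT //.
    by apply/seteqP; split => y //= _; rewrite mul0r addr0.
  rewrite (_ : [set y | _] = set0) ?measure0 //.
  apply/seteqP; split => y //=; rewrite mul0r addr0 => WA; apply: wA.
  exact/mem_set.
rewrite (eq_integral (fun w => normal_prob (W w) b A)); last first.
  by move=> w _; rewrite [in RHS]normal_prob_affine.
have mW' : measurable_fun [set: T] (W : T -> measurableTypeR R) by exact: mW.
pose Wmix := isMeasurableFun.Build _ _ _ _ _ mW'.
pose WRV : {RV P >-> measurableTypeR R} := HB.pack (W : T -> measurableTypeR R) Wmix.
have mnp := measurable_normal_prob b0 mA.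
transitivity (\int[distribution P WRV]_u normal_prob u b A)%E.
  by rewrite ge0_integral_distribution.
have v0 : Num.sqrt (s ^+ 2 + b ^+ 2) != 0.
  by rewrite gt_eqF // sqrtr_gt0 ltr_wpDl ?sqr_ge0 // exprn_even_gt0.
rewrite /gauss_law (negPf v0).
have [s0|s0] := eqVneq s 0.
  transitivity (\int[\d_(0%R : measurableTypeR R)]_u normal_prob u b A)%E.
    apply: eq_measure_integral => B mB _; transitivity (gauss_law s B); last by rewrite /gauss_law s0 eqxx.
    exact: hW.
  rewrite integral_dirac // diracT mul1e s0 expr0n add0r sqrtr_sqr.
  by rewrite normal_prob_norm.
transitivity (\int[@normal_prob R 0 s]_u normal_prob u b A)%E.
  apply: eq_measure_integral => B mB _; transitivity (gauss_law s B); last by rewrite /gauss_law (negPf s0).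
  exact: hW.
exact: normal_prob_convolution.
Qed.

(** Independent standard normals, with independence recorded only through the laws of their linear
    combinations. *)
Definition std_normal_family n : Prop :=
  exists (d : measure_display) (T : measurableType d) (P : probability T R)
    (Z : nat -> {RV P >-> R}), forall (a : nat -> R) (A : set R), measurable A ->
    P ((fun w => \sum_(k < n) a k * Z k w) @^-1` A) =
    gauss_law (Num.sqrt (\sum_(k < n) a k ^+ 2)) A.

Lemma std_normal_family_exists n : std_normal_family n.
Proof.
elim: n => [|n [d [T [P [Z hZ]]]]].
  exists _, (measurableTypeR R), (@normal_prob R 0 1 : probability _ _).
  exists (fun=> cst 0) => a A mA; rewrite big_ord0 sqrtr0 /gauss_law eqxx diracE.
  rewrite (_ : _ @^-1` A = if 0 \in A then setT else set0).
    by case: ifP => _; rewrite ?measure0 ?probability_setT.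
  apply/seteqP; split => w /=; rewrite big_ord0.
    by move=> /mem_set ->.
  by case: ifPn => // /set_mem.
pose P' : probability (T * measurableTypeR R)%type R := (P \x N)%E.
have mZ k : measurable_fun setT (fun w : T * measurableTypeR R =>
    if (k < n)%N then Z k w.1 else w.2 : measurableTypeR R).
  case: (k < n)%N; last exact: measurable_snd.
  exact: measurableT_comp (measurable_funPT (Z k)) measurable_fst.
pose Zmix k := isMeasurableFun.Build _ _ _ _ _ (mZ k).
pose Z' k : {RV P' >-> R} := HB.pack (fun w : T * measurableTypeR R =>
    if (k < n)%N then Z k w.1 else w.2 : measurableTypeR R) (Zmix k).
exists _, _, P', Z' => a A mA.
pose s := Num.sqrt (\sum_(k < n) a k ^+ 2).
have s2 : s ^+ 2 = \sum_(k < n) a k ^+ 2.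
  by rewrite sqr_sqrtr // sumr_ge0 // => k _; rewrite sqr_ge0.
have -> : \sum_(k < n.+1) a k ^+ 2 = s ^+ 2 + a n ^+ 2 by rewrite big_ord_recr s2.
have mW : measurable_fun [set: T] (fun w => \sum_(k < n) a k * Z k w).
  by apply: measurable_sum => k; apply: measurable_funM.
rewrite -(gauss_law_add (a n) (sqrtr_ge0 _) mW (hZ a) mA); congr (P' _).
apply/funext => -[w y] /=; congr (A _); rewrite big_ord_recr /= ltnn; congr (_ + _).
by apply: eq_bigr => k _; rewrite ltn_ord.
Qed.

End GaussianFamily.

(** * Bounds for the hyperbolic and the ordinary cosine *)

Section ExponentialBounds.
Variable R : realType.
Implicit Types u x : R.

Lemma expR_ge_pow n u : 0 <= u -> u ^+ n / n`!%:R <= expR u.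
Proof.
move=> u0; apply: le_trans (truncexp_le_expR n u0).
rewrite /truncexp big_ord_recr /= lerDr sumr_ge0 // => i _.
by rewrite divr_ge0 // exprn_ge0.
Qed.

Lemma expR_norm_le u : expR `|u| <= expR u + expR (- u).
Proof.
by have [u0|u0] := ger0P u; rewrite ?lerDl ?lerDr expR_ge0.
Qed.

(** With [x = u / 2] the right side is [2 + (exp x - exp (- x)) ^ 2], and the second order bounds on
    the exponential give [exp x - exp (- x) >= 2 x]. *)
Lemma cosh_ge u : 2 + u ^+ 2 <= expR u + expR (- u).
Proof.
wlog u0 : u / 0 <= u => [hw|].
  have [/hw//|u0] := leP 0 u.
  by have := hw (- u); rewrite oppr_ge0 sqrrN opprK [expR (- u) + _]addrC; apply; exact: ltW.
set x := u / 2; have x0 : 0 <= x by rewrite divr_ge0.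
have e1 : 1 + x + x ^+ 2 / 2 <= expR x.
  have := truncexp_le_expR 2 x0; rewrite /truncexp !big_ord_recr big_ord0 /= /expterm.
  by rewrite expr0 expr1 !divr1 add0r.
have xp : 0 <= x ^+ 2 by rewrite sqr_ge0.
have d0 : 0 < 1 + x + x ^+ 2 / 2 by lra.
have e2 : expR (- x) <= 1 - x + x ^+ 2 / 2.
  rewrite expRN; apply: le_trans (_ : (1 + x + x ^+ 2 / 2)^-1 <= _).
    by rewrite lef_pV2 // posrE // expR_gt0.
  rewrite -[leLHS]mul1r ler_pdivrMr //.
  have -> : (1 - x + x ^+ 2 / 2) * (1 + x + x ^+ 2 / 2) = 1 + (x ^+ 2) ^+ 2 / 4 by field.
  by rewrite lerDl divr_ge0 // sqr_ge0.
have -> : expR u = expR x ^+ 2 by rewrite -expRM_natl; congr expR; rewrite /x; field.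
have -> : expR (- u) = expR (- x) ^+ 2 by rewrite -expRM_natl; congr expR; rewrite /x; field.
have ee : expR x * expR (- x) = 1 by rewrite -expRD subrr expR0.
have h : 2 * x <= expR x - expR (- x) by lra.
have : (2 * x) ^+ 2 <= (expR x - expR (- x)) ^+ 2 by rewrite ler_sqr ?nnegrE; lra.
have -> : (2 * x) ^+ 2 = u ^+ 2 by rewrite /x; field.
by nra.
Qed.

Lemma cosh_le u : expR u + expR (- u) <= 2 + u ^+ 2 + `|u| ^+ 3 * expR `|u|.
Proof.
wlog u0 : u / 0 <= u => [hw|].
  have [/hw//|u0] := leP 0 u.
  by have := hw (- u); rewrite oppr_ge0 normrN sqrrN opprK [expR (- u) + _]addrC; apply; exact: ltW.
rewrite ger0_norm //; set x := u / 2; have x0 : 0 <= x by rewrite divr_ge0.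
have eu : expR u = expR x ^+ 2 by rewrite -expRM_natl; congr expR; rewrite /x; field.
have eN : expR (- u) = expR (- x) ^+ 2 by rewrite -expRM_natl; congr expR; rewrite /x; field.
have ee : expR x * expR (- x) = 1 by rewrite -expRD subrr expR0.
have e0 := expR_gt0 x; have e0' := expR_gt0 (- x).
have h1 : 1 - 2 * x <= expR (- x) ^+ 2 by rewrite -eN; have := expR_ge1Dx (- u); rewrite /x; lra.
have h2 : expR x - expR (- x) <= 2 * x * expR x.
  have -> : expR (- x) = expR x * expR (- x) ^+ 2 by rewrite expr2 mulrA ee mul1r.
  nra.
have h3 : 0 <= expR x - expR (- x) by rewrite subr_ge0 ler_expR; lra.
have : (expR x - expR (- x)) ^+ 2 <= (2 * x * expR x) ^+ 2 by rewrite ler_sqr ?nnegrE //; apply: mulr_ge0; lra.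
have -> : (2 * x * expR x) ^+ 2 = u ^+ 2 * expR u by rewrite eu /x; field.
have h4 : expR u - 1 <= u * expR u.
  have := expR_ge1Dx (- u); rewrite expRN => h.
  have eu0 := expR_gt0 u; have : (1 - u) * expR u <= (expR u)^-1 * expR u by rewrite ler_pM2r.
  by rewrite mulVf ?gt_eqF //; lra.
have h5 : u ^+ 2 * (expR u - 1) <= u ^+ 2 * (u * expR u) by rewrite ler_wpM2l ?sqr_ge0.
have -> : u ^+ 3 * expR u = u ^+ 2 * (u * expR u) by ring.
by rewrite eu eN; rewrite eu in h5; nra.
Qed.

Lemma cos_ge_quad_all u : 1 - u ^+ 2 / 2 <= cos u.
Proof.
have [u0|u0] := leP 0 u; first exact: cos_ge_quad.
by have := @cos_ge_quad _ (- u); rewrite oppr_ge0 cosN sqrrN; apply; exact: ltW.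
Qed.

(** Through [cos u = 1 - 2 sin (u / 2) ^ 2] and the cubic lower bound on the sine; where that bound
    is negative and cannot be squared, the claimed lower bound on the square is nonpositive. *)
Lemma cos_le_quartic u : cos u <= 1 - u ^+ 2 / 2 + u ^+ 4 / 24.
Proof.
wlog u0 : u / 0 <= u => [hw|].
  have [/hw//|u0] := leP 0 u.
  have := hw (- u); rewrite oppr_ge0 cosN sqrrN.
  by rewrite (_ : (- u) ^+ 4 = u ^+ 4) ?exprN; [apply; exact: ltW | ring].
set x := u / 2; have x0 : 0 <= x by rewrite divr_ge0.
have -> : u = x + x by rewrite /x; field.
rewrite cosD; have cs := cos2Dsin2 x; have sx := sin_ge_cubic x0.
have h : x ^+ 2 - x ^+ 4 / 3 <= sin x ^+ 2.
  have [y0|y0] := leP 0 (x - x ^+ 3 / 6).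
    have : (x - x ^+ 3 / 6) ^+ 2 <= sin x ^+ 2 by rewrite ler_sqr ?nnegrE //; lra.
    have : 0 <= (x ^+ 3) ^+ 2 by rewrite sqr_ge0.
    have -> : (x - x ^+ 3 / 6) ^+ 2 = x ^+ 2 - x ^+ 4 / 3 + (x ^+ 3) ^+ 2 / 36 by field.
    lra.
  apply: le_trans (sqr_ge0 (sin x)).
  have -> : x ^+ 2 - x ^+ 4 / 3 = x * (x - x ^+ 3 / 3) by field.
  have x3 : 0 <= x ^+ 3 by rewrite exprn_ge0.
  by rewrite mulr_ge0_le0 //; lra.
have -> : (x + x) ^+ 2 = 4 * x ^+ 2 by ring.
have -> : (x + x) ^+ 4 = 16 * x ^+ 4 by ring.
rewrite -!expr2; lra.
Qed.

End ExponentialBounds.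

Lemma prob_bounded_integrable (R : realType) d (T : measurableType d) (P : probability T R)
    (f : T -> R) (M : R) :
  measurable_fun setT f -> (forall x, `|f x| <= M) -> P.-integrable setT (EFin \o f).
Proof.
move=> mf hM; apply: measurable_bounded_integrable => //.
  by apply: (@le_lt_trans _ _ 1%E); [exact: probability_le1 | exact: ltry].
exists M; split; first exact: num_real.
by move=> y My x _; apply: le_trans (hM x) (ltW My).
Qed.

Lemma EFin_Rintegral (R : realType) d (T : measurableType d) (mu : {measure set T -> \bar R}) (f : T -> R) :
  mu.-integrable setT (EFin \o f) -> (\int[mu]_x (f x)%:E = (\int[mu]_x f x)%:E)%E.
Proof. by move=> hf; rewrite /Rintegral fineK //; apply: integrable_fin_num. Qed.

Lemma integrable_scale (R : realType) d (T : measurableType d) (mu : {measure set T -> \bar R})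
    (c : R) (f : T -> R) :
  mu.-integrable setT (EFin \o f) -> mu.-integrable setT (EFin \o (fun x => c * f x)).
Proof. by move=> hf; apply: (integrableZl measurableT c hf). Qed.

Lemma integrable_add (R : realType) d (T : measurableType d) (mu : {measure set T -> \bar R})
    (f g : T -> R) :
  mu.-integrable setT (EFin \o f) -> mu.-integrable setT (EFin \o g) ->
  mu.-integrable setT (EFin \o (fun x => f x + g x)).
Proof. by move=> hf hg; apply: (@integrableD _ _ _ mu setT measurableT (EFin \o f) (EFin \o g)). Qed.

(** * Moments of the standard normal law *)

Section StandardNormal.
Variable R : realType.
Local Notation N := (@normal_prob R 0 1 : probability (measurableTypeR R) R).
Implicit Types l b s c : R.

Lemma integral_normal_exp l : (\int[N]_y (expR (l * y))%:E = (expR (l ^+ 2 / 2))%:E)%E.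
Proof.
have ml : measurable_fun setT (fun y : measurableTypeR R => expR (l * y)).
  by apply: measurableT_comp => //; exact: measurable_funM.
rewrite ge0_integral_normal; first last.
- by move=> y; rewrite lee_fin expR_ge0.
- exact/measurable_EFinP.
transitivity (\int[lebesgue_measure]_y ((expR (l ^+ 2 / 2))%:E * (normal_pdf l 1 y)%:E))%E.
  apply: eq_integral => y _; rewrite -!EFinM; congr _%:E.
  rewrite !normal_pdfE ?oner_neq0 // mulrCA [RHS]mulrCA; congr (_ * _).
  rewrite /normal_fun -!expRD; congr expR; rewrite expr1n; by field.
rewrite ge0_integralZl //.
- by rewrite integral_normal_pdf mule1.
- by apply/measurable_EFinP; exact: measurable_normal_pdf.
- by move=> u _; rewrite lee_fin normal_pdf_ge0.
Qed.

Lemma integrable_normal_exp l : N.-integrable setT (EFin \o (fun y => expR (l * y))).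
Proof.
apply/integrableP; split.
  by apply/measurable_EFinP; apply: measurableT_comp => //; exact: measurable_funM.
under eq_integral do rewrite /= ger0_norm ?expR_ge0 //.
by rewrite integral_normal_exp ltry.
Qed.

Lemma Rintegral_normal_exp l : \int[N]_y expR (l * y) = expR (l ^+ 2 / 2).
Proof. by rewrite /Rintegral integral_normal_exp. Qed.

Lemma integrable_normal_cosh l :
  N.-integrable setT (EFin \o (fun y => expR (l * y) + expR (- (l * y)))).
Proof.
apply: integrable_add; first exact: integrable_normal_exp.
by under eq_fun do rewrite -mulNr; exact: integrable_normal_exp.
Qed.

Lemma Rintegral_normal_cosh l :
  \int[N]_y (expR (l * y) + expR (- (l * y))) = 2 * expR (l ^+ 2 / 2).
Proof.
under [LHS]eq_Rintegral do rewrite -mulNr.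
rewrite RintegralD //; [|exact: integrable_normal_exp..].
by rewrite !Rintegral_normal_exp sqrrN mulr2n mulrDl !mul1r.
Qed.

Lemma integrable_normal_pow n : N.-integrable setT (EFin \o (fun y => y ^+ n)).
Proof.
have i1 : N.-integrable setT (EFin \o (fun y => n`!%:R * (expR (1 * y) + expR (- (1 * y))))).
  by apply: integrable_scale; exact: integrable_normal_cosh.
apply: le_integrable i1 => //.
  by apply/measurable_EFinP; apply: exprn_measurable.
move=> y _ /=; rewrite lee_fin normrX !mul1r [leRHS]ger0_norm; last first.
  by rewrite mulr_ge0 // addr_ge0 // expR_ge0.
have := expR_ge_pow n (normr_ge0 y); rewrite ler_pdivrMr ?ltr0n ?fact_gt0 // mulrC => h.
by apply: le_trans h _; rewrite ler_wpM2l // expR_norm_le.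
Qed.

Lemma integrable_normal_cst c : N.-integrable setT (EFin \o (fun=> c)).
Proof. exact: (@prob_bounded_integrable _ _ _ N (cst c) `|c|). Qed.

Local Ltac integrable_normal := repeat first
  [ exact: integrable_normal_cst | exact: integrable_normal_cosh
  | exact: integrable_normal_pow | apply: integrable_scale | apply: integrable_add ].

(** The second moment [m] is read off the exponential moments: [l ^ 2 m <= 2 exp (l ^ 2 / 2) - 2 <=
    l ^ 2 m + l ^ 3 K] for small [l], and division by [l ^ 2] leaves 1 in the limit. *)
Lemma normal_second_moment : \int[N]_y (y ^+ 2) = 1.
Proof.
set m := (X in X = _).
have i2 := integrable_normal_pow 2.
have RIc (c : R) : \int[N]_y c = c by rewrite Rintegral_cst // [X in fine X](probability_setT N) mulr1.
have m0 : 0 <= m by apply: Rintegral_ge0 => y _; rewrite sqr_ge0.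
have lower l : l ^+ 2 * m <= 2 * expR (l ^+ 2 / 2) - 2.
  rewrite lerBrDl -Rintegral_normal_cosh -{1}(RIc 2) -RintegralZl // -RintegralD //;
    [|by integrable_normal..].
  apply: le_Rintegral => //; [by integrable_normal..|].
  by move=> y _; rewrite -exprMn cosh_ge.
(* A bound on the integral of [|y| ^ 3 exp |y|], through [|y| ^ 3 <= 6 exp |y|] and the exponential
   moments of [2 y]. *)
pose K : R := 12 * (2 * expR (2 ^+ 2 / 2)) + 24.
have upper (l : R) : 0 <= l <= 1 -> 2 * expR (l ^+ 2 / 2) - 2 <= l ^+ 2 * m + l ^+ 3 * K.
  move=> /andP[l0 l1].
  have KE : K = \int[N]_y (12 * (expR (2 * y) + expR (- (2 * y))) + 24).
    by rewrite RintegralD // ?RIc ?RintegralZl // ?Rintegral_normal_cosh //; integrable_normal.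
  have mE : l ^+ 2 * m + l ^+ 3 * K = \int[N]_y (l ^+ 2 * y ^+ 2 +
      l ^+ 3 * (12 * (expR (2 * y) + expR (- (2 * y))) + 24)).
    by rewrite KE -!RintegralZl // -?RintegralD //; integrable_normal.
  rewrite lerBlDl -Rintegral_normal_cosh mE -{1}(RIc 2) -RintegralD //; [|by integrable_normal..].
  apply: le_Rintegral => //; [by integrable_normal..|].
  move=> y _; apply: le_trans (cosh_le _) _.
  rewrite exprMn -addrA !lerD2l normrM exprMn (ger0_norm l0) -mulrA ler_wpM2l ?exprn_ge0 //.
  have e1 : expR (l * `|y|) <= expR `|y| by rewrite ler_expR ler_piMl.
  have e2 : `|y| ^+ 3 <= 6 * expR `|y|.
    by have := expR_ge_pow 3 (normr_ge0 y); rewrite ler_pdivrMr ?ltr0n // mulrC.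
  apply: (@le_trans _ _ (6 * expR `|y| * expR `|y|)).
    by apply: ler_pM => //; rewrite ?exprn_ge0 ?expR_ge0.
  have e3 : expR `|y| * expR `|y| = expR `|2 * y| by rewrite -expRD normrM ger0_norm //; congr expR; ring.
  have := expR_norm_le (2 * y); have := expR_ge0 `|2 * y|; rewrite -mulrA e3.
  lra.
have K0 : 0 <= K by rewrite addr_ge0 // !mulr_ge0 // expR_ge0.
apply/eqP; rewrite eq_le; apply/andP; split.
  apply/ler_addgt0Pr => e e0.
  (* Chosen so that [(1 + e) (1 - l) >= 1]. *)
  pose l := Num.min 1 (e / (e + 1)).
  have l0 : 0 < l by rewrite lt_min ltr01 divr_gt0 //; lra.
  have l1 : l <= 1 by rewrite ge_min lexx.
  have le : l <= e / (e + 1) by rewrite ge_min lexx orbT.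
  have h := lower l; have l2 : 0 < l ^+ 2 by rewrite exprn_gt0.
  have l2l : l ^+ 2 <= l by rewrite expr2 ler_piMl // ltW.
  have xe : expR (l ^+ 2 / 2) - 1 <= l ^+ 2 / 2 * expR (l ^+ 2 / 2).
    have := expR_ge1Dx (- (l ^+ 2 / 2)); rewrite expRN => h'.
    have eu0 := expR_gt0 (l ^+ 2 / 2).
    have : (1 - l ^+ 2 / 2) * expR (l ^+ 2 / 2) <= (expR (l ^+ 2 / 2))^-1 * expR (l ^+ 2 / 2) by rewrite ler_pM2r.
    by rewrite mulVf ?gt_eqF //; lra.
  have mE : m <= expR (l ^+ 2 / 2).
    by rewrite -(ler_pM2l l2); lra.
  have h2 : (1 - l) * expR (l ^+ 2 / 2) <= 1 by have := expR_gt0 (l ^+ 2 / 2); nra.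
  have h3 : 1 <= (1 + e) * (1 - l).
    move: le; rewrite ler_pdivlMr; last by lra.
    lra.
  apply: le_trans mE _; have := expR_gt0 (l ^+ 2 / 2); nra.
apply/ler_addgt0Pr => e e0.
pose l := Num.min 1 (e / (K + 1)).
have l0 : 0 < l by rewrite lt_min ltr01 divr_gt0 //; lra.
have l1 : l <= 1 by rewrite ge_min lexx.
have le : l <= e / (K + 1) by rewrite ge_min lexx orbT.
have lK : l * K <= e.
  move: le; rewrite ler_pdivlMr; last by lra.
  nra.
have := upper l; rewrite (ltW l0) l1 => /(_ isT) h.
have h' := expR_ge1Dx (l ^+ 2 / 2); have l2 : 0 < l ^+ 2 by rewrite exprn_gt0.
have h3 : l ^+ 2 * 1 <= l ^+ 2 * (m + l * K).
  have -> : l ^+ 2 * (m + l * K) = l ^+ 2 * m + l ^+ 3 * K by ring.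
  lra.
by move: h3; rewrite ler_pM2l //; lra.
Qed.

End StandardNormal.

Section GaussLawTransfer.
Variables (R : realType) (d : measure_display) (T : measurableType d) (P : probability T R).
Variables (W : T -> R) (s : R).
Hypothesis s_ge0 : 0 <= s.
Hypothesis mW : measurable_fun setT W.
Hypothesis hW : forall A, measurable A -> P (W @^-1` A) = gauss_law s A.
Local Notation N := (@normal_prob R 0 1 : probability (measurableTypeR R) R).

(** [W] has the law of [s] times a standard normal, also for [s = 0], so its integrals reduce to
    standard normal ones. *)
Lemma ge0_integral_gauss (g : R -> \bar R) : measurable_fun setT g ->
  (forall x, 0 <= g x)%E -> (\int[P]_w g (W w) = \int[N]_y g (s * y)%R)%E.
Proof.
move=> mg g0.
have mW' : measurable_fun [set: T] (W : T -> measurableTypeR R) by exact: mW.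
pose Wmix := isMeasurableFun.Build _ _ _ _ _ mW'.
pose WRV : {RV P >-> measurableTypeR R} := HB.pack (W : T -> measurableTypeR R) Wmix.
have mF : measurable_fun [set: measurableTypeR R] (fun y : measurableTypeR R => s * y : measurableTypeR R).
  exact: measurable_funM.
pose Fmix := isMeasurableFun.Build _ _ _ _ _ mF.
pose FRV : {RV N >-> measurableTypeR R} := HB.pack (fun y : measurableTypeR R => s * y : measurableTypeR R) Fmix.
transitivity (\int[distribution P WRV]_u g u)%E.
  by rewrite ge0_integral_distribution.
transitivity (\int[distribution N FRV]_u g u)%E; last by rewrite ge0_integral_distribution.
apply: eq_measure_integral => B mB _; transitivity (gauss_law s B); first exact: hW.
by rewrite -{1}(ger0_norm s_ge0) -gauss_law_scale.
Qed.

Lemma gauss_integrable (f : R -> R) : measurable_fun setT f ->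
  N.-integrable setT (EFin \o (fun y => f (s * y))) -> P.-integrable setT (EFin \o (fun w => f (W w))).
Proof.
move=> mf /integrableP[_ h]; apply/integrableP; split.
  by apply/measurable_EFinP; apply: measurableT_comp.
have -> : (\int[P]_w `|(EFin \o (fun w => f (W w))) w| = \int[N]_y `|(f (s * y))%:E|)%E.
  rewrite -(@ge0_integral_gauss (fun x => `|(f x)%:E|%E)) //.
  by apply: measurableT_comp => //; apply/measurable_EFinP.
exact: h.
Qed.

Lemma gauss_Rintegral (f : R -> R) : measurable_fun setT f ->
  \int[P]_w f (W w) = \int[N]_y f (s * y).
Proof.
move=> mf; rewrite /Rintegral integralE [in RHS]integralE.
have mE : measurable_fun setT (EFin \o f) by apply/measurable_EFinP.
have hp := @ge0_integral_gauss ((EFin \o f)^\+)%E (measurable_funepos mE) (fun x => funepos_ge0 _ x).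
have hn := @ge0_integral_gauss ((EFin \o f)^\-)%E (measurable_funeneg mE) (fun x => funeneg_ge0 _ x).
congr (fine (_ - _)%E).
- etransitivity; last (etransitivity; first exact: hp); by apply: eq_integral => x _; rewrite !funeposE.
- etransitivity; last (etransitivity; first exact: hn); by apply: eq_integral => x _; rewrite !funenegE.
Qed.

End GaussLawTransfer.

(** * The characteristic function of the normal law *)

Section NormalCharacteristic.
Variable R : realType.
Local Notation N := (@normal_prob R 0 1 : probability (measurableTypeR R) R).
Implicit Types b c s v : R.

Definition normal_char b : R := \int[N]_y cos (b * y).

Lemma measurable_cos_affine b c :
  measurable_fun setT (fun y : measurableTypeR R => cos (b * y + c)).
Proof.
apply: measurableT_comp; first exact: continuous_measurable_fun (@continuous_cos R).
by apply: measurable_funD => //; apply: measurable_funM.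
Qed.

Lemma measurable_sin_scale b :
  measurable_fun setT (fun y : measurableTypeR R => sin (b * y)).
Proof.
apply: measurableT_comp; first exact: continuous_measurable_fun (@continuous_sin R).
exact: measurable_funM.
Qed.

Lemma integrable_cos_affine b c : N.-integrable setT (EFin \o (fun y => cos (b * y + c))).
Proof.
apply: (@prob_bounded_integrable _ _ _ N _ 1); first exact: measurable_cos_affine.
by move=> y; rewrite ler_norml cos_geN1 cos_le1.
Qed.

Lemma integrable_cos_scale b : N.-integrable setT (EFin \o (fun y => cos (b * y))).
Proof. by have := integrable_cos_affine b 0; under eq_fun do rewrite addr0. Qed.

Lemma integrable_sin_scale b : N.-integrable setT (EFin \o (fun y => sin (b * y))).
Proof.
apply: (@prob_bounded_integrable _ _ _ N _ 1); first exact: measurable_sin_scale.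
by move=> y; rewrite ler_norml sin_geN1 sin_le1.
Qed.

Lemma normal_odd (f : R -> R) : measurable_fun setT f -> (forall y, f (- y) = - f y) ->
  N.-integrable setT (EFin \o f) -> \int[N]_y f y = 0.
Proof.
move=> mf fN fi.
have mO : measurable_fun [set: measurableTypeR R] (fun y : measurableTypeR R => -1 * y) by exact: measurable_funM.
have h : \int[N]_y f (-1 * y) = \int[N]_y f (1 * y).
  apply: (@gauss_Rintegral R _ _ N (fun y => -1 * y) 1) => //.
  by move=> A mA; rewrite -[X in gauss_law X A]normr1 -normrN -gauss_law_scale.
have : \int[N]_y f y = - \int[N]_y f y.
  rewrite -mulN1r -RintegralZl //; under [RHS]eq_Rintegral do rewrite mulN1r -fN -mulN1r.
  by rewrite h; under [RHS]eq_Rintegral do rewrite mul1r.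
lra.
Qed.

Lemma normal_sin b : \int[N]_y sin (b * y) = 0.
Proof.
apply: normal_odd; [exact: measurable_sin_scale | | exact: integrable_sin_scale].
by move=> y; rewrite mulrN sinN.
Qed.

Lemma normal_cos_affine b c : \int[N]_y cos (b * y + c) = cos c * normal_char b.
Proof.
transitivity (\int[N]_y (cos c * cos (b * y) + - sin c * sin (b * y))).
  by apply: eq_Rintegral => y _; rewrite cosD; ring.
rewrite RintegralD //; last 2 first.
- by apply: integrable_scale; exact: integrable_cos_scale.
- by apply: integrable_scale; exact: integrable_sin_scale.
rewrite !RintegralZl //; last 2 first.
- exact: integrable_sin_scale.
- exact: integrable_cos_scale.
by rewrite normal_sin mulr0 addr0.
Qed.

(** Fubini for two independent standard normals: conditionally on the first, the addition formula
    leaves a factor [normal_char b], the sine part being odd. *)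
Lemma normal_char_add s b : 0 <= s ->
  normal_char (Num.sqrt (s ^+ 2 + b ^+ 2)) = normal_char s * normal_char b.
Proof.
move=> s0; pose P' : probability (measurableTypeR R * measurableTypeR R)%type R := (N \x N)%E.
have mz1 : measurable_fun setT (fun z : measurableTypeR R * measurableTypeR R => s * z.1 : measurableTypeR R).
  by apply: measurable_funM => //; exact: measurable_fst.
have mz2 : measurable_fun setT (fun z : measurableTypeR R * measurableTypeR R => b * z.2 : measurableTypeR R).
  by apply: measurable_funM => //; exact: measurable_snd.
have mz := measurable_funD mz1 mz2.
have ms : measurable_fun [set: measurableTypeR R] (fun y : measurableTypeR R => s * y) by exact: measurable_funM.
have hs A : measurable A -> N ((fun y => s * y) @^-1` A) = gauss_law s A.
  by move=> mA; rewrite -[in RHS](ger0_norm s0) -gauss_law_scale.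
have law := gauss_law_add b s0 ms hs.
have mcos : measurable_fun setT (@cos R) by exact: continuous_measurable_fun (@continuous_cos R).
rewrite /normal_char -(@gauss_Rintegral R _ _ P' (fun z => s * z.1 + b * z.2) _ (sqrtr_ge0 _) mz law cos mcos).
have mc : measurable_fun setT (fun z : measurableTypeR R * measurableTypeR R => 1 + cos (s * z.1 + b * z.2)).
  by apply: measurable_funD => //; exact: measurableT_comp.
have ic : P'.-integrable setT (EFin \o (fun z => cos (s * z.1 + b * z.2))).
  apply: (@prob_bounded_integrable _ _ _ P' _ 1); first exact: measurableT_comp.
  by move=> y; rewrite ler_norml cos_geN1 cos_le1.
rewrite /Rintegral -(integral12_prod_meas1 ic).
transitivity (fine (\int[N]_x ((normal_char b) * cos (s * x))%:E))%E; last first.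
  transitivity (normal_char b * normal_char s); last by rewrite mulrC.
  by apply: RintegralZl => //; exact: integrable_cos_scale.
congr fine; apply: eq_integral => x _; rewrite /fubini_F /= EFin_Rintegral; last first.
  by under eq_fun do rewrite addrC; exact: integrable_cos_affine.
congr _%:E; under eq_Rintegral do rewrite addrC.
by rewrite normal_cos_affine mulrC.
Qed.

(* As a function of the variance [v], [expR (v / 2) * normal_char (Num.sqrt v)] has
   quadratic increments, hence is constant. *)
Lemma normal_charE s : 0 <= s -> normal_char s = expR (- (s ^+ 2 / 2)).
Proof.
move=> s0; pose F v := expR (v / 2) * normal_char (Num.sqrt v).
have char_le1 b : `|normal_char b| <= 1.
  apply: le_trans (le_normr_Rintegral _ _) _ => //; first exact: integrable_cos_scale.
  apply: (@le_trans _ _ (\int[N]_y (1 : R))); last first.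
    by rewrite Rintegral_cst // [X in fine X](probability_setT N) mulr1.
  apply: le_Rintegral => //.
  - exact: (integrable_abse (integrable_cos_scale b)).
  - exact: integrable_normal_cst.
  - by move=> y _; rewrite ler_norml cos_geN1 cos_le1.
pose K : R := \int[N]_y (y ^+ 4).
have K0 : 0 <= K by apply: Rintegral_ge0 => y _; rewrite exprn_even_ge0.
(* Quadratic and quartic bounds on the cosine, integrated with second moment 1 and fourth moment
   [K]. *)
have small (h : R) : 0 <= h -> `|normal_char (Num.sqrt h) - 1 + h / 2| <= h ^+ 2 * K.
  move=> h0; have sq : Num.sqrt h ^+ 2 = h by rewrite sqr_sqrtr.
  have i2 := @integrable_normal_pow R 2; have i4 := @integrable_normal_pow R 4.
  have i1 := @integrable_normal_cst R 1.
  have lowE : 1 - h / 2 = \int[N]_y (1 + - (h / 2) * y ^+ 2).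
    rewrite RintegralD //; last exact: integrable_scale.
    rewrite RintegralZl // normal_second_moment Rintegral_cst // [X in fine X](probability_setT N).
    by rewrite /= !mulr1.
  have upE : 1 - h / 2 + h ^+ 2 * K = \int[N]_y (1 + - (h / 2) * y ^+ 2 + h ^+ 2 * y ^+ 4).
    rewrite RintegralD //; [|by apply: integrable_add => //; exact: integrable_scale|exact: integrable_scale].
    by rewrite -lowE RintegralZl.
  have lo : 1 - h / 2 <= normal_char (Num.sqrt h).
    rewrite lowE; apply: le_Rintegral => //.
    - by apply: integrable_add => //; exact: integrable_scale.
    - exact: integrable_cos_scale.
    move=> y _; apply: le_trans (cos_ge_quad_all _); rewrite exprMn sq; lra.
  have up : normal_char (Num.sqrt h) <= 1 - h / 2 + h ^+ 2 * K.
    rewrite upE; apply: le_Rintegral => //.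
    - exact: integrable_cos_scale.
    - by apply: integrable_add; [apply: integrable_add => //|]; exact: integrable_scale.
    move=> y _; apply: le_trans (cos_le_quartic _) _.
    have -> : (Num.sqrt h * y) ^+ 4 = h ^+ 2 * y ^+ 4.
      by rewrite exprMn -[in Num.sqrt h ^+ 4](_ : (2 * 2)%N = 4%N) // exprM sq.
    have y4 : 0 <= h ^+ 2 * y ^+ 4 by rewrite mulr_ge0 ?sqr_ge0 // exprn_even_ge0.
    rewrite exprMn sq; lra.
  have hK : 0 <= h ^+ 2 * K by rewrite mulr_ge0 ?sqr_ge0.
  by rewrite ler_norml; apply/andP; split; lra.
have expN (h : R) : 0 <= h -> `|expR (- h) - 1 + h| <= h ^+ 2.
  move=> h0; have l := expR_ge1Dx (- h).
  have u : expR (- h) <= 1 - h + h ^+ 2.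
    rewrite expRN; apply: le_trans (_ : (1 + h)^-1 <= _).
      by rewrite lef_pV2 ?posrE ?expR_gt0 ?expR_ge1Dx //; lra.
    rewrite -[leLHS]mul1r ler_pdivrMr; last by lra.
    have -> : (1 - h + h ^+ 2) * (1 + h) = 1 + h ^+ 3 by ring.
    by rewrite lerDl exprn_ge0.
  by rewrite ler_norml; apply/andP; split; have := sqr_ge0 h; lra.
have incr (b b' : R) : 0 <= b -> b <= b' -> b' <= s ^+ 2 ->
    `|F b' - F b| <= (expR (s ^+ 2) * (K + 1)) * (b' - b) ^+ 2.
  move=> b0 bb' b'a; set h := b' - b; have h0 : 0 <= h by rewrite subr_ge0.
  (* Additivity in the variance reduces any increment to one starting at variance 0. *)
  have chE : normal_char (Num.sqrt b') = normal_char (Num.sqrt b) * normal_char (Num.sqrt h).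
    rewrite -normal_char_add ?sqrtr_ge0 //; congr normal_char; congr Num.sqrt.
    by rewrite !sqr_sqrtr // /h addrC subrK.
  have -> : F b' - F b = expR (b' / 2) * normal_char (Num.sqrt b) * (normal_char (Num.sqrt h) - expR (- (h / 2))).
    rewrite /F chE mulrBr; congr (_ - _); first by rewrite mulrA.
    rewrite mulrAC -expRD; by congr (expR _ * _); rewrite /h; field.
  rewrite normrM -[leRHS]mulrA; apply: ler_pM => //.
    rewrite normrM ger0_norm ?expR_ge0 // -[leRHS]mulr1; apply: ler_pM; rewrite ?expR_ge0 ?normr_ge0 //.
    by rewrite ler_expR; lra.
  have h1 := small h h0; have h2 := expN (h / 2) (divr_ge0 h0 (ler0n _ 2)).
  have -> : normal_char (Num.sqrt h) - expR (- (h / 2)) =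
     (normal_char (Num.sqrt h) - 1 + h / 2) - (expR (- (h / 2)) - 1 + h / 2) by ring.
  apply: le_trans (ler_normB _ _) _; have hh := sqr_ge0 h.
  have -> : (K + 1) * h ^+ 2 = h ^+ 2 * K + h ^+ 2 by ring.
  apply: lerD => //; apply: le_trans h2 _.
  have -> : (h / 2) ^+ 2 = h ^+ 2 / 4 by field.
  lra.
have FE : F (s ^+ 2) = F 0 by apply: (quadratic_increments_eq (sqr_ge0 s)) => b b' b0 bb' b'a; exact: incr.
have F0 : F 0 = 1.
  rewrite /F mul0r expR0 mul1r sqrtr0 /normal_char; under eq_Rintegral do rewrite mul0r cos0.
  by rewrite Rintegral_cst // [X in fine X](probability_setT N) mulr1.
move: FE; rewrite F0 /F sqrtr_sqr ger0_norm // expRN => h.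
by apply: (mulfI (lt0r_neq0 (expR_gt0 (s ^+ 2 / 2)))); rewrite h divff // gt_eqF // expR_gt0.
Qed.

End NormalCharacteristic.

Section GaussLawMoments.
Variables (R : realType) (d : measure_display) (T : measurableType d) (P : probability T R).
Variables (W : T -> R) (s : R).
Hypothesis s_ge0 : 0 <= s.
Hypothesis mW : measurable_fun setT W.
Hypothesis hW : forall A, measurable A -> P (W @^-1` A) = gauss_law s A.
Local Notation N := (@normal_prob R 0 1 : probability (measurableTypeR R) R).

Lemma gauss_cos c : \int[P]_w cos (W w + c) = cos c * expR (- (s ^+ 2 / 2)).
Proof.
rewrite (gauss_Rintegral s_ge0 mW hW (f := fun x => cos (x + c))); last first.
  by have := measurable_cos_affine (1 : R) c; under eq_fun do rewrite mul1r.
by rewrite normal_cos_affine normal_charE.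
Qed.

Lemma integrable_gauss_pow n : P.-integrable setT (EFin \o (fun w => W w ^+ n)).
Proof.
apply: (gauss_integrable s_ge0 mW hW (f := fun x => x ^+ n)); first exact: exprn_measurable.
under eq_fun do rewrite exprMn.
by apply: integrable_scale; exact: integrable_normal_pow.
Qed.

Lemma gauss_mean : \int[P]_w W w = 0.
Proof.
rewrite (gauss_Rintegral s_ge0 mW hW (f := fun x => x)); last exact: measurable_id.
have i1 : N.-integrable setT (EFin \o (fun y => y)).
  by have := @integrable_normal_pow R 1; under eq_fun do rewrite expr1.
by rewrite RintegralZl // (@normal_odd R (fun y => y)) ?mulr0.
Qed.

Lemma gauss_second_moment : \int[P]_w (W w ^+ 2) = s ^+ 2.
Proof.
rewrite (gauss_Rintegral s_ge0 mW hW (f := fun x => x ^+ 2)); last exact: exprn_measurable.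
under eq_Rintegral do rewrite exprMn.
by rewrite RintegralZl ?normal_second_moment ?mulr1 //; exact: integrable_normal_pow.
Qed.

End GaussLawMoments.

(** * Factorization of positive semidefinite forms *)

Section PositiveSemidefinite.
Variable R : realType.
Implicit Types A : nat -> nat -> R.

Definition psd n A := forall x : nat -> R,
  0 <= \sum_(i < n) \sum_(j < n) x i * x j * A i j.

(** On the vector [e_i + u e_n] the form is affine in [u]; being nonnegative for all [u], it has
    slope zero. *)
Lemma psd_diag0 n A : (forall i j, A i j = A j i) -> psd n.+1 A -> A n n = 0 ->
  forall i, (i < n)%N -> A i n = 0.
Proof.
move=> sA pA An i ilt.
have q (u : R) : 0 <= A i i + 2 * u * A i n.
  pose x k : R := if k == i then 1 else if k == n then u else 0.
  have := pA x; have io : (i < n.+1)%N by rewrite ltnS ltnW.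
  have nE : (n == i) = false by rewrite gtn_eqF.
  have row (a : nat -> R) : \sum_(j < n.+1) x j * a j = a i + u * a n.
    rewrite (bigD1 (Ordinal io)) //= (bigD1 (@ord_max n)) /=; last by rewrite -val_eqE /= nE.
    rewrite big1 ?addr0 /x ?eqxx ?nE ?mul1r // => j /andP[]; rewrite -!val_eqE /= => /negPf-> /negPf->.
    by rewrite mul0r.
  rewrite (eq_bigr (fun k : 'I_n.+1 => x k * (A k i + u * A k n))).
    by rewrite (row (fun k => A k i + u * A k n)) An (sA n i) mulr0 addr0 -addrA -mulrDl -mulrA mulr_natl mulr2n mulrDl.
  move=> k _; rewrite -(row (A k)) mulr_sumr; apply: eq_bigr => j _; ring.
have [//|a0] := eqVneq (A i n) 0.
have := q (- (A i i + 1) / (2 * A i n)).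
have -> : 2 * (- (A i i + 1) / (2 * A i n)) * A i n = - (A i i + 1) by field.
lra.
Qed.

(** A Cholesky factorization by Schur complements. If the last diagonal entry is zero, division by
    zero yields zero and the complement is the matrix itself, in accordance with [psd_diag0]. *)
Lemma psd_factor n A : (forall i j, A i j = A j i) -> psd n A ->
  exists B : nat -> nat -> R, forall i j, (i < n)%N -> (j < n)%N ->
    A i j = \sum_(k < n) B i k * B j k.
Proof.
elim: n A => [|n IH] A sA pA; first by exists A.
have Ann : 0 <= A n n.
  have pick (a : nat -> R) : \sum_(j < n.+1) (j == n :> nat)%:R * a j = a n.
    by rewrite big_ord_recr /= eqxx mul1r big1 ?add0r // => j _; rewrite ltn_eqF // mul0r.
  have := pA (fun k => (k == n)%:R); rewrite (eq_bigr (fun i : 'I_n.+1 => (i == n :> nat)%:R * A i n)).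
    by rewrite (pick (fun i => A i n)).
  by move=> i _; rewrite -(pick (A i)) mulr_sumr; apply: eq_bigr => j _; rewrite mulrA.
pose A' i j := A i j - A i n * A j n / A n n.
have sA' i j : A' i j = A' j i by rewrite /A' (sA i j) [A i n * _]mulrC.
have pA' : psd n A'.
  move=> x; pose m := \sum_(i < n) x i * A i n.
  (* The last coordinate that minimizes the form for given first [n] coordinates; the minimum is the
     Schur complement. *)
  pose y k : R := if k == n then - m / A n n else x k.
  have yE (k : 'I_n) : y k = x k by rewrite /y ltn_eqF.
  have last_row : \sum_(j < n.+1) y n * y j * A n j = y n * (m + y n * A n n).
    rewrite big_ord_recr /= mulrDr mulrA; congr (_ + _); rewrite /m mulr_sumr; apply: eq_bigr => j _.
    by rewrite yE (sA n j) mulrA.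
  have rows : \sum_(i < n) \sum_(j < n.+1) y i * y j * A i j =
      \sum_(i < n) \sum_(j < n) x i * x j * A i j + y n * m.
    rewrite /m mulr_sumr -big_split /=; apply: eq_bigr => i _; rewrite big_ord_recr /=.
    congr (_ + _); first by apply: eq_bigr => j _; rewrite !yE.
    rewrite yE; ring.
  have := pA y; rewrite big_ord_recr /= rows last_row => h.
  have -> : \sum_(i < n) \sum_(j < n) x i * x j * A' i j =
      \sum_(i < n) \sum_(j < n) x i * x j * A i j - m * m / A n n.
    rewrite {1}/m !mulr_suml -sumrB; apply: eq_bigr => i _.
    rewrite /m mulr_sumr mulr_suml -sumrB; apply: eq_bigr => j _; rewrite /A'; ring.
  apply: le_trans h _; rewrite -addrA lerD2l /y eqxx.
  have [A0|A0] := eqVneq (A n n) 0; first by rewrite A0 invr0 !mulr0 !mul0r addr0.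
  rewrite le_eqVlt; apply/orP; left; apply/eqP; field.
  by [].
have [B hB] := IH A' sA' pA'.
exists (fun i k => if k == n then A i n / Num.sqrt (A n n) else if i == n then 0 else B i k) => i j.
rewrite !ltnS => ile jle; rewrite big_ord_recr /= eqxx.
have sq : Num.sqrt (A n n) * Num.sqrt (A n n) = A n n by rewrite -expr2 sqr_sqrtr.
have tail : A i n / Num.sqrt (A n n) * (A j n / Num.sqrt (A n n)) = A i n * A j n / A n n.
  by rewrite mulrACA -invfM sq.
rewrite tail; under eq_bigr => k _ do rewrite ltn_eqF //.
have deg (l : nat) : (l <= n)%N -> A l n = A l n * A n n / A n n.
  move=> ln; have [A0|A0] := eqVneq (A n n) 0; last by rewrite mulfK.
  rewrite A0 mulr0 mul0r; move: ln; rewrite leq_eqVlt => /orP[/eqP->//|ln].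
  exact: psd_diag0 sA pA A0 _ ln.
have [->|iN] := eqVneq i n.
  rewrite big1 ?add0r => [|k _]; last by rewrite mul0r.
  by rewrite (sA n j) {1}(deg j jle) [A j n * _]mulrC.
have [->|jN] := eqVneq j n.
  by rewrite big1 ?add0r => [|k _]; rewrite ?mulr0 // -deg.
by rewrite -hB ?/A' ?subrK // ltn_neqAle ?iN ?jN.
Qed.

End PositiveSemidefinite.

(** * Convergence in distribution *)

Section TrigonometricApproximation.
Variables (R : realType) (n : nat).
Implicit Types (x xi : nat -> R) (k : nat -> nat).

(** The phase [c] makes sines available, so these are all real trigonometric polynomials in [n]
    variables. *)
Inductive trigpoly : ((nat -> R) -> R) -> Prop :=
| trigpoly_cos xi c : trigpoly (fun x => cos (\sum_(i < n) xi i * x i + c))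
| trigpoly_add g h : trigpoly g -> trigpoly h -> trigpoly (fun x => g x + h x)
| trigpoly_scale a g : trigpoly g -> trigpoly (fun x => a * g x).

Lemma trigpoly_ext g h : (forall x, g x = h x) -> trigpoly g -> trigpoly h.
Proof. by move=> e; rewrite (_ : g = h) //; apply/funext. Qed.

Lemma trigpoly_cst c : trigpoly (fun=> c).
Proof.
apply: (trigpoly_ext _ (trigpoly_scale c (trigpoly_cos (fun=> 0) 0))) => x.
by rewrite big1 ?add0r ?cos0 ?mulr1 // => i _; rewrite mul0r.
Qed.

Lemma trigpoly_mul g h : trigpoly g -> trigpoly h -> trigpoly (fun x => g x * h x).
Proof.
move=> tg th; elim: tg => [xi c|g1 g2 _ IH1 _ IH2|a g1 _ IH]; last first.
- by apply: (trigpoly_ext _ (trigpoly_scale a IH)) => x; rewrite mulrA.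
- by apply: (trigpoly_ext _ (trigpoly_add IH1 IH2)) => x; rewrite mulrDl.
elim: th => [xi' c'|h1 h2 _ IH1 _ IH2|a h1 _ IH]; last first.
- by apply: (trigpoly_ext _ (trigpoly_scale a IH)) => x; rewrite mulrCA.
- by apply: (trigpoly_ext _ (trigpoly_add IH1 IH2)) => x; rewrite mulrDr.
pose s := trigpoly_cos (fun i => xi i + xi' i) (c + c').
pose t := trigpoly_cos (fun i => xi i - xi' i) (c - c').
apply: (trigpoly_ext _ (trigpoly_scale 2^-1 (trigpoly_add s t))) => x.
set a := \sum_(i < n) xi i * x i + c; set b := \sum_(i < n) xi' i * x i + c'.
have -> : \sum_(i < n) (xi i + xi' i) * x i + (c + c') = a + b.
  by rewrite /a /b addrACA -big_split /=; congr (_ + _); apply: eq_bigr => i _; rewrite mulrDl.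
have -> : \sum_(i < n) (xi i - xi' i) * x i + (c - c') = a - b.
  rewrite /a /b opprD addrACA -sumrN -big_split /=; congr (_ + _).
  by apply: eq_bigr => i _; rewrite mulrBl.
by rewrite cosD cosB; field.
Qed.

Definition incr k i : nat -> nat := fun j => (k j + (j == i))%N.

Definition walk_step (p : nat -> R) i (H : (nat -> nat) -> R) k : R :=
  (1 - p i) * H k + p i * H (incr k i).

(* [walk p l H k] is the expectation of [H] at the end of a walk from [k] that makes,
   for each [i] in [l], an [i]-step with probability [p i]: a multivariate Bernstein
   polynomial in [p]. *)
Definition walk p (l : seq nat) (H : (nat -> nat) -> R) : (nat -> nat) -> R :=
  foldr (walk_step p) H l.

Lemma walk_le p l H H' : (forall i, 0 <= p i <= 1) -> (forall k, H k <= H' k) ->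
  forall k, walk p l H k <= walk p l H' k.
Proof.
move=> p01 hH; elim: l => [//|i l IH] k /=; have /andP[p0 p1] := p01 i.
by apply: lerD; apply: ler_wpM2l; rewrite ?subr_ge0.
Qed.

Lemma walk_affine p l (a b : R) H k :
  walk p l (fun k' => a + b * H k') k = a + b * walk p l H k.
Proof. by elim: l k => [//|i l IH] k /=; rewrite /walk_step !IH; ring. Qed.

Lemma walk_cst p l (c : R) k : walk p l (fun=> c) k = c.
Proof. by elim: l k => [//|i l IH] k /=; rewrite /walk_step !IH; ring. Qed.

(** Expected sum of [(k_j + B_j - M p_j) ^ 2] over [j], with [B_j] binomial of parameters [s_j] and
    [p_j]: squared mean plus variance when [s_j] steps remain in direction [j]. *)
Definition walk_quad (p : nat -> R) (M : nat) (s k : nat -> nat) : R :=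
  \sum_(j < n) (((k j)%:R + (s j)%:R * p j - M%:R * p j) ^+ 2 + (s j)%:R * (p j * (1 - p j))).

Lemma walk_step_quad p M i s k : (i < n)%N ->
  walk_step p i (walk_quad p M s) k = walk_quad p M (incr s i) k.
Proof.
move=> iltn; rewrite /walk_step /walk_quad !mulr_sumr -big_split; apply: eq_bigr => j _ /=.
by rewrite /incr; case: eqP => [->|_]; rewrite ?addn0 ?addn1 -?natr1; ring.
Qed.

Lemma walk_walk_quad p M l k : all (fun i => i < n)%N l ->
  walk p l (walk_quad p M (fun=> 0%N)) k = walk_quad p M (fun i => count_mem i l) k.
Proof.
elim: l k => [//|i l IH] k /= /andP[il ll].
transitivity (walk_step p i (walk_quad p M (fun i => count_mem i l)) k).
  by rewrite /walk_step !IH.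
rewrite walk_step_quad //; apply: eq_bigr => j _; rewrite /incr addnC.
by rewrite [i == j]eq_sym.
Qed.

Lemma trigpoly_walk (p : (nat -> R) -> nat -> R) l (H : (nat -> nat) -> R) k :
  (forall i, (i < n)%N -> trigpoly (fun x => p x i)) -> all (fun i => i < n)%N l ->
  trigpoly (fun x => walk (p x) l H k).
Proof.
move=> tp; elim: l k => [|i l IH] k /=; first by move=> _; exact: trigpoly_cst.
move=> /andP[il ll]; apply: trigpoly_add; apply: trigpoly_mul; try exact: IH; last exact: tp.
apply: (trigpoly_ext _ (trigpoly_add (trigpoly_cst 1) (trigpoly_scale (-1) (tp i il)))) => x.
by rewrite mulN1r.
Qed.

Lemma trigpoly_sin (L : R) i : (i < n)%N -> trigpoly (fun x => (1 + sin (x i / L)) / 2).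
Proof.
move=> iltn.
pose xi j : R := if j == i then L^-1 else 0.
apply: (trigpoly_ext _ (trigpoly_scale 2^-1 (trigpoly_add (trigpoly_cst 1) (trigpoly_cos xi (- (pi / 2)))))).
move=> x; rewrite (bigD1 (Ordinal iltn)) //= big1 ?addr0; last first.
  by move=> j; rewrite -val_eqE /= /xi => /negPf->; rewrite mul0r.
have -> : xi i * x i = x i / L by rewrite /xi eqxx mulrC.
by rewrite cosB cos_pihalf sin_pihalf; field.
Qed.

(** In [sin a - sin b = 2 cos ((a + b) / 2) sin ((a - b) / 2)] both factors are at least [sin h]:
    the midpoint of two points of the interval at distance at least [2 h] stays [h] away from its
    ends. *)
Lemma sin_separation (h a b : R) : 0 < h -> h <= pi / 2 ->
  - (pi / 2) <= a <= pi / 2 -> - (pi / 2) <= b <= pi / 2 -> 2 * h <= `|a - b| ->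
  2 * sin h ^+ 2 <= `|sin a - sin b|.
Proof.
move=> h0 hp; wlog ab : a b / b <= a => [hw|].
  have [/hw//|ab] := leP b a => ha hb hab.
  by rewrite distrC; apply: hw => //; [exact: ltW | rewrite distrC].
move=> /andP[a1 a2] /andP[b1 b2]; rewrite (ger0_norm (_ : 0 <= a - b)) ?subr_ge0 // => hab.
have sE : sin a - sin b = 2 * (cos ((a + b) / 2) * sin ((a - b) / 2)).
  have -> : sin a = sin ((a + b) / 2 + (a - b) / 2) by congr sin; field.
  have -> : sin b = sin ((a + b) / 2 - (a - b) / 2) by congr sin; field.
  by rewrite sinD sinB; ring.
have mono (u v : R) : - (pi / 2) <= u -> u <= v -> v <= pi / 2 -> sin u <= sin v.
  move=> u1 uv v1; have [->//|nuv] := eqVneq u v.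
  by apply: ltW; rewrite ltr_sin ?in_itv /= ?u1 ?v1 ?(le_trans u1 uv) ?(le_trans uv v1) // lt_neqAle nuv.
have s1 : sin h <= sin ((a - b) / 2) by apply: mono; lra.
have cosE (v : R) : cos v = sin (pi / 2 - v) by rewrite sinB sin_pihalf cos_pihalf; ring.
have s2 : sin h <= cos ((a + b) / 2).
  have [c0|c0] := leP 0 ((a + b) / 2); first by rewrite cosE; apply: mono; lra.
  by rewrite -cosN cosE; apply: mono; lra.
have sh : 0 <= sin h by apply: sin_ge0_pi; apply/andP; split; lra.
rewrite ger0_norm; last by rewrite sE !mulr_ge0 //; apply: le_trans sh _.
by rewrite sE ler_wpM2l // expr2; apply: ler_pM.
Qed.

(** Only [x] is confined to the compact box; the nearby point [y] may leave it. *)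
Lemma unif_continuous_box (f : 'rV[R]_n -> R) (r : R) (d : R) : continuous f -> 0 < d ->
  exists2 h : R, 0 < h & forall x y, (forall i, (i < n)%N -> `|x i| <= r) ->
    (forall i, (i < n)%N -> `|x i - y i| < h) ->
    `|f (\row_(i < n) x i) - f (\row_(i < n) y i)| <= d.
Proof.
move=> cf d0.
have cB : compact [set v : 'rV[R]_n | forall i : 'I_n, [set` `[- r, r]] (v ord0 i)].
  by apply: (@rV_compact _ n (fun=> [set` `[- r, r]])) => i; exact: segment_compact.
move/compact_near_coveringP: cB => /(_ R (0^'+)
  (fun h v => forall w : 'rV[R]_n, ball v h w -> `|f v - f w| <= d) _) cB.
have {}cB : \forall h \near 0^'+, [set v : 'rV[R]_n | forall i : 'I_n, [set` `[- r, r]] (v ord0 i)] `<=`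
    [set v | forall w : 'rV[R]_n, ball v h w -> `|f v - f w| <= d].
  apply: cB => v _.
  have /cvgrPdist_le /(_ (d / 2)) := cf v; rewrite divr_gt0 // => /(_ isT).
  rewrite -nbhs_ballE => -[e /= e0 he].
  exists (ball v (e / 2), [set h | h < e / 2]) => /=.
    by split; [apply: nbhsx_ballx | apply: nbhs_right_lt]; rewrite divr_gt0.
  move=> [v' h] /= [vv' hh] w v'w.
  have h1 : `|f v - f v'| <= d / 2.
    by apply: he; apply: le_ball vv'; lra.
  have h2 : `|f v - f w| <= d / 2.
    apply: he; rewrite [e]splitr; apply: ball_triangle vv' _.
    by apply: le_ball v'w; exact: ltW.
  have -> : f v' - f w = (f v - f w) - (f v - f v') by ring.
  by apply: le_trans (ler_normB _ _) _; lra.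
have [h [h0 hh]] : exists h, 0 < h /\ [set v : 'rV[R]_n | forall i : 'I_n, [set` `[- r, r]] (v ord0 i)] `<=`
    [set v | forall w : 'rV[R]_n, ball v h w -> `|f v - f w| <= d].
  have : \forall h \near (0 : R)^'+, 0 < h /\ [set v : 'rV[R]_n | forall i : 'I_n, [set` `[- r, r]] (v ord0 i)] `<=`
    [set v | forall w : 'rV[R]_n, ball v h w -> `|f v - f w| <= d].
    near=> h; split; first by near: h; exact: nbhs_right_gt.
    by near: h.
  by move=> /filter_ex[h]; exists h.
exists h => // x y hx hy; apply: hh => [i|]; last split => // i j; rewrite ?mxE.
  by rewrite /= in_itv /= -ler_norml; exact: hx.
exact: hy.
Unshelve. all: by end_near.
Qed.

(** Bernstein approximation in the variables [p_i = (1 + sin (x_i / r)) / 2]: they are trigonometric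
    in [x], and on the box the sine is injective. As an average of values of [f], the approximant
    keeps the bound [Mf] on the whole space, which the tail estimates need. *)
Lemma trigpoly_approx (f : 'rV[R]_n -> R) (Mf r d : R) : continuous f ->
  (forall v, `|f v| <= Mf) -> 0 < r -> 0 < d ->
  exists g, [/\ trigpoly g, forall x, `|g x| <= Mf &
    forall x, (forall i, (i < n)%N -> `|x i| <= r) -> `|f (\row_(i < n) x i) - g x| <= d].
Proof.
move=> cf hMf r0 d0.
have M0 : 0 <= Mf by apply: le_trans (hMf 0).
have d20 : 0 < d / 2 by rewrite divr_gt0.
have [h0 h0p hunif] := unif_continuous_box r cf d20.
have pi1 : 1 <= (pi : R) / 2 by have := pi_ge2 R; lra.
pose h := Num.min (h0 / r / 2) 1.
have hp : 0 < h by rewrite lt_min ltr01 andbT !divr_gt0.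
have h1 : h <= 1 by rewrite ge_min lexx orbT.
have hh0 : 2 * h * r <= h0.
  have : h <= h0 / r / 2 by rewrite ge_min lexx.
  by rewrite ler_pdivlMr // ler_pdivlMr //; lra.
have sh : 0 < sin h by apply: sin_gt0_pi; apply/andP; split; lra.
pose c := sin h ^+ 2; have c0 : 0 < c by rewrite exprn_gt0.
(* Chebyshev constant: a frequency off by at least [c] costs at most [2 Mf], hence at most [K] times
   its squared error. *)
pose K := 2 * Mf / c ^+ 2.
have K0 : 0 <= K by rewrite divr_ge0 ?sqr_ge0 // mulr_ge0.
pose M := (Num.truncn (2 * K * n%:R / d)).+1.
have MK : K * n%:R / M%:R <= d / 2.
  have : 2 * K * n%:R / d < M%:R by exact: truncnS_gt.
  by rewrite ltr_pdivrMr // ler_pdivrMr ?ltr0n //; lra.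
have M00 : (0 : R) < M%:R by rewrite ltr0n.
(* The point whose variable [p] equals the frequency [k / M]. The minimum keeps the argument of
   [asin] in range for every [k], since [walk_le] compares at all of them. *)
pose y (k : nat) : R := r * asin (2 * (minn k M)%:R / M%:R - 1).
pose p x i : R := (1 + sin (x i / r)) / 2.
have p01 x i : 0 <= p x i <= 1.
  by rewrite /p; have := sin_geN1 (x i / r); have := sin_le1 (x i / r); lra.
pose l := flatten (nseq M (iota 0 n)).
have ll : all (fun i => i < n)%N l.
  apply/allP => i /flattenP[s]; rewrite mem_nseq => /andP[_ /eqP->].
  by rewrite mem_iota.
have lc (i : 'I_n) : count_mem (i : nat) l = M.
  rewrite /l count_flatten map_nseq sumn_nseq count_uniq_mem ?iota_uniq // mem_iota /=.
  by rewrite ltn_ord mul1n.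
pose H k := f (\row_(i < n) y (k i)).
exists (fun x => walk (p x) l H (fun=> 0%N)); split.
- by apply: trigpoly_walk => // i iltn; exact: trigpoly_sin.
- move=> x; rewrite ler_norml; apply/andP; split.
    have := walk_le l (p01 x) (H := fun=> - Mf) (H' := H) _ (fun=> 0%N).
    rewrite walk_cst; apply => k.
    by have := hMf (\row_(i < n) y (k i)); rewrite ler_norml => /andP[].
  have := walk_le l (p01 x) (H := H) (H' := fun=> Mf) _ (fun=> 0%N).
  rewrite walk_cst; apply => k.
  by have := hMf (\row_(i < n) y (k i)); rewrite ler_norml => /andP[].
move=> x xr.
pose q := walk_quad (p x) M (fun=> 0%N).
have KM : 0 <= K / M%:R ^+ 2 by rewrite divr_ge0 // sqr_ge0.
have key k : `|f (\row_(i < n) x i) - H k| <= d / 2 + K / M%:R ^+ 2 * q k.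
  have qE : q k = \sum_(j < n) ((k j)%:R - M%:R * p x j) ^+ 2.
    by apply: eq_bigr => j _; rewrite !mul0r !addr0.
  have q0 : 0 <= q k by rewrite qE sumr_ge0 // => j _; rewrite sqr_ge0.
  (* Near nodes are handled by uniform continuity. At a far node some coordinate differs by [h0], so
     its angle by [2 h], so its frequency by [c]. *)
  have [close|/existsNP[i /negP]] := pselect (forall i : 'I_n, `|x i - y (k i)| < h0).
    apply: le_trans (_ : d / 2 <= _); last by rewrite lerDl mulr_ge0.
    by apply: (hunif x (fun i => y (k i))) => // i il; exact: (close (Ordinal il)).
  rewrite -leNgt => far.
  apply: le_trans (_ : 2 * Mf <= _).
    by apply: le_trans (ler_normB _ _) _; rewrite mulr2n mulrDl mul1r lerD ?hMf.
  apply: le_trans (_ : K / M%:R ^+ 2 * q k <= _); last by rewrite lerDr ltW.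
  have qi : ((k i)%:R - M%:R * p x i) ^+ 2 <= q k.
    by rewrite qE (bigD1 i) //= lerDl sumr_ge0 // => j _; rewrite sqr_ge0.
  apply: le_trans (ler_wpM2l KM qi).
  have -> : 2 * Mf = K / M%:R ^+ 2 * (M%:R * c) ^+ 2.
    rewrite /K; field; apply/andP; split; exact: lt0r_neq0.
  apply: ler_wpM2l => //.
  set m := minn (k i) M; have mM : (m <= M)%N by exact: geq_minr.
  have tI : -1 <= (2 * m%:R / M%:R - 1 : R) <= 1.
    have m0 : 0 <= m%:R / M%:R :> R by rewrite divr_ge0.
    have m1 : m%:R / M%:R <= 1 :> R by rewrite ler_pdivrMr // mul1r ler_nat.
    by rewrite -mulrA; lra.
  have [aI sA] := asin_def tI.
  have xI : - (pi / 2) <= x i / r <= pi / 2.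
    have : `|x i / r| <= 1 by rewrite normrM normfV (gtr0_norm r0) ler_pdivrMr // mul1r xr.
    by rewrite ler_norml; lra.
  have dist : 2 * h <= `|x i / r - asin (2 * m%:R / M%:R - 1)|.
    rewrite -(ler_pM2r r0); apply: le_trans hh0 _; apply: le_trans far _.
    rewrite -[X in _ * X](gtr0_norm r0) -normrM mulrBl divfK ?lt0r_neq0 //.
    by rewrite /y mulrC.
  have hpi : h <= pi / 2 by lra.
  have := sin_separation hp hpi xI aI dist; rewrite sA -/c => sep.
  have sep' : M%:R * c <= `|m%:R - M%:R * p x i|.
    have -> : m%:R - M%:R * p x i = - (M%:R / 2) * (sin (x i / r) - (2 * m%:R / M%:R - 1)).
      by rewrite /p; field; exact: lt0r_neq0.
    rewrite normrM normrN [`|M%:R / 2|]ger0_norm ?divr_ge0 ?ler0n //.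
    by apply: le_trans (ler_wpM2l (divr_ge0 (ler0n _ M) (ler0n _ 2)) sep); lra.
  have sep2 : M%:R * c <= `|(k i)%:R - M%:R * p x i|.
    apply: le_trans sep' _; have [kM|Mk] := leqP (k i) M.
      by rewrite /m (minn_idPl kM).
    rewrite /m (minn_idPr (ltnW Mk)); have /andP[_ p1] := p01 x i.
    have MkR : M%:R <= (k i)%:R :> R by rewrite ler_nat ltnW.
    have Mp : M%:R * p x i <= M%:R by rewrite ler_piMr // ltW.
    by rewrite !ger0_norm ?subr_ge0 //; lra.
  rewrite -[leRHS]real_normK ?num_real // ler_sqr ?nnegrE //.
  by rewrite mulr_ge0 // ltW.
have fin : walk (p x) l (fun k => d / 2 + K / M%:R ^+ 2 * q k) (fun=> 0%N) <= d.
  rewrite walk_affine walk_walk_quad // /walk_quad.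
  apply: le_trans (_ : d / 2 + K / M%:R ^+ 2 * (n%:R * M%:R) <= _).
    rewrite lerD2l; apply: ler_wpM2l; first exact: KM.
    apply: (@le_trans _ _ (\sum_(j < n) M%:R)); last by rewrite sumr_const card_ord mulr_natl.
    apply: ler_sum => j _; rewrite lc add0r subrr expr0n add0r ler_piMr ?ler0n //.
    have /andP[a b] := p01 x j; nra.
  have -> : K / M%:R ^+ 2 * (n%:R * M%:R) = K * n%:R / M%:R.
    by field; exact: lt0r_neq0.
  lra.
pose A := f (\row_(i < n) x i); rewrite -/A; pose q' := fun k => d / 2 + K / M%:R ^+ 2 * q k.
rewrite ler_norml; apply/andP; split.
  have := walk_le l (p01 x) (H := H) (H' := fun k => A + 1 * q' k) _ (fun=> 0%N).
  rewrite walk_affine => /(_ _) hh.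
  have {}hh : walk (p x) l H (fun=> 0%N) <= A + 1 * walk (p x) l q' (fun=> 0%N).
    apply: hh => k; have := key k; rewrite ler_norml /q' mul1r -/A => /andP[u v]; lra.
  rewrite /q' in hh; lra.
have := walk_le l (p01 x) (H := fun k => A + (-1) * q' k) (H' := H) _ (fun=> 0%N).
rewrite walk_affine => /(_ _) hh.
have {}hh : A + -1 * walk (p x) l q' (fun=> 0%N) <= walk (p x) l H (fun=> 0%N).
  apply: hh => k; have := key k; rewrite ler_norml /q' -/A => /andP[u v]; lra.
rewrite /q' in hh; lra.
Qed.

End TrigonometricApproximation.

(** * Weak convergence from convergence of cosines *)

Section WeakConvergence.
Variables (R : realType) (n : nat).

Lemma measurable_trigpoly d (T : measurableType d) (X : T -> nat -> R) (g : (nat -> R) -> R) :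
  (forall i, (i < n)%N -> measurable_fun setT (fun w => X w i)) -> trigpoly n g ->
  measurable_fun setT (fun w => g (X w)).
Proof.
move=> mX; elim=> [xi c|g1 h1 _ m1 _ m2|a g1 _ m1]; first last.
- exact: measurable_funM.
- exact: measurable_funD.
apply: measurableT_comp; first exact: continuous_measurable_fun (@continuous_cos R).
apply: measurable_funD => //; apply: measurable_sum => i.
by apply: measurable_funM => //; exact: mX.
Qed.

Lemma trigpoly_bounded (g : (nat -> R) -> R) : trigpoly n g -> exists C, forall x, `|g x| <= C.
Proof.
elim=> [xi c|g1 h1 _ [A hA] _ [B hB]|a g1 _ [A hA]].
- by exists 1 => x; rewrite ler_norml cos_geN1 cos_le1.
- by exists (A + B) => x; apply: le_trans (ler_normD _ _) _; exact: lerD.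
- by exists (`|a| * A) => x; rewrite normrM ler_wpM2l.
Qed.

(** The function is a pointwise limit of trigonometric polynomials, approximating within
    [1 / (m + 1)] on the box of radius [m + 1]. *)
Lemma measurable_continuous_row d (T : measurableType d) (X : T -> nat -> R)
    (f : 'rV[R]_n -> R) (Mf : R) :
  (forall i, (i < n)%N -> measurable_fun setT (fun w => X w i)) -> continuous f ->
  (forall v, `|f v| <= Mf) -> measurable_fun setT (fun w => f (\row_(i < n) X w i)).
Proof.
move=> mX cf hM.
have app (m : nat) : exists g, trigpoly n g /\
    forall x : nat -> R, (forall i, (i < n)%N -> `|x i| <= m.+1%:R) ->
      `|f (\row_(i < n) x i) - g x| <= m.+1%:R^-1.
  have m0 : (0 : R) < m.+1%:R by rewrite ltr0n.
  have mi0 : (0 : R) < m.+1%:R^-1 by rewrite invr_gt0.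
  by have [g [tg _ hg]] := trigpoly_approx cf hM m0 mi0; exists g.
pose g m := sval (cid (app m)); have hg m := svalP (cid (app m)).
apply: (@measurable_fun_cvg _ _ _ _ (fun m w => g m (X w))) => [m|w _].
  by apply: measurable_trigpoly => //; case: (hg m).
apply/cvgrPdist_le => /= e e0.
near=> m; have [_ gm] := hg m; apply: le_trans (gm _ _) _ => [i il|].
  apply: (@le_trans _ _ (\sum_(j < n) `|X w j|)).
    by rewrite (bigD1 (Ordinal il)) //= lerDl sumr_ge0.
  near: m; exists (Num.truncn (\sum_(j < n) `|X w j|)) => // m /= hm.
  by apply: ltW; apply: lt_le_trans (truncnS_gt _) _; rewrite ler_nat ltnS.
near: m; exists (Num.truncn e^-1) => // m /= hm.
rewrite -[leRHS]invrK lef_pV2 ?posrE ?invr_gt0 ?ltr0n //.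
by apply: ltW; apply: lt_le_trans (truncnS_gt _) _; rewrite ler_nat ltnS.
Unshelve. all: by end_near.
Qed.

Definition tail_event d (T : measurableType d) (X : T -> nat -> R) (r : R) (i : nat) : set T :=
  [set w | r < `|X w i|].

(** Inside the box the functions differ by at most [e]; outside, by at most [2 Mf], and a union
    bound over the [n] coordinates controls the probability. *)
Lemma approx_expectation d (T : measurableType d) (P : probability T R) (X : T -> nat -> R)
    (f : 'rV[R]_n -> R) (g : (nat -> R) -> R) (Mf r e p : R) :
  (forall i, (i < n)%N -> measurable_fun setT (fun w => X w i)) -> continuous f ->
  (forall v, `|f v| <= Mf) -> trigpoly n g -> (forall x, `|g x| <= Mf) -> 0 <= e ->
  (forall x, (forall i, (i < n)%N -> `|x i| <= r) -> `|f (\row_(i < n) x i) - g x| <= e) ->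
  (forall i, (i < n)%N -> (P (tail_event X r i) <= p%:E)%E) ->
  `|\int[P]_w f (\row_(i < n) X w i) - \int[P]_w g (X w)| <= e + 2 * Mf * (n%:R * p).
Proof.
move=> mX cf hMf tg hMg e0 hfg hp.
have M0 : 0 <= Mf by apply: le_trans (hMf 0).
have mf := measurable_continuous_row mX cf hMf.
have mg := measurable_trigpoly mX tg.
have fi : P.-integrable setT (EFin \o (fun w => f (\row_(i < n) X w i))).
  exact: (prob_bounded_integrable P mf (fun w => hMf _)).
have gi : P.-integrable setT (EFin \o (fun w => g (X w))).
  exact: (prob_bounded_integrable P mg (fun w => hMg _)).
have mtail i : (i < n)%N -> measurable (tail_event X r i).
  move=> il; have -> : tail_event X r i = (fun w => `|X w i|) @^-1` `]r, +oo[%classic.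
    by apply/seteqP; split => w; rewrite /tail_event /= in_itv /= andbT.
  rewrite -[_ @^-1` _]setTI; have := mX i il => mXi.
  by apply: (measurableT_comp _ mXi) => //; exact: normr_measurable.
pose ind i : T -> R := \1_(tail_event X r i).
have indi i : (i < n)%N -> P.-integrable setT (EFin \o ind i).
  move=> il; apply: (@prob_bounded_integrable _ _ _ P _ 1) => [|w].
    by apply: measurable_indic; exact: mtail.
  by rewrite /ind indicE ger0_norm // lern1 leq_b1.
have sumi k : (k <= n)%N -> P.-integrable setT (EFin \o (fun w => \sum_(i < k) ind i w)) /\
    \int[P]_w (\sum_(i < k) ind i w) <= k%:R * p.
  elim: k => [_|k IH kn].
    split.
      rewrite (_ : (fun w => _) = cst 0); last by apply/funext => w; rewrite big_ord0.
      by apply: (@prob_bounded_integrable _ _ _ P _ 0) => // w; rewrite normr0.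
    under eq_Rintegral do rewrite big_ord0.
    by rewrite Rintegral_cst // !mul0r.
  have [ik hk] := IH (ltnW kn).
  have sE w : \sum_(i < k.+1) ind i w = \sum_(i < k) ind i w + ind k w by rewrite big_ord_recr.
  split.
    by under eq_fun do rewrite sE; apply: integrable_add => //; exact: indi.
  under eq_Rintegral do rewrite sE.
  rewrite RintegralD //; last exact: indi.
  rewrite -natr1 mulrDl mul1r lerD // /Rintegral /ind integral_indic ?setIT //; last exact: mtail.
  rewrite -lee_fin fineK ?fin_num_measure //; [exact: hp | exact: mtail].
have [si hs] := sumi n (leqnn n).
rewrite -RintegralB //; apply: le_trans (le_normr_Rintegral _ _) _ => //.
  by have := integrable_add fi (integrable_scale (-1) gi); under eq_fun do rewrite mulN1r.
apply: (@le_trans _ _ (\int[P]_w (e + 2 * Mf * \sum_(i < n) ind i w))).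
  apply: le_Rintegral => //.
  - apply: (@prob_bounded_integrable _ _ _ P _ (Mf + Mf)) => [|w].
      by apply: measurableT_comp => //; exact: measurable_funB.
    by rewrite normr_id; apply: le_trans (ler_normB _ _) _; exact: lerD.
  - apply: integrable_add; last exact: integrable_scale.
    exact: (@prob_bounded_integrable _ _ _ P (cst e) `|e|).
  move=> w _; have [close|/existsNP[i /negP]] := pselect (forall i : 'I_n, `|X w i| <= r).
    apply: (@le_trans _ _ e); first by apply: hfg => i il; exact: (close (Ordinal il)).
    by rewrite lerDl mulr_ge0 ?mulr_ge0 // sumr_ge0 // => i _; rewrite /ind indicE.
  rewrite -ltNge => far.
  apply: (@le_trans _ _ (2 * Mf)).
    by apply: le_trans (ler_normB _ _) _; rewrite mulr2n mulrDl mul1r lerD.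
  apply: (@le_trans _ _ (2 * Mf * \sum_(i < n) ind i w)); last by rewrite lerDr.
  rewrite ler_peMr ?mulr_ge0 // (bigD1 i) //= {1}/ind indicE mem_set //.
  by rewrite lerDl sumr_ge0 // => j _; rewrite /ind indicE.
rewrite RintegralD //; last 2 first.
- exact: (@prob_bounded_integrable _ _ _ P (cst e) `|e|).
- exact: integrable_scale.
rewrite RintegralZl // Rintegral_cst // [X in fine X](probability_setT P) mulr1 lerD2l.
by rewrite ler_wpM2l // mulr_ge0.
Qed.

Variables (F : set_system R) (FF : ProperFilter F).
Variables (d : R -> measure_display) (T : forall e, measurableType (d e)).
Variables (P : forall e, probability (T e) R) (X : forall e, T e -> nat -> R).
Variables (d' : measure_display) (T' : measurableType d') (P' : probability T' R) (Y : T' -> nat -> R).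
Hypothesis mX : \forall e \near F, forall i, (i < n)%N -> measurable_fun setT (fun w => @X e w i).
Hypothesis mY : forall i, (i < n)%N -> measurable_fun setT (fun w => Y w i).
Hypothesis hcos : forall (xi : nat -> R) (c : R),
  \int[P e]_w cos (\sum_(i < n) xi i * @X e w i + c) @[e --> F] -->
  \int[P']_w cos (\sum_(i < n) xi i * Y w i + c).
Hypothesis tight : forall p : R, 0 < p -> exists2 r : R, 0 < r &
  (\forall e \near F, forall i, (i < n)%N -> (P e (tail_event (@X e) r i) <= p%:E)%E) /\
  (forall i, (i < n)%N -> (P' (tail_event Y r i) <= p%:E)%E).

Lemma cvg_trigpoly g : trigpoly n g ->
  \int[P e]_w g (@X e w) @[e --> F] --> \int[P']_w g (Y w).
Proof.
have ti dd (TT : measurableType dd) (Q : probability TT R) (Z : TT -> nat -> R) h :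
    (forall i, (i < n)%N -> measurable_fun setT (fun w => Z w i)) -> trigpoly n h ->
    Q.-integrable setT (EFin \o (fun w => h (Z w))).
  move=> mZ th; have [C hC] := trigpoly_bounded th.
  exact: (prob_bounded_integrable Q (measurable_trigpoly mZ th) (fun w => hC _)).
elim=> [xi c|g1 h1 t1 c1 t2 c2|a g1 t1 c1].
- exact: hcos.
- rewrite RintegralD //; [|exact: ti..].
  apply: cvg_trans (cvgD c1 c2); apply: near_eq_cvg.
  near=> e; rewrite RintegralD //; apply: ti => //; near: e; exact: mX.
- rewrite RintegralZl //; last exact: ti.
  apply: cvg_trans (cvgMr c1); apply: near_eq_cvg.
  by near=> e; rewrite RintegralZl //; apply: ti => //; near: e; exact: mX.
Unshelve. all: by end_near.
Qed.

Theorem cvg_in_distribution_cos :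
  cvg_in_distribution F P (fun e w => \row_(i < n) @X e w i) P' (fun w => \row_(i < n) Y w i).
Proof.
move=> f cf [Mf hMf].
have M0 : 0 <= Mf by apply: le_trans (hMf 0).
have EE dd (TT : measurableType dd) (Q : probability TT R) (Z : TT -> nat -> R) :
    (forall i, (i < n)%N -> measurable_fun setT (fun w => Z w i)) ->
    ('E_Q[fun w => f (\row_(i < n) Z w i)] = (\int[Q]_w f (\row_(i < n) Z w i))%:E)%E.
  move=> mZ; rewrite unlock; apply: EFin_Rintegral.
  exact: (prob_bounded_integrable Q (measurable_continuous_row mZ cf hMf) (fun w => hMf _)).
rewrite EE //; apply: cvg_trans (_ : (\int[P e]_w f (\row_(i < n) @X e w i))%:E @[e --> F] --> _).
  by apply: near_eq_cvg; near=> e; rewrite EE //; near: e; exact: mX.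
apply: cvg_EFin; first by near=> e.
apply/cvgrPdist_le => /= e e0.
have e3 : 0 < e / 6 by rewrite divr_gt0.
(* Two approximation errors of at most [e / 6 + e / 6] and one convergence error of [e / 6] stay
   below [e]; the added 1 prevents a zero denominator. *)
pose p := e / 6 / (2 * Mf * n%:R + 1).
have Mn : 0 <= 2 * Mf * n%:R by rewrite !mulr_ge0.
have p0 : 0 < p by rewrite divr_gt0 // ltr_wpDl.
have hp : 2 * Mf * (n%:R * p) <= e / 6.
  rewrite mulrA /p mulrA ler_pdivrMr; last by rewrite ltr_wpDl.
  by rewrite mulrC ler_wpM2l ?lerDl // ltW.
have [r r0 [tX tY]] := tight p0.
have [g [tg gM hfg]] := trigpoly_approx cf hMf r0 e3.
have hY := approx_expectation mY cf hMf tg gM (ltW e3) hfg tY.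
have /cvgrPdist_le/(_ _ e3) hc := cvg_trigpoly tg.
near=> x.
have hX : `|\int[P x]_w f (\row_(i < n) @X x w i) - \int[P x]_w g (@X x w)| <= e / 6 + 2 * Mf * (n%:R * p).
  by apply: (approx_expectation _ cf hMf tg gM (ltW e3) hfg); near: x.
have hc' : `|\int[P']_w g (Y w) - \int[P x]_w g (@X x w)| <= e / 6 by near: x.
move: hX hY hc'; rewrite !ler_norml => /andP[a1 a2] /andP[b1 b2] /andP[c1 c2].
by apply/andP; split; lra.
Unshelve. all: by end_near.
Qed.

End WeakConvergence.

Lemma integrable_comb_on (R : realType) d (T : measurableType d) (mu : {measure set T -> \bar R})
    (D : set T) (p q : R) (f g : T -> R) : measurable D ->
  mu.-integrable D (EFin \o f) -> mu.-integrable D (EFin \o g) ->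
  mu.-integrable D (EFin \o (fun x => p * f x + q * g x)) /\
  \int[mu]_(x in D) (p * f x + q * g x) = p * \int[mu]_(x in D) f x + q * \int[mu]_(x in D) g x.
Proof.
move=> mD hf hg.
have h1 : mu.-integrable D (EFin \o (fun x => p * f x)) by apply: (integrableZl mD p hf).
have h2 : mu.-integrable D (EFin \o (fun x => q * g x)) by apply: (integrableZl mD q hg).
split; first by apply: (integrableD mD h1 h2).
by rewrite RintegralD // !RintegralZl.
Qed.

(** * Contour integrals *)

Section ComplexCurves.
Variable R : realType.
Local Open Scope complex_scope.
Local Notation mu := (@lebesgue_measure R).
Implicit Types (x y z a b : R[i]) (h k : R -> R[i]).

Lemma Re_add x y : complex.Re (x + y) = complex.Re x + complex.Re y.
Proof. by case: x; case: y. Qed.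

Lemma Im_add x y : complex.Im (x + y) = complex.Im x + complex.Im y.
Proof. by case: x; case: y. Qed.

Lemma Re_mul x y :
  complex.Re (x * y) = complex.Re x * complex.Re y - complex.Im x * complex.Im y.
Proof. by case: x; case: y. Qed.

Lemma Im_mul x y :
  complex.Im (x * y) = complex.Re x * complex.Im y + complex.Im x * complex.Re y.
Proof. by case: x => p q; case: y => r s /=; rewrite addrC. Qed.

Lemma Re_inv x : complex.Re x^-1 = complex.Re x / (complex.Re x ^+ 2 + complex.Im x ^+ 2).
Proof. by case: x. Qed.

Lemma Im_inv x : complex.Im x^-1 = - complex.Im x / (complex.Re x ^+ 2 + complex.Im x ^+ 2).
Proof. by case: x => p q /=; rewrite mulNr. Qed.

Lemma complex_ext x y : complex.Re x = complex.Re y -> complex.Im x = complex.Im y -> x = y.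
Proof. by case: x => p q; case: y => r s /= -> ->. Qed.

Lemma sqr_normc_gt0 x : x != 0 -> 0 < complex.Re x ^+ 2 + complex.Im x ^+ 2.
Proof.
move=> x0; rewrite lt_neqAle addr_ge0 ?sqr_ge0 // andbT eq_sym paddr_eq0 ?sqr_ge0 //.
rewrite !sqrf_eq0; apply: contra x0 => /andP[/eqP r0 /eqP i0].
by apply/eqP/complex_ext.
Qed.

Definition ccont h := continuous (re_part h) /\ continuous (im_part h).

Definition cint h := mu.-integrable `[0, 1] (EFin \o re_part h) /\
  mu.-integrable `[0, 1] (EFin \o im_part h).

Lemma ccont_ext h k : (forall u, h u = k u) -> ccont h -> ccont k.
Proof. by move=> /funext ->. Qed.

Lemma ccont_cst a : ccont (fun=> a).
Proof. by split=> u; exact: cvg_cst. Qed.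

Lemma ccontD h k : ccont h -> ccont k -> ccont (fun u => h u + k u).
Proof.
move=> [h1 h2] [k1 k2]; split.
- rewrite (_ : re_part _ = fun u => re_part h u + re_part k u); last by apply/funext => u; exact: Re_add.
  by move=> u; apply: cvgD; [exact: h1 | exact: k1].
- rewrite (_ : im_part _ = fun u => im_part h u + im_part k u); last by apply/funext => u; exact: Im_add.
  by move=> u; apply: cvgD; [exact: h2 | exact: k2].
Qed.

Lemma ccontM h k : ccont h -> ccont k -> ccont (fun u => h u * k u).
Proof.
move=> [h1 h2] [k1 k2]; split.
- rewrite (_ : re_part _ = fun u => re_part h u * re_part k u - im_part h u * im_part k u);
    last by apply/funext => u; exact: Re_mul.
  by move=> u; apply: cvgB; apply: cvgM; [exact: h1 | exact: k1 | exact: h2 | exact: k2].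
- rewrite (_ : im_part _ = fun u => re_part h u * im_part k u + im_part h u * re_part k u);
    last by apply/funext => u; exact: Im_mul.
  by move=> u; apply: cvgD; apply: cvgM; [exact: h1 | exact: k2 | exact: h2 | exact: k1].
Qed.

Lemma ccontX h n : ccont h -> ccont (fun u => h u ^+ n).
Proof.
move=> hc; elim: n => [|n IH]; first exact: ccont_cst.
by apply: (ccont_ext _ (ccontM hc IH)) => u; rewrite exprS.
Qed.

Lemma ccontV h : (forall u, h u != 0) -> ccont h -> ccont (fun u => (h u)^-1).
Proof.
move=> h0 [h1 h2].
have q0 u : re_part h u ^+ 2 + im_part h u ^+ 2 != 0 by rewrite gt_eqF // sqr_normc_gt0.
have cq : continuous (fun u => (re_part h u ^+ 2 + im_part h u ^+ 2)^-1).
  move=> u; apply: cvgV; first exact: q0.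
  by apply: cvgD; rewrite expr2; apply: cvgM; [exact: h1..|exact: h2|exact: h2].
split.
- rewrite (_ : re_part _ = fun u => re_part h u * (re_part h u ^+ 2 + im_part h u ^+ 2)^-1);
    last by apply/funext => u; exact: Re_inv.
  by move=> u; apply: cvgM; [exact: h1 | exact: cq].
- rewrite (_ : im_part _ = fun u => - im_part h u * (re_part h u ^+ 2 + im_part h u ^+ 2)^-1);
    last by apply/funext => u; exact: Im_inv.
  by move=> u; apply: cvgM; [apply: cvgN; exact: h2 | exact: cq].
Qed.

Lemma ccont_cexp h : ccont h -> ccont (fun u => cexp (h u)).
Proof.
move=> [h1 h2]; have ce : continuous (fun u => expR (re_part h u)).
  by move=> u; apply: (continuous_comp (h1 u)); exact: continuous_expR.
split=> u; apply: cvgM; try exact: ce.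
- by apply: (continuous_comp (h2 u)); exact: continuous_cos.
- by apply: (continuous_comp (h2 u)); exact: continuous_sin.
Qed.

Lemma continuous_integrable01 (f : R -> R) : continuous f -> mu.-integrable `[0, 1] (EFin \o f).
Proof.
move=> cf; apply: (@continuous_compact_integrable R f); first exact: segment_compact.
exact: continuous_subspaceT.
Qed.

Lemma ccont_cint h : ccont h -> cint h.
Proof. by move=> [h1 h2]; split; exact: continuous_integrable01. Qed.

Lemma integrable01_comb (f g : R -> R) (p q : R) :
  mu.-integrable `[0, 1] (EFin \o f) -> mu.-integrable `[0, 1] (EFin \o g) ->
  mu.-integrable `[0, 1] (EFin \o (fun u => p * f u + q * g u)).
Proof.
by move=> hf hg; case: (integrable_comb_on p q _ hf hg).
Qed.

Lemma Rintegral01_comb (f g : R -> R) (p q : R) :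
  mu.-integrable `[0, 1] (EFin \o f) -> mu.-integrable `[0, 1] (EFin \o g) ->
  \int[mu]_(u in `[0, 1]) (p * f u + q * g u) =
  p * \int[mu]_(u in `[0, 1]) f u + q * \int[mu]_(u in `[0, 1]) g u.
Proof.
by move=> hf hg; case: (integrable_comb_on p q _ hf hg).
Qed.

Lemma cint_ext h k : (forall u, h u = k u) -> cint h -> cint k.
Proof. by move=> /funext ->. Qed.

Lemma cint_add h k : cint h -> cint k -> cint (fun u => h u + k u).
Proof.
move=> [h1 h2] [k1 k2]; split.
- have := integrable01_comb 1 1 h1 k1; congr (integrable _ _ (EFin \o _)).
  by apply/funext => u; rewrite /re_part Re_add !mul1r.
- have := integrable01_comb 1 1 h2 k2; congr (integrable _ _ (EFin \o _)).
  by apply/funext => u; rewrite /im_part Im_add !mul1r.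
Qed.

Lemma cint_scale a h : cint h -> cint (fun u => a * h u).
Proof.
move=> [h1 h2]; split.
- have := integrable01_comb (complex.Re a) (- complex.Im a) h1 h2; congr (integrable _ _ (EFin \o _)).
  by apply/funext => u; rewrite /re_part Re_mul mulNr.
- have := integrable01_comb (complex.Re a) (complex.Im a) h2 h1; congr (integrable _ _ (EFin \o _)).
  by apply/funext => u; rewrite /im_part Im_mul.
Qed.

Lemma integral01_add h k : cint h -> cint k ->
  integral01 (fun u => h u + k u) = integral01 h + integral01 k.
Proof.
move=> [h1 h2] [k1 k2]; apply: complex_ext; rewrite ?Re_add ?Im_add /=.
- rewrite -[X in X + _]mul1r -[X in _ + X]mul1r -Rintegral01_comb //.
  by apply: eq_Rintegral => u _; rewrite /re_part Re_add !mul1r.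
- rewrite -[X in X + _]mul1r -[X in _ + X]mul1r -Rintegral01_comb //.
  by apply: eq_Rintegral => u _; rewrite /im_part Im_add !mul1r.
Qed.

Lemma integral01_scale a h : cint h -> integral01 (fun u => a * h u) = a * integral01 h.
Proof.
move=> [h1 h2]; apply: complex_ext; rewrite ?Re_mul ?Im_mul /=.
- rewrite -mulNr -Rintegral01_comb //.
  by apply: eq_Rintegral => u _; rewrite /re_part Re_mul mulNr.
- rewrite -Rintegral01_comb //.
  by apply: eq_Rintegral => u _; rewrite /im_part Im_mul.
Qed.

Definition has_cderiv h u a :=
  has_deriv (re_part h) u (complex.Re a) /\ has_deriv (im_part h) u (complex.Im a).

Lemma has_cderiv_eq h u a b : has_cderiv h u a -> a = b -> has_cderiv h u b.
Proof. by move=> ? <-. Qed.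

Lemma has_cderiv_ext h k u a : (forall v, h v = k v) -> has_cderiv h u a -> has_cderiv k u a.
Proof. by move=> /funext ->. Qed.

Lemma has_cderiv_cst a u : has_cderiv (fun=> a) u 0.
Proof. by split; exact: has_deriv_cst. Qed.

Lemma has_cderivM h k u a b : has_cderiv h u a -> has_cderiv k u b ->
  has_cderiv (fun v => h v * k v) u (a * k u + h u * b).
Proof.
move=> [h1 h2] [k1 k2]; split.
- apply: (@has_deriv_ext _ (fun v => re_part h v * re_part k v - im_part h v * im_part k v)).
    by move=> v; rewrite /re_part Re_mul.
  apply: has_deriv_eq (has_derivB (has_derivM h1 k1) (has_derivM h2 k2)) _.
  by rewrite Re_add !Re_mul /re_part /im_part; ring.
- apply: (@has_deriv_ext _ (fun v => re_part h v * im_part k v + im_part h v * re_part k v)).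
    by move=> v; rewrite /im_part Im_mul.
  apply: has_deriv_eq (has_derivD (has_derivM h1 k2) (has_derivM h2 k1)) _.
  by rewrite Im_add !Im_mul /re_part /im_part; ring.
Qed.

Lemma has_cderivZ c h u a : has_cderiv h u a -> has_cderiv (fun v => c * h v) u (c * a).
Proof. by move=> hh; apply: has_cderiv_eq (has_cderivM (has_cderiv_cst c u) hh) _; rewrite mul0r add0r. Qed.

Lemma has_cderivX h n u a : has_cderiv h u a ->
  has_cderiv (fun v => h v ^+ n.+1) u (n.+1%:R * h u ^+ n * a).
Proof.
move=> hh; elim: n => [|n IH]; first by rewrite expr0 !mul1r; apply: has_cderiv_ext hh => v; rewrite expr1.
apply: (@has_cderiv_ext (fun v => h v * h v ^+ n.+1)) => [v|]; first by rewrite -exprS.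
apply: has_cderiv_eq (has_cderivM hh IH) _; rewrite -[n.+2%:R]natr1 exprS; ring.
Qed.

Lemma has_derivV (f : R -> R) (u p : R) : f u != 0 -> has_deriv f u p ->
  has_deriv (fun v => (f v)^-1) u (- (p / f u ^+ 2)).
Proof.
move=> f0 hf; have h := is_deriveV f0 hf.
by apply: (@is_derive_eq _ _ _ _ _ _ _ _ h); rewrite /GRing.scale /= mulNr mulrC.
Qed.

Lemma has_cderivV h u a : (forall v, h v != 0) -> has_cderiv h u a ->
  has_cderiv (fun v => (h v)^-1) u (- (a * (h u)^-1 ^+ 2)).
Proof.
move=> h0 [h1 h2].
have q0 v : re_part h v ^+ 2 + im_part h v ^+ 2 != 0 by rewrite gt_eqF // sqr_normc_gt0.
have hq := @has_derivV (fun v => re_part h v ^+ 2 + im_part h v ^+ 2) u _ (q0 u) (has_derivD (has_derivX 2 h1) (has_derivX 2 h2)).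
rewrite -mulN1r expr2; split.
- apply: (@has_deriv_ext _ (fun v => re_part h v * (re_part h v ^+ 2 + im_part h v ^+ 2)^-1)).
    by move=> v; rewrite /re_part Re_inv.
  apply: has_deriv_eq (has_derivM h1 hq) _.
  rewrite !(Re_mul, Im_mul, Re_inv, Im_inv) /re_part /im_part /= oppr0.
  by have := q0 u; rewrite /re_part /im_part => q; field.
- apply: (@has_deriv_ext _ (fun v => - im_part h v * (re_part h v ^+ 2 + im_part h v ^+ 2)^-1)).
    by move=> v; rewrite /im_part Im_inv.
  apply: has_deriv_eq (has_derivM (has_derivN h2) hq) _.
  rewrite !(Re_mul, Im_mul, Re_inv, Im_inv) /re_part /im_part /= oppr0.
  by have := q0 u; rewrite /re_part /im_part => q; field.
Qed.

Lemma has_cderiv_cexp h u a : has_cderiv h u a ->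
  has_cderiv (fun v => cexp (h v)) u (cexp (h u) * a).
Proof.
move=> [h1 h2]; split.
- apply: has_deriv_eq (has_derivM (has_deriv_expR h1) (has_deriv_cos h2)) _.
  by rewrite Re_mul /cexp /re_part /im_part /=; ring.
- apply: has_deriv_eq (has_derivM (has_deriv_expR h1) (has_deriv_sin h2)) _.
  by rewrite Im_mul /cexp /re_part /im_part /=; ring.
Qed.

Lemma Rintegral01_deriv (F f : R -> R) : (forall u, has_deriv F u (f u)) -> continuous f ->
  \int[mu]_(u in `[0, 1]) f u = F 1 - F 0.
Proof.
move=> hF cf; have cF : continuous F by move=> u; exact: has_deriv_continuous (hF u).
rewrite /Rintegral (@continuous_FTC2 R f F 0 1) //.
- exact: continuous_subspaceT.
- split; first by move=> u _; case: (hF u).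
  + by apply: cvg_at_right_filter; exact: cF.
  + by apply: cvg_at_left_filter; exact: cF.
- by move=> u _; rewrite derive1E; case: (hF u).
Qed.

Lemma integral01_deriv H h : (forall u, has_cderiv H u (h u)) -> ccont h ->
  integral01 h = H 1 - H 0.
Proof.
move=> hH [h1 h2]; apply: complex_ext; rewrite -[in RHS]mulN1r ?Re_add ?Im_add ?Re_mul ?Im_mul /= oppr0.
- rewrite (@Rintegral01_deriv (re_part H)) => [|u|//]; last by case: (hH u).
  by rewrite /re_part; ring.
- rewrite (@Rintegral01_deriv (im_part H)) => [|u|//]; last by case: (hH u).
  by rewrite /im_part; ring.
Qed.

Lemma continuous_bounded01 (f : R -> R) : continuous f ->
  exists2 C, 0 <= C & forall u, 0 <= u <= 1 -> f u <= C.
Proof.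
move=> cf; have [c _ hc] := @EVT_max R f 0 1 ler01 (continuous_subspaceT cf).
exists `|f c| => // u u01; apply: le_trans (ler_norm _); apply: hc.
by rewrite in_itv.
Qed.

(** Two applications of the mean value theorem; this produces the hypothesis of
    [quadratic_increments_eq]. *)
Lemma second_order_bound (f f1 f2 : R -> R) (p q C : R) : p <= q ->
  (forall t, has_deriv f t (f1 t)) -> (forall t, has_deriv f1 t (f2 t)) ->
  (forall t, p <= t <= q -> `|f2 t| <= C) ->
  `|f q - f p - (q - p) * f1 p| <= C * (q - p) ^+ 2.
Proof.
move=> pq hf hf1 hC.
have [x /andP[px xq] ->] := @has_deriv_mean_value _ f f1 p q pq (fun t _ => hf t).
rewrite -[(q - p) * _]mulrC -mulrBl normrM (ger0_norm (_ : 0 <= q - p)) ?subr_ge0 // expr2 mulrA.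
rewrite ler_wpM2r ?subr_ge0 //.
have [y /andP[py yx] ->] := @has_deriv_mean_value _ f1 f2 p x px (fun t _ => hf1 t).
rewrite normrM (ger0_norm (_ : 0 <= x - p)) ?subr_ge0 //.
by apply: ler_pM; rewrite ?subr_ge0 ?lerB ?hC // py (le_trans yx).
Qed.

End ComplexCurves.

(** * Exponential moments along a contour *)

Section ContourMoments.
Variable R : realType.
Local Open Scope complex_scope.
Local Notation mu := (@lebesgue_measure R).
Variable g : R -> R[i].
Hypothesis hg : contour_around0 g.

Lemma contour_deriv u : has_cderiv g u (velocity g u).
Proof.
case: hg => _ + _ _ _ => /(_ u)[d1 d2].
by split; rewrite /= derive1E; exact: derivableP.
Qed.

Lemma contour_cont : ccont g.
Proof. split=> u; have [d1 d2] := contour_deriv u.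
- exact: has_deriv_continuous d1.
- exact: has_deriv_continuous d2. Qed.

Lemma velocity_cont : ccont (velocity g).
Proof. by case: hg => _ _ [v1 v2] _ _; split. Qed.

Lemma contour_neq0 u : g u != 0.
Proof. by case: hg => _ _ _ _ [h _]; exact: h. Qed.

Lemma contour_closed : g 1 = g 0.
Proof. by case: hg => h _ _ _ _; rewrite -(h 0) add0r. Qed.

Definition cont_on (f : R[i] -> R[i]) := ccont (fun u => f (g u)).

Lemma contour_integralD f k : cont_on f -> cont_on k ->
  contour_integral g (fun z => f z + k z) = contour_integral g f + contour_integral g k.
Proof.
move=> hf hk; rewrite /contour_integral -integral01_add.
- by congr integral01; apply/funext => u; rewrite mulrDl.
- by apply: ccont_cint; apply: ccontM => //; exact: velocity_cont.
- by apply: ccont_cint; apply: ccontM => //; exact: velocity_cont.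
Qed.

Lemma contour_integralZ c f : cont_on f ->
  contour_integral g (fun z => c * f z) = c * contour_integral g f.
Proof.
move=> hf; rewrite /contour_integral -integral01_scale.
- by congr integral01; apply/funext => u; rewrite mulrA.
- by apply: ccont_cint; apply: ccontM => //; exact: velocity_cont.
Qed.

Lemma contour_integral_deriv (H f : R[i] -> R[i]) :
  (forall u, has_cderiv (fun v => H (g v)) u (f (g u) * velocity g u)) -> cont_on f ->
  contour_integral g f = 0.
Proof.
move=> hH hf; rewrite /contour_integral (integral01_deriv hH) ?contour_closed ?subrr //.
by apply: ccontM => //; exact: velocity_cont.
Qed.

Lemma cont_on_exp (t : R) : cont_on (fun z => cexp (t%:C * z)).
Proof. by apply: ccont_cexp; apply: ccontM; [exact: ccont_cst | exact: contour_cont]. Qed.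

Lemma cont_on_X m : cont_on (fun z => z ^+ m).
Proof. by apply: ccontX; exact: contour_cont. Qed.

Lemma cont_on_V m : cont_on (fun z => z^-1 ^+ m).
Proof. by apply: ccontX; apply: ccontV; [exact: contour_neq0 | exact: contour_cont]. Qed.

Definition pos_moment (t : R) m := contour_integral g (fun z => cexp (t%:C * z) * z ^+ m).
Definition neg_moment (t : R) m := contour_integral g (fun z => cexp (t%:C * z) * z^-1 ^+ m).

Lemma exp_deriv (t : R) u : has_cderiv (fun v => cexp (t%:C * g v)) u
  (t%:C * cexp (t%:C * g u) * velocity g u).
Proof.
apply: has_cderiv_eq (has_cderiv_cexp (has_cderivZ t%:C (contour_deriv u))) _.
ring.
Qed.

Lemma cont_on_pos (t : R) m : cont_on (fun z => cexp (t%:C * z) * z ^+ m).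
Proof. by apply: ccontM; [exact: cont_on_exp | exact: cont_on_X]. Qed.

Lemma cont_on_neg (t : R) m : cont_on (fun z => cexp (t%:C * z) * z^-1 ^+ m).
Proof. by apply: ccontM; [exact: cont_on_exp | exact: cont_on_V]. Qed.

Lemma pos_moment_rec0 (t : R) : t%:C * pos_moment t 0 = 0.
Proof.
rewrite /pos_moment -contour_integralZ; last exact: cont_on_pos.
apply: (@contour_integral_deriv (fun z => cexp (t%:C * z))).
  by move=> u; apply: has_cderiv_eq (exp_deriv t u) _; rewrite expr0 mulr1.
by apply: ccontM; [exact: ccont_cst | exact: cont_on_pos].
Qed.

(** The integral of the exact differential of [exp (t z) z ^ (m + 1)] around a closed curve
    vanishes. *)
Lemma pos_moment_rec (t : R) m :
  t%:C * pos_moment t m.+1 + m.+1%:R * pos_moment t m = 0.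
Proof.
rewrite /pos_moment -!contour_integralZ; [|exact: cont_on_pos..].
have c1 : cont_on (fun z => t%:C * (cexp (t%:C * z) * z ^+ m.+1)).
  by apply: ccontM; [exact: ccont_cst | exact: cont_on_pos].
have c2 : cont_on (fun z => m.+1%:R * (cexp (t%:C * z) * z ^+ m)).
  by apply: ccontM; [exact: ccont_cst | exact: cont_on_pos].
rewrite -contour_integralD //.
apply: (@contour_integral_deriv (fun z => cexp (t%:C * z) * z ^+ m.+1)); last exact: ccontD.
move=> u; apply: has_cderiv_eq (has_cderivM (exp_deriv t u) (has_cderivX m (contour_deriv u))) _.
ring.
Qed.

(** The same with the primitive [exp (t z) z ^ - (m + 1)]; the recursion cannot reach the residue at
    [z ^ - 1], which is found separately. *)
Lemma neg_moment_rec (t : R) m :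
  t%:C * neg_moment t m.+1 = m.+1%:R * neg_moment t m.+2.
Proof.
apply/eqP; rewrite -subr_eq0 -mulNr; apply/eqP.
rewrite /neg_moment -!contour_integralZ; [|exact: cont_on_neg..].
have c1 : cont_on (fun z => t%:C * (cexp (t%:C * z) * z^-1 ^+ m.+1)).
  by apply: ccontM; [exact: ccont_cst | exact: cont_on_neg].
have c2 : cont_on (fun z => - m.+1%:R * (cexp (t%:C * z) * z^-1 ^+ m.+2)).
  by apply: ccontM; [exact: ccont_cst | exact: cont_on_neg].
rewrite -contour_integralD //.
apply: (@contour_integral_deriv (fun z => cexp (t%:C * z) * z^-1 ^+ m.+1)); last exact: ccontD.
move=> u; apply: has_cderiv_eq (has_cderivM (exp_deriv t u)
  (has_cderivX m (has_cderivV contour_neq0 (contour_deriv u)))) _.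
rewrite !exprS; ring.
Qed.

Lemma pos_moment0_eq0 (t : R) : pos_moment t 0 = 0.
Proof.
have [->|t0] := eqVneq t 0; last first.
  have := pos_moment_rec0 t => /eqP; rewrite mulf_eq0 => /orP[|/eqP//].
  by rewrite eq_complex /= eqxx andbT (negPf t0).
apply: (@contour_integral_deriv (fun z => z)).
  move=> u; apply: has_cderiv_eq (contour_deriv u) _.
  by rewrite expr0 mulr1 mul0r /cexp /= expR0 cos0 sin0 mulr1 mulr0 mul1r.
exact: cont_on_pos.
Qed.

Lemma pos_moment_eq0 (t : R) m : pos_moment t m = 0.
Proof.
have [->|t0] := eqVneq t 0.
  have := pos_moment_rec 0 m; rewrite mul0r add0r => /eqP; rewrite mulf_eq0 pnatr_eq0 /= => /eqP.
  by [].
elim: m => [|m IH]; first exact: pos_moment0_eq0.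
have := pos_moment_rec t m; rewrite IH mulr0 addr0 => /eqP; rewrite mulf_eq0 => /orP[|/eqP//].
by rewrite eq_complex /= eqxx andbT (negPf t0).
Qed.

(** The hypothesis says that the derivative in [t] vanishes. A bound on the second derivative of the
    integrand, uniform in [u], makes the increments of the integral quadratic. *)
Lemma exp_integral_cst (w : R -> R[i]) (t : R) : 0 <= t -> ccont w ->
  (forall p, \int[mu]_(u in `[0, 1]) complex.Re (g u * cexp (p%:C * g u) * w u) = 0) ->
  \int[mu]_(u in `[0, 1]) complex.Re (cexp (t%:C * g u) * w u) =
  \int[mu]_(u in `[0, 1]) complex.Re (cexp (0 * g u) * w u).
Proof.
move=> t0 cw hw; have cg := contour_cont.
pose psi (p : R) := \int[mu]_(u in `[0, 1]) complex.Re (cexp (p%:C * g u) * w u).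
(* Dominates the second derivative in the parameter for all parameters between 0 and [t]. *)
pose B u := (`|complex.Re (g u * g u * w u)| + `|complex.Im (g u * g u * w u)|) *
  expR (t * `|complex.Re (g u)|).
have cB : continuous B.
  have [c1 c2] := ccontM (ccontM cg cg) cw; have [g1 _] := cg.
  move=> u; apply: cvgM; first by apply: cvgD; apply: cvg_norm; [exact: c1 | exact: c2].
  apply: (@continuous_comp _ _ _ (fun u => t * `|complex.Re (g u)|)); last exact: continuous_expR.
  by apply: cvgM; [exact: cvg_cst | apply: cvg_norm; exact: g1].
have [C C0 hC] := continuous_bounded01 cB.
have ci (p : R) : continuous (fun u => complex.Re (cexp (p%:C * g u) * w u)).
  by have [] := ccontM (cont_on_exp p) cw.
have ci1 (p : R) : continuous (fun u => complex.Re (g u * cexp (p%:C * g u) * w u)).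
  by have [] := ccontM (ccontM cg (cont_on_exp p)) cw.
have inc p q : 0 <= p -> p <= q -> q <= t -> `|psi q - psi p| <= C * (q - p) ^+ 2.
  move=> p0 pq qt.
  (* The first order term may be subtracted because its integral vanishes by hypothesis. *)
  have -> : psi q - psi p = \int[mu]_(u in `[0, 1]) (complex.Re (cexp (q%:C * g u) * w u) -
      complex.Re (cexp (p%:C * g u) * w u) - (q - p) * complex.Re (g u * cexp (p%:C * g u) * w u)).
    rewrite !RintegralB ?RintegralZl // ?hw ?mulr0 ?subr0 //; try exact: continuous_integrable01.
    - apply: continuous_integrable01 => u; apply: cvgB; exact: ci.
    - by apply: continuous_integrable01 => u; apply: cvgM; [exact: cvg_cst | exact: ci1].
  have cd : continuous (fun u => complex.Re (cexp (q%:C * g u) * w u) -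
      complex.Re (cexp (p%:C * g u) * w u) - (q - p) * complex.Re (g u * cexp (p%:C * g u) * w u)).
    move=> u; apply: cvgB; first by apply: cvgB; exact: ci.
    by apply: cvgM; [exact: cvg_cst | exact: ci1].
  apply: le_trans (le_normr_Rintegral _ _) _ => //; first exact: continuous_integrable01.
  have -> : C * (q - p) ^+ 2 = \int[mu]_(u in `[0, 1]) (C * (q - p) ^+ 2).
    have m1 : fine (mu `[0, 1]%classic) = 1 by rewrite lebesgue_measure_itv /= lte_fin ltr01 -EFinB subr0.
    by rewrite Rintegral_cst // [X in _ = _ * X]m1 mulr1.
  apply: le_Rintegral => //.
  - by apply: continuous_integrable01 => u; apply: cvg_norm; exact: cd.
  - by apply: continuous_integrable01 => u; exact: cvg_cst.
  move=> u; rewrite /= in_itv /= => u01.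
  have dE (k : R[i]) (s : R) : has_deriv (fun s : R => complex.Re (cexp (s%:C * g u) * k)) s
      (complex.Re (cexp (s%:C * g u) * (g u * k))).
    have hid : has_cderiv (fun s : R => s%:C * g u) s (g u).
      have h1 : has_cderiv (fun s : R => s%:C) s 1 by split; [exact: has_deriv_id | exact: has_deriv_cst].
      by apply: has_cderiv_eq (has_cderivM h1 (has_cderiv_cst (g u) s)) _; rewrite mul1r mulr0 addr0.
    have [h1 _] := has_cderivM (has_cderiv_cexp hid) (has_cderiv_cst k s).
    by apply: has_deriv_eq h1 _; rewrite mulr0 addr0 mulrA.
  have d1 s : has_deriv (fun s : R => complex.Re (cexp (s%:C * g u) * w u)) s
      (complex.Re (g u * cexp (s%:C * g u) * w u)).
    by apply: has_deriv_eq (dE _ s) _; congr complex.Re; ring.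
  have d2 s : has_deriv (fun s : R => complex.Re (g u * cexp (s%:C * g u) * w u)) s
      (complex.Re (cexp (s%:C * g u) * (g u * g u * w u))).
    apply: (@has_deriv_ext _ (fun s : R => complex.Re (cexp (s%:C * g u) * (g u * w u)))).
      by move=> s'; congr complex.Re; ring.
    by apply: has_deriv_eq (dE _ s) _; congr complex.Re; ring.
  apply: (second_order_bound pq d1 d2) => s /andP[ps sq].
  apply: le_trans (hC u u01); rewrite Re_mul /B; set A := g u * g u * w u.
  rewrite /cexp /= (Re_mul s%:C (g u)) /= mul0r subr0 mulrDl.
  apply: le_trans (ler_normB _ _) _; apply: lerD.
  - rewrite normrM mulrC ler_wpM2l // normrM -[leRHS]mulr1 ler_pM //.
      rewrite ger0_norm ?expR_ge0 // ler_expR; apply: le_trans (ler_norm _) _.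
      by rewrite normrM ger0_norm ?(le_trans p0) // ler_wpM2r // (le_trans sq).
    by rewrite ler_norml cos_geN1 cos_le1.
  - rewrite normrM mulrC ler_wpM2l // normrM -[leRHS]mulr1 ler_pM //.
      rewrite ger0_norm ?expR_ge0 // ler_expR; apply: le_trans (ler_norm _) _.
      by rewrite normrM ger0_norm ?(le_trans p0) // ler_wpM2r // (le_trans sq).
    by rewrite ler_norml sin_geN1 sin_le1.
exact: (quadratic_increments_eq t0 inc).
Qed.

(** The value does not depend on [t], and at [t = 0] it is the winding condition on the contour. The
    imaginary part is reduced to the real one by the factor [- i] in the weight. *)
Lemma neg_moment1 (t : R) : 0 <= t -> neg_moment t 1 = 0 +i* (2 * pi).
Proof.
move=> t0; case: (hg) => _ _ _ _ [_ <-].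
have cw : ccont (fun u => (g u)^-1 * velocity g u).
  by apply: ccontM velocity_cont; apply: ccontV; [exact: contour_neq0 | exact: contour_cont].
have cw' : ccont (fun u => - 'i * ((g u)^-1 * velocity g u)).
  by apply: ccontM cw; exact: ccont_cst.
have J0 p : integral01 (fun u => g u * cexp (p%:C * g u) * ((g u)^-1 * velocity g u)) = 0.
  rewrite -[RHS](pos_moment0_eq0 p); congr integral01; apply/funext => u.
  by rewrite expr0 mulr1; have := contour_neq0 u => gu; field.
have ImE z : complex.Im z = complex.Re (- 'i * z) by case: z => x y /=; ring.
apply: complex_ext; rewrite /= /re_part /im_part.
- transitivity (\int[mu]_(u in `[0, 1]) complex.Re (cexp (t%:C * g u) * ((g u)^-1 * velocity g u))).
    by apply: eq_Rintegral => u _; rewrite expr1 mulrA.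
  rewrite (exp_integral_cst t0 cw) => [|p]; last by have /(congr1 (@complex.Re R)) := J0 p.
  apply: eq_Rintegral => u _; rewrite mul0r /cexp /= expR0 cos0 sin0 mulr0 mulr1.
  by rewrite mul1r.
- transitivity (\int[mu]_(u in `[0, 1]) complex.Re (cexp (t%:C * g u) * (- 'i * ((g u)^-1 * velocity g u)))).
    by apply: eq_Rintegral => u _; rewrite ImE expr1; congr complex.Re; ring.
  rewrite (exp_integral_cst t0 cw') => [|p].
    apply: eq_Rintegral => u _; rewrite mul0r ImE; congr complex.Re.
    by rewrite /cexp /= expR0 cos0 sin0 mulr0 mulr1 mul1r.
  apply: etrans (congr1 (@complex.Im R) (J0 p)); apply: eq_Rintegral => u _.
  by rewrite /im_part ImE; congr complex.Re; ring.
Qed.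

Lemma neg_momentE (t : R) n : 0 <= t ->
  neg_moment t n.+1 = (0 +i* (2 * pi)) * expterm t%:C n.
Proof.
move=> t0; elim: n => [|n IH]; first by rewrite neg_moment1 // expterm0 mulr1.
have := neg_moment_rec t n; rewrite IH mulrCA -exptermS => h.
have n0 : n.+1%:R != 0 :> R[i] by rewrite pnatr_eq0.
by apply: (mulfI n0); rewrite -h mulrCA.
Qed.

(* [q] counts from the exponent -1, so that a nonnegative [q] selects a residue. *)
Definition weight_monomial (t : R) (q : int) (z : R[i]) : R[i] :=
  cexp (t%:C * z) * (1 + z) * (if q is Posz n then z^-1 ^+ n.+1 else z ^+ `|q|.-1).

Lemma cont_on_weight (t : R) q : cont_on (weight_monomial t q).
Proof.
apply: ccontM; last by case: q => n; [exact: cont_on_V | exact: cont_on_X].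
apply: ccontM; first exact: cont_on_exp.
by apply: ccontD; [exact: ccont_cst | exact: contour_cont].
Qed.

(** The factor [1 + z] splits the integral into two neighbouring moments, matching the two terms of
    [exp1coef]. *)
Lemma weight_momentE (t : R) q : 0 <= t ->
  contour_integral g (weight_monomial t q) =
  (0 +i* (2 * pi)) * int_coef (exp1coef t%:C) q.
Proof.
move=> t0; case: q => [n|n]; rewrite /weight_monomial /=.
  case: n => [|n].
    transitivity (neg_moment t 1 + pos_moment t 0).
      rewrite -contour_integralD; [|exact: cont_on_neg|exact: cont_on_pos].
      congr integral01; apply/funext => u; rewrite expr0 expr1.
      by have := contour_neq0 u => gu; field.
    by rewrite pos_moment_eq0 addr0 neg_momentE // exp1coef0 expterm0.
  transitivity (neg_moment t n.+2 + neg_moment t n.+1).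
    rewrite -contour_integralD; [|exact: cont_on_neg|exact: cont_on_neg].
    congr integral01; apply/funext => u; rewrite !exprS.
    by have := contour_neq0 u => gu; field.
  rewrite (neg_momentE n.+1 t0) (neg_momentE n t0) -mulrDr.
    by congr (_ * _).
rewrite mulr0; transitivity (pos_moment t n + pos_moment t n.+1).
  rewrite -contour_integralD; [|exact: cont_on_pos|exact: cont_on_pos].
  congr integral01; apply/funext => u; rewrite exprS; ring.
by rewrite !pos_moment_eq0 addr0.
Qed.

End ContourMoments.

(** * Geometric expansion of the kernel *)

Section ContourKernel.
Variable R : realType.
Local Open Scope complex_scope.
Local Notation mu := (@lebesgue_measure R).
Implicit Types (a b : R[i] -> R[i]) (h : R -> R[i]).

(** A norm with values in [R] that fits integrals taken separately in real and imaginary parts; the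
    modulus has values in [R[i]]. *)
Definition l1norm (z : R[i]) : R := `|complex.Re z| + `|complex.Im z|.

Lemma l1norm_ge0 z : 0 <= l1norm z. Proof. exact: addr_ge0. Qed.

Lemma l1normM x y : l1norm (x * y) <= l1norm x * l1norm y.
Proof.
rewrite /l1norm Re_mul Im_mul mulrDl !mulrDr -!normrM.
have h1 := ler_normB (complex.Re x * complex.Re y) (complex.Im x * complex.Im y).
have h2 := ler_normD (complex.Re x * complex.Im y) (complex.Im x * complex.Re y).
lra.
Qed.

Lemma l1norm_eq0 z : l1norm z <= 0 -> z = 0.
Proof.
rewrite /l1norm => h; have := normr_ge0 (complex.Re z); have := normr_ge0 (complex.Im z) => h1 h2.
apply: complex_ext; apply/eqP; rewrite -normr_eq0 eq_le normr_ge0 andbT; lra.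
Qed.

Lemma normC_l1 (x y : R[i]) (q : R) : 0 <= q -> `|x| <= q%:C * `|y| -> l1norm x <= 2 * q * l1norm y.
Proof.
move=> q0; rewrite !normc_def -rmorphM lecR => h.
have hx : l1norm x <= 2 * Num.sqrt (complex.Re x ^+ 2 + complex.Im x ^+ 2).
  have h1 : `|complex.Re x| <= Num.sqrt (complex.Re x ^+ 2 + complex.Im x ^+ 2).
    by rewrite -sqrtr_sqr ler_wsqrtr // lerDl sqr_ge0.
  have h2 : `|complex.Im x| <= Num.sqrt (complex.Re x ^+ 2 + complex.Im x ^+ 2).
    by rewrite -sqrtr_sqr ler_wsqrtr // lerDr sqr_ge0.
  by rewrite /l1norm; lra.
have hy : Num.sqrt (complex.Re y ^+ 2 + complex.Im y ^+ 2) <= l1norm y.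
  rewrite -[leRHS]ger0_norm ?l1norm_ge0 // -sqrtr_sqr ler_wsqrtr // /l1norm sqrrD !real_normK ?num_real //.
  by rewrite -addrA lerD2l lerDr mulrn_wge0 // mulr_ge0.
apply: le_trans hx _; rewrite -mulrA ler_wpM2l //; apply: le_trans h _.
by rewrite ler_wpM2l.
Qed.

Lemma integral01_bound h (C : R) : cint h ->
  (forall u, 0 <= u <= 1 -> l1norm (h u) <= C) -> l1norm (integral01 h) <= 2 * C.
Proof.
move=> [h1 h2] hC; have m1 : fine (mu `[0, 1]%classic) = 1.
  by rewrite lebesgue_measure_itv /= lte_fin ltr01 -EFinB subr0.
have bound (f : R -> R) : mu.-integrable `[0, 1] (EFin \o f) ->
    (forall u, 0 <= u <= 1 -> `|f u| <= C) -> `|\int[mu]_(u in `[0, 1]) f u| <= C.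
  move=> hf fC; apply: le_trans (le_normr_Rintegral _ _) _ => //.
  have -> : C = \int[mu]_(u in `[0, 1]) C by rewrite Rintegral_cst // [X in _ = _ * X]m1 mulr1.
  apply: le_Rintegral => //.
  - exact: (integrable_abse hf).
  - by apply: continuous_integrable01 => u; exact: cvg_cst.
rewrite /l1norm /= mulr2n mulrDl mul1r; apply: lerD; apply: bound => // u u01; apply: le_trans (hC u u01).
- by rewrite lerDl.
- by rewrite lerDr.
Qed.

Variables g1 g2 : R -> R[i].
Hypotheses (hg1 : contour_around0 g1) (hg2 : contour_around0 g2).
Hypothesis nested : forall u v, `|g2 v| < `|g1 u|.

(** By compactness of a period, the pointwise strict inequality becomes a uniform ratio: the maximum
    of [|g2|] over the minimum of [|g1|]. *)
Lemma nested_ratio : exists2 q : R, 0 <= q < 1 & forall u v,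
  0 <= u <= 1 -> 0 <= v <= 1 -> `|g2 v| <= q%:C * `|g1 u|.
Proof.
pose N (g : R -> R[i]) u := Num.sqrt (complex.Re (g u) ^+ 2 + complex.Im (g u) ^+ 2).
have cN g : contour_around0 g -> continuous (N g).
  move=> hg; have [c1 c2] := contour_cont hg.
  move=> u; apply: (@continuous_comp _ _ _ (fun u => complex.Re (g u) ^+ 2 + complex.Im (g u) ^+ 2));
    last exact: sqrt_continuous.
  by apply: cvgD; rewrite expr2; apply: cvgM; [exact: c1..|exact: c2|exact: c2].
have N0 g u : contour_around0 g -> 0 < N g u.
  by move=> hg; rewrite sqrtr_gt0; apply: sqr_normc_gt0; exact: contour_neq0.
have [u0 _ hu0] := @EVT_min R (N g1) 0 1 ler01 (continuous_subspaceT (cN _ hg1)).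
have [v0 _ hv0] := @EVT_max R (N g2) 0 1 ler01 (continuous_subspaceT (cN _ hg2)).
have n12 u v : N g2 v < N g1 u by have := nested u v; rewrite !normc_def ltcR.
exists (N g2 v0 / N g1 u0).
  by rewrite divr_ge0 ?ltW ?N0 //= ltr_pdivrMr ?N0 // mul1r n12.
move=> u v u01 v01; rewrite !normc_def -rmorphM lecR -/(N g2 v) -/(N g1 u).
apply: (@le_trans _ _ (N g2 v0)); first by apply: hv0; rewrite in_itv.
rewrite mulrAC ler_pdivlMr ?N0 // ler_wpM2l ?(ltW (N0 _ _ hg2)) //.
by apply: hu0; rewrite in_itv.
Qed.

Lemma nested_neq u v : g1 u - g2 v != 0.
Proof.
apply/negP => /eqP/subr0_eq e; have := nested u v.
by rewrite e ltxx.
Qed.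

Definition kernel_partial M (z1 z2 : R[i]) : R[i] := \sum_(m < M) z2 ^+ m.+1 * z1^-1 ^+ m.+1.

Lemma kernel_remainder M z1 z2 : z1 != 0 -> z1 - z2 != 0 ->
  z2 / (z1 - z2) - kernel_partial M z1 z2 = (z2 / z1) ^+ M * (z2 / (z1 - z2)).
Proof.
move=> z10 z12; rewrite /kernel_partial; elim: M => [|M IH].
  by rewrite big_ord0 subr0 expr0 mul1r.
rewrite big_ord_recr /= opprD addrA IH -[z2 ^+ M.+1 * _]exprMn !exprS.
have XE : z2 / (z1 - z2) = z2 / z1 + z2 / z1 * (z2 / (z1 - z2)) by field; rewrite z10 z12.
rewrite {1}XE; ring.
Qed.

Variables a b : R[i] -> R[i].
Hypotheses (ca : cont_on g2 a) (cb : cont_on g1 b).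

Definition kernel_inner (z2 : R[i]) := contour_integral g1 (fun z1 => b z1 * (z2 / (z1 - z2))).

Let B m := contour_integral g1 (fun z => b z * z^-1 ^+ m.+1).
Let A m := contour_integral g2 (fun z => a z * z ^+ m.+1).

Lemma cont_on_kernel v : cont_on g1 (fun z1 => b z1 * (g2 v / (z1 - g2 v))).
Proof.
apply: ccontM cb _; apply: ccontM; first exact: ccont_cst.
apply: ccontV; first by move=> u; exact: nested_neq.
by apply: ccontD; [exact: contour_cont | exact: ccont_cst].
Qed.

Lemma cont_on_kernel_partial M v : cont_on g1 (fun z1 => b z1 * kernel_partial M z1 (g2 v)).
Proof.
apply: ccontM cb _; rewrite /kernel_partial; elim: M => [|M IH].
  by apply: (ccont_ext _ (ccont_cst 0)) => u; rewrite big_ord0.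
apply: (ccont_ext (h := fun u => \sum_(m < M) g2 v ^+ m.+1 * (g1 u)^-1 ^+ m.+1 + g2 v ^+ M.+1 * (g1 u)^-1 ^+ M.+1)).
  by move=> u; rewrite big_ord_recr.
by apply: ccontD IH _; apply: ccontM; [exact: ccont_cst | exact: (cont_on_V hg1)].
Qed.

Lemma kernel_partial_integral M v :
  contour_integral g1 (fun z1 => b z1 * kernel_partial M z1 (g2 v)) =
  \sum_(m < M) g2 v ^+ m.+1 * B m.
Proof.
elim: M => [|M IH].
  rewrite big_ord0 (_ : (fun z1 => _) = (fun z1 => 0 * b z1)).
    by rewrite contour_integralZ // mul0r.
  by apply/funext => z; rewrite /kernel_partial big_ord0 mulr0 mul0r.
rewrite big_ord_recr /= -IH /B -contour_integralZ //; last first.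
  by apply: ccontM cb _; exact: (cont_on_V hg1).
rewrite -contour_integralD //.
- congr (contour_integral g1 _); apply/funext => z.
  by rewrite /kernel_partial big_ord_recr /=; ring.
- exact: cont_on_kernel_partial.
- by apply: ccontM; [exact: ccont_cst | apply: ccontM cb _; exact: (cont_on_V hg1)].
Qed.

(** The remainder of the geometric series is [(z2 / z1) ^ M z2 / (z1 - z2)], of modulus at most
    [q ^ M q / (1 - q)] uniformly on the two curves. *)
Lemma kernel_inner_approx : exists C q : R, [/\ 0 <= C, 0 <= q < 1 & forall M v, 0 <= v <= 1 ->
  l1norm (kernel_inner (g2 v) - \sum_(m < M) g2 v ^+ m.+1 * B m) <= C * q ^+ M].
Proof.
have [q /andP[q0 q1] hq] := nested_ratio.
have c2 := contour_cont hg2; have c1 := contour_cont hg1; have v1 := velocity_cont hg1.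
have bounded01 (h : R -> R[i]) : ccont h -> exists2 C, 0 <= C & forall u, 0 <= u <= 1 -> l1norm (h u) <= C.
  move=> [h1 h2]; apply: (@continuous_bounded01 _ (fun u => l1norm (h u))) => u.
  by apply: cvgD; apply: cvg_norm; [exact: h1 | exact: h2].
have [C1 C10 hC1] := bounded01 _ (ccontM cb v1).
pose K := C1 * (4 * q / (1 - q)).
have K0 : 0 <= K by rewrite mulr_ge0 ?divr_ge0 ?mulr_ge0 //; lra.
exists (2 * (2 * K)), q; split => [||M v v01].
- by apply: mulr_ge0 => //; exact: mulr_ge0.
- by rewrite q0 q1.
rewrite -kernel_partial_integral /kernel_inner -[X in _ - X]mul1r -mulNr -contour_integralZ //; last first.
  exact: cont_on_kernel_partial.
rewrite -contour_integralD //; last 2 first.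
- exact: cont_on_kernel.
- by apply: ccontM; [exact: ccont_cst | exact: cont_on_kernel_partial].
rewrite -2!mulrA; apply: integral01_bound.
  apply: ccont_cint; apply: ccontM v1; apply: ccontD; first exact: cont_on_kernel.
  by apply: ccontM; [exact: ccont_cst | exact: cont_on_kernel_partial].
move=> u u01; have z10 := contour_neq0 hg1 u; have z12 := nested_neq u v.
have -> : (b (g1 u) * (g2 v / (g1 u - g2 v)) + -1 * (b (g1 u) * kernel_partial M (g1 u) (g2 v))) * velocity g1 u =
   b (g1 u) * velocity g1 u * ((g2 v / g1 u) ^+ M * (g2 v / (g1 u - g2 v))).
  rewrite -kernel_remainder //; ring.
apply: le_trans (l1normM _ _) _.
have hz := hq u v u01 v01.
have n1 : 0 < `|g1 u| by rewrite normr_gt0.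
have r1 : `|(g2 v / g1 u) ^+ M * (g2 v / (g1 u - g2 v))| <= (q ^+ M * (q / (1 - q)))%:C * `|1|.
  rewrite normr1 mulr1 normrM normrX !normrM !normfV.
  have e1 : `|g2 v| / `|g1 u| <= q%:C by rewrite ler_pdivrMr.
  rewrite [in X in _ <= X]rmorphM rmorphXn; apply: ler_pM.
  - by rewrite exprn_ge0 // divr_ge0.
  - by rewrite divr_ge0.
  - by apply: lerXn2r; rewrite ?nnegrE ?divr_ge0 // lecR.
  have p1 : 0 < 1 - q by lra.
  have e2 : (1 - q)%:C * `|g1 u| <= `|g1 u - g2 v|.
    apply: le_trans (lerB_dist _ _); rewrite rmorphB mulrBl mul1r lerD2l lerN2.
    exact: hz.
  have d0 : 0 < (1 - q)%:C * `|g1 u| by rewrite mulr_gt0 // ltcR.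
  have d1 : 0 < `|g1 u - g2 v| by rewrite normr_gt0.
  rewrite ler_pdivrMr //; apply: le_trans hz _.
  rewrite rmorphM fmorphV -mulrA ler_wpM2l ?lecR // ler_pdivlMl ?ltcR //.
have q2 : 0 <= q ^+ M * (q / (1 - q)) by rewrite mulr_ge0 ?exprn_ge0 // divr_ge0 //; lra.
have := normC_l1 q2 r1; rewrite {2}/l1norm /= normr1 normr0 addr0 mulr1 => r2.
apply: le_trans (ler_pM _ _ (hC1 u u01) r2) _; rewrite ?l1norm_ge0 //.
rewrite /K; set y := q / (1 - q); have -> : 4 * q / (1 - q) = 4 * y by rewrite /y mulrA.
have y0 : 0 <= C1 * (y * q ^+ M).
  by rewrite mulr_ge0 // mulr_ge0 ?exprn_ge0 // divr_ge0 //; lra.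
have -> : C1 * (2 * (q ^+ M * y)) = 2 * (C1 * (y * q ^+ M)) by ring.
have -> : C1 * (4 * y) * q ^+ M = 4 * (C1 * (y * q ^+ M)) by ring.
lra.
Qed.

Lemma small_geometric (C q : R) : 0 <= C -> 0 <= q < 1 -> forall e, 0 < e -> exists M0, forall M, (M0 <= M)%N -> C * q ^+ M <= e.
Proof.
move=> C0 /andP[q0 q1] e e0.
have qn : (fun M => q ^+ M) @ \oo --> (0 : R) by apply: cvg_expr; rewrite ger0_norm.
have /cvgrPdist_le/(_ (e / (C + 1))) := qn; rewrite divr_gt0 ?ltr_wpDl // => /(_ isT)[M0 _ hM].
exists M0 => M MM; have := hM M MM; rewrite sub0r normrN ger0_norm ?exprn_ge0 // ler_pdivlMr ?ltr_wpDl // => h.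
have : 0 <= q ^+ M by rewrite exprn_ge0.
nra.
Qed.

(** The inner integral is not shown to be continuous in the outer variable: it is measurable as a
    limit of the partial sums, and bounded by their uniform error. *)
Lemma cint_kernel : cint (fun v => a (g2 v) * kernel_inner (g2 v) * velocity g2 v).
Proof.
have [C [q [C0 q01 happrox]]] := kernel_inner_approx.
have v2 := velocity_cont hg2; have c2 := contour_cont hg2.
pose S M v := \sum_(m < M) g2 v ^+ m.+1 * B m.
have cS M : ccont (S M).
  rewrite /S; elim: M => [|M IH].
    by apply: (ccont_ext _ (ccont_cst 0)) => u; rewrite big_ord0.
  apply: (ccont_ext (h := fun v => S M v + g2 v ^+ M.+1 * B M)).
    by move=> u; rewrite /S big_ord_recr.
  by apply: ccontD => //; apply: ccontM; [exact: ccontX | exact: ccont_cst].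
have cT M : ccont (fun v => a (g2 v) * S M v * velocity g2 v).
  by apply: ccontM => //; exact: ccontM.
have [D D0 hD] : exists2 D, 0 <= D & forall u, 0 <= u <= 1 -> l1norm (a (g2 u) * velocity g2 u) <= D.
  have [h1 h2] := ccontM ca v2.
  apply: (@continuous_bounded01 _ (fun u => l1norm (a (g2 u) * velocity g2 u))) => u.
  by apply: cvgD; apply: cvg_norm; [exact: h1 | exact: h2].
have close M v : 0 <= v <= 1 -> l1norm (a (g2 v) * kernel_inner (g2 v) * velocity g2 v -
    a (g2 v) * S M v * velocity g2 v) <= D * C * q ^+ M.
  move=> v01; have -> : a (g2 v) * kernel_inner (g2 v) * velocity g2 v - a (g2 v) * S M v * velocity g2 v =
     a (g2 v) * velocity g2 v * (kernel_inner (g2 v) - S M v) by ring.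
  apply: le_trans (l1normM _ _) _; rewrite -mulrA; apply: ler_pM; rewrite ?l1norm_ge0 ?hD //.
  exact: happrox.
have main (pr : R[i] -> R) : (forall x y, pr (x - y) = pr x - pr y) -> (forall x, `|pr x| <= l1norm x) ->
    (forall M, continuous (fun v => pr (a (g2 v) * S M v * velocity g2 v))) ->
    mu.-integrable `[0, 1] (EFin \o (fun v => pr (a (g2 v) * kernel_inner (g2 v) * velocity g2 v))).
  move=> prB prl prc.
  have mu01 : (mu (`[0%R, 1%R]%classic : set R) < +oo)%E.
    by rewrite lebesgue_measure_itv /= lte_fin ltr01 -EFinB ltry.
  have m01 : measurable (`[0, 1]%classic : set (measurableTypeR R)) by [].
  have [E E0 hE] : exists2 E, 0 <= E & forall u, 0 <= u <= 1 -> `|pr (a (g2 u) * S 0 u * velocity g2 u)| <= E.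
    by apply: (@continuous_bounded01 _ (fun u => `|pr (a (g2 u) * S 0 u * velocity g2 u)|)) => u; apply: cvg_norm; exact: prc.
  apply: measurable_bounded_integrable => //.
  - apply: (@measurable_fun_cvg _ _ _ _ (fun M v => pr (a (g2 v) * S M v * velocity g2 v))).
      move=> M; apply: measurable_funS measurableT _ _ => //.
      exact: continuous_measurable_fun (prc M).
    move=> v; rewrite /= in_itv /= => v01; apply/cvgrPdist_le => /= e e0.
    have [M0 hM0] := small_geometric (mulr_ge0 D0 C0) q01 e0.
    exists M0 => // M /= MM; rewrite -prB; apply: le_trans (prl _) _.
    by apply: le_trans (close M v v01) _; exact: hM0.
  - exists (D * C * q ^+ 0 + E); split; first exact: num_real.
    move=> y hy v; rewrite /= in_itv /= => v01; apply: le_trans (ltW hy).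
    rewrite -[pr _](subrK (pr (a (g2 v) * S 0 v * velocity g2 v))).
    apply: le_trans (ler_normD _ _) _; apply: lerD; last exact: hE.
    by rewrite -prB; apply: le_trans (prl _) _; exact: close.
split; apply: main.
- by move=> x y; rewrite Re_add; congr (_ + _); case: y.
- by move=> x; rewrite lerDl.
- by move=> M; case: (cT M).
- by move=> x y; rewrite Im_add; congr (_ + _); case: y.
- by move=> x; rewrite lerDr.
- by move=> M; case: (cT M).
Qed.

(** Term by term integration of the geometric series, which the hypothesis on the outer moments
    makes finite. *)
Lemma contour_kernel s : (forall m, (s <= m)%N -> A m = 0) ->
  contour_integral g2 (fun z => a z * kernel_inner z) = \sum_(m < s) A m * B m.
Proof.
move=> A0; have [C [q [C0 q01 happrox]]] := kernel_inner_approx.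
have v2 := velocity_cont hg2; have c2 := contour_cont hg2.
have partial M : cont_on g2 (fun z => a z * \sum_(m < M) z ^+ m.+1 * B m) /\
    contour_integral g2 (fun z => a z * \sum_(m < M) z ^+ m.+1 * B m) = \sum_(m < M) A m * B m.
  elim: M => [|M [IH1 IH2]].
    rewrite big_ord0 (_ : (fun z => _) = (fun z => 0 * a z)).
      by rewrite contour_integralZ // mul0r; split=> //; apply: ccontM => //; exact: ccont_cst.
    by apply/funext => z; rewrite big_ord0 mulr0 mul0r.
  have cM : cont_on g2 (fun z => B M * (a z * z ^+ M.+1)).
    by apply: ccontM; [exact: ccont_cst | apply: ccontM => //; exact: ccontX].
  have -> : (fun z => a z * \sum_(m < M.+1) z ^+ m.+1 * B m) =
      (fun z => a z * \sum_(m < M) z ^+ m.+1 * B m + B M * (a z * z ^+ M.+1)).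
    by apply/funext => z; rewrite big_ord_recr /=; ring.
  split; first exact: ccontD.
  have cN : cont_on g2 (fun z => a z * z ^+ M.+1) by apply: ccontM => //; exact: ccontX.
  rewrite (contour_integralD hg2 IH1 cM) IH2 (contour_integralZ hg2 (B M) cN) [RHS]big_ord_recr /=.
  have swap (x y z : R[i]) : x + y * z = x + z * y by rewrite [y * z]mulrC.
  exact: swap.
have [D D0 hD] : exists2 D, 0 <= D & forall u, 0 <= u <= 1 -> l1norm (a (g2 u) * velocity g2 u) <= D.
  have [h1 h2] := ccontM ca v2.
  apply: (@continuous_bounded01 _ (fun u => l1norm (a (g2 u) * velocity g2 u))) => u.
  by apply: cvgD; apply: cvg_norm; [exact: h1 | exact: h2].
have tail M : (s <= M)%N -> \sum_(m < M) A m * B m = \sum_(m < s) A m * B m.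
  move=> sM; rewrite (big_ord_widen_cond M xpredT (fun m => A m * B m) sM) [RHS]big_mkcond /=.
  by apply: eq_bigr => m _; case: ifPn => //; rewrite -leqNgt => /A0 ->; rewrite mul0r.
apply/eqP; rewrite -subr_eq0; apply/eqP; apply: l1norm_eq0; apply/ler_addgt0Pr => e e0; rewrite add0r.
have [M0 hM0] := small_geometric (mulr_ge0 (ler0n _ 2) (mulr_ge0 D0 C0)) q01 e0.
pose M := maxn M0 s.
rewrite -(tail M (leq_maxr _ _)) -(partial M).2.
apply: le_trans (hM0 M (leq_maxl _ _)).
rewrite -[X in _ - X]mul1r -mulNr -(contour_integralZ hg2); last by case: (partial M).
rewrite /contour_integral -integral01_add; last 2 first.
- exact: cint_kernel.
- apply: ccont_cint; apply: ccontM => //; apply: ccontM; first exact: ccont_cst.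
  by case: (partial M).
rewrite -!mulrA; apply: integral01_bound.
  apply: cint_add; first exact: cint_kernel.
  apply: ccont_cint; apply: ccontM => //; apply: ccontM; first exact: ccont_cst.
  by case: (partial M).
move=> v v01.
set S := \sum_(m < M) _.
have -> : a (g2 v) * kernel_inner (g2 v) * velocity g2 v + -1 * (a (g2 v) * S) * velocity g2 v =
   a (g2 v) * velocity g2 v * (kernel_inner (g2 v) - S) by ring.
apply: le_trans (l1normM _ _) _; apply: ler_pM; rewrite ?l1norm_ge0 ?hD //.
exact: happrox.
Qed.

End ContourKernel.

(** * Squared Vandermonde products as sums over permutations *)

Section VandermondeSquare.
Variable F : fieldType.
Local Open Scope ring_scope.

Lemma vandermonde_sq k (z : nat -> F) :
  \prod_(j < k) \prod_(i < j) (z i - z j) ^+ 2 =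
  \sum_(s : 'S_k) \sum_(t : 'S_k) (-1) ^+ s * (-1) ^+ t * \prod_(l < k) z l ^+ (s l + t l).
Proof.
pose V : 'M[F]_k := Vandermonde k (\row_(j < k) z j).
have detV : \det V = \sum_(s : 'S_k) (-1) ^+ s * \prod_(l < k) z l ^+ s l.
  rewrite -det_tr; apply: eq_bigr => s _; congr (_ * _); apply: eq_bigr => l _.
  by rewrite !mxE.
transitivity (\det V * \det V); last first.
  rewrite detV mulr_suml; apply: eq_bigr => s _; rewrite mulr_sumr; apply: eq_bigr => t _.
  rewrite mulrACA -big_split /=; congr (_ * _); apply: eq_bigr => l _.
  by rewrite exprD.
rewrite det_Vandermonde -big_split /=.
transitivity (\prod_(j < k) \prod_(i < k | (i < j)%N) (z i - z j) ^+ 2).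
  apply: eq_bigr => j _; rewrite (big_ord_widen_cond k (fun=> true) (fun i => (z i - z j) ^+ 2)).
    by apply: eq_bigl => i.
  exact: ltnW (ltn_ord j).
rewrite (exchange_big_dep xpredT) //=; apply: eq_bigr => i _; rewrite -big_split /=.
by apply: eq_bigr => j _; rewrite !mxE -expr2 -sqrrN opprB.
Qed.

(** Composing [t] with [s] and relabelling the factors by [s] turns the inner sum into the same
    determinant for each of the [k!] permutations [s]. *)
Lemma sum_perm_det k (f : 'I_k -> 'I_k -> F) :
  \sum_(s : 'S_k) \sum_(t : 'S_k) (-1) ^+ s * (-1) ^+ t * \prod_(l < k) f (s l) (t l) =
  k`!%:R * \det (\matrix_(i, j) f i j).
Proof.
transitivity (\sum_(s : 'S_k) \det (\matrix_(i, j) f i j)); last first.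
  by rewrite sumr_const card_Sn mulr_natl.
apply: eq_bigr => s _; rewrite (reindex_inj (mulgI s)) /=; apply: eq_bigr => t _.
rewrite odd_permM signr_addb mulrA -signr_addb addbb expr0 mul1r; congr (_ * _).
rewrite [RHS](reindex_inj (@perm_inj _ s)); apply: eq_bigr => l _.
by rewrite mxE permM.
Qed.

(** The relabelling by [s] also moves the marked index [j]; this is absorbed by summing over all
    [j]. *)
Lemma sum_perm_det_shift k (f : bool -> 'I_k -> 'I_k -> F) :
  \sum_(j < k) \sum_(s : 'S_k) \sum_(t : 'S_k)
    (-1) ^+ s * (-1) ^+ t * \prod_(l < k) f (l == j) (s l) (t l) =
  k`!%:R * \sum_(j < k) \det (\matrix_(a, b) f (a == j) a b).
Proof.
rewrite mulr_sumr -(eq_bigr _ (fun j _ => sum_perm_det (fun a b => f (a == j) a b))).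
rewrite exchange_big [RHS]exchange_big /=; apply: eq_bigr => s _.
rewrite [RHS](reindex_inj (@perm_inj _ s)) /=; apply: eq_bigr => j _.
apply: eq_bigr => t _; congr (_ * _); apply: eq_bigr => l _.
by rewrite (inj_eq perm_inj).
Qed.

End VandermondeSquare.

(** * From Hankel to Toeplitz determinants *)

Section HankelDeterminants.
Variables (F : fieldType) (c : nat -> F).

Definition rev_perm k : 'S_k := perm (@rev_ord_inj k).

Definition hankel_shift k (m : int) (l : 'I_k) : 'M[F]_k :=
  \matrix_(i, j) int_coef c (k%:Z - i%:Z - j%:Z + (if i == l then m else 0)).

(** Reversing the columns changes [k - i - j] into [1 + j - i] and leaves the rows, hence the shift
    of row [l], in place. *)
Lemma det_hankel_shift k m (l : 'I_k) :
  \det (hankel_shift m l) = (-1) ^+ rev_perm k * \det (toeplitz_shift c m l).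
Proof.
rewrite -det_tr -[in RHS]det_tr -[in RHS]det_perm -det_mulmx -row_permE; congr (\det _).
apply/matrixP => i j; rewrite !mxE permE; congr int_coef; congr (_ + _).
rewrite /= -subzn ?ltn_ord // -addn1 PoszD; ring.
Qed.

Definition hankel k : 'M[F]_k := \matrix_(i, j) int_coef c (k%:Z - i%:Z - j%:Z).

Lemma det_hankel k : \det (hankel k) = (-1) ^+ rev_perm k * \det (toeplitz c k 0).
Proof.
rewrite -det_tr -[in RHS]det_tr -[in RHS]det_perm -det_mulmx -row_permE; congr (\det _).
apply/matrixP => i j; rewrite !mxE permE; congr int_coef.
rewrite /= -subzn ?ltn_ord // -addn1 PoszD; ring.
Qed.

End HankelDeterminants.

(** * Iterated integrals of sums of products *)

Section IteratedIntegrals.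
Variable R : realType.
Local Open Scope complex_scope.
Implicit Types (gs : seq (R -> R[i])) (zs : seq R[i]).

Fixpoint on_curves gs zs : Prop :=
  match gs, zs with
  | [::], [::] => True
  | g :: gs', z :: zs' => (exists u, z = g u) /\ on_curves gs' zs'
  | _, _ => False
  end.

Lemma on_curves_size gs zs : on_curves gs zs -> size zs = size gs.
Proof. by elim: gs zs => [|g gs IH] [|z zs] //= [_ /IH ->]. Qed.

Lemma on_curves_nth gs zs l : on_curves gs zs -> (l < size gs)%N ->
  exists u, zs`_l = nth (fun=> 0) gs l u.
Proof. by elim: gs zs l => [|g gs IH] [|z zs] [|l] //= [hz hzs]; last exact: IH. Qed.

Lemma eq_contour_integral (g : R -> R[i]) f f' : (forall u, f (g u) = f' (g u)) ->
  contour_integral g f = contour_integral g f'.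
Proof. by move=> ff; congr integral01; apply/funext => u; rewrite ff. Qed.

Lemma eq_iterated gs f f' : (forall zs, on_curves gs zs -> f zs = f' zs) ->
  iterated_contour_integral gs f = iterated_contour_integral gs f'.
Proof.
elim: gs f f' => [|g gs IH] f f' ff /=; first exact: ff.
apply: eq_contour_integral => u; apply: IH => zs hzs; apply: ff; split=> //.
by exists u.
Qed.

Definition cint_on (g : R -> R[i]) (f : R[i] -> R[i]) := cint (fun u => f (g u) * velocity g u).

Lemma cint0 : cint (fun=> 0 : R[i]).
Proof. by apply: ccont_cint; exact: ccont_cst. Qed.

Lemma contour_integral_sum (I : Type) (r : seq I) (k : I -> R[i]) (b : I -> R[i] -> R[i])
    (g : R -> R[i]) : (forall i, cint_on g (b i)) ->
  contour_integral g (fun z => \sum_(i <- r) k i * b i z) =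
  \sum_(i <- r) k i * contour_integral g (b i).
Proof.
move=> hb.
suff [_] : cint_on g (fun z => \sum_(i <- r) k i * b i z) /\
  contour_integral g (fun z => \sum_(i <- r) k i * b i z) =
  \sum_(i <- r) k i * contour_integral g (b i) by [].
elim: r => [|i r [IH1 IH2]].
  split; first by apply: (cint_ext _ cint0) => u; rewrite big_nil mul0r.
  rewrite big_nil; transitivity (integral01 (fun u => 0 * (fun=> 0 : R[i]) u)).
    by congr integral01; apply/funext => u; rewrite big_nil !mul0r.
  by rewrite integral01_scale ?mul0r //; exact: cint0.
have hs : cint_on g (fun z => k i * b i z).
  by apply: (cint_ext _ (cint_scale (k i) (hb i))) => u; rewrite mulrA.
split; first by apply: (cint_ext _ (cint_add hs IH1)) => u; rewrite big_cons mulrDl.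
have e : contour_integral g (fun z => k i * b i z) = k i * contour_integral g (b i).
  rewrite /contour_integral -(integral01_scale _ (hb i)); congr integral01.
  by apply/funext => u; rewrite mulrA.
rewrite big_cons -IH2 -e /contour_integral -(integral01_add hs IH1).
by congr integral01; apply/funext => u; rewrite big_cons mulrDl.
Qed.

(** Only integrability of the one-variable factors is assumed, since one of them will contain the
    inner kernel integral. *)
Lemma iterated_sum_prod (I : Type) (r : seq I) (c : I -> R[i]) (a : I -> nat -> R[i] -> R[i]) gs :
  (forall i l, (l < size gs)%N -> cint_on (nth (fun=> 0) gs l) (a i l)) ->
  iterated_contour_integral gs (fun zs => \sum_(i <- r) c i * \prod_(l < size gs) a i l zs`_l) =
  \sum_(i <- r) c i * \prod_(l < size gs) contour_integral (nth (fun=> 0) gs l) (a i l).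
Proof.
elim: gs c a => [|g gs IH] c a ha /=.
  by apply: eq_bigr => i _; rewrite !big_ord0.
transitivity (contour_integral g (fun z => \sum_(i <- r)
   (c i * \prod_(l < size gs) contour_integral (nth (fun=> 0) gs l) (a i l.+1)) * a i 0%N z)).
  apply: eq_contour_integral => u.
  transitivity (iterated_contour_integral gs (fun zs => \sum_(i <- r)
      (c i * a i 0%N (g u)) * \prod_(l < size gs) (fun l => a i l.+1) l zs`_l)).
    congr iterated_contour_integral; apply/funext => zs; apply: eq_bigr => i _.
    by rewrite big_ord_recl /= mulrA.
  rewrite (IH (fun i => c i * a i 0%N (g u)) (fun i l => a i l.+1)); last by move=> i l hl; exact: (ha i l.+1).
  by apply: eq_bigr => i _; rewrite mulrAC.
rewrite contour_integral_sum; last by move=> i; exact: (ha i 0%N).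
by apply: eq_bigr => i _; rewrite big_ord_recl /= mulrAC -mulrA.
Qed.

End IteratedIntegrals.

(** * The contour formula for the covariance *)

Section ContourCovariance.
Variables (R : realType) (tau : R).
Hypothesis tau_ge0 : 0 <= tau.
Local Open Scope complex_scope.
Local Notation C := (exp1coef tau%:C : nat -> R[i]).
Local Notation D := (truncexp tau%:C : nat -> R[i]).
Local Notation w := (0 +i* (2 * pi) : R[i]).
Local Notation wm := (weight_monomial tau).

Lemma two_pi_i_neq0 : w != 0.
Proof. by rewrite eq_complex /= eqxx /= mulf_neq0 // gt_eqF // pi_gt0. Qed.

Lemma weight_monomialE q (z : R[i]) : z != 0 ->
  wm q z = cexp (tau%:C * z) * (1 + z) * z ^ (- q - 1).
Proof.
move=> z0; rewrite /weight_monomial; case: q => n; congr (_ * _).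
  by rewrite exprVn -opprD -PoszD addn1 exprnN.
have -> : - Negz n - 1 = n%:Z by rewrite NegzE opprK -addn1 PoszD addrK.
by [].
Qed.

Lemma weight_monomial_shift q m (z : R[i]) : z != 0 -> wm q z * z ^ m = wm (q - m) z.
Proof.
move=> z0; rewrite !weight_monomialE // -mulrA -expfzDr //; congr (_ * _ ^ _); ring.
Qed.

Definition permn k (s : 'S_k) (l : nat) : nat := if insub l is Some o then s o else 0%N.

Lemma permnE k (s : 'S_k) (l : 'I_k) : permn s l = s l.
Proof. by rewrite /permn valK. Qed.

Definition sgn2 k (p : 'S_k * 'S_k) : R[i] := (-1) ^+ p.1 * (-1) ^+ p.2.

(** The index of [weight_monomial] for the variable [l]: the two Vandermonde expansions raise
    [z_l ^ - (k + 1)] by the values of the two permutations at [l]. *)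
Definition row_degree k (p : 'S_k * 'S_k) (l : nat) : int :=
  k%:Z - (permn p.1 l)%:Z - (permn p.2 l)%:Z.

Lemma F_tauE k zs : size zs = k -> (forall l, (l < k)%N -> zs`_l != 0) ->
  F_tau tau zs = \sum_(p : 'S_k * 'S_k) sgn2 p * \prod_(l < k) wm (row_degree p l) zs`_l.
Proof.
move=> zk z0; rewrite /F_tau (big_nth 0) big_mkord zk vandermonde_sq mulr_suml.
rewrite -(pair_bigA _ (fun s t => sgn2 (s, t) * \prod_(l < k) wm (row_degree (s, t) l) zs`_l)) /=.
apply: eq_bigr => s _; rewrite mulr_suml; apply: eq_bigr => t _.
rewrite -[LHS]mulrA -big_split /=; congr (_ * _); apply: eq_bigr => l _.
have zl := z0 l (ltn_ord l); rewrite weight_monomialE // mulrCA; congr (_ * _).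
rewrite /row_degree /= !permnE exprnN [X in X * _]exprnP -expfzDr //; congr (_ ^ _).
by rewrite -addn1 !PoszD; ring.
Qed.

(** The integral over the variable [l] after multiplication by [z_l ^ - d]. *)
Definition mom k (p : 'S_k * 'S_k) (l : nat) (d : int) : R[i] := w * int_coef C (row_degree p l + d).

(** The permutation sums become shifted Hankel determinants, and column reversal makes them Toeplitz
    at the price of a sign that also occurs in the denominator. *)
Lemma sum_mom_shift k d :
  \sum_(j < k) \sum_(p : 'S_k * 'S_k) sgn2 p * \prod_(l < k) mom p l (if l == j then d else 0) =
  w ^+ k * k`!%:R * (-1) ^+ rev_perm k * \sum_(j < k) \det (toeplitz_shift C d j).
Proof.
transitivity (w ^+ k * \sum_(j < k) \sum_(s : 'S_k) \sum_(t : 'S_k) (-1) ^+ s * (-1) ^+ t *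
  \prod_(l < k) (fun b (i i' : 'I_k) => int_coef C (k%:Z - i%:Z - i'%:Z + (if b then d else 0))) (l == j) (s l) (t l)).
  rewrite mulr_sumr; apply: eq_bigr => j _; rewrite pair_bigA mulr_sumr /=; apply: eq_bigr => p _.
  rewrite mulrCA; congr (_ * _); rewrite big_split /= prodr_const card_ord; congr (_ * _).
  by apply: eq_bigr => l _; rewrite /row_degree !permnE.
have := sum_perm_det_shift (fun b (i i' : 'I_k) => int_coef C (k%:Z - i%:Z - i'%:Z + (if b then d else 0))).
rewrite /= => ->; rewrite -!mulrA; congr (_ * (_ * _)); rewrite mulr_sumr; apply: eq_bigr => j _.
exact: det_hankel_shift.
Qed.

Lemma sum_mom k :
  \sum_(p : 'S_k * 'S_k) sgn2 p * \prod_(l < k) mom p l 0 =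
  w ^+ k * k`!%:R * (-1) ^+ rev_perm k * D k.
Proof.
transitivity (w ^+ k * \sum_(s : 'S_k) \sum_(t : 'S_k) (-1) ^+ s * (-1) ^+ t *
  \prod_(l < k) (fun (i i' : 'I_k) => int_coef C (k%:Z - i%:Z - i'%:Z)) (s l) (t l)).
  rewrite pair_bigA mulr_sumr /=; apply: eq_bigr => p _.
  rewrite mulrCA; congr (_ * _); rewrite big_split /= prodr_const card_ord; congr (_ * _).
  by apply: eq_bigr => l _; rewrite /row_degree !permnE addr0.
have := sum_perm_det (fun i i' : 'I_k => int_coef C (k%:Z - i%:Z - i'%:Z)).
rewrite /= => ->; rewrite -!mulrA; congr (_ * (_ * _)).
rewrite -(det_toeplitz0 (exp1coef0 tau%:C) (truncexp_duality tau%:C)).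
exact: det_hankel.
Qed.

Section Curves.
Variable gs : seq (R -> R[i]).
Hypothesis hgs : forall l, (l < size gs)%N -> contour_around0 (nth (fun=> 0) gs l).

Lemma on_curves_neq0 zs : on_curves gs zs -> forall l, (l < size gs)%N -> zs`_l != 0.
Proof.
move=> hz l hl; have [u ->] := on_curves_nth hz hl.
by apply: contour_neq0; exact: hgs.
Qed.

Lemma cint_on_cont (g : R -> R[i]) f : contour_around0 g -> cont_on g f -> cint_on g f.
Proof. by move=> hg hf; apply: ccont_cint; apply: ccontM => //; exact: velocity_cont. Qed.

Lemma denominatorE :
  cov_denominator tau gs = w ^+ (size gs) * (size gs)`!%:R * (-1) ^+ rev_perm (size gs) * D (size gs).
Proof.
rewrite /cov_denominator -sum_mom.
transitivity (iterated_contour_integral gs (fun zs => \sum_(p : 'S_(size gs) * 'S_(size gs)) sgn2 p *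
   \prod_(l < size gs) (fun l => wm (row_degree p l)) l zs`_l)).
  apply: eq_iterated => zs hz; apply: F_tauE; first exact: on_curves_size.
  exact: on_curves_neq0.
rewrite (@iterated_sum_prod _ _ _ _ (fun p l => wm (row_degree p l))).
  apply: eq_bigr => p _; congr (_ * _); apply: eq_bigr => l _.
  by rewrite weight_momentE // ?/mom ?addr0 //; exact: hgs.
by move=> p l hl; apply: cint_on_cont (hgs hl) _; exact: cont_on_weight (hgs hl) _ _.
Qed.

End Curves.

Lemma prod_if k (j : 'I_k) (x y : 'I_k -> R[i]) :
  \prod_(l < k) (if l == j then x l else y l) = x j * \prod_(l < k | l != j) y l.
Proof.
rewrite (bigD1 j) //= eqxx; congr (_ * _); apply: eq_bigr => l /negPf lj.
by rewrite lj.
Qed.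

Variables (g1 g2 : seq (R -> R[i])).
Hypothesis hg1 : forall l, (l < size g1)%N -> contour_around0 (nth (fun=> 0) g1 l).
Hypothesis hg2 : forall l, (l < size g2)%N -> contour_around0 (nth (fun=> 0) g2 l).
Hypothesis nested : forall i j u v, (i < size g1)%N -> (j < size g2)%N ->
  `|nth (fun=> 0) g2 j v| < `|nth (fun=> 0) g1 i u|.
Local Notation r := (size g1).
Local Notation s := (size g2).
Local Notation c1 l := (nth (fun=> 0 : R[i]) g1 l).
Local Notation c2 l := (nth (fun=> 0 : R[i]) g2 l).

Let inner (p : 'S_r * 'S_r) (i : nat) (z2 : R[i]) : R[i] := kernel_inner (c1 i) (wm (row_degree p i)) z2.

(** Each kernel term involves a single variable of the outer family of contours, so all other
    integrals over that family are plain moments. *)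
Lemma inner_integral zs2 : on_curves g2 zs2 ->
  iterated_contour_integral g1 (fun zs1 =>
     (\sum_(z1 <- zs1) \sum_(z2 <- zs2) z2 / (z1 - z2)) * F_tau tau zs2 * F_tau tau zs1) =
  \sum_(x : ('I_r * 'I_s) * ('S_r * 'S_r)) F_tau tau zs2 * sgn2 x.2 *
    (inner x.2 x.1.1 zs2`_(x.1.2) * \prod_(l < r | l != x.1.1) mom x.2 l 0).
Proof.
move=> hz2.
pose a (x : ('I_r * 'I_s) * ('S_r * 'S_r)) (l : nat) (z : R[i]) : R[i] :=
  wm (row_degree x.2 l) z * (if l == x.1.1 :> nat then zs2`_(x.1.2) / (z - zs2`_(x.1.2)) else 1).
transitivity (iterated_contour_integral g1 (fun zs1 => \sum_x F_tau tau zs2 * sgn2 x.2 *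
    \prod_(l < r) a x l zs1`_l)).
  apply: eq_iterated => zs1 hz1.
  rewrite (F_tauE (on_curves_size hz1) (on_curves_neq0 hg1 hz1)).
  rewrite (big_nth 0) big_mkord (on_curves_size hz1).
  rewrite -(pair_bigA _ (fun (y : 'I_r * 'I_s) p => F_tau tau zs2 * sgn2 p * \prod_(l < r) a (y, p) l zs1`_l)) /=.
  rewrite -(pair_bigA _ (fun (i : 'I_r) (j : 'I_s) => \sum_p F_tau tau zs2 * sgn2 p * \prod_(l < r) a ((i, j), p) l zs1`_l)) /=.
  rewrite -mulrA mulr_suml; apply: eq_bigr => i _.
  rewrite (big_nth 0) big_mkord (on_curves_size hz2) mulr_suml; apply: eq_bigr => j _.
  rewrite !mulr_sumr; apply: eq_bigr => p _.
  have -> : \prod_(l < r) a ((i, j), p) l zs1`_l =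
     \prod_(l < r) wm (row_degree p l) zs1`_l * (zs2`_j / (zs1`_i - zs2`_j)).
    rewrite /a big_split /=; congr (_ * _); rewrite (bigD1 i) //= eqxx big1 ?mulr1 // => l.
    by rewrite -val_eqE /= => /negPf ->.
  ring.
rewrite (@iterated_sum_prod _ _ _ _ a).
  apply: eq_bigr => -[[i j] p] _; congr (_ * _) => /=.
  rewrite -(prod_if i (fun l => inner p l zs2`_j) (fun l => mom p l 0)).
  apply: eq_bigr => l _; rewrite /a /= -val_eqE /=; case: eqP => li.
    by rewrite /inner /kernel_inner.
  rewrite -[RHS](_ : contour_integral (c1 l) (wm (row_degree p l)) = _).
    by congr contour_integral; apply/funext => z; rewrite mulr1.
  by rewrite weight_momentE // ?/mom ?addr0 //; exact: hg1.
move=> [[i j] p] l hl; rewrite /a /=; apply: cint_on_cont (hg1 hl) _.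
apply: ccontM; first exact: cont_on_weight (hg1 hl) _ _.
case: eqP => _; last exact: ccont_cst.
have [v ->] := on_curves_nth hz2 (ltn_ord j).
apply: ccontM; first exact: ccont_cst.
apply: ccontV.
  by move=> u; apply: (@nested_neq _ (c1 l) (c2 j)) => u' v'; exact: nested.
by apply: ccontD; [exact: contour_cont (hg1 hl) | exact: ccont_cst].
Qed.

(** The series stops at [s]: a row degree is at most [s], so a shift by [m + 1 > s] makes it
    negative and the moment vanishes. *)
Lemma kernel_moment (p : 'S_r * 'S_r) (p' : 'S_s * 'S_s) (i : 'I_r) (j : 'I_s) :
  contour_integral (c2 j) (fun z => wm (row_degree p' j) z * inner p i z) =
  \sum_(m < s) mom p' j (- m.+1%:Z) * mom p i m.+1%:Z.
Proof.
have h1 := hg1 (ltn_ord i); have h2 := hg2 (ltn_ord j).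
have AE m : contour_integral (c2 j) (fun z => wm (row_degree p' j) z * z ^+ m.+1) = mom p' j (- m.+1%:Z).
  rewrite /mom -(weight_momentE h2 _ tau_ge0); apply: eq_contour_integral => u.
  by rewrite exprnP weight_monomial_shift //; exact: contour_neq0.
have BE m : contour_integral (c1 i) (fun z => wm (row_degree p i) z * z^-1 ^+ m.+1) = mom p i m.+1%:Z.
  rewrite /mom -(weight_momentE h1 _ tau_ge0); apply: eq_contour_integral => u.
  have z0 := contour_neq0 h1 u.
  by rewrite exprVn exprnN (weight_monomial_shift _ _ z0) opprK.
rewrite (@contour_kernel R (c1 i) (c2 j) h1 h2 (fun u v => nested u v (ltn_ord i) (ltn_ord j))
  (wm (row_degree p' j)) (wm (row_degree p i)) (cont_on_weight h2 _ _) (cont_on_weight h1 _ _) s).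
  by apply: eq_bigr => m _; rewrite AE BE.
move=> m sm; rewrite AE /mom.
suff -> : int_coef C (row_degree p' j - m.+1%:Z) = 0 by rewrite mulr0.
rewrite /row_degree; case E : (_ - m.+1%:Z) => [q|//].
by move: E sm; lia.
Qed.

Lemma numeratorE : cov_numerator tau g2 g1 =
  \sum_(m < s)
   (w ^+ s * s`!%:R * (-1) ^+ rev_perm s * \sum_(j < s) \det (toeplitz_shift C (- m.+1%:Z) j)) *
   (w ^+ r * r`!%:R * (-1) ^+ rev_perm r * \sum_(i < r) \det (toeplitz_shift C m.+1%:Z i)).
Proof.
pose a (x : (('I_r * 'I_s) * ('S_r * 'S_r)) * ('S_s * 'S_s)) (l : nat) (z : R[i]) : R[i] :=
  if l == x.1.1.2 :> nat then wm (row_degree x.2 l) z * inner x.1.2 x.1.1.1 z else wm (row_degree x.2 l) z.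
rewrite /cov_numerator.
transitivity (iterated_contour_integral g2 (fun zs2 => \sum_x
    (sgn2 x.1.2 * sgn2 x.2 * \prod_(l < r | l != x.1.1.1) mom x.1.2 l 0) *
    \prod_(l < s) a x l zs2`_l)).
  apply: eq_iterated => zs2 hz2; rewrite inner_integral //.
  rewrite -(pair_bigA _ (fun (y : ('I_r * 'I_s) * ('S_r * 'S_r)) p' =>
     (sgn2 y.2 * sgn2 p' * \prod_(l < r | l != y.1.1) mom y.2 l 0) * \prod_(l < s) a (y, p') l zs2`_l)) /=.
  apply: eq_bigr => -[[i j] p] _ /=.
  rewrite (F_tauE (on_curves_size hz2) (on_curves_neq0 hg2 hz2)) -mulrA mulr_suml.
  apply: eq_bigr => p' _.
  have -> : \prod_(l < s) a ((i, j), p, p') l zs2`_l =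
     \prod_(l < s) wm (row_degree p' l) zs2`_l * inner p i zs2`_j.
    rewrite [in RHS](bigD1 j) //= /a /= (bigD1 j) //= eqxx [RHS]mulrAC; congr (_ * _).
    by apply: eq_bigr => l; rewrite -val_eqE /= => /negPf ->.
  ring.
rewrite (@iterated_sum_prod _ _ _ _ a); last first.
  move=> [[[i j] p] p'] l hl; rewrite /a /=; case: eqP => [->|_]; last first.
    by apply: cint_on_cont (hg2 hl) _; exact: cont_on_weight (hg2 hl) _ _.
  have h1 := hg1 (ltn_ord i); have h2 := hg2 (ltn_ord j).
  exact: (@cint_kernel R (c1 i) (c2 j) h1 h2 (fun u v => nested u v (ltn_ord i) (ltn_ord j))
    (wm (row_degree p' j)) (wm (row_degree p i)) (cont_on_weight h2 _ _) (cont_on_weight h1 _ _)).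
transitivity (\sum_(x : (('I_r * 'I_s) * ('S_r * 'S_r)) * ('S_s * 'S_s)) \sum_(m < s)
   (sgn2 x.2 * \prod_(l < s) mom x.2 l (if l == x.1.1.2 then - m.+1%:Z else 0)) *
   (sgn2 x.1.2 * \prod_(l < r) mom x.1.2 l (if l == x.1.1.1 then m.+1%:Z else 0))).
  apply: eq_bigr => -[[[i j] p] p'] _ /=.
  have -> : \prod_(l < s) contour_integral (c2 l) (a ((i, j), p, p') l) =
     (\sum_(m < s) mom p' j (- m.+1%:Z) * mom p i m.+1%:Z) * \prod_(l < s | l != j) mom p' l 0.
    rewrite -kernel_moment -(prod_if j (fun l => contour_integral (c2 l) (fun z => wm (row_degree p' l) z * inner p i z)) (fun l => mom p' l 0)).
    apply: eq_bigr => l _; rewrite /a /= -val_eqE /=; case: eqP => lj //.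
    by rewrite weight_momentE // ?/mom ?addr0 //; exact: hg2.
  (* For fixed [m] the summand now factors into one shifted product for each family, with opposite
     shifts at [j] and [i]. *)
  rewrite mulr_suml mulr_sumr; apply: eq_bigr => m _.
  have e1 : \prod_(l < s) mom p' l (if l == j then - m.+1%:Z else 0) =
      mom p' j (- m.+1%:Z) * \prod_(l < s | l != j) mom p' l 0.
    rewrite -(prod_if j (fun l => mom p' l (- m.+1%:Z)) (fun l => mom p' l 0)).
    by apply: eq_bigr => l _; case: ifP.
  have e2 : \prod_(l < r) mom p l (if l == i then m.+1%:Z else 0) =
      mom p i m.+1%:Z * \prod_(l < r | l != i) mom p l 0.
    rewrite -(prod_if i (fun l => mom p l m.+1%:Z) (fun l => mom p l 0)).
    by apply: eq_bigr => l _; case: ifP.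
  rewrite e1 e2; ring.
rewrite exchange_big /=; apply: eq_bigr => m _; rewrite -!sum_mom_shift.
pose A (j : 'I_s) (p' : 'S_s * 'S_s) := sgn2 p' * \prod_(l < s) mom p' l (if l == j then - m.+1%:Z else 0).
pose B (i : 'I_r) (p : 'S_r * 'S_r) := sgn2 p * \prod_(l < r) mom p l (if l == i then m.+1%:Z else 0).
rewrite -(pair_bigA _ (fun (y : ('I_r * 'I_s) * ('S_r * 'S_r)) p' => A y.1.2 p' * B y.1.1 y.2)) /=.
rewrite -(pair_bigA _ (fun (y : 'I_r * 'I_s) p => \sum_p' A y.2 p' * B y.1 p)) /=.
rewrite -(pair_bigA _ (fun i j => \sum_p \sum_p' A j p' * B i p)) /= exchange_big /=.
rewrite mulr_suml; apply: eq_bigr => j _; rewrite mulr_sumr; apply: eq_bigr => i _.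
by rewrite mulr_sumr; apply: eq_bigr => p _; rewrite mulr_suml.
Qed.

Lemma truncexp_complex k : D k = (truncexp tau k)%:C.
Proof.
rewrite /truncexp rmorph_sum; apply: eq_bigr => j _.
by rewrite /expterm fmorph_div rmorphXn rmorph_nat.
Qed.

Lemma truncexp_complex_neq0 k : D k != 0.
Proof.
rewrite truncexp_complex eq_complex /= eqxx andbT gt_eqF //.
by apply: lt_le_trans (truncexp_ge1 k tau_ge0).
Qed.

Lemma denominator_neq0 gs : (forall l, (l < size gs)%N -> contour_around0 (nth (fun=> 0) gs l)) ->
  cov_denominator tau gs != 0.
Proof.
move=> hgs; rewrite denominatorE // mulf_neq0 ?truncexp_complex_neq0 // mulf_neq0 ?signr_eq0 //.
by rewrite mulf_neq0 ?expf_neq0 ?two_pi_i_neq0 // pnatr_eq0 -lt0n fact_gt0.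
Qed.

Theorem contour_covariance : (s <= r)%N ->
  cov_numerator tau g2 g1 / (cov_denominator tau g2 * cov_denominator tau g1) =
  (limit_cov tau r s / (truncexp tau r * truncexp tau s))%:C.
Proof.
move=> sr.
have Ds := truncexp_complex_neq0 s; have Dr := truncexp_complex_neq0 r.
have key : \sum_(m < s) (\sum_(j < s) \det (toeplitz_shift C (- m.+1%:Z) j)) *
    (\sum_(i < r) \det (toeplitz_shift C m.+1%:Z i)) = limit_cov tau%:C r s.
  (* The extra term at [m = 0], that is for a shift by 1, is the exceptional value in
     [truncexp_newton]. *)
  rewrite (eq_bigr (fun m : 'I_s => D (s - m.+1)%N * (D r - D (r + m.+1)%N) +
      (if m == 0%N :> nat then tau%:C * D r * D s.-1 else 0))).
    rewrite /limit_cov; case: s => [|s']; first by rewrite big_ord0.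
    rewrite big_split /= addrC; congr (_ + _).
      by rewrite (bigD1 ord0) //= big1 ?addr0 // => m; rewrite -val_eqE /= => /negPf ->.
    rewrite -sumrN; apply: eq_bigr => m _; rewrite subSS -mulrN opprB.
    by [].
  move=> m _; have ms := ltn_ord m.
  rewrite (sum_det_shiftN (exp1coef0 tau%:C) (truncexp_duality tau%:C)) // ms.
  (* The upward shift may not exceed the size [r] of the matrix, which holds because
     [m + 1 <= s <= r]. *)
  rewrite (sum_det_shiftP (exp1coef0 tau%:C) (truncexp_duality tau%:C)) //; last by rewrite /= (leq_trans ms).
  rewrite truncexp_newton //= !exprS mulN1r eqSS.
  have sg : (-1) ^+ m * (-1) ^+ m = 1 :> R[i] by rewrite -expr2 sqrr_sign.
  case: eqP => [m0|_].
    by rewrite m0 expr0 subn1; ring.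
  transitivity ((-1) ^+ m * (-1) ^+ m * (D (s - m.+1)%N * (D r - D (r + m.+1)%N))); first by ring.
  by rewrite sg mul1r addr0.
rewrite numeratorE !denominatorE //.
set us := w ^+ s * s`!%:R * (-1) ^+ rev_perm s; set ur := w ^+ r * r`!%:R * (-1) ^+ rev_perm r.
have us0 : us != 0.
  by rewrite !mulf_neq0 ?signr_eq0 ?expf_neq0 ?two_pi_i_neq0 // pnatr_eq0 -lt0n fact_gt0.
have ur0 : ur != 0.
  by rewrite !mulf_neq0 ?signr_eq0 ?expf_neq0 ?two_pi_i_neq0 // pnatr_eq0 -lt0n fact_gt0.
transitivity (limit_cov tau%:C r s / (D r * D s)).
  rewrite -key (eq_bigr (fun m : 'I_s => us * ur *
      ((\sum_(j < s) \det (toeplitz_shift C (- m.+1%:Z) j)) * (\sum_(i < r) \det (toeplitz_shift C m.+1%:Z i))))).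
    rewrite -mulr_sumr; set X := \sum_(m < s) _; field.
    by rewrite us0 ur0 Ds Dr.
  by move=> m _; ring.
have mM (x y : R) : (x * y)%:C = x%:C * y%:C by rewrite rmorphM.
have mB (x y : R) : (x - y)%:C = x%:C - y%:C by rewrite rmorphB.
have mV (x y : R) : (x / y)%:C = x%:C / y%:C by rewrite fmorph_div.
rewrite mV mM -!truncexp_complex; congr (_ / _).
rewrite /limit_cov; case: (s) => [//|s'].
have ms (f : 'I_s'.+1 -> R) : (\sum_i f i)%:C = \sum_i (f i)%:C by rewrite rmorph_sum.
rewrite mB !mM -!truncexp_complex; congr (_ - _); rewrite [RHS]ms.
by apply: eq_bigr => m _; rewrite mM mB -!truncexp_complex.
Qed.

End ContourCovariance.

(** * Fluctuations at a fixed time *)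

Section ConfigurationFunctions.
Variable R : realType.
Implicit Types (x y : config) (e : R).

Lemma first_coords_comp n (h : config -> R) (phi : R -> R) :
  first_coords n h -> first_coords n (fun x => phi (h x)).
Proof. by move=> hh x y xy; rewrite (hh x y xy). Qed.

Definition log_height e b x : R := e * \sum_(k < b) ((x k)%:~R + k.+1%:R).

Lemma expR_mulz e (z : int) : expR (- e) ^ z = expR (- (e * z%:~R)).
Proof.
case: z => m; first by rewrite -exprnP -expRM_natl; congr expR; ring.
by rewrite NegzE -exprnN -expRM_natl -expRN mulrNz; congr expR; ring.
Qed.

Lemma exp_heightE e b x : exp_height (expR (- e)) b x = expR (log_height e b x).
Proof.
rewrite /log_height /exp_height; elim: b => [|b IH]; first by rewrite !big_ord0 mulr0 expR0.
rewrite !big_ord_recr /= IH mulrDr expRD; congr (_ * _).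
by rewrite /cum_rate expR_mulz -expRN opprK; congr (expR (_ * _)); rewrite rmorphD.
Qed.

Lemma first_coords_log_height e n b : (b <= n)%N -> first_coords n (log_height e b).
Proof.
move=> bn x y xy; rewrite /log_height; congr (_ * _); apply: eq_bigr => k _.
by rewrite xy // (leq_trans _ bn).
Qed.

Lemma log_heightS e b x : log_height e b.+1 x - log_height e b x = e * ((x b)%:~R + b.+1%:R).
Proof. by rewrite /log_height big_ord_recr /= mulrDr addrC addKr. Qed.

(** The inequality [exp x >= 1 + x], at [l - ln D] and at its opposite, encloses the logarithm
    between two bounds that differ by [(exp l - D) ^ 2 / (D exp l)]. *)
Lemma log_linearization (l D : R) : 0 <= l -> 1 <= D ->
  `|l - ln D - (expR l - D) / D| <= (expR l - D) ^+ 2.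
Proof.
move=> l0 D1; have D0 : 0 < D by lra.
have f1 : 1 <= expR l by have := expR_ge1Dx l; lra.
have f0 : 0 < expR l by exact: expR_gt0.
have lD : expR (ln D) = D by rewrite lnK // posrE.
have up : l - ln D <= (expR l - D) / D.
  have := expR_ge1Dx (l - ln D); rewrite expRD expRN lD mulrBl divff ?gt_eqF //; lra.
have lo : 1 - D / expR l <= l - ln D.
  have := expR_ge1Dx (ln D - l); rewrite expRD expRN lD; lra.
have key : (expR l - D) / D - (1 - D / expR l) <= (expR l - D) ^+ 2.
  have -> : (expR l - D) / D - (1 - D / expR l) = (expR l - D) ^+ 2 / (expR l * D).
    by field; rewrite !gt_eqF.
  rewrite ler_pdivrMr ?mulr_gt0 // ler_peMr ?sqr_ge0 //.
  by rewrite -[1]mulr1 ler_pM.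
by rewrite ler_norml; apply/andP; split; have := sqr_ge0 (expR l - D); lra.
Qed.

(** The shape of every truncation error produced by [dynkin_le]: the factorial beats the growth rate
    [v]. *)
Lemma vanishing_expterm (C s v : R) : (fun M => C * v ^+ M.+1 * expterm s M * s) @ \oo --> (0 : R).
Proof.
rewrite (_ : (fun M => _) = (fun M => C * v * s * exp_coeff (v * s) M)).
  rewrite -[X in _ --> X](mulr0 (C * v * s)); apply: cvgMr.
  by apply: cvg_series_cvg_0; exact: is_cvg_series_exp_coeff.
by apply/funext => M; rewrite /expterm /exp_coeff /= exprMn exprS; ring.
Qed.

End ConfigurationFunctions.

Section ProbabilityIntegrals.
Variables (R : realType) (d : measure_display) (T : measurableType d) (P : probability T R).
Implicit Types f g : T -> R.

Lemma Rintegral_prob_cst (c : R) : \int[P]_w c = c.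
Proof. by rewrite Rintegral_cst // [X in fine X](probability_setT P) mulr1. Qed.

Lemma Rintegral_add f g : P.-integrable setT (EFin \o f) -> P.-integrable setT (EFin \o g) ->
  \int[P]_w (f w + g w) = \int[P]_w f w + \int[P]_w g w.
Proof. by move=> hf hg; rewrite RintegralD. Qed.

Lemma Rintegral_scale (c : R) f : P.-integrable setT (EFin \o f) ->
  \int[P]_w (c * f w) = c * \int[P]_w f w.
Proof. by move=> hf; rewrite RintegralZl. Qed.

Lemma integrable_prob_cst (c : R) : P.-integrable setT (EFin \o (fun=> c)).
Proof. exact: (@prob_bounded_integrable _ _ _ P (cst c) `|c|). Qed.

End ProbabilityIntegrals.

(** * Estimates at a fixed value of the parameter *)

Section FixedTime.
Variables (R : realType) (d : measure_display) (T : measurableType d) (P : probability T R).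
Variables (e s : R) (X : R -> T -> config) (n : nat) (B : R).
Hypothesis e0 : 0 < e.
Hypothesis s0 : 0 <= s.
Local Notation t := (expR (- e)).
Local Notation kappa := (tkappa t).
Hypothesis hX : slowed_tTASEP P t packed X.
Hypothesis kappa_le1 : kappa <= 1.
Hypothesis sB : kappa * s <= B.
Local Notation sigma := (kappa * s).
Local Notation texp := (trunc_expect n (jump_rate t) jump packed).

Let t01 : 0 < t < 1.
Proof. by rewrite expR_gt0 /= expR_lt1 oppr_lt0. Qed.

Let k0 : 0 < kappa. Proof. exact: tkappa_gt0. Qed.

Let sig0 : 0 <= sigma. Proof. by rewrite mulr_ge0 // ltW. Qed.

Lemma bounded_expectation (h : config -> R) (C : R) : first_coords n h -> (forall x, 0 <= h x) ->
  ('E_P[fun w => h (X s w)] <= C%:E)%E ->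
  P.-integrable setT (EFin \o (fun w => h (X s w))) /\ \int[P]_w h (X s w) <= C.
Proof.
move=> hh h0; rewrite unlock => hE.
have hi : P.-integrable setT (EFin \o (fun w => h (X s w))).
  apply/integrableP; split.
    by apply/measurable_EFinP; exact: measurable_first_coords s0 hX _ _ hh.
  under eq_integral do rewrite /= ger0_norm //.
  by apply: le_lt_trans hE _; rewrite ltry.
by split=> //; move: hE; rewrite EFin_Rintegral // lee_fin.
Qed.

Lemma texp_le_valid (h g : config -> R) M : (forall x, valid x -> h x <= g x) ->
  texp M s h <= texp M s g.
Proof.
move=> hg; apply: (trunc_expect_le valid_packed _ _ _ _ s0 hg).
- by move=> x k; exact: jump_rate_ge0.
- by move=> x; exact: sum_jump_rate_le1.
- by move=> x k; exact: valid_jump.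
Qed.

Lemma texp_cst_le (c : R) M : 0 <= c -> texp M s (fun=> c) <= c.
Proof.
move=> c0; apply: (trunc_expect_cst_le valid_packed) => //.
- by move=> x k; exact: jump_rate_ge0.
- by move=> x; exact: sum_jump_rate_le1.
- by move=> x k; exact: valid_jump.
Qed.

Local Notation F b := (fluct t b s).

Lemma first_coords_fluct b : (b <= n)%N -> first_coords n (F b).
Proof.
move=> bn; have := first_coords_comp (fun l => expR l - truncexp sigma b) (first_coords_log_height e bn).
by congr first_coords; apply/funext => x; rewrite /fluct exp_heightE.
Qed.

Lemma measurable_fluct b : (b <= n)%N -> measurable_fun setT (fun w => F b (X s w)).
Proof. by move=> bn; exact: measurable_first_coords s0 hX _ _ (first_coords_fluct bn). Qed.

Lemma cvg0_cst : (fun _ : nat => 0 : R) @ \oo --> (0 : R).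
Proof. exact: cvg_cst. Qed.

Lemma fluct_second_moment b : (b <= n)%N ->
  P.-integrable setT (EFin \o (fun w => F b (X s w) ^+ 2)) /\
  \int[P]_w (F b (X s w) ^+ 2) <= kappa * var_bound B b.
Proof.
move=> bn.
have hc : first_coords n (fun x => F b x ^+ 2).
  exact: first_coords_comp (fun u => u ^+ 2) (first_coords_fluct bn).
have h0 x : 0 <= F b x ^+ 2 by exact: sqr_ge0.
apply: (bounded_expectation hc h0).
apply: (expect_le_trunc t01 s0 hX hc h0 cvg0_cst) => M; rewrite addr0.
by apply: (texp_fluct2 t01 kappa_le1 s0 sB) => //; rewrite s0 lexx.
Qed.

Lemma fluct_integrable b : (b <= n)%N -> P.-integrable setT (EFin \o (fun w => F b (X s w))).
Proof.
move=> bn; have [i2 _] := fluct_second_moment bn.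
have i1 : P.-integrable setT (EFin \o (fun w => 1 + F b (X s w) ^+ 2)).
  by apply: (integrable_add _ i2); exact: (@prob_bounded_integrable _ _ _ P (cst 1) `|1|).
apply: le_integrable i1 => //; first by apply/measurable_EFinP; exact: measurable_fluct.
move=> w _ /=; rewrite lee_fin [leRHS]ger0_norm; last by rewrite addr_ge0 // sqr_ge0.
set u := F b _; have h1 := sqr_ge0 (`|u| - 1); rewrite -(real_normK (num_real u)).
nra.
Qed.

Lemma fluct_lin_stat b a : (b <= n)%N -> exists2 C, 0 <= C & forall M,
  texp M.+1 s (fun x => a * F b x) <= C * t^-1 ^+ M.+1 * expterm s M * s.
Proof.
move=> bn; pose xi r : R := (r == b)%:R.
have xs i : (n < i)%N -> xi i = 0 by move=> ni; rewrite /xi gtn_eqF // (leq_ltn_trans bn).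
have [C C0 hC] := texp_lin_stat t01 xs s0 sB a.
exists C => // M; apply: le_trans (hC M); rewrite le_eqVlt; apply/orP; left; apply/eqP.
congr (trunc_expect _ _ _ _ _ _ _); apply/funext => x; congr (_ * _).
have bn' : (b < n.+1)%N by [].
rewrite lin_stat_end (bigD1 (Ordinal bn')) //= /xi eqxx mul1r big1 ?addr0 // => i.
by rewrite -val_eqE /= => /negPf ->; rewrite mul0r.
Qed.

(** The comparison of truncated and true expectations requires a nonnegative function, so it is
    applied to [f_b = F_b + D]: the sign [+1] of the zero-drift estimate bounds the mean of [f_b]
    above by [D], the sign [-1] below. *)
Lemma fluct_mean b : (b <= n)%N -> \int[P]_w F b (X s w) = 0.
Proof.
move=> bn; have D1 := truncexp_ge1 b sig0; set D := truncexp sigma b in D1 *.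
have D0 : 0 <= D by lra.
have r_ge0 (x : config) k : valid x -> 0 <= jump_rate t x k by exact: jump_rate_ge0.
have r_le1 (x : config) : valid x -> \sum_(k < n) jump_rate t x k <= 1 by exact: sum_jump_rate_le1.
have VJ (x : config) k : valid x -> jump_rate t x k != 0 -> valid (jump x k) by exact: valid_jump.
have fE x : exp_height t b x = F b x + D by rewrite /fluct subrK.
have hc : first_coords n (exp_height t b).
  by move=> x y xy; rewrite !fE (first_coords_fluct bn xy).
have h0 x : 0 <= exp_height t b x by rewrite exp_heightE expR_ge0.
have [C C0 hC] := fluct_lin_stat 1 bn; have [C' C'0 hC'] := fluct_lin_stat (-1) bn.
have up : ('E_P[fun w => exp_height t b (X s w)] <= D%:E)%E.
  apply: (expect_le_trunc t01 s0 hX hc h0 (vanishing_expterm C s t^-1)) => M.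
  apply: le_trans (_ : texp M.+1 s (fun x => 1 * F b x) + texp M.+1 s (fun=> D) <= _).
    rewrite -trunc_expectD; apply: texp_le_valid => x _; rewrite fE mul1r //.
  by rewrite addrC lerD ?hC // texp_cst_le.
have [hi hup] := bounded_expectation hc h0 up.
have lo : D <= \int[P]_w exp_height t b (X s w).
  have lim : (fun M => D * (\sum_(m < M.+1) poisson_weight s m) -
      C' * t^-1 ^+ M.+1 * expterm s M * s) @ \oo --> D.
    rewrite -[X in _ --> X]subr0 -[X in _ --> X - _]mulr1.
    apply: cvgB; last exact: vanishing_expterm.
    apply: cvgMr; rewrite (_ : (fun M => _) = (fun M => expR (- s) * series (exp_coeff s) M.+1)).
      rewrite -(expRxMexpNx_1 s) mulrC; apply: cvgMr.
      by rewrite (cvg_shiftS (series (exp_coeff s))); exact: is_cvg_series_exp_coeff.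
    apply/funext => M; rewrite /series /= big_mkord mulr_sumr; apply: eq_bigr => m _.
    by rewrite /poisson_weight /expterm /exp_coeff.
  rewrite -(cvg_lim (@Rhausdorff R) lim); apply: limr_le; first exact: (cvgP _ lim).
  apply: nearW => M.
  have := expect_ge_trunc t01 s0 hX hc h0 M.+1; rewrite unlock EFin_Rintegral // lee_fin.
  apply: le_trans; rewrite lerBlDr.
  have -> : D * (\sum_(m < M.+1) poisson_weight s m) = texp M.+1 s (fun=> D).
    rewrite /trunc_expect mulr_sumr; apply: eq_bigr => m _; rewrite mulrC; congr (_ * _).
    by rewrite iter_chain_step_cst.
  apply: le_trans (lerD (lexx _) (hC' M)); rewrite -trunc_expectD.
  by apply: texp_le_valid => x _; rewrite fE; lra.
have Fi := fluct_integrable bn.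
have : \int[P]_w exp_height t b (X s w) = \int[P]_w F b (X s w) + D.
  have Di : P.-integrable setT (EFin \o (fun=> D)) by exact: (@prob_bounded_integrable _ _ _ P (cst D) `|D|).
  have -> : D = \int[P]_w D :> R by rewrite Rintegral_cst // [X in fine X](probability_setT P) mulr1.
  by rewrite -RintegralD //; apply: eq_Rintegral => w _; rewrite fE.
lra.
Qed.

(** The error in linearizing [ln f_b] around [ln D_b]. *)
Definition remainder b x : R :=
  log_height e b x - ln (truncexp sigma b) - F b x / truncexp sigma b.

Lemma log_height_ge0 b x : valid x -> 0 <= log_height e b x.
Proof.
move=> vx; apply: mulr_ge0; first exact: ltW.
apply: sumr_ge0 => k _.
have [_ h] := vx k; have : ((- k.+1%:Z)%:~R : R) <= (x k)%:~R by rewrite ler_int.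
by rewrite mulrNz -pmulrn; lra.
Qed.

Lemma remainder_bound b : (b <= n)%N ->
  P.-integrable setT (EFin \o (fun w => `|remainder b (X s w)|)) /\
  \int[P]_w `|remainder b (X s w)| <= kappa * var_bound B b.
Proof.
move=> bn; have D1 := truncexp_ge1 b sig0.
have hc : first_coords n (fun x => `|remainder b x|).
  move=> x y xy; rewrite /remainder (first_coords_fluct bn xy).
  by rewrite (first_coords_log_height e bn xy).
apply: (bounded_expectation hc) => [x|]; first exact: normr_ge0.
apply: (expect_le_trunc t01 s0 hX hc _ cvg0_cst) => [x|M]; first exact: normr_ge0.
rewrite addr0; apply: le_trans (_ : texp M.+1 s (fun x => F b x ^+ 2) <= _).
  apply: texp_le_valid => x vx; rewrite /remainder /fluct exp_heightE.
  by apply: log_linearization => //; exact: log_height_ge0.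
by apply: (texp_fluct2 t01 kappa_le1 s0 sB) => //; rewrite s0 lexx.
Qed.

Lemma measurable_log_height b : (b <= n)%N -> measurable_fun setT (fun w => log_height e b (X s w)).
Proof. by move=> bn; exact: measurable_first_coords s0 hX _ _ (first_coords_log_height e bn). Qed.

Lemma remainder_integrable b : (b <= n)%N -> P.-integrable setT (EFin \o (fun w => remainder b (X s w))).
Proof.
move=> bn; have [ir _] := remainder_bound bn.
apply: le_integrable ir => // [|w _ /=]; last by rewrite lee_fin normr_id.
apply/measurable_EFinP; apply: measurable_funB.
  by apply: measurable_funB => //; exact: measurable_log_height.
by apply: measurable_funM => //; exact: measurable_fluct.
Qed.

Lemma log_heightE b x : log_height e b x =
  ln (truncexp sigma b) + ((truncexp sigma b)^-1 * F b x + remainder b x).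
Proof. by rewrite /remainder; ring. Qed.

Lemma log_height_mean b : (b <= n)%N ->
  P.-integrable setT (EFin \o (fun w => log_height e b (X s w))) /\
  \int[P]_w log_height e b (X s w) = ln (truncexp sigma b) + \int[P]_w remainder b (X s w).
Proof.
move=> bn; have Fi := integrable_scale (truncexp sigma b)^-1 (fluct_integrable bn).
have Ri := remainder_integrable bn; have FRi := integrable_add Fi Ri.
have ci (c : R) : P.-integrable setT (EFin \o (fun=> c)) by exact: (@prob_bounded_integrable _ _ _ P (cst c) `|c|).
under eq_fun do rewrite log_heightE.
split; first exact: integrable_add.
rewrite (Rintegral_add (ci _) FRi) (Rintegral_add Fi Ri) Rintegral_scale ?fluct_mean ?mulr0 ?add0r ?Rintegral_prob_cst //.
exact: fluct_integrable.
Qed.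

(** Equals [sqrt e] times the centered sum of the first [b] positions, since [log_height] carries a
    factor [e] and the deterministic labels cancel. *)
Definition height_fluctuation b w : R :=
  (Num.sqrt e)^-1 * (log_height e b (X s w) - \int[P]_w' log_height e b (X s w')).

Lemma coordinate_fluctuation i w : (i < n)%N ->
  Num.sqrt e * ((X s w i)%:~R - fine ('E_P[fun w' => (X s w' i)%:~R])%E) =
  height_fluctuation i.+1 w - height_fluctuation i w.
Proof.
move=> il; have [i1 _] := log_height_mean il; have [i2 _] := log_height_mean (ltnW il).
have xE w' : (X s w' i)%:~R = e^-1 * (log_height e i.+1 (X s w') + (-1) * log_height e i (X s w')) + (- i.+1%:R) :> R.
  by rewrite mulN1r log_heightS mulKf ?gt_eqF // addrK.
have ci (c : R) : P.-integrable setT (EFin \o (fun=> c)) by exact: (@prob_bounded_integrable _ _ _ P (cst c) `|c|).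
have i3 := integrable_add i1 (integrable_scale (-1) i2).
have i4 := integrable_scale e^-1 i3; have i5 := integrable_add i4 (ci (- i.+1%:R)).
have -> : (fun w' => (X s w' i)%:~R) = (fun w' => e^-1 * (log_height e i.+1 (X s w') + (-1) * log_height e i (X s w')) + (- i.+1%:R)) :> (T -> R).
  by apply/funext.
have mE : \int[P]_w' (e^-1 * (log_height e i.+1 (X s w') + (-1) * log_height e i (X s w')) + (- i.+1%:R)) =
    e^-1 * (\int[P]_w' log_height e i.+1 (X s w') - \int[P]_w' log_height e i (X s w')) - i.+1%:R.
  rewrite (Rintegral_add i4 (ci _)) (Rintegral_scale e^-1 i3).
  rewrite (Rintegral_add i1 (integrable_scale (-1) i2)) (Rintegral_scale (-1) i2) mulN1r.
  by rewrite Rintegral_prob_cst.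
rewrite unlock (EFin_Rintegral i5) mE xE /= mulN1r.
rewrite /height_fluctuation; set a := log_height e i.+1 _; set b := log_height e i _.
set a' := \int[P]_w' log_height e i.+1 _; set b' := \int[P]_w' log_height e i _.
have s_neq0 : Num.sqrt e != 0 by rewrite gt_eqF // sqrtr_gt0.
have -> : e^-1 = (Num.sqrt e)^-1 * (Num.sqrt e)^-1.
  by rewrite -invfM -expr2 sqr_sqrtr // ltW.
by move: a b a' b' => a b a' b'; field.
Qed.

Lemma measurable_height_fluctuation b : (b <= n)%N -> measurable_fun setT (height_fluctuation b).
Proof.
move=> bn; apply: measurable_funM => //; apply: measurable_funB => //.
exact: measurable_log_height.
Qed.

Lemma fluct_abs_moment b : (b <= n)%N ->
  P.-integrable setT (EFin \o (fun w => `|F b (X s w)|)) /\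
  \int[P]_w `|F b (X s w)| <= Num.sqrt kappa * (1 + var_bound B b).
Proof.
move=> bn; have [i2 h2] := fluct_second_moment bn.
have Fi : P.-integrable setT (EFin \o (fun w => `|F b (X s w)|)) by exact: (integrable_abse (fluct_integrable bn)).
split=> //; set v := Num.sqrt kappa.
have v0 : 0 < v by rewrite sqrtr_gt0.
have vv : v * v = kappa by rewrite -expr2 sqr_sqrtr // ltW.
have ci (c : R) : P.-integrable setT (EFin \o (fun=> c)) by exact: (@prob_bounded_integrable _ _ _ P (cst c) `|c|).
have i3 := integrable_scale v^-1 i2.
apply: (@le_trans _ _ (\int[P]_w (v + v^-1 * F b (X s w) ^+ 2))).
  apply: le_Rintegral => //; first exact: integrable_add.
  move=> w _; set u := F b _; rewrite -(ler_pM2l v0) mulrDr mulVKf ?gt_eqF //.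
  have := sqr_ge0 (`|u| - v); rewrite -[u ^+ 2]real_normK ?num_real //.
  by have := normr_ge0 u; nra.
rewrite RintegralD // RintegralZl // Rintegral_cst // [X in fine X](probability_setT P) mulr1.
rewrite mulrDr mulr1 lerD2l -(ler_pM2l v0) mulVKf ?gt_eqF // mulrA vv.
exact: h2.
Qed.

Variable D : nat -> R.

(** The first term compares the prefactor with its limit [1 / D b]; the second counts the
    linearization remainder twice, once for itself and once for its mean. *)
Definition linearization_error b : R :=
  `|Num.sqrt kappa / Num.sqrt e / truncexp sigma b - (D b)^-1| * (1 + var_bound B b) +
  2 * (kappa / Num.sqrt e) * var_bound B b.

Lemma height_fluctuation_linear b : (b <= n)%N ->
  P.-integrable setT (EFin \o (fun w => `|height_fluctuation b w - (Num.sqrt kappa)^-1 * (F b (X s w) / D b)|)) /\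
  \int[P]_w `|height_fluctuation b w - (Num.sqrt kappa)^-1 * (F b (X s w) / D b)| <= linearization_error b.
Proof.
move=> bn; set v := Num.sqrt kappa; set q := Num.sqrt e.
have v0 : 0 < v by rewrite sqrtr_gt0.
have q0 : 0 < q by rewrite sqrtr_gt0.
have [Fi hF] := fluct_abs_moment bn; have [Ri hR] := remainder_bound bn.
have [_ hL] := log_height_mean bn.
set m := \int[P]_w remainder b (X s w) in hL.
have hm : `|m| <= kappa * var_bound B b.
  apply: le_trans hR; apply: le_normr_Rintegral => //; exact: remainder_integrable.
pose a := v / q / truncexp sigma b - (D b)^-1.
have ci (c : R) : P.-integrable setT (EFin \o (fun=> c)) by exact: (@prob_bounded_integrable _ _ _ P (cst c) `|c|).
have bound w : `|height_fluctuation b w - v^-1 * (F b (X s w) / D b)| <=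
    `|a| * v^-1 * `|F b (X s w)| + (q^-1 * `|remainder b (X s w)| + q^-1 * `|m|).
  have -> : height_fluctuation b w - v^-1 * (F b (X s w) / D b) =
      a * v^-1 * F b (X s w) + (q^-1 * remainder b (X s w) - q^-1 * m).
    rewrite /height_fluctuation hL log_heightE -/q /a.
    have -> : v / q / truncexp sigma b = v * (q^-1 / truncexp sigma b) by rewrite mulrA.
    move: (q^-1) ((truncexp sigma b)^-1) ((D b)^-1) => q' t' D'; field.
    by rewrite gt_eqF.
  apply: le_trans (ler_normD _ _) _; apply: lerD.
    by rewrite !normrM (gtr0_norm (_ : 0 < v^-1)) ?invr_gt0.
  apply: le_trans (ler_normB _ _) _.
  by rewrite !normrM (gtr0_norm (_ : 0 < q^-1)) ?invr_gt0.
have i1 := integrable_scale (`|a| * v^-1) Fi.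
have i2 := integrable_scale q^-1 Ri.
have i3 := integrable_add i2 (ci (q^-1 * `|m|)).
have i4 := integrable_add i1 i3.
have hi : P.-integrable setT (EFin \o (fun w => `|height_fluctuation b w - v^-1 * (F b (X s w) / D b)|)).
  apply: le_integrable i4 => // [|w _ /=].
    apply/measurable_EFinP; apply: measurableT_comp => //; apply: measurable_funB.
      exact: measurable_height_fluctuation.
    by apply: measurable_funM => //; apply: measurable_funM => //; exact: measurable_fluct.
  by rewrite lee_fin normr_id; apply: le_trans (bound w) (ler_norm _).
split=> //.
apply: le_trans (le_Rintegral _ hi i4 (fun w _ => bound w)) _ => //.
rewrite RintegralD // RintegralZl // RintegralD // RintegralZl // Rintegral_cst //.
rewrite [X in fine X](probability_setT P) mulr1 /linearization_error -/v -/q -/a; apply: lerD.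
  rewrite -mulrA ler_wpM2l // -(ler_pM2l v0) mulVKf ?gt_eqF //; exact: hF.
have -> : 2 * (kappa / q) * var_bound B b = q^-1 * (kappa * var_bound B b) + q^-1 * (kappa * var_bound B b) by ring.
by apply: lerD; rewrite ler_wpM2l // invr_ge0 ltW.
Qed.

Lemma height_fluctuation_moment b : (b <= n)%N ->
  P.-integrable setT (EFin \o (fun w => `|height_fluctuation b w|)) /\
  \int[P]_w `|height_fluctuation b w| <= linearization_error b + `|D b|^-1 * (1 + var_bound B b).
Proof.
move=> bn; set v := Num.sqrt kappa; have v0 : 0 < v by rewrite sqrtr_gt0.
have [i1 h1] := height_fluctuation_linear bn; have [i2 h2] := fluct_abs_moment bn.
have i3 := integrable_scale (v^-1 * `|D b|^-1) i2.
have i4 := integrable_add i1 i3.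
have bound w : `|height_fluctuation b w| <= `|height_fluctuation b w - v^-1 * (F b (X s w) / D b)| +
    v^-1 * `|D b|^-1 * `|F b (X s w)|.
  have -> : v^-1 * `|D b|^-1 * `|F b (X s w)| = `|v^-1 * (F b (X s w) / D b)|.
    by rewrite !normrM !normfV (gtr0_norm v0); ring.
  by rewrite -{1}[height_fluctuation b w](subrK (v^-1 * (F b (X s w) / D b))) ler_normD.
have hi : P.-integrable setT (EFin \o (fun w => `|height_fluctuation b w|)).
  apply: le_integrable i4 => // [|w _ /=].
    apply/measurable_EFinP; apply: measurableT_comp => //; exact: measurable_height_fluctuation.
  by rewrite lee_fin normr_id; apply: le_trans (bound w) (ler_norm _).
split=> //; apply: le_trans (le_Rintegral _ hi i4 (fun w _ => bound w)) _ => //.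
rewrite RintegralD // RintegralZl //; apply: lerD => //.
rewrite [v^-1 * _]mulrC -mulrA ler_wpM2l ?invr_ge0 // -(ler_pM2l v0) mulVKf ?gt_eqF //; exact: h2.
Qed.

Variables (eta : nat -> R) (c : R).
Let xi r : R := if (r <= n)%N then eta r / D r else 0.

Definition limit_form (u : R) : R :=
  \sum_(r < n.+1) \sum_(r' < n.+1) eta r / D r * (eta r' / D r') * sym_cov u r r'.

Lemma fluct_cos :
  `|\int[P]_w cos ((Num.sqrt kappa)^-1 * (\sum_(r < n.+1) eta r / D r * F r (X s w)) + c) -
    cos c * expR (- (limit_form sigma / 2))| <=
  half_bound n xi B * (B * Num.sqrt kappa * clt_const n xi B).
Proof.
have xs i : (n < i)%N -> xi i = 0 by rewrite ltnNge /xi => /negPf ->.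
have xiE (r : 'I_n.+1) : xi r = eta r / D r by rewrite /xi -ltnS ltn_ord.
pose h x : R := cos ((Num.sqrt kappa)^-1 * (\sum_(r < n.+1) eta r / D r * F r x) + c).
have hc : first_coords n h.
  move=> x y xy; rewrite /h; congr (cos (_ * _ + _)); apply: eq_bigr => r _.
  by rewrite (first_coords_fluct (_ : (r <= n)%N) xy) // -ltnS.
have mh : measurable_fun setT (fun w => h (X s w)) by exact: measurable_first_coords s0 hX _ _ hc.
have hi : P.-integrable setT (EFin \o (fun w => h (X s w))).
  by apply: (prob_bounded_integrable P mh (M := 1)) => w; rewrite ler_norml cos_geN1 cos_le1.
have ci (a : R) : P.-integrable setT (EFin \o (fun=> a)) by exact: (@prob_bounded_integrable _ _ _ P (cst a) `|a|).
set q := cos c * _; set K := _ * (_ * _ * _).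
have one_side (sg : R) : `|sg| = 1 -> sg * \int[P]_w h (X s w) <= sg * q + K.
  move=> sg1.
  have hsg x : -1 <= sg * h x <= 1.
    by rewrite -ler_norml normrM sg1 mul1r ler_norml cos_geN1 cos_le1.
  (* The constant 1 makes the function nonnegative, as the passage from truncated to true
     expectations requires; both signs together give the absolute value. *)
  have hc1 : first_coords n (fun x => 1 + sg * h x) by exact: first_coords_comp (fun u => 1 + sg * u) hc.
  have h0 x : 0 <= 1 + sg * h x by have := hsg x; lra.
  have eps : (fun M => half_bound n xi B * half_bound n xi B * (1 : R) ^+ M.+1 * expterm s M * s) @ \oo --> (0 : R).
    exact: vanishing_expterm.
  have hE : ('E_P[fun w => (1 + sg * h (X s w))%R] <= (1 + (sg * q + K))%:E)%E.
    apply: (expect_le_trunc t01 s0 hX hc1 h0 eps) => M.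
    apply: le_trans (_ : texp M.+1 s (fun=> 1) + texp M.+1 s (fun x => sg * h x) <= _).
      by rewrite -trunc_expectD.
    rewrite -!addrA; apply: lerD; first exact: texp_cst_le.
    have := cos_estimate t01 xs kappa_le1 s0 sB c (sg := sg) M; rewrite sg1 lexx => /(_ isT).
    have -> : (fun x => sg * cos ((Num.sqrt kappa)^-1 * \sum_(r < n.+1) xi r * fluct t r s x + c)) = (fun x => sg * h x).
      apply/funext => x; rewrite /h; congr (_ * cos (_ * _ + _)); apply: eq_bigr => r _.
      by rewrite xiE.
    have -> : \sum_(r < n.+1) \sum_(r' < n.+1) xi r * xi r' * sym_cov sigma r r' = limit_form sigma.
      by apply: eq_bigr => r _; apply: eq_bigr => r' _; rewrite !xiE.
    move=> h1; apply: le_trans h1 _; rewrite -/q lerD2l mulrDr /K lerD2l expr1n.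
    by rewrite le_eqVlt; apply/orP; left; apply/eqP; ring.
  have [_] := bounded_expectation hc1 h0 hE.
  rewrite RintegralD //; last exact: integrable_scale.
  by rewrite RintegralZl // Rintegral_cst // [X in fine X](probability_setT P) mulr1 lerD2l.
have h1 := one_side 1 (normr1 _); have h2 := one_side (-1).
rewrite normrN1 in h2; have {}h2 := h2 erefl.
rewrite ler_norml; apply/andP; split; lra.
Qed.

Lemma fluctuation_cos :
  `|\int[P]_w cos (\sum_(r < n.+1) eta r * height_fluctuation r w + c) -
    cos c * expR (- (limit_form sigma / 2))| <=
  \sum_(r < n.+1) `|eta r| * linearization_error r +
  half_bound n xi B * (B * Num.sqrt kappa * clt_const n xi B).
Proof.
set v := Num.sqrt kappa; have v0 : 0 < v by rewrite sqrtr_gt0.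
set A := \int[P]_w cos _; set Q := cos c * _.
pose b w := cos (v^-1 * (\sum_(r < n.+1) eta r / D r * F r (X s w)) + c).
rewrite (_ : A - Q = (A - \int[P]_w b w) + (\int[P]_w b w - Q)); last by rewrite addrA subrK.
apply: le_trans (ler_normD _ _) _; apply: lerD; last exact: fluct_cos.
have rn (r : 'I_n.+1) : (r <= n)%N by rewrite -ltnS.
have ma : measurable_fun setT (fun w => cos (\sum_(r < n.+1) eta r * height_fluctuation r w + c)).
  apply: measurableT_comp; first exact: continuous_measurable_fun (@continuous_cos R).
  apply: measurable_funD => //; apply: measurable_sum => r; apply: measurable_funM => //.
  exact: measurable_height_fluctuation.
have mb : measurable_fun setT b.
  apply: measurableT_comp; first exact: continuous_measurable_fun (@continuous_cos R).
  apply: measurable_funD => //; apply: measurable_funM => //; apply: measurable_sum => r.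
  by apply: measurable_funM => //; exact: measurable_fluct.
have ia : P.-integrable setT (EFin \o (fun w => cos (\sum_(r < n.+1) eta r * height_fluctuation r w + c))).
  by apply: (@prob_bounded_integrable _ _ _ P _ 1 ma) => w; rewrite ler_norml cos_geN1 cos_le1.
have ib : P.-integrable setT (EFin \o b).
  by apply: (@prob_bounded_integrable _ _ _ P _ 1 mb) => w; rewrite ler_norml cos_geN1 cos_le1.
rewrite /A -RintegralB //; apply: le_trans (le_normr_Rintegral _ _) _ => //.
  by have := integrable_add ia (integrable_scale (-1) ib); under eq_fun do rewrite mulN1r.
pose g (r : nat) w := `|height_fluctuation r w - v^-1 * (F r (X s w) / D r)|.
have sumi k : (k <= n.+1)%N -> P.-integrable setT (EFin \o (fun w => \sum_(r < k) `|eta r| * g r w)) /\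
    \int[P]_w (\sum_(r < k) `|eta r| * g r w) <= \sum_(r < k) `|eta r| * linearization_error r.
  elim: k => [_|k IH kn].
    split.
      rewrite (_ : (fun w => _) = cst 0); last by apply/funext => w; rewrite big_ord0.
      by apply: (@prob_bounded_integrable _ _ _ P _ 0) => // w; rewrite normr0.
    under eq_Rintegral do rewrite big_ord0.
    by rewrite Rintegral_cst // mul0r big_ord0.
  have [ik hk] := IH (ltnW kn); have [il hl] := height_fluctuation_linear kn.
  have sE w : \sum_(r < k.+1) `|eta r| * g r w = \sum_(r < k) `|eta r| * g r w + `|eta k| * g k w.
    by rewrite big_ord_recr.
  have i2 := integrable_scale `|eta k| il.
  split; first by under eq_fun do rewrite sE; exact: integrable_add.
  under eq_Rintegral do rewrite sE.
  by rewrite RintegralD // big_ord_recr /= RintegralZl // lerD // ler_wpM2l.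
have [si hs] := sumi n.+1 (leqnn _).
apply: le_trans hs; apply: le_Rintegral => //.
- by have := integrable_add ia (integrable_scale (-1) ib); under eq_fun do rewrite mulN1r; move=> /integrable_abse.
move=> w _; rewrite /b.
set y := v^-1 * _ + c; set x := \sum_(r < n.+1) eta r * height_fluctuation r w + c.
(* The cosine is 1-Lipschitz, so the first absolute moments of the linearization errors suffice. *)
have := cos_lipschitz y (x - y); rewrite addrCA subrr addr0 => h; apply: le_trans h _.
have -> : x - y = \sum_(r < n.+1) eta r * (height_fluctuation r w - v^-1 * (F r (X s w) / D r)).
  rewrite /x /y opprD addrACA subrr addr0 mulr_sumr -sumrB; apply: eq_bigr => r _; ring.
apply: le_trans (ler_norm_sum _ _ _) _; apply: ler_sum => r _.
by rewrite normrM.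
Qed.

End FixedTime.

(** * The Gaussian limit *)

Section GaussianVectors.
Variable R : realType.

Definition rv_of d (T : measurableType d) (P : probability T R) (f : T -> R) (mf : measurable_fun [set: T] f) :
  {RV P >-> R} := HB.pack f (isMeasurableFun.Build _ _ T R f mf).

Lemma gaussian_family_exists n (A : nat -> nat -> R) : (forall i j, A i j = A j i) -> psd n A ->
  exists (d : measure_display) (T : measurableType d) (P : probability T R) (G : 'I_n -> {RV P >-> R}),
  forall (a : 'I_n -> R) (S : set R), measurable S ->
    P ((fun w => \sum_(i < n) a i * G i w) @^-1` S) =
    gauss_law (Num.sqrt (\sum_(i < n) \sum_(j < n) a i * a j * A i j)) S.
Proof.
move=> sA pA; have [B hB] := psd_factor sA pA.
have [d [T [P [Z hZ]]]] := std_normal_family_exists R n.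
have mG (i : 'I_n) : measurable_fun [set: T] (fun w => \sum_(k < n) B i k * Z k w).
  by apply: measurable_sum => k; apply: measurable_funM.
pose G (i : 'I_n) : {RV P >-> R} := rv_of P (mG i).
exists d, T, P, G => a S mS.
pose b k := \sum_(i < n) a i * B i k.
have -> : (fun w => \sum_(i < n) a i * G i w) = (fun w => \sum_(k < n) b k * Z k w).
  apply/funext => w; rewrite (eq_bigr (fun i : 'I_n => \sum_(k < n) a i * B i k * Z k w)).
    by rewrite exchange_big; apply: eq_bigr => k _; rewrite mulr_suml.
  by move=> i _; rewrite mulr_sumr; apply: eq_bigr => k _; rewrite mulrA.
have E : \sum_(k < n) b k ^+ 2 = \sum_(i < n) \sum_(j < n) a i * a j * A i j.
  rewrite (eq_bigr (fun k : 'I_n => \sum_(i < n) \sum_(j < n) a i * a j * (B i k * B j k))); last first.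
    move=> k _; rewrite expr2 mulr_suml; apply: eq_bigr => i _; rewrite mulr_sumr.
    by apply: eq_bigr => j _; ring.
  rewrite exchange_big; apply: eq_bigr => i _; rewrite exchange_big; apply: eq_bigr => j _.
  by rewrite -mulr_sumr hB.
by rewrite (hZ b S mS) E.
Qed.

Variables (n : nat) (A : nat -> nat -> R).
Hypothesis sA : forall i j, A i j = A j i.
Hypothesis pA : psd n A.
Variables (d : measure_display) (T : measurableType d) (P : probability T R) (G : 'I_n -> {RV P >-> R}).
Hypothesis hG : forall (a : 'I_n -> R) (S : set R), measurable S ->
  P ((fun w => \sum_(i < n) a i * G i w) @^-1` S) =
  gauss_law (Num.sqrt (\sum_(i < n) \sum_(j < n) a i * a j * A i j)) S.
Implicit Types a b : 'I_n -> R.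

Definition lin_form a w : R := \sum_(i < n) a i * G i w.
Definition bilin a b : R := \sum_(i < n) \sum_(j < n) a i * b j * A i j.

Lemma measurable_lin_form a : measurable_fun setT (lin_form a).
Proof. by apply: measurable_sum => i; apply: measurable_funM. Qed.

Lemma bilinC a b : bilin a b = bilin b a.
Proof.
rewrite /bilin exchange_big; apply: eq_bigr => j _; apply: eq_bigr => i _.
by rewrite sA [a i * _]mulrC.
Qed.

Lemma bilin_ge0 a : 0 <= bilin a a.
Proof.
pose x k : R := if insub k is Some i then a i else 0.
have := pA x; congr (_ <= _); apply: eq_bigr => i _; apply: eq_bigr => j _.
by rewrite /x !valK.
Qed.

Lemma lin_form_moments a :
  [/\ \int[P]_w lin_form a w = 0, P.-integrable setT (EFin \o (fun w => lin_form a w ^+ 2)),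
      P.-integrable setT (EFin \o lin_form a) & \int[P]_w (lin_form a w ^+ 2) = bilin a a].
Proof.
have s0 := sqrtr_ge0 (bilin a a); have mW := measurable_lin_form a; have hW := hG a.
split.
- exact: (gauss_mean s0 mW hW).
- exact: (integrable_gauss_pow s0 mW hW 2).
- by have := integrable_gauss_pow s0 mW hW 1; under eq_fun do rewrite expr1.
- by rewrite (gauss_second_moment s0 mW hW) sqr_sqrtr // bilin_ge0.
Qed.

Lemma lin_form_cos a c : \int[P]_w cos (lin_form a w + c) = cos c * expR (- (bilin a a / 2)).
Proof.
rewrite (gauss_cos (sqrtr_ge0 (bilin a a)) (measurable_lin_form a) (hG a)) sqr_sqrtr //.
exact: bilin_ge0.
Qed.

(** Polarization: the product is half the square of the sum minus the two squares, and second
    moments of linear forms are known from their laws. *)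
Lemma lin_form_covariance a b :
  fine (covariance P (lin_form a) (lin_form b)) = bilin a b.
Proof.
have [ma i2a i1a va] := lin_form_moments a; have [mb i2b i1b vb] := lin_form_moments b.
pose ab i : R := a i + b i.
have [mab i2ab i1ab vab] := lin_form_moments ab.
have abE w : lin_form ab w = lin_form a w + lin_form b w.
  by rewrite /lin_form -big_split; apply: eq_bigr => i _; rewrite /ab mulrDl.
have E0 f : P.-integrable setT (EFin \o f) -> \int[P]_w f w = 0 -> fine ('E_P[f])%E = 0.
  by move=> fi f0; rewrite unlock EFin_Rintegral //= f0.
rewrite covariance.unlock (E0 _ i1a ma) (E0 _ i1b mb).
have prodE w : (lin_form a \- cst 0) w * (lin_form b \- cst 0) w =
   2^-1 * (lin_form ab w ^+ 2 + (-1) * (lin_form a w ^+ 2 + lin_form b w ^+ 2)).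
  by rewrite /= !subr0 abE; field.
have iS := integrable_add i2a i2b; have iT := integrable_add i2ab (integrable_scale (-1) iS).
rewrite unlock /= (_ : (fun x => _) = EFin \o (fun w => 2^-1 * (lin_form ab w ^+ 2 + (-1) * (lin_form a w ^+ 2 + lin_form b w ^+ 2)))); last first.
  by apply/funext => w; rewrite /=; congr _%:E; exact: prodE.
rewrite EFin_Rintegral /=; last exact: integrable_scale.
rewrite (Rintegral_scale 2^-1 iT) (Rintegral_add i2ab (integrable_scale (-1) iS)).
rewrite (Rintegral_scale (-1) iS) (Rintegral_add i2a i2b) vab va vb.
have -> : bilin ab ab = bilin a a + bilin a b + (bilin b a + bilin b b).
  rewrite /bilin -!big_split; apply: eq_bigr => i _; rewrite -!big_split; apply: eq_bigr => j _ /=.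
  by rewrite /ab; ring.
by rewrite [bilin b a]bilinC; field.
Qed.

End GaussianVectors.

(** Markov's inequality. *)
Lemma tail_event_le (R : realType) d (T : measurableType d) (P : probability T R) (Y : T -> nat -> R)
    (r C : R) i : 0 < r -> measurable_fun setT (fun w => Y w i) ->
  P.-integrable setT (EFin \o (fun w => `|Y w i|)) -> \int[P]_w `|Y w i| <= C ->
  (P (tail_event Y r i) <= (C / r)%:E)%E.
Proof.
move=> r0 mY iY hC.
have mt : measurable (tail_event Y r i).
  have -> : tail_event Y r i = (fun w => `|Y w i|) @^-1` `]r, +oo[%classic.
    by apply/seteqP; split => w; rewrite /tail_event /= in_itv /= andbT.
  rewrite -[_ @^-1` _]setTI.
  by apply: (measurableT_comp _ mY) => //; exact: normr_measurable.
have hi : P.-integrable setT (EFin \o (fun w => r * \1_(tail_event Y r i) w)).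
  apply: integrable_scale; apply: (@prob_bounded_integrable _ _ _ P _ 1) => [|w].
    exact: measurable_indic.
  by rewrite indicE ger0_norm // lern1 leq_b1.
have : \int[P]_w (r * \1_(tail_event Y r i) w) <= C.
  apply: le_trans hC; apply: le_Rintegral => // w _; rewrite indicE.
  have [/set_mem h|_] := boolP (w \in _); last by rewrite mulr0.
  by rewrite mulr1 ltW.
have ii : P.-integrable setT (EFin \o \1_(tail_event Y r i)).
  apply: (@prob_bounded_integrable _ _ _ P _ 1) => [|w]; first exact: measurable_indic.
  by rewrite indicE ger0_norm // lern1 leq_b1.
rewrite (Rintegral_scale r ii) mulrC -ler_pdivlMr // /Rintegral integral_indic // setIT => h.
by rewrite -(fineK (_ : P (tail_event Y r i) \is a fin_num)) ?lee_fin // fin_num_measure.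
Qed.

(** * From partial sums to single particles *)

Section PartialSums.
Variable R : realType.
Implicit Types (xi a : nat -> R).

Definition backward_diff n xi r : R :=
  (if r is r'.+1 then xi r' else 0) - (if (r < n)%N then xi r else 0).

Lemma summation_by_parts n xi a :
  \sum_(i < n) xi i * (a i.+1 - a i) = \sum_(r < n.+1) backward_diff n xi r * a r.
Proof.
rewrite (eq_bigr (fun i : 'I_n => xi i * a i.+1 - xi i * a i)); last by move=> i _; rewrite mulrBr.
rewrite sumrB (eq_bigr (fun r : 'I_n.+1 => (if nat_of_ord r is r'.+1 then xi r' else 0) * a r -
   (if (r < n)%N then xi r else 0) * a r)); last by move=> r _; rewrite mulrBl.
rewrite sumrB; congr (_ - _).
  by rewrite [RHS]big_ord_recl /= mul0r add0r; apply: eq_bigr.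
rewrite [RHS]big_ord_recr /= ltnn mul0r addr0; apply: eq_bigr => i _.
by rewrite ltn_ord.
Qed.

(** If [K] is the covariance of partial sums, this is the covariance of the summands [i] and [j]. *)
Definition mixed_diff (K : nat -> nat -> R) i j : R :=
  K i.+1 j.+1 - K i.+1 j - (K i j.+1 - K i j).

Lemma summation_by_parts2 n xi (K : nat -> nat -> R) :
  \sum_(r < n.+1) \sum_(r' < n.+1) backward_diff n xi r * backward_diff n xi r' * K r r' =
  \sum_(i < n) \sum_(j < n) xi i * xi j * mixed_diff K i j.
Proof.
pose a r := \sum_(j < n) xi j * (K r j.+1 - K r j).
rewrite (eq_bigr (fun r : 'I_n.+1 => backward_diff n xi r * a r)); last first.
  move=> r _; rewrite /a (summation_by_parts n xi (K r)) mulr_sumr; apply: eq_bigr => r' _.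
  by rewrite mulrA.
rewrite -summation_by_parts; apply: eq_bigr => i _; rewrite /a -sumrB mulr_sumr.
by apply: eq_bigr => j _; rewrite /mixed_diff -mulrBr mulrA.
Qed.

Lemma telescope_ord m (a : nat -> R) : \sum_(i < m) (a i.+1 - a i) = a m - a 0%N.
Proof.
elim: m => [|m IH]; first by rewrite big_ord0 subrr.
by rewrite big_ord_recr /= IH addrC addrA subrK.
Qed.

Lemma sum_mixed_diff (K : nat -> nat -> R) r s : (forall j, K 0%N j = 0) -> (forall i, K i 0%N = 0) ->
  \sum_(i < r) \sum_(j < s) mixed_diff K i j = K r s.
Proof.
move=> K0 K0'; rewrite (eq_bigr (fun i : 'I_r => K i.+1 s - K i s)).
  by rewrite (telescope_ord r (fun i => K i s)) K0 subr0.
move=> i _; rewrite sumrB (telescope_ord s (K i.+1)) (telescope_ord s (K i)).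
by rewrite !K0' !subr0.
Qed.

End PartialSums.

(** * Limits as the parameter tends to zero *)

Section SmallParameterLimits.
Variables (R : realType) (tau : R).
Hypothesis tau0 : 0 < tau.
Implicit Type e : R.

Definition macro_time e : R := tau / (1 - expR (- e)).
Local Notation kap e := (tkappa (expR (- e))).

Lemma kappaE e : kap e = expR e - 1.
Proof. by rewrite /tkappa -expRN opprK. Qed.

Lemma macro_timeE e : 0 < e -> kap e * macro_time e = tau * expR e.
Proof.
move=> e0; rewrite kappaE /macro_time expRN; have h : expR e != 1 by rewrite gt_eqF // expR_gt1.
have h' := lt0r_neq0 (expR_gt0 e); field; rewrite h' subr_eq0 h; exact: isT.
Qed.

Lemma macro_time_ge0 e : 0 < e -> 0 <= macro_time e.
Proof. by move=> e0; rewrite divr_ge0 ?ltW // subr_gt0 expR_lt1 oppr_lt0. Qed.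

Lemma cvg_expR0 : expR e @[e --> 0^'+] --> (1 : R).
Proof. by apply: cvg_at_right_filter; rewrite -(@expR0 R); exact: continuous_expR. Qed.

Lemma cvg_kappa : kap e @[e --> 0^'+] --> (0 : R).
Proof.
under eq_fun do rewrite kappaE.
have h : expR e - 1 @[e --> 0^'+] --> (1 - 1 : R) by apply: cvgB; [exact: cvg_expR0 | exact: cvg_cst].
by rewrite subrr in h.
Qed.

Lemma cvg_sqrt_kappa : Num.sqrt (kap e) @[e --> 0^'+] --> (0 : R).
Proof.
have h : Num.sqrt (kap e) @[e --> 0^'+] --> Num.sqrt (0 : R).
  by apply: cvg_comp; [exact: cvg_kappa | exact: sqrt_continuous].
by rewrite sqrtr0 in h.
Qed.

Lemma cvg_ratio : Num.sqrt (kap e) / Num.sqrt e @[e --> 0^'+] --> (1 : R).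
Proof.
apply: (@squeeze_cvgr _ _ _ _ (fun=> 1) expR); [|exact: cvg_cst|exact: cvg_expR0].
near=> e; have e0 : 0 < e by near: e; exact: nbhs_right_gt.
have q0 : 0 < Num.sqrt e by rewrite sqrtr_gt0.
have k1 : e <= kap e by rewrite kappaE; have := expR_ge1Dx e; lra.
have k0 : 0 < kap e by lra.
have k2 : kap e <= e * expR e.
  have h := expR_ge1Dx (- e); rewrite expRN in h; have E0 := expR_gt0 e.
  have : (1 - e) * expR e <= (expR e)^-1 * expR e by rewrite ler_pM2r.
  by rewrite mulVf ?lt0r_neq0 // kappaE; lra.
set r := _ / _; have r2 : r ^+ 2 = kap e / e.
  by rewrite /r exprMn exprVn !sqr_sqrtr // ltW.
(* Since the ratio is at least 1 it is at most its square [kappa / e], which is at most [exp e]. *)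
have r1 : 1 <= r by rewrite /r ler_pdivlMr // mul1r ler_wsqrtr.
rewrite r1 /=; apply: le_trans (_ : r ^+ 2 <= _).
  by rewrite expr2 ler_peMr // (le_trans ler01).
by rewrite r2 ler_pdivrMr // mulrC.
Unshelve. all: by end_near.
Qed.

Lemma cvg_kappa_sqrt : kap e / Num.sqrt e @[e --> 0^'+] --> (0 : R).
Proof.
have h : Num.sqrt (kap e) * (Num.sqrt (kap e) / Num.sqrt e) @[e --> 0^'+] --> (0 * 1 : R).
  by apply: cvgM; [exact: cvg_sqrt_kappa | exact: cvg_ratio].
rewrite mul0r in h.
apply: cvg_trans h; apply: near_eq_cvg; near=> e.
have e0 : 0 < e by near: e; exact: nbhs_right_gt.
have k0 : 0 <= kap e by rewrite kappaE; have := expR_ge1Dx e; lra.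
by rewrite /= mulrA -expr2 sqr_sqrtr.
Unshelve. all: by end_near.
Qed.

Lemma cvg_macro_time (f : R -> R) : {for tau, continuous f} ->
  f (kap e * macro_time e) @[e --> 0^'+] --> f tau.
Proof.
move=> cf; apply: (@cvg_comp _ _ _ (fun e => kap e * macro_time e) f _ (nbhs tau)); last exact: cf.
have h : tau * expR e @[e --> 0^'+] --> tau * 1 by apply: cvgM; [exact: cvg_cst | exact: cvg_expR0].
rewrite mulr1 in h; apply: cvg_trans h; apply: near_eq_cvg; near=> e.
by rewrite macro_timeE //; near: e; exact: nbhs_right_gt.
Unshelve. all: by end_near.
Qed.

Lemma near_small : \forall e \near (0 : R)^'+,
  [/\ 0 < e, kap e <= 1 & kap e * macro_time e <= 2 * tau].
Proof.
have /cvgrPdist_le/(_ 1 ltr01) h := cvg_expR0.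
near=> e; have e0 : 0 < e by near: e; exact: nbhs_right_gt.
have E2 : expR e <= 2.
  have : `|1 - expR e| <= 1 by near: e; exact: h.
  by rewrite ler_norml => /andP[]; lra.
split=> //; first by rewrite kappaE; lra.
by rewrite macro_timeE // mulrC ler_wpM2r // ltW.
Unshelve. all: by end_near.
Qed.

Lemma cvg_linearization_error (B : R) b :
  linearization_error e (macro_time e) B (truncexp tau) b @[e --> 0^'+] --> (0 : R).
Proof.
pose V := var_bound B b; pose D := truncexp tau b.
have D0 : D != 0 by rewrite gt_eqF // (lt_le_trans ltr01) // truncexp_ge1 // ltW.
have hD : (truncexp (kap e * macro_time e) b)^-1 @[e --> 0^'+] --> D^-1.
  apply: cvgV => //; apply: (@cvg_macro_time (fun u => truncexp u b)).
  exact: has_deriv_continuous (has_deriv_truncexp tau b).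
have h : linearization_error e (macro_time e) B (truncexp tau) b @[e --> 0^'+] -->
    (`|1 * D^-1 - D^-1| * (1 + V) + 2 * 0 * V : R).
  apply: cvgD; apply: cvgM; try exact: cvg_cst.
    apply: cvg_norm; apply: cvgB; last exact: cvg_cst.
    by apply: cvgM; [exact: cvg_ratio | exact: hD].
  by apply: cvgM; [exact: cvg_cst | exact: cvg_kappa_sqrt].
by rewrite mul1r subrr normr0 mulr0 !mul0r addr0 in h.
Qed.

Lemma continuous_limit_form n (D eta : nat -> R) : {for tau, continuous (limit_form n D eta)}.
Proof.
apply: (@has_deriv_continuous _ _ _ (\sum_(r < n.+1) \sum_(r' < n.+1)
  eta r / D r * (eta r' / D r') * sym_cov_drift tau r r')).
apply: has_deriv_sum => r _; apply: has_deriv_sum => r' _; apply: has_derivZ.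
exact: has_deriv_sym_cov.
Qed.

End SmallParameterLimits.

(** * Convergence of the rescaled fluctuations *)

Section ConvergenceOfFluctuations.
Variables (R : realType) (tau : R).
Hypothesis tau0 : 0 < tau.
Variables (d : R -> measure_display) (T : forall e : R, measurableType (d e)).
Variables (P : forall e : R, probability (T e) R) (x : forall e : R, R -> T e -> config).
Hypothesis hx : forall e : R, 0 < e -> slowed_tTASEP (P e) (expR (- e)) packed (@x e).
Variable n : nat.
Local Notation D := (truncexp tau).
Local Notation kap e := (tkappa (expR (- e))).
Local Notation W e b w := (height_fluctuation (P e) e (macro_time tau e) (@x e) b w).
Local Notation X e w i := (rescaled_fluctuation (P e) e tau (@x e) i w).

(** Limiting covariance of the partial sums: linearizing the logarithm divides each [f_r - D_r] by
    [D_r]. *)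
Definition sum_cov r s : R := sym_cov tau r s / (D r * D s).

Definition coord_cov i j : R := mixed_diff sum_cov i j.

Lemma cvg_height_cos (eta : nat -> R) (c : R) :
  \int[P e]_w cos (\sum_(r < n.+1) eta r * W e r w + c) @[e --> 0^'+] -->
  cos c * expR (- (limit_form n D eta tau / 2)).
Proof.
pose Q e := cos c * expR (- (limit_form n D eta (kap e * macro_time tau e) / 2)).
pose xi r : R := if (r <= n)%N then eta r / D r else 0.
pose K := half_bound n xi (2 * tau) * (2 * tau) * clt_const n xi (2 * tau).
pose err e := \sum_(r < n.+1) `|eta r| * linearization_error e (macro_time tau e) (2 * tau) D r +
   K * Num.sqrt (kap e).
have cQ : Q e @[e --> 0^'+] --> cos c * expR (- (limit_form n D eta tau / 2)).
  have h : {for tau, continuous (fun u => cos c * expR (- (limit_form n D eta u / 2)))}; last first.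
    exact: (cvg_macro_time h).
  apply: cvgM; first exact: cvg_cst.
  apply: (@continuous_comp _ _ _ (fun u => - (limit_form n D eta u / 2)) expR); last exact: continuous_expR.
  by apply: cvgN; apply: cvgM; [exact: continuous_limit_form | exact: cvg_cst].
have cerr : err e @[e --> 0^'+] --> (0 : R).
  have h1 : \sum_(r < n.+1) `|eta r| * linearization_error e (macro_time tau e) (2 * tau) D r
      @[e --> 0^'+] --> \sum_(r < n.+1) (`|eta r| * 0).
    apply: (@cvg_big R _ +%R 0 xpredT) => [|r _]; first exact: add_continuous.
    by apply: cvgM; [exact: cvg_cst | exact: cvg_linearization_error].
  have E0 : \sum_(r < n.+1) (`|eta r| * 0) = 0 by rewrite big1 // => r _; rewrite mulr0.
  rewrite E0 in h1.
  have h3 : err e @[e --> 0^'+] --> (0 + K * 0 : R).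
    apply: cvgD; first exact: h1.
    by apply: cvgM; [exact: cvg_cst | exact: cvg_sqrt_kappa].
  by rewrite mulr0 addr0 in h3.
have diff : \int[P e]_w cos (\sum_(r < n.+1) eta r * W e r w + c) - Q e @[e --> 0^'+] --> (0 : R).
  apply: norm_cvg0; apply: (@squeeze_cvgr _ _ _ _ (fun=> 0) err); [|exact: cvg_cst|exact: cerr].
  near=> e; have [e0 k1 sB] : [/\ 0 < e, kap e <= 1 & kap e * macro_time tau e <= 2 * tau].
    by near: e; exact: near_small.
  apply/andP; split; first exact: normr_ge0.
  have hfc := fluctuation_cos n e0 (macro_time_ge0 tau0 e0) (hx e0) k1 sB D eta c. apply: le_trans hfc _.
  by rewrite /err /K lerD2l le_eqVlt; apply/orP; left; apply/eqP; ring.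
have h : (\int[P e]_w cos (\sum_(r < n.+1) eta r * W e r w + c) - Q e) + Q e @[e --> 0^'+] -->
    0 + cos c * expR (- (limit_form n D eta tau / 2)) by apply: cvgD.
rewrite add0r in h; apply: cvg_trans h; apply: near_eq_cvg.
by near=> e; rewrite /= subrK.
Unshelve. all: by end_near.
Qed.

Lemma near_coordinate : \forall e \near (0 : R)^'+, forall w i, (i < n)%N ->
  X e w i = W e i.+1 w - W e i w.
Proof.
near=> e => w i il; have [e0 k1 sB] : [/\ 0 < e, kap e <= 1 & kap e * macro_time tau e <= 2 * tau].
  by near: e; exact: near_small.
exact: (coordinate_fluctuation e0 (macro_time_ge0 tau0 e0) (hx e0) k1 sB w il).
Unshelve. all: by end_near.
Qed.

Definition coord_form (xi : nat -> R) : R := \sum_(i < n) \sum_(j < n) xi i * xi j * coord_cov i j.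

Lemma limit_formE xi : limit_form n D (backward_diff n xi) tau = coord_form xi.
Proof.
rewrite /coord_form -(summation_by_parts2 n xi sum_cov); apply: eq_bigr => r _; apply: eq_bigr => r' _.
by rewrite /sum_cov invfM; ring.
Qed.

Lemma cvg_coordinate_cos (xi : nat -> R) (c : R) :
  \int[P e]_w cos (\sum_(i < n) xi i * X e w i + c) @[e --> 0^'+] -->
  cos c * expR (- (coord_form xi / 2)).
Proof.
rewrite -limit_formE; apply: cvg_trans (@cvg_height_cos (backward_diff n xi) c).
have nc := near_coordinate; apply: near_eq_cvg; near=> e.
have hc : forall w i, (i < n)%N -> X e w i = W e i.+1 w - W e i w by near: e; exact: nc.
apply: eq_Rintegral => w _; congr (cos (_ + c)).
rewrite -(summation_by_parts n xi (fun b => W e b w)); apply: eq_bigr => i _; congr (_ * _).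
by rewrite hc.
Unshelve. all: by end_near.
Qed.

Lemma coord_cov_sym i j : coord_cov i j = coord_cov j i.
Proof.
have K_sym r s : sum_cov r s = sum_cov s r by rewrite /sum_cov sym_covC [D r * _]mulrC.
by rewrite /coord_cov /mixed_diff ![sum_cov i _]K_sym ![sum_cov i.+1 _]K_sym; ring.
Qed.

Lemma near_measurable : \forall e \near (0 : R)^'+, forall i, (i < n)%N ->
  measurable_fun setT (fun w => X e w i).
Proof.
have nc := near_coordinate; near=> e => i il.
have [e0 k1 sB] : [/\ 0 < e, kap e <= 1 & kap e * macro_time tau e <= 2 * tau].
  by near: e; exact: near_small.
have hc : forall w i, (i < n)%N -> X e w i = W e i.+1 w - W e i w by near: e; exact: nc.
rewrite (_ : (fun w => X e w i) = (fun w => W e i.+1 w - W e i w)); last by apply/funext => w; exact: hc.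
apply: measurable_funB.
- exact: (measurable_height_fluctuation (macro_time_ge0 tau0 e0) (hx e0) il).
- exact: (measurable_height_fluctuation (macro_time_ge0 tau0 e0) (hx e0) (ltnW il)).
Unshelve. all: by end_near.
Qed.

(** Positivity is inherited from the processes: the cosines have expectations at most 1, so their
    limit [exp (- Q / 2)] is at most 1 and the form [Q] is nonnegative. *)
Lemma coord_cov_psd : psd n coord_cov.
Proof.
move=> xi; change (0 <= coord_form xi); have nm := near_measurable.
have h := @cvg_coordinate_cos xi 0; rewrite cos0 mul1r in h.
have : expR (- (coord_form xi / 2)) <= 1.
  rewrite -(cvg_lim (@Rhausdorff R) h); apply: limr_le; first exact: (cvgP _ h).
  near=> e; apply: le_trans (ler_norm _) _.
  have hm : forall i, (i < n)%N -> measurable_fun setT (fun w => X e w i) by near: e; exact: nm.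
  have mX : measurable_fun setT (fun w => cos (\sum_(i < n) xi i * X e w i + 0)).
    apply: measurableT_comp; first exact: continuous_measurable_fun (@continuous_cos R).
    apply: measurable_funD => //; apply: measurable_sum => i; apply: measurable_funM => //.
    exact: hm.
  have bX w : `|cos (\sum_(i < n) xi i * X e w i + 0)| <= 1 by rewrite ler_norml cos_geN1 cos_le1.
  have iX := prob_bounded_integrable (P e) mX bX.
  apply: le_trans (le_normr_Rintegral measurableT iX) _.
  rewrite -[leRHS](Rintegral_prob_cst (P e) 1); apply: le_Rintegral => //.
  - exact: (integrable_abse iX).
  - exact: integrable_prob_cst.
rewrite -[leRHS]expR0 ler_expR; lra.
Unshelve. all: by end_near.
Qed.

(** A uniform first absolute moment, from which Markov's inequality derives tightness. *)
Lemma near_moment : exists2 M : R, 0 <= M & \forall e \near (0 : R)^'+, forall i, (i < n)%N ->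
  (P e).-integrable setT (EFin \o (fun w => `|X e w i|)) /\ \int[P e]_w `|X e w i| <= M.
Proof.
pose m b := 1 + `|D b|^-1 * (1 + `|var_bound (2 * tau) b|).
have m0 b : 0 <= m b by rewrite addr_ge0 // mulr_ge0 ?invr_ge0 // addr_ge0.
pose M := \sum_(b < n.+1) m b.
have mM b : (b <= n)%N -> m b <= M.
  by move=> bn; rewrite /M (bigD1 (Ordinal (bn : (b < n.+1)%N))) //= lerDl sumr_ge0.
have M0 : 0 <= M by rewrite sumr_ge0.
exists (M + M); first exact: addr_ge0.
have err1 : \forall e \near (0 : R)^'+, forall b : 'I_n.+1,
    linearization_error e (macro_time tau e) (2 * tau) D b <= 1.
  apply: filter_forall => b.
  have /cvgrPdist_le/(_ 1 ltr01) h := cvg_linearization_error tau0 (2 * tau) b.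
  apply: filterS h => e; rewrite sub0r normrN; apply: le_trans; exact: ler_norm.
have nc := near_coordinate; have nm := near_measurable.
near=> e => i il.
have [e0 k1 sB] : [/\ 0 < e, kap e <= 1 & kap e * macro_time tau e <= 2 * tau].
  by near: e; exact: near_small.
have hc : forall w i, (i < n)%N -> X e w i = W e i.+1 w - W e i w by near: e; exact: nc.
have he : forall b : 'I_n.+1, linearization_error e (macro_time tau e) (2 * tau) D b <= 1 by near: e; exact: err1.
have hm : measurable_fun setT (fun w => X e w i) by move: i il; near: e; exact: nm.
have s0 := macro_time_ge0 tau0 e0.
have Wm b : (b <= n)%N -> (P e).-integrable setT (EFin \o (fun w => `|W e b w|)) /\ \int[P e]_w `|W e b w| <= M.
  move=> bn; have [i1 h1] := height_fluctuation_moment e0 s0 (hx e0) k1 sB D bn; split=> //.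
  apply: le_trans h1 _; apply: le_trans (mM b bn); rewrite /m; apply: lerD.
    exact: (he (Ordinal (bn : (b < n.+1)%N))).
  by rewrite ler_wpM2l ?invr_ge0 // lerD2l ler_norm.
have [i1 h1] := Wm _ il; have [i2 h2] := Wm _ (ltnW il).
have i3 := integrable_add i1 i2.
have bound w : `|X e w i| <= `|W e i.+1 w| + `|W e i w| by rewrite hc // ler_normB.
have iX : (P e).-integrable setT (EFin \o (fun w => `|X e w i|)).
  apply: le_integrable i3 => // [|w _ /=]; first by apply/measurable_EFinP; apply: measurableT_comp.
  by rewrite lee_fin normr_id; apply: le_trans (bound w) (ler_norm _).
split=> //; apply: le_trans (le_Rintegral measurableT iX i3 (fun w _ => bound w)) _.
by rewrite (Rintegral_add i1 i2) lerD.
Unshelve. all: by end_near.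
Qed.

Lemma sum_cov0 s : sum_cov 0 s = 0.
Proof. by rewrite /sum_cov /sym_cov min0n /limit_cov mul0r. Qed.

Lemma sum_coord_cov r s : (s <= r)%N -> \sum_(i < r) \sum_(j < s) coord_cov i j =
  limit_cov tau r s / (D r * D s).
Proof.
move=> sr; rewrite sum_mixed_diff.
- by rewrite /sum_cov sym_covE // (leq_trans sr).
- exact: sum_cov0.
- by move=> i; rewrite /sum_cov sym_covC [D i * _]mulrC; exact: sum_cov0.
Qed.

End ConvergenceOfFluctuations.

Local Open Scope complex_scope.

Theorem proposition7p2 (R : realType) (tau : R) (htau : 0 < tau)
  (d : R -> measure_display) (T : forall e : R, measurableType (d e))
  (P : forall e : R, probability (T e) R)
  (x : forall e : R, R -> T e -> config)
  (hx : forall e : R, 0 < e ->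
     slowed_tTASEP (P e) (expR (- e)) packed (x e))
  (n : nat) (hn : (1 <= n)%N) :
  exists (d' : measure_display) (T' : measurableType d')
         (P' : probability T' R) (G : 'I_n -> {RV P' >-> R}),
  [/\ gaussian_vector G,
      forall i : 'I_n, 'E_P'[G i]%E = 0%E,
      cvg_in_distribution (0^'+) P
        (fun e w => \row_(i < n) rescaled_fluctuation (P e) e tau (x e) i w)
        P' (fun w => \row_(i < n) G i w) &
      forall r s : nat, (1 <= s)%N -> (s <= r)%N -> (r <= n)%N ->
      forall (g1 : r.-tuple (R -> R[i])) (g2 : s.-tuple (R -> R[i])),
        (forall i, contour_around0 (tnth g1 i)) ->
        (forall j, contour_around0 (tnth g2 j)) ->
        (forall i j u v, `|tnth g2 j v| < `|tnth g1 i u|) ->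
        [/\ cov_denominator tau g2 != 0,
            cov_denominator tau g1 != 0 &
            (fine (covariance P' (fun w => \sum_(i < n | (i < r)%N) G i w)
                                 (fun w => \sum_(i < n | (i < s)%N) G i w)))%:C
            = cov_numerator tau g2 g1 /
              (cov_denominator tau g2 * cov_denominator tau g1)]].
Proof.
have sA := @coord_cov_sym R tau; have pA := coord_cov_psd htau hx n.
have [d' [T' [P' [G hG]]]] := gaussian_family_exists sA pA.
exists d', T', P', G.
have GE (i : 'I_n) w : lin_form G (fun k => (k == i)%:R) w = G i w.
  rewrite /lin_form (bigD1 i) //= eqxx mul1r big1 ?addr0 // => k /negPf ->.
  by rewrite mul0r.
have sumE m w : lin_form G (fun i : 'I_n => (i < m)%N%:R) w = \sum_(i < n | (i < m)%N) G i w.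
  rewrite [RHS]big_mkcond; apply: eq_bigr => i _.
  by case: ifP => _; rewrite ?mul1r ?mul0r.
split.
- by move=> a; exists 0, (Num.sqrt (bilin (coord_cov tau) a a)) => A mA; exact: hG.
- move=> i; have [m0 _ i1 _] := lin_form_moments pA hG (fun k => (k == i)%:R).
  rewrite unlock (_ : (fun w => _) = EFin \o lin_form G (fun k => (k == i)%:R)).
    by rewrite EFin_Rintegral //= m0.
  by apply/funext => w /=; rewrite GE.
(* The Gaussian vector is extended by zero to all natural indices, the form in which the convergence
   criterion takes its vectors. *)
- pose Y (w : T') (k : nat) : R := if insub k is Some i then G i w else 0.
  have YE w (i : 'I_n) : Y w i = G i w by rewrite /Y valK.
  have -> : (fun w => \row_(i < n) G i w) = (fun w => \row_(i < n) Y w i).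
    by apply/funext => w; apply/rowP => i; rewrite !mxE YE.
  have YF i (il : (i < n)%N) : (fun w => Y w i) = lin_form G (fun k => (k == Ordinal il)%:R).
    by apply/funext => w; rewrite GE -YE.
  have mY i : (i < n)%N -> measurable_fun setT (fun w => Y w i).
    by move=> il; rewrite (YF i il); exact: measurable_lin_form.
  apply: (@cvg_in_distribution_cos R n (0^'+) _ d T P
    (fun e w i => rescaled_fluctuation (P e) e tau (x e) i w)) => //.
  + exact: near_measurable.
  + move=> xi c.
    have -> : \int[P']_w cos (\sum_(i < n) xi i * Y w i + c) =
        cos c * expR (- (coord_form tau n xi / 2)).
      rewrite -(lin_form_cos pA hG (fun i : 'I_n => xi i) c); apply: eq_Rintegral => w _.
      by congr (cos (_ + c)); apply: eq_bigr => i _; rewrite YE.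
    exact: cvg_coordinate_cos.
  + move=> p p0; have [M M0 hM] := near_moment htau hx n.
    have iY i : (i < n)%N -> P'.-integrable setT (EFin \o (fun w => `|Y w i|)).
      move=> il; have [_ _ i1 _] := lin_form_moments pA hG (fun k => (k == Ordinal il)%:R).
      rewrite (_ : (fun w => `|Y w i|) = (fun w => `|lin_form G (fun k => (k == Ordinal il)%:R) w|)).
        exact: (integrable_abse i1).
      by apply/funext => w; rewrite GE -YE.
    pose m i : R := \int[P']_w `|Y w i|.
    have m0 i : 0 <= m i by apply: Rintegral_ge0.
    pose M' := \sum_(i < n) m i.
    have mM i : (i < n)%N -> m i <= M'.
      by move=> il; rewrite /M' (bigD1 (Ordinal il)) //= lerDl sumr_ge0.
    have M'0 : 0 <= M' by rewrite sumr_ge0.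
    (* One radius for both sides: [M] bounds the first moments before the limit and [M'] those of
       the limit, and the added 1 keeps the radius positive. *)
    have r0 : 0 < (M + M' + 1) / p by rewrite divr_gt0 // ltr_wpDl // addr_ge0.
    have le_p C : C <= M + M' -> C / ((M + M' + 1) / p) <= p.
      move=> hC; rewrite ler_pdivrMr // mulrC divfK ?gt_eqF //; lra.
    exists ((M + M' + 1) / p) => //; split.
      have nm := near_measurable htau hx n; near=> e => i il.
      have hm : forall i, (i < n)%N -> measurable_fun setT (fun w => rescaled_fluctuation (P e) e tau (x e) i w).
        by near: e; exact: nm.
      have hM' : forall i, (i < n)%N ->
          (P e).-integrable setT (EFin \o (fun w => `|rescaled_fluctuation (P e) e tau (x e) i w|)) /\
          \int[P e]_w `|rescaled_fluctuation (P e) e tau (x e) i w| <= M by near: e; exact: hM.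
      have [iX hX] := hM' i il.
      apply: le_trans (@tail_event_le _ _ _ (P e) (fun w i => rescaled_fluctuation (P e) e tau (x e) i w) _ _ _ r0 (hm i il) iX hX) _.
      by rewrite lee_fin le_p // lerDl.
    move=> i il; apply: le_trans (tail_event_le r0 (mY i il) (iY i il) (lexx _)) _.
    by rewrite lee_fin le_p // (le_trans (mM i il)) // lerDr.
- move=> r s s1 sr rn g1 g2 hg1 hg2 nested.
  have nthE m (g : m.-tuple (R -> R[i])) l (lm : (l < m)%N) :
      nth (fun=> 0) g l = tnth g (Ordinal lm) by rewrite (tnth_nth (fun=> 0)).
  have h1 l : (l < size g1)%N -> contour_around0 (nth (fun=> 0) g1 l).
    by rewrite size_tuple => lr; rewrite (nthE _ _ _ lr).
  have h2 l : (l < size g2)%N -> contour_around0 (nth (fun=> 0) g2 l).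
    by rewrite size_tuple => ls; rewrite (nthE _ _ _ ls).
  have h12 i j u v : (i < size g1)%N -> (j < size g2)%N ->
      `|nth (fun=> 0) g2 j v| < `|nth (fun=> 0) g1 i u|.
    by rewrite !size_tuple => ir js; rewrite (nthE _ _ _ ir) (nthE _ _ _ js).
  have tau_ge0 := ltW htau; split; [exact: denominator_neq0|exact: denominator_neq0|].
  rewrite (contour_covariance tau_ge0 h1 h2 h12); last by rewrite !size_tuple.
  rewrite !size_tuple; congr (_%:C).
  have -> : (fun w => \sum_(i < n | (i < r)%N) G i w) = lin_form G (fun i : 'I_n => (i < r)%N%:R).
    by apply/funext => w; rewrite sumE.
  have -> : (fun w => \sum_(i < n | (i < s)%N) G i w) = lin_form G (fun i : 'I_n => (i < s)%N%:R).
    by apply/funext => w; rewrite sumE.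
  (* Partial sums are the linear forms of indicator vectors, so their covariance is the sum of the
     coordinate covariances over the first [r] rows and [s] columns. *)
  rewrite (lin_form_covariance sA pA hG) -(sum_coord_cov tau sr) /bilin.
  rewrite (big_ord_widen _ (fun i => \sum_(j < s) coord_cov tau i j) rn) [RHS]big_mkcond.
  apply: eq_bigr => i _; case: ifP => _; last by rewrite big1 // => j _; rewrite !mul0r.
  rewrite (big_ord_widen _ (fun j => coord_cov tau i j) (leq_trans sr rn)) [RHS]big_mkcond.
  by apply: eq_bigr => j _; case: ifP => _; rewrite !mul1r ?mul0r // mul1r.
Unshelve. all: by end_near.
Qed.
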